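(* For every $\tau$ in the interior $\mathbb{D}^\circ$ of $\mathbb{D}$, $$E_4(\tau)=\frac{\vartheta_{00}(\tau)^8+\vartheta_{01}(\tau)^8+\vartheta_{10}(\tau)^8}{2}=F\Bigl(\tfrac1{12},\tfrac5{12},1;\tfrac1{j(\tau)}\Bigr)^4 .$$ Moreover, this extends to an equality on the whole upper half-plane $\mathbb{H}$, where the right-hand side is understood as the analytic continuation to $\mathbb{H}$ of the function $\tau\mapsto F(\frac1{12},\frac5{12},1;\frac1{j(\tau)})^4$ on $\mathbb{D}^\circ$.
   Context: $i=\sqrt{-1}$, $\mathbb{H}$ is the upper half-plane. Theta constants: for $p,q\in\{0,1\}$ and $\tau\in\mathbb{H}$, $\vartheta_{pq}(\tau)=\sum_{n\in\mathbb{Z}}\exp\bigl(\pi i(n+\frac p2)^2\tau+2\pi i(n+\frac p2)\frac q2\bigr)$. Lambda function: $\lambda(\tau)=\vartheta_{10}(\tau)^4/\vartheta_{00}(\tau)^4$. Normalized Eisenstein series: $E_4(\tau)=\frac1{2\zeta(4)}\sum_{(n_1,n_2)\in\mathbb{Z}^2-\{(0,0)\}}\frac1{(n_1\tau+n_2)^4}$, $\zeta$ being Riemann's zeta function. $j$-invariant (normalized so that $j(i)=1$): $$j(\tau)=\frac{4}{27}\,\frac{(\lambda(\tau)^2-\lambda(\tau)+1)^3}{\lambda(\tau)^2(1-\lambda(\tau))^2}=\frac1{54}\,\frac{\bigl(\vartheta_{00}(\tau)^8+\vartheta_{01}(\tau)^8+\vartheta_{10}(\tau)^8\bigr)^3}{\vartheta_{00}(\tau)^8\,\vartheta_{01}(\tau)^8\,\vartheta_{10}(\tau)^8}.$$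 Hypergeometric function: $F(a,b,c;z)=\sum_{n\ge0}\frac{(a,n)(b,n)}{(c,n)(1,n)}z^n$ for $|z|<1$, with $(a,n)=a(a+1)\cdots(a+n-1)$; the same symbol denotes its single-valued holomorphic continuation to $\mathbb{C}-[1,\infty)$. $$\mathbb{D}=\{\tau\in\mathbb{H}\mid -\tfrac12<\mathrm{Re}(\tau)\le\tfrac12,\ |\tau|>1\}\cup\{\tau\in\mathbb{H}\mid |\tau|=1,\ 0\le\mathrm{Re}(\tau)\le\tfrac12\}.$$ *)

(* Defs.v *)
From Stdlib Require Import Reals ZArith List ClassicalEpsilon.
From Coquelicot Require Import Coquelicot.
Import ListNotations.

Set Implicit Arguments.
Local Open Scope R_scope.
Local Open Scope C_scope.

Definition Cexp (z : C) : C := exp (Re z) * (cos (Im z), sin (Im z)).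

Definition upper_half_plane (tau : C) : Prop := (0 < Im tau)%R.

(* Unordered summation over the elements of A: the limit of the sums over the
   finite subsets of A, these being represented by lists without repetition. *)
Definition finite_subsets {T : Type} (A : T -> Prop) :
    (list T -> Prop) -> Prop :=
  fun P => exists s0 : list T, List.Forall A s0 /\
    forall s : list T, NoDup s -> List.Forall A s -> incl s0 s -> P s.

Definition is_sum_over {T : Type} (A : T -> Prop) (f : T -> C) (l : C) : Prop :=
  filterlim (fun s : list T => fold_right Cplus 0 (map f s))
    (finite_subsets A) (locally (T := C_UniformSpace) l).

Definition sum_over {T : Type} (A : T -> Prop) (f : T -> C) : C :=
  iota (T := C_CompleteNormedModule) (is_sum_over A f).

Definition theta (p q : Z) (tau : C) : C :=
  sum_over (fun _ : Z => True) (fun n =>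
    Cexp (PI * Ci * (IZR n + IZR p / 2) ^ 2 * tau
          + 2 * PI * Ci * (IZR n + IZR p / 2) * (IZR q / 2))).

Definition lambda (tau : C) : C := theta 1 0 tau ^ 4 / theta 0 0 tau ^ 4.

Definition j_invariant (tau : C) : C :=
  4 / 27 * ((lambda tau ^ 2 - lambda tau + 1) ^ 3
            / (lambda tau ^ 2 * (1 - lambda tau) ^ 2)).

(* Only meaningful for k >= 2, where the series converges. *)
Definition zeta (k : nat) : R := Series (fun n => / INR (S n) ^ k)%R.

Definition E4 (tau : C) : C :=
  1 / (2 * zeta 4)
  * sum_over (fun n : Z * Z => n <> (0%Z, 0%Z))
      (fun n => 1 / (IZR (fst n) * tau + IZR (snd n)) ^ 4).

(* Complex differentiability at every point; used for open sets U. *)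
Definition holomorphic_on (U : C -> Prop) (f : C -> C) : Prop :=
  forall z : C, U z -> ex_derive (K := C_AbsRing) (V := C_NormedModule) f z.

Definition is_continuation (D U : C -> Prop) (f g : C -> C) : Prop :=
  holomorphic_on U g /\ forall z : C, D z -> g z = f z.

Fixpoint pochhammer (a : C) (n : nat) : C :=
  match n with
  | O => 1
  | S m => pochhammer a m * (a + INR m)
  end.

Definition hypergeometric_series (a b c z : C) : C :=
  iota (T := C_CompleteNormedModule)
    (is_series (K := C_AbsRing) (V := C_NormedModule) (fun n =>
       pochhammer a n * pochhammer b n / (pochhammer c n * pochhammer 1 n)
       * z ^ n)).

Definition slit_plane (z : C) : Prop := ~ (Im z = 0%R /\ (1 <= Re z)%R).

(* The holomorphic continuation to C - [1, +oo) of the sum of the series, by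
   definite description: it is unique there, since the slit plane is connected.
   The values on [1, +oo) are unspecified. *)
Definition hypergeometric (a b c : C) : C -> C :=
  epsilon (inhabits (hypergeometric_series a b c))
    (is_continuation (fun z => (Cmod z < 1)%R) slit_plane
       (hypergeometric_series a b c)).

Definition fundamental_domain (tau : C) : Prop :=
  (upper_half_plane tau /\ (- (1 / 2) < Re tau <= 1 / 2)%R /\ (1 < Cmod tau)%R)
  \/ (upper_half_plane tau /\ Cmod tau = 1%R /\ (0 <= Re tau <= 1 / 2)%R).

Definition Cinterior (A : C -> Prop) (z : C) : Prop :=
  locally (T := C_UniformSpace) z A.

(* Main.v *)
Require Import Defs.
From Stdlib Require Import Reals ZArith List Lra Lia Permutation ClassicalEpsilon Classical.
From Coquelicot Require Import Coquelicot.
Import ListNotations.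
Open Scope R_scope.
Open Scope C_scope.

(* The even theta constants satisfy Jacobi's identity A = B + C (A, B, C their fourth
   powers), because (A - B - C)^2 is a modular form of weight 4 vanishing at the cusp.  The
   same vanishing principle identifies the lattice sum E4 with (A^2 + B^2 + C^2)/2 and gives
   Ramanujan's differential equations for E4, E6 and P = Delta'/Delta, Delta = (A B C)^2.
   On the fundamental domain R = E6/(A B C) is imaginary on the boundary, so Re R > 0 inside
   by the minimum principle; since E4^3/Delta = R^2 + 27/4, this keeps E4 away from 0 and
   t = 1/j = (27/4) Delta/E4^3 inside C - [1, oo).  The Ramanujan equations turn the
   hypergeometric equation for g = F(1/12, 5/12, 1; t) into V' = L V for V = g' - L g,
   L = E4'/(4 E4).  Hence V^4/E4 is constant along vertical rays and tends to 0 at the cusp,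
   so V = 0; then g^4/E4 is constant as well, with limit 1.

   F is continued to C - [1, oo) through z = 4w/(1 + w)^2, which maps the unit disc onto the
   slit plane and makes F a power series in w with bounded coefficients.  The inversion
   formula of theta is obtained by Polya's method, as a limit of a finite Poisson summation
   for binomial coefficients. *)

(** * Complex derivatives *)

(** What shapes the proof is the claim that 1/j avoids the whole cut. For it, j - 1 needs a
    single-valued square root whose boundary behaviour is visible, and theta constants provide one:
    E6/(A B C) changes sign under both generators of the modular group and is conjugated by the
    reflection tau -> - conj tau. On each boundary arc this reflection coincides with a generator or
    its inverse, so the value there is minus its own conjugate. The number 27/4 is 1728/256, as
    Delta = (A B C)^2 is 256 times the usual discriminant.

    The vanishing principle covers weights up to 6, while the equation for E6' has weight 8. It is
    recovered by differentiating E4^3 - E6^2 = (27/4) Delta and dividing by E6, which has no zero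
    where Re R > 0.

    F is compared with a fourth root of E4. Working with V^4/E4 and g^4/E4 replaces the choice of a
    branch by two quotients with derivative 0. The domain is stable under upward translation, so
    each ray ends at the cusp, where both limits are known. *)

Lemma Cmod_minus_sym (a b : C) : Cmod (a - b) = Cmod (b - a).
Proof. rewrite <- Cmod_opp. f_equal. ring. Qed.

Lemma Cmod_minus_triangle (a b c : C) : (Cmod (a - c) <= Cmod (a - b) + Cmod (b - c)).
Proof. replace (a - c) with ((a - b) + (b - c)) by ring. apply Cmod_triangle. Qed.

Lemma Cmod_sub_le (a b : C) : (Cmod (a - b) <= Cmod a + Cmod b).
Proof. unfold Cminus. rewrite <- (Cmod_opp b). apply Cmod_triangle. Qed.

Lemma Cmod_reverse_triangle (a b : C) : (Cmod a - Cmod b <= Cmod (a - b)).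
Proof.
  pose proof (Cmod_triangle (a - b) b).
  replace (a - b + b) with a in H by ring. lra.
Qed.

Lemma im_le_Cmod (c : C) : (Rabs (Im c) <= Cmod c).
Proof. eapply Rle_trans; [|apply Rmax_Cmod]. apply Rmax_r. Qed.

Lemma Cmod_le_re_im (c : C) : (Cmod c <= Rabs (Re c) + Rabs (Im c)).
Proof.
  destruct c as [x y]. change (Re (x, y)) with x. change (Im (x, y)) with y.
  replace (x, y) with (RtoC x + Ci * y).
  - eapply Rle_trans; [apply Cmod_triangle|].
    rewrite Cmod_mult, Cmod_Ci, !Cmod_R. lra.
  - apply injective_projections; simpl; ring.
Qed.

Lemma Cdecomp (z : C) : z = Re z + Ci * Im z.
Proof. destruct z. apply injective_projections; simpl; ring. Qed.

Lemma C_locally_Cmod (z : C) (P : C -> Prop) :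
  locally (T := C_UniformSpace) z P <->
  exists d : R, (0 < d) /\ forall w, (Cmod (w - z) < d) -> P w.
Proof.
  split.
  - intros [d Hd]. exists d. split. apply cond_pos.
    intros w Hw. apply Hd. apply C_NormedModule_mixin_compat1. exact Hw.
  - intros (d & Hd & H).
    assert (Hs : (0 < sqrt 2)) by (apply sqrt_lt_R0; lra).
    assert (Hp : (0 < d / sqrt 2)) by (apply Rdiv_lt_0_compat; lra).
    exists (mkposreal _ Hp). intros w Hw. apply H.
    apply C_NormedModule_mixin_compat2 in Hw. simpl in Hw.
    replace (sqrt 2 * (d / sqrt 2))%R with d in Hw by (field; lra). exact Hw.
Qed.

Lemma CA_locally_Cmod (z : C) (P : C -> Prop) :
  locally (T := AbsRing_UniformSpace C_AbsRing) z P <->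
  exists d : R, (0 < d) /\ forall w, (Cmod (w - z) < d) -> P w.
Proof.
  split.
  - intros [d Hd]. exists d. split. apply cond_pos. intros w Hw. apply Hd. exact Hw.
  - intros (d & Hd & H). exists (mkposreal _ Hd). intros w Hw. apply H. exact Hw.
Qed.

Lemma C_filterlim_iff {T : Type} (F : (T -> Prop) -> Prop) {FF : Filter F} (f : T -> C) (l : C) :
  filterlim f F (locally (T := C_UniformSpace) l) <->
  forall eps : R, (0 < eps) -> F (fun t => (Cmod (f t - l) < eps)).
Proof.
  split.
  - intros H eps He. apply (H (fun w => (Cmod (w - l) < eps))).
    apply C_locally_Cmod. exists eps; auto.
  - intros H P HP. apply C_locally_Cmod in HP. destruct HP as (d & Hd & HP).
    unfold filtermap. generalize (H d Hd). apply filter_imp. auto.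
Qed.

Lemma C_continuous_iff {T : UniformSpace} (f : T -> C) (x : T) :
  continuous (U := C_UniformSpace) f x <->
  forall eps : R, (0 < eps) -> locally x (fun y => (Cmod (f y - f x) < eps)).
Proof. apply C_filterlim_iff. apply locally_filter. Qed.

Lemma C_filterlim_plus {T : Type} (F : (T -> Prop) -> Prop) {FF : Filter F} (f g : T -> C) (a b : C) :
  filterlim f F (locally (T := C_UniformSpace) a) ->
  filterlim g F (locally (T := C_UniformSpace) b) ->
  filterlim (fun t => f t + g t) F (locally (T := C_UniformSpace) (a + b)).
Proof.
  rewrite !C_filterlim_iff; auto. intros Hf Hg eps He.
  assert (H2 : (0 < eps / 2)) by lra.
  generalize (filter_and _ _ (Hf _ H2) (Hg _ H2)). apply filter_imp.
  intros t [H1 H3]. replace (f t + g t - (a + b)) with ((f t - a) + (g t - b)) by ring.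
  eapply Rle_lt_trans; [apply Cmod_triangle|]. lra.
Qed.

Lemma C_filterlim_mult {T : Type} (F : (T -> Prop) -> Prop) {FF : Filter F} (f g : T -> C) (a b : C) :
  filterlim f F (locally (T := C_UniformSpace) a) ->
  filterlim g F (locally (T := C_UniformSpace) b) ->
  filterlim (fun t => f t * g t) F (locally (T := C_UniformSpace) (a * b)).
Proof.
  rewrite !C_filterlim_iff; auto. intros Hf Hg eps He.
  pose proof (Cmod_ge_0 a) as Ha. pose proof (Cmod_ge_0 b) as Hb.
  set (M := (1 + Cmod a + Cmod b)%R).
  assert (HM : (0 < M)) by (unfold M; lra).
  set (d := Rmin 1 (eps / (2 * M))).
  assert (Hd : (0 < d)).
  { unfold d. apply Rmin_pos; [lra|]. apply Rdiv_lt_0_compat; lra. }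
  assert (Hd1 : (d <= 1)) by apply Rmin_l.
  assert (Hd2 : (d * M <= eps / 2)).
  { apply Rle_trans with (eps / (2 * M) * M)%R.
    - apply Rmult_le_compat_r; [lra|apply Rmin_r].
    - right. field. lra. }
  generalize (filter_and _ _ (Hf _ Hd) (Hg _ Hd)). apply filter_imp.
  intros t [H1 H3].
  replace (f t * g t - a * b)
    with ((f t - a) * (g t - b) + (f t - a) * b + a * (g t - b)) by ring.
  eapply Rle_lt_trans; [apply Cmod_triangle|].
  eapply Rle_lt_trans; [apply Rplus_le_compat_r; apply Cmod_triangle|].
  rewrite !Cmod_mult.
  pose proof (Cmod_ge_0 (f t - a)). pose proof (Cmod_ge_0 (g t - b)).
  unfold M in Hd2. nra.
Qed.

Lemma C_filterlim_inv {T : Type} (F : (T -> Prop) -> Prop) {FF : Filter F} (f : T -> C) (a : C) :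
  a <> 0 ->
  filterlim f F (locally (T := C_UniformSpace) a) ->
  filterlim (fun t => / f t) F (locally (T := C_UniformSpace) (/ a)).
Proof.
  intros Ha. rewrite !C_filterlim_iff; auto. intros Hf eps He.
  apply Cmod_gt_0 in Ha as Ha'. set (m := Cmod a) in *.
  set (d := Rmin (m / 2) (eps * (m * m / 2))).
  assert (Hmm : (0 < m * m)) by (apply Rmult_lt_0_compat; lra).
  assert (Hd : (0 < d)).
  { unfold d. apply Rmin_pos; [lra|]. apply Rmult_lt_0_compat; lra. }
  generalize (Hf _ Hd). apply filter_imp. intros t H1.
  assert (H2 : (Cmod (f t - a) < m / 2)) by (eapply Rlt_le_trans; [exact H1|apply Rmin_l]).
  assert (H3 : (Cmod (f t - a) < eps * (m * m / 2)))
    by (eapply Rlt_le_trans; [exact H1|apply Rmin_r]).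
  assert (H4 : (m / 2 < Cmod (f t))).
  { pose proof (Cmod_reverse_triangle a (f t)) as H4. rewrite Cmod_minus_sym in H4. fold m in H4. lra. }
  assert (Hft : f t <> 0). { intro E. rewrite E, Cmod_0 in H4. lra. }
  replace (/ f t - / a) with ((a - f t) / (f t * a)) by (field; auto).
  rewrite Cmod_div by (apply Cmult_neq_0; auto). rewrite Cmod_mult, Cmod_minus_sym. fold m.
  apply Rmult_lt_reg_r with (Cmod (f t) * m)%R. { apply Rmult_lt_0_compat; lra. }
  replace (Cmod (f t - a) / (Cmod (f t) * m) * (Cmod (f t) * m))%R with (Cmod (f t - a)) by (field; lra).
  eapply Rlt_trans; [exact H3|]. apply Rmult_lt_compat_l; [lra|]. nra.
Qed.

Section continuity.
Context {T : UniformSpace}.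
Implicit Types f g : T -> C.

Lemma C_continuous_ext_loc f g x : locally x (fun y => f y = g y) ->
  continuous (U := C_UniformSpace) f x -> continuous (U := C_UniformSpace) g x.
Proof. apply (continuous_ext_loc (U := C_UniformSpace)). Qed.

Lemma C_continuous_ext f g x : (forall y, f y = g y) ->
  continuous (U := C_UniformSpace) f x -> continuous (U := C_UniformSpace) g x.
Proof. apply (continuous_ext (U := C_UniformSpace)). Qed.

Lemma C_continuous_plus f g x :
  continuous (U := C_UniformSpace) f x -> continuous (U := C_UniformSpace) g x ->
  continuous (U := C_UniformSpace) (fun y => f y + g y) x.
Proof. intros. apply C_filterlim_plus; auto; apply locally_filter. Qed.

Lemma C_continuous_mult f g x :
  continuous (U := C_UniformSpace) f x -> continuous (U := C_UniformSpace) g x ->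
  continuous (U := C_UniformSpace) (fun y => f y * g y) x.
Proof. intros. apply C_filterlim_mult; auto; apply locally_filter. Qed.

Lemma C_continuous_inv f x : f x <> 0 ->
  continuous (U := C_UniformSpace) f x ->
  continuous (U := C_UniformSpace) (fun y => / f y) x.
Proof. intros. apply C_filterlim_inv; auto; apply locally_filter. Qed.

Lemma C_continuous_const (c : C) (x : T) :
  continuous (U := C_UniformSpace) (fun _ => c) x.
Proof. apply continuous_const. Qed.

Lemma C_continuous_minus f g x :
  continuous (U := C_UniformSpace) f x -> continuous (U := C_UniformSpace) g x ->
  continuous (U := C_UniformSpace) (fun y => f y - g y) x.
Proof.
  intros. apply C_continuous_plus; auto.
  apply C_continuous_ext with (fun y => (-1) * g y). { intro. ring. }
  apply C_continuous_mult; auto. apply C_continuous_const.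
Qed.

Lemma C_continuous_div f g x : g x <> 0 ->
  continuous (U := C_UniformSpace) f x -> continuous (U := C_UniformSpace) g x ->
  continuous (U := C_UniformSpace) (fun y => f y / g y) x.
Proof. intros. apply C_continuous_mult; auto. apply C_continuous_inv; auto. Qed.

Lemma C_continuous_pow f x n :
  continuous (U := C_UniformSpace) f x ->
  continuous (U := C_UniformSpace) (fun y => f y ^ n) x.
Proof.
  intros H. induction n; simpl.
  - apply C_continuous_const.
  - apply C_continuous_mult; auto.
Qed.
End continuity.

(* First order expansion with error [o(h)]: the definition of the complex
   derivative without Coquelicot's filters. *)
Definition cder (f : C -> C) (z l : C) : Prop :=
  forall eps : R, (0 < eps) -> exists d : R, (0 < d) /\
    forall h : C, (Cmod h < d) -> (Cmod (f (z + h) - f z - l * h) <= eps * Cmod h).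

Notation is_Cderive f z l := (is_derive (K := C_AbsRing) (V := C_NormedModule) f z l).
Notation ex_Cderive f z := (ex_derive (K := C_AbsRing) (V := C_NormedModule) f z).

Lemma is_Cderive_cder (f : C -> C) (z l : C) : is_Cderive f z l <-> cder f z l.
Proof.
  split.
  - intros [_ H] eps He.
    specialize (H z (fun P HP => HP) (mkposreal eps He)).
    apply CA_locally_Cmod in H. destruct H as (d & Hd & H). exists d. split; auto.
    intros h Hh. specialize (H (z + h)).
    replace (z + h - z) with h in H by ring. specialize (H Hh).
    change (Cmod ((f (z + h) - f z) - (z + h - z) * l) <= eps * Cmod (z + h - z)) in H.
    replace (z + h - z) with h in H by ring. rewrite Cmult_comm. exact H.
  - intros H. split.
    + apply is_linear_scal_l.
    + intros x Hx eps.
      assert (E : z = x) by (apply (is_filter_lim_locally_unique (K := C_AbsRing)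
                             (V := AbsRing_NormedModule C_AbsRing)); exact Hx).
      subst x. apply CA_locally_Cmod. destruct (H eps (cond_pos eps)) as (d & Hd & H').
      exists d. split; auto. intros w Hw. specialize (H' (w - z) Hw).
      replace (z + (w - z)) with w in H' by ring.
      change (Cmod ((f w - f z) - (w - z) * l) <= eps * Cmod (w - z)).
      rewrite (Cmult_comm (w - z)). exact H'.
Qed.

Lemma cder_C_derive (f : C -> C) (z l : C) : cder f z l -> C_derive f z = l.
Proof. intros H. apply is_C_derive_unique. apply is_Cderive_cder. exact H. Qed.

Lemma ex_Cderive_cder (f : C -> C) (z : C) : ex_Cderive f z <-> cder f z (C_derive f z).
Proof.
  split.
  - intros [l H]. apply is_Cderive_cder in H as H'. rewrite (cder_C_derive f z l); auto.
  - intros H. exists (C_derive f z). apply is_Cderive_cder. exact H.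
Qed.

Lemma cder_ex (f : C -> C) (z l : C) : cder f z l -> ex_Cderive f z.
Proof. intros H. exists l. apply is_Cderive_cder. exact H. Qed.

Lemma cder_ext_loc (f g : C -> C) (z l : C) (r : R) : (0 < r) ->
  (forall w, (Cmod (w - z) < r) -> f w = g w) -> cder f z l -> cder g z l.
Proof.
  intros Hr E H eps He. destruct (H eps He) as (d & Hd & H').
  exists (Rmin d r). split. { apply Rmin_pos; auto. }
  intros h Hh. rewrite <- !E.
  - apply H'. eapply Rlt_le_trans; [exact Hh|apply Rmin_l].
  - replace (z - z) with (RtoC 0) by ring. rewrite Cmod_0. auto.
  - replace (z + h - z) with h by ring. eapply Rlt_le_trans; [exact Hh|apply Rmin_r].
Qed.

Lemma cder_ext (f g : C -> C) (z l : C) : (forall w, f w = g w) -> cder f z l -> cder g z l.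
Proof. intros E. apply (cder_ext_loc f g z l 1); auto. lra. Qed.

Lemma cder_val (f : C -> C) (z l l' : C) : cder f z l -> l = l' -> cder f z l'.
Proof. intros H E. subst. exact H. Qed.

Lemma cder_lipschitz (f : C -> C) (z l : C) : cder f z l ->
  exists d : R, (0 < d) /\ forall h, (Cmod h < d) ->
    (Cmod (f (z + h) - f z) <= (Cmod l + 1) * Cmod h).
Proof.
  intros H. destruct (H 1%R Rlt_0_1) as (d & Hd & H'). exists d. split; auto.
  intros h Hh. specialize (H' h Hh).
  replace (f (z + h) - f z) with ((f (z + h) - f z - l * h) + l * h) by ring.
  eapply Rle_trans; [apply Cmod_triangle|]. rewrite Cmod_mult. lra.
Qed.

Lemma cder_continuous (f : C -> C) (z l : C) : cder f z l ->
  continuous (T := C_UniformSpace) (U := C_UniformSpace) f z.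
Proof.
  intros H. destruct (cder_lipschitz f z l H) as (d & Hd & H').
  apply C_continuous_iff. intros eps He. apply C_locally_Cmod.
  pose proof (Cmod_ge_0 l) as Hl.
  exists (Rmin d (eps / (Cmod l + 2))). split.
  { apply Rmin_pos; auto. apply Rdiv_lt_0_compat; lra. }
  intros w Hw. assert (H1 : (Cmod (w - z) < d)) by (eapply Rlt_le_trans; [exact Hw|apply Rmin_l]).
  assert (H2 : (Cmod (w - z) < eps / (Cmod l + 2))) by (eapply Rlt_le_trans; [exact Hw|apply Rmin_r]).
  specialize (H' (w - z) H1). replace (z + (w - z)) with w in H' by ring.
  eapply Rle_lt_trans; [exact H'|].
  apply Rle_lt_trans with ((Cmod l + 1) * (eps / (Cmod l + 2)))%R.
  { apply Rmult_le_compat_l; lra. }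
  apply Rmult_lt_reg_r with (Cmod l + 2)%R; [lra|].
  replace ((Cmod l + 1) * (eps / (Cmod l + 2)) * (Cmod l + 2))%R with ((Cmod l + 1) * eps)%R by (field; lra).
  nra.
Qed.

Lemma ex_Cderive_continuous (f : C -> C) (z : C) : ex_Cderive f z ->
  continuous (T := C_UniformSpace) (U := C_UniformSpace) f z.
Proof. intros H. apply ex_Cderive_cder in H. eapply cder_continuous; eauto. Qed.

(* Caratheodory: differentiability is the continuity of the difference quotient. *)
Lemma cder_quotient (f : C -> C) (z l : C) :
  cder f z l <->
  continuous (T := C_UniformSpace) (U := C_UniformSpace)
    (fun w => if Ceq_dec w z then l else (f w - f z) / (w - z)) z.
Proof.
  rewrite C_continuous_iff. split.
  - intros H eps He. apply C_locally_Cmod.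
    destruct (H (eps / 2)%R ltac:(lra)) as (d & Hd & H').
    exists d. split; auto. intros w Hw.
    destruct (Ceq_dec z z) as [_|n]; [|congruence].
    destruct (Ceq_dec w z) as [E|n].
    + replace (l - l) with (RtoC 0) by ring. rewrite Cmod_0. lra.
    + assert (N : w - z <> 0) by (apply Cminus_eq_contra; auto).
      specialize (H' (w - z) Hw). replace (z + (w - z)) with w in H' by ring.
      replace ((f w - f z) / (w - z) - l) with ((f w - f z - l * (w - z)) / (w - z)) by (field; auto).
      rewrite Cmod_div by auto. apply Cmod_gt_0 in N.
      apply Rle_lt_trans with (eps / 2 * Cmod (w - z) / Cmod (w - z))%R.
      * apply Rmult_le_compat_r; auto. left. apply Rinv_0_lt_compat. auto.
      * replace (eps / 2 * Cmod (w - z) / Cmod (w - z))%R with (eps / 2)%R by (field; lra). lra.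
  - intros H eps He. destruct (proj1 (C_locally_Cmod _ _) (H eps He)) as (d & Hd & H').
    exists d. split; auto. intros h Hh. specialize (H' (z + h)).
    replace (z + h - z) with h in H' by ring. specialize (H' Hh).
    destruct (Ceq_dec z z) as [_|n]; [|congruence].
    destruct (Ceq_dec (z + h) z) as [E|n].
    + assert (E' : h = 0) by (replace h with (z + h - z) by ring; rewrite E; ring).
      subst h. rewrite Cplus_0_r, Cmult_0_r. replace (f z - f z - 0) with (RtoC 0) by ring.
      rewrite Cmod_0. lra.
    + assert (N : h <> 0) by (intro E; apply n; rewrite E; ring).
      replace (f (z + h) - f z - l * h) with (((f (z + h) - f z) / h - l) * h) by (field; auto).
      rewrite Cmod_mult. apply Rmult_le_compat_r; [apply Cmod_ge_0|lra].
Qed.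

Lemma cder_const (c z : C) : cder (fun _ => c) z 0.
Proof.
  intros eps He. exists 1%R. split; [lra|]. intros h _.
  replace (c - c - 0 * h) with (RtoC 0) by ring. rewrite Cmod_0.
  apply Rmult_le_pos; [lra|apply Cmod_ge_0].
Qed.

Lemma cder_id (z : C) : cder (fun w => w) z 1.
Proof.
  intros eps He. exists 1%R. split; [lra|]. intros h _.
  replace (z + h - z - 1 * h) with (RtoC 0) by ring. rewrite Cmod_0.
  apply Rmult_le_pos; [lra|apply Cmod_ge_0].
Qed.

Lemma cder_plus (f g : C -> C) (z a b : C) :
  cder f z a -> cder g z b -> cder (fun w => f w + g w) z (a + b).
Proof.
  intros Hf Hg eps He. destruct (Hf (eps / 2)%R ltac:(lra)) as (d1 & Hd1 & H1).
  destruct (Hg (eps / 2)%R ltac:(lra)) as (d2 & Hd2 & H2).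
  exists (Rmin d1 d2). split. { apply Rmin_pos; auto. }
  intros h Hh.
  specialize (H1 h (Rlt_le_trans _ _ _ Hh (Rmin_l _ _))).
  specialize (H2 h (Rlt_le_trans _ _ _ Hh (Rmin_r _ _))).
  replace (f (z + h) + g (z + h) - (f z + g z) - (a + b) * h)
    with ((f (z + h) - f z - a * h) + (g (z + h) - g z - b * h)) by ring.
  eapply Rle_trans; [apply Cmod_triangle|]. lra.
Qed.

Lemma cder_mult (f g : C -> C) (z a b : C) :
  cder f z a -> cder g z b -> cder (fun w => f w * g w) z (a * g z + f z * b).
Proof.
  intros Hf Hg. pose proof (cder_continuous _ _ _ Hf) as Cf.
  apply cder_quotient in Hf. apply cder_quotient in Hg. apply cder_quotient.
  (* In Caratheodory's form the product rule is an identity between difference quotients, and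
     continuity passes to sums and products. *)
  assert (K : continuous (T := C_UniformSpace) (U := C_UniformSpace)
     (fun w => (if Ceq_dec w z then a else (f w - f z) / (w - z)) * g z
       + f w * (if Ceq_dec w z then b else (g w - g z) / (w - z))) z).
  { apply C_continuous_plus; apply C_continuous_mult; auto. apply C_continuous_const. }
  revert K. apply C_continuous_ext. intros w. destruct (Ceq_dec w z) as [E|n].
  - rewrite E. reflexivity.
  - field. apply Cminus_eq_contra; auto.
Qed.

Lemma cder_scal (c : C) (f : C -> C) (z a : C) : cder f z a -> cder (fun w => c * f w) z (c * a).
Proof.
  intros H. eapply cder_val. { apply cder_mult; [apply cder_const|exact H]. } cbv beta. ring.
Qed.

Lemma cder_opp (f : C -> C) (z a : C) : cder f z a -> cder (fun w => - f w) z (- a).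
Proof.
  intros H. apply cder_ext with (fun w => (-1) * f w). { intros; ring. }
  eapply cder_val. { apply cder_scal. exact H. } ring.
Qed.

Lemma cder_minus (f g : C -> C) (z a b : C) :
  cder f z a -> cder g z b -> cder (fun w => f w - g w) z (a - b).
Proof. intros Hf Hg. apply cder_plus; auto. apply cder_opp. auto. Qed.

Lemma cder_inv (f : C -> C) (z a : C) : f z <> 0 ->
  cder f z a -> cder (fun w => / f w) z (- a / f z ^ 2).
Proof.
  intros N Hf. pose proof (cder_continuous _ _ _ Hf) as Cf.
  apply cder_quotient in Hf. apply cder_quotient.
  assert (Cn : locally (T := C_UniformSpace) z (fun w => f w <> 0)).
  { apply C_continuous_iff with (eps := Cmod (f z)) in Cf; [|apply Cmod_gt_0; auto].
    revert Cf. apply filter_imp. intros w Hw E. rewrite E in Hw.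
    replace (0 - f z) with (- f z) in Hw by ring. rewrite Cmod_opp in Hw. lra. }
  assert (K : continuous (T := C_UniformSpace) (U := C_UniformSpace)
     (fun w => (- (1)) * (if Ceq_dec w z then a else (f w - f z) / (w - z)) * (/ f w * / f z)) z).
  { apply C_continuous_mult; [apply C_continuous_mult; auto; apply C_continuous_const|].
    apply C_continuous_mult; [apply C_continuous_inv; auto | apply C_continuous_const]. }
  revert K. apply C_continuous_ext_loc. revert Cn. apply filter_imp. intros w Hw.
  destruct (Ceq_dec w z) as [E|n].
  - rewrite E. simpl. field. auto.
  - field. repeat split; auto. apply Cminus_eq_contra; auto.
Qed.

Lemma cder_div (f g : C -> C) (z a b : C) : g z <> 0 ->
  cder f z a -> cder g z b -> cder (fun w => f w / g w) z ((a * g z - f z * b) / g z ^ 2).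
Proof.
  intros N Hf Hg. eapply cder_val.
  { apply cder_mult; [exact Hf|apply cder_inv; [exact N|exact Hg]]. }
  cbv beta. simpl. field. auto.
Qed.

Lemma cder_pow (f : C -> C) (z a : C) (n : nat) :
  cder f z a -> cder (fun w => f w ^ n) z (INR n * f z ^ (n - 1) * a).
Proof.
  intros H. induction n.
  - simpl. eapply cder_val; [apply cder_const|]. ring.
  - simpl Cpow. eapply cder_val; [apply cder_mult; [exact H|exact IHn]|].
    rewrite S_INR, RtoC_plus. replace (S n - 1)%nat with n by lia.
    destruct n as [|n]. { simpl. ring. }
    replace (S n - 1)%nat with n by lia. simpl (S n - 0)%nat. rewrite Cpow_S. ring.
Qed.

Lemma cder_comp (f g : C -> C) (z a b : C) :
  cder g z b -> cder f (g z) a -> cder (fun w => f (g w)) z (a * b).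
Proof.
  intros Hg Hf. pose proof (cder_continuous _ _ _ Hg) as Cg.
  apply cder_quotient in Hf. apply cder_quotient in Hg. apply cder_quotient.
  (* For w <> z with g w = g z, the outer quotient takes the value a and the inner one is 0, so the
     product is still the quotient of the composite. *)
  assert (K : continuous (T := C_UniformSpace) (U := C_UniformSpace)
     (fun w => (if Ceq_dec (g w) (g z) then a else (f (g w) - f (g z)) / (g w - g z)) *
               (if Ceq_dec w z then b else (g w - g z) / (w - z))) z).
  { apply C_continuous_mult; auto.
    apply (continuous_comp (U := C_UniformSpace) g
      (fun u => if Ceq_dec u (g z) then a else (f u - f (g z)) / (u - g z))); auto. }
  revert K. apply C_continuous_ext. intros w. destruct (Ceq_dec w z) as [E|n].
  - rewrite E. destruct (Ceq_dec (g z) (g z)); congruence.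
  - destruct (Ceq_dec (g w) (g z)) as [E|n'].
    + rewrite E. field. apply Cminus_eq_contra; auto.
    + field. split; apply Cminus_eq_contra; auto.
Qed.

(** * Integrals of complex-valued functions of a real variable *)

Notation Ccont f x := (continuous (U := C_UniformSpace) f x).
Notation CInt f a b := (RInt (V := C_R_CompleteNormedModule) f a b : C).
Notation is_CInt f a b l := (is_RInt (V := C_R_NormedModule) f a b l).

(** A continuous linear map commutes with Riemann sums, hence with their limit. It is applied to
    multiplication by a complex constant, which is not a scalar of the real module C, and to the
    real part. *)
Lemma is_RInt_linear_map {V W : NormedModule R_AbsRing} (L : V -> W) (f : R -> V) (a b : R) (l : V) :
  (forall x y, L (plus x y) = plus (L x) (L y)) ->
  (forall k x, L (scal k x) = scal k (L x)) ->
  continuous L l ->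
  is_RInt f a b l -> is_RInt (fun x => L (f x)) a b (L l).
Proof.
  intros Hp Hs Hc H. unfold is_RInt in *.
  apply filterlim_ext with (fun ptd => L (scal (sign (b - a)) (Riemann_sum f ptd))).
  - intros ptd. rewrite Hs. f_equal.
    assert (Z : L zero = zero).
    { transitivity (L (scal 0%R zero)). { f_equal. symmetry. apply (scal_zero_l (V := V)). }
      rewrite Hs. apply (scal_zero_l (V := W)). }
    apply (SF_cons_ind (fun p => L (Riemann_sum f p) = Riemann_sum (fun x => L (f x)) p)).
    + intros x0. apply Z.
    + intros h s IH. rewrite !Riemann_sum_cons, Hp, Hs, IH. reflexivity.
  - eapply filterlim_comp; [exact H|exact Hc].
Qed.

Lemma is_CInt_scal (c : C) (f : R -> C) (a b : R) (l : C) :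
  is_CInt f a b l -> is_CInt (fun t => c * f t) a b (c * l).
Proof.
  apply (is_RInt_linear_map (V := C_R_NormedModule) (W := C_R_NormedModule) (fun z : C => c * z)).
  - intros x y. apply Cmult_plus_distr_l.
  - intros k x. rewrite !scal_R_Cmult. rewrite !Cmult_assoc, (Cmult_comm c). reflexivity.
  - apply (C_continuous_mult (T := C_UniformSpace)). apply C_continuous_const. apply continuous_id.
Qed.

Lemma continuous_Re (z : C) : continuous (T := C_UniformSpace) (U := R_UniformSpace) Re z.
Proof. apply continuous_fst. Qed.

Lemma continuous_Im (z : C) : continuous (T := C_UniformSpace) (U := R_UniformSpace) Im z.
Proof. apply continuous_snd. Qed.

Lemma is_RInt_Re (f : R -> C) (a b : R) (l : C) :
  is_CInt f a b l -> is_RInt (fun t => Re (f t)) a b (Re l).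
Proof.
  apply (is_RInt_linear_map (V := C_R_NormedModule) (W := R_NormedModule) Re).
  - intros x y. apply re_plus.
  - intros k x. rewrite scal_R_Cmult. apply re_scal_l.
  - apply continuous_Re.
Qed.

Definition continuous_on_seg (f : R -> C) (a b : R) : Prop :=
  forall t, Rmin a b <= t <= Rmax a b -> Ccont f t.

Lemma is_CInt_CInt (f : R -> C) (a b : R) : continuous_on_seg f a b -> is_CInt f a b (CInt f a b).
Proof. intros H. apply (RInt_correct (V := C_R_CompleteNormedModule)). apply (ex_RInt_continuous (V := C_R_CompleteNormedModule)). exact H. Qed.

Lemma is_CInt_eq (f : R -> C) (a b : R) (l : C) : is_CInt f a b l -> CInt f a b = l.
Proof. apply (is_RInt_unique (V := C_R_CompleteNormedModule)). Qed.

Lemma CInt_ext (f g : R -> C) (a b : R) :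
  (forall t, Rmin a b <= t <= Rmax a b -> f t = g t) -> CInt f a b = CInt g a b.
Proof. intros H. apply (RInt_ext (V := C_R_CompleteNormedModule)). intros. apply H. lra. Qed.

Lemma CInt_plus (f g : R -> C) (a b : R) : continuous_on_seg f a b -> continuous_on_seg g a b ->
  CInt (fun t => f t + g t) a b = CInt f a b + CInt g a b.
Proof.
  intros Hf Hg. apply is_CInt_eq. apply (is_RInt_plus (V := C_R_NormedModule)); apply is_CInt_CInt; auto.
Qed.

Lemma CInt_scal (c : C) (f : R -> C) (a b : R) : continuous_on_seg f a b ->
  CInt (fun t => c * f t) a b = c * CInt f a b.
Proof. intros Hf. apply is_CInt_eq. apply is_CInt_scal. apply is_CInt_CInt; auto. Qed.

Lemma CInt_minus (f g : R -> C) (a b : R) : continuous_on_seg f a b -> continuous_on_seg g a b ->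
  CInt (fun t => f t - g t) a b = CInt f a b - CInt g a b.
Proof.
  intros Hf Hg. apply is_CInt_eq. apply (is_RInt_minus (V := C_R_NormedModule)); apply is_CInt_CInt; auto.
Qed.

Lemma CInt_const (c : C) (a b : R) : CInt (fun _ => c) a b = (b - a)%R * c.
Proof. rewrite (RInt_const (V := C_R_CompleteNormedModule)). apply scal_R_Cmult. Qed.

Lemma CInt_swap (f : R -> C) (a b : R) : continuous_on_seg f a b -> CInt f b a = - CInt f a b.
Proof.
  intros H. symmetry. apply (opp_RInt_swap (V := C_R_CompleteNormedModule)).
  apply (ex_RInt_continuous (V := C_R_CompleteNormedModule)). exact H.
Qed.

Lemma CInt_Chasles (f : R -> C) (a b c : R) :
  continuous_on_seg f a b -> continuous_on_seg f b c ->
  CInt f a b + CInt f b c = CInt f a c.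
Proof.
  intros H1 H2. apply (RInt_Chasles (V := C_R_CompleteNormedModule));
  apply (ex_RInt_continuous (V := C_R_CompleteNormedModule)); auto.
Qed.

Lemma CInt_bound (f : R -> C) (a b M : R) : continuous_on_seg f a b ->
  (forall t, Rmin a b <= t <= Rmax a b -> Cmod (f t) <= M) ->
  Cmod (CInt f a b) <= M * Rabs (b - a).
Proof.
  assert (Main : forall a b, a <= b -> continuous_on_seg f a b ->
     (forall t, Rmin a b <= t <= Rmax a b -> Cmod (f t) <= M) ->
     Cmod (CInt f a b) <= M * (b - a)).
  { clear. intros a b Hab Hc Hb. rewrite Rmult_comm, Cmod_norm.
    apply (norm_RInt_le_const (V := C_R_NormedModule) f a b (CInt f a b) M Hab).
    - intros t Ht. rewrite <- Cmod_norm. apply Hb. rewrite Rmin_left, Rmax_right; auto.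
    - apply is_CInt_CInt; auto. }
  intros Hc Hb. destruct (Rle_dec a b) as [H|H].
  - rewrite Rabs_pos_eq by lra. auto.
  - rewrite Rabs_left by lra. assert (Hc' : continuous_on_seg f b a).
    { intros t Ht. apply Hc. rewrite Rmin_comm, Rmax_comm. exact Ht. }
    rewrite CInt_swap, Cmod_opp by exact Hc'.
    replace (- (b - a))%R with (a - b)%R by ring. apply Main; [lra|exact Hc'|].
    intros t Ht. apply Hb. rewrite Rmin_comm, Rmax_comm. exact Ht.
Qed.

Notation is_RCderive f t l := (is_derive (K := R_AbsRing) (V := C_R_NormedModule) f t (l : C)).

Lemma CInt_FTC (F f : R -> C) (a b : R) :
  (forall t, Rmin a b <= t <= Rmax a b -> is_RCderive F t (f t)) ->
  continuous_on_seg f a b -> CInt f a b = F b - F a.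
Proof.
  intros HF Hf. apply is_CInt_eq. apply (is_RInt_derive (V := C_R_CompleteNormedModule)); auto.
Qed.

Lemma is_derive_R_iff {V : NormedModule R_AbsRing} (f : R -> V) (t : R) (l : V) :
  is_derive f t l <->
  forall eps : R, 0 < eps -> exists d : R, 0 < d /\
    forall h : R, Rabs h < d -> norm (minus (minus (f (t + h)%R) (f t)) (scal h l)) <= eps * Rabs h.
Proof.
  split.
  - intros [_ H] eps He.
    destruct (H t (fun P HP => HP) (mkposreal eps He)) as [d Hd]. exists d. split. apply cond_pos.
    intros h Hh. specialize (Hd (t + h)%R).
    assert (E : (t + h + - t)%R = h) by ring.
    assert (B : ball t d (t + h)%R).
    { change (Rabs (t + h + - t) < d). rewrite E. exact Hh. }
    specialize (Hd B).
    change (norm (minus (minus (f (t + h)%R) (f t)) (scal (t + h + - t)%R l)) <= eps * Rabs (t + h + - t)) in Hd.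
    rewrite E in Hd. exact Hd.
  - intros H. split. { apply is_linear_scal_l. }
    intros x Hx eps.
    assert (E : t = x) by (apply (is_filter_lim_locally_unique (K := R_AbsRing)
                             (V := AbsRing_NormedModule R_AbsRing)); exact Hx).
    subst x.
    destruct (H eps (cond_pos eps)) as (d & Hd & H'). exists (mkposreal d Hd).
    intros s Hs. specialize (H' (s - t)%R Hs).
    assert (E : (t + (s - t))%R = (s : R)) by (simpl in s; ring).
    rewrite E in H'.
    exact H'.
Qed.

Lemma is_RCderive_iff (f : R -> C) (t : R) (l : C) :
  is_RCderive f t l <->
  forall eps : R, 0 < eps -> exists d : R, 0 < d /\
    forall h : R, Rabs h < d -> Cmod (f (t + h)%R - f t - h * l) <= eps * Rabs h.
Proof.
  rewrite is_derive_R_iff.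
  split; intros H eps He; destruct (H eps He) as (d & Hd & H'); exists d; (split; [exact Hd|]);
  intros h Hh; specialize (H' h Hh).
  - rewrite scal_R_Cmult in H'. rewrite Cmod_norm. exact H'.
  - rewrite scal_R_Cmult. rewrite Cmod_norm in H'. exact H'.
Qed.

Lemma is_RCderive_components (f : R -> C) (t : R) (l : C) :
  is_derive (fun s => Re (f s)) t (Re l) -> is_derive (fun s => Im (f s)) t (Im l) ->
  is_RCderive f t l.
Proof.
  rewrite is_RCderive_iff, !is_derive_R_iff. intros H1 H2 eps He.
  destruct (H1 (eps / 2)%R ltac:(lra)) as (d1 & Hd1 & H1').
  destruct (H2 (eps / 2)%R ltac:(lra)) as (d2 & Hd2 & H2').
  exists (Rmin d1 d2). split. { apply Rmin_pos; auto. }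
  intros h Hh. specialize (H1' h (Rlt_le_trans _ _ _ Hh (Rmin_l _ _))).
  specialize (H2' h (Rlt_le_trans _ _ _ Hh (Rmin_r _ _))).
  eapply Rle_trans; [apply Cmod_le_re_im|].
  change (Rabs ((Re (f (t + h)%R) - Re (f t)) - h * Re l) <= eps / 2 * Rabs h) in H1'.
  change (Rabs ((Im (f (t + h)%R) - Im (f t)) - h * Im l) <= eps / 2 * Rabs h) in H2'.
  unfold Cminus. rewrite !re_plus, !im_plus, !re_opp, !im_opp, !re_scal_l, !im_scal_l.
  unfold Rminus in H1', H2'. lra.
Qed.

Lemma cder_along (f : C -> C) (p : R -> C) (t : R) (l v : C) :
  is_RCderive p t v -> cder f (p t) l -> is_RCderive (fun s => f (p s)) t (l * v).
Proof.
  intros Hp Hf. apply is_RCderive_iff. rewrite is_RCderive_iff in Hp.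
  intros eps He. pose proof (Cmod_ge_0 v) as Hv. pose proof (Cmod_ge_0 l) as Hl.
  destruct (Hp 1%R Rlt_0_1) as (d1 & Hd1 & H1).
  destruct (Hp (eps / 2 / (Cmod l + 1))%R) as (d2 & Hd2 & H2).
  { apply Rdiv_lt_0_compat; lra. }
  destruct (Hf (eps / 2 / (Cmod v + 1))%R) as (d3 & Hd3 & H3).
  { apply Rdiv_lt_0_compat; lra. }
  assert (Hd4 : 0 < d3 / (Cmod v + 1)) by (apply Rdiv_lt_0_compat; lra).
  exists (Rmin (Rmin d1 d2) (d3 / (Cmod v + 1))). split.
  { repeat apply Rmin_pos; auto. }
  intros h Hh.
  assert (A1 : Rabs h < d1) by (eapply Rlt_le_trans; [exact Hh|]; eapply Rle_trans; apply Rmin_l).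
  assert (A2 : Rabs h < d2) by (eapply Rlt_le_trans; [exact Hh|]; eapply Rle_trans; [apply Rmin_l|apply Rmin_r]).
  assert (A3 : Rabs h < d3 / (Cmod v + 1)) by (eapply Rlt_le_trans; [exact Hh|apply Rmin_r]).
  specialize (H1 h A1). specialize (H2 h A2). pose proof (Rabs_pos h) as Hh0.
  set (k := p (t + h)%R - p t) in *.
  assert (Hk : Cmod k <= (Cmod v + 1) * Rabs h).
  { replace k with ((k - h * v) + h * v) by ring. eapply Rle_trans; [apply Cmod_triangle|].
    rewrite Cmod_mult, Cmod_R. lra. }
  specialize (H3 k).
  replace (p t + k) with (p (t + h)%R) in H3 by (unfold k; ring).
  replace (f (p (t + h)%R) - f (p t) - h * (l * v))
    with ((f (p (t + h)%R) - f (p t) - l * k) + l * (k - h * v)) by ring.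
  eapply Rle_trans; [apply Cmod_triangle|]. rewrite Cmod_mult.
  assert (Hk3 : Cmod k < d3).
  { eapply Rle_lt_trans; [exact Hk|]. apply Rmult_lt_reg_r with (/ (Cmod v + 1))%R.
    { apply Rinv_0_lt_compat; lra. }
    replace ((Cmod v + 1) * Rabs h * / (Cmod v + 1))%R with (Rabs h) by (field; lra). exact A3. }
  specialize (H3 Hk3).
  assert (B1 : eps / 2 / (Cmod v + 1) * Cmod k <= eps / 2 * Rabs h).
  { apply Rle_trans with (eps / 2 / (Cmod v + 1) * ((Cmod v + 1) * Rabs h))%R.
    - apply Rmult_le_compat_l; auto. left. apply Rdiv_lt_0_compat; lra.
    - right. field. lra. }
  assert (B2 : Cmod l * Cmod (k - h * v) <= eps / 2 * Rabs h).
  { apply Rle_trans with (Cmod l * (eps / 2 / (Cmod l + 1) * Rabs h))%R.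
    - apply Rmult_le_compat_l; auto.
    - apply Rle_trans with ((Cmod l + 1) * (eps / 2 / (Cmod l + 1) * Rabs h))%R.
      + apply Rmult_le_compat_r; [|lra]. apply Rmult_le_pos; auto. left. apply Rdiv_lt_0_compat; lra.
      + right. field. lra. }
  lra.
Qed.

(** * Goursat's lemma *)

Definition RectInt (f : C -> C) (x1 x2 y1 y2 : R) : C :=
  CInt (fun x => f (x, y1)) x1 x2 + Ci * CInt (fun y => f (x2, y)) y1 y2
  - CInt (fun x => f (x, y2)) x1 x2 - Ci * CInt (fun y => f (x1, y)) y1 y2.

(** The corners may come in any order, because primitives are integrated from the centre of a disc
    towards points on every side of it. *)
Definition in_rect (x1 x2 y1 y2 : R) (z : C) : Prop :=
  (Rmin x1 x2 <= Re z <= Rmax x1 x2) /\ (Rmin y1 y2 <= Im z <= Rmax y1 y2).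

Lemma Cmod_horizontal (x x' y : R) : Cmod ((x', y) - (x, y)) = Rabs (x' - x).
Proof.
  rewrite <- Cmod_R. f_equal. apply injective_projections; simpl; ring.
Qed.

Lemma Cmod_vertical (x y y' : R) : Cmod ((x, y') - (x, y)) = Rabs (y' - y).
Proof.
  replace ((x, y') - (x, y)) with (Ci * RtoC (y' - y)) by (apply injective_projections; simpl; ring).
  rewrite Cmod_mult, Cmod_Ci, Cmod_R. apply Rmult_1_l.
Qed.

Lemma Ccont_horizontal (f : C -> C) (x y : R) : Ccont f (x, y) -> Ccont (fun x => f (x, y)) x.
Proof.
  intros H. apply (continuous_comp (V := C_UniformSpace) (fun x : R => (x, y) : C) f); auto.
  apply C_continuous_iff. intros eps He. exists (mkposreal eps He). intros x' Hx'.
  eapply Rle_lt_trans; [right; apply Cmod_horizontal|exact Hx'].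
Qed.

Lemma Ccont_vertical (f : C -> C) (x y : R) : Ccont f (x, y) -> Ccont (fun y => f (x, y)) y.
Proof.
  intros H. apply (continuous_comp (V := C_UniformSpace) (fun y : R => (x, y) : C) f); auto.
  apply C_continuous_iff. intros eps He. exists (mkposreal eps He). intros y' Hy'.
  eapply Rle_lt_trans; [right; apply Cmod_vertical|exact Hy'].
Qed.

Lemma Ccont_sides (f : C -> C) (x1 x2 y1 y2 : R) :
  (forall z, in_rect x1 x2 y1 y2 z -> Ccont f z) ->
  (forall y, Rmin y1 y2 <= y <= Rmax y1 y2 -> continuous_on_seg (fun x => f (x, y)) x1 x2) /\
  (forall x, Rmin x1 x2 <= x <= Rmax x1 x2 -> continuous_on_seg (fun y => f (x, y)) y1 y2).
Proof.
  intros H. split.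
  - intros y Hy x Hx. apply Ccont_horizontal. apply H. split; auto.
  - intros x Hx y Hy. apply Ccont_vertical. apply H. split; auto.
Qed.

Ltac minmax := unfold Rmin, Rmax in *; repeat match goal with
  | |- context [Rle_dec ?a ?b] => destruct (Rle_dec a b)
  | H : context [Rle_dec ?a ?b] |- _ => destruct (Rle_dec a b) end; try lra.

Lemma RectInt_split_x (f : C -> C) (x1 m x2 y1 y2 : R) : x1 <= m <= x2 ->
  (forall z, in_rect x1 x2 y1 y2 z -> Ccont f z) ->
  RectInt f x1 x2 y1 y2 = RectInt f x1 m y1 y2 + RectInt f m x2 y1 y2.
Proof.
  intros Hm H. apply Ccont_sides in H. destruct H as [H _].
  unfold RectInt.
  rewrite <- (CInt_Chasles (fun x => f (x, y1)) x1 m x2), <- (CInt_Chasles (fun x => f (x, y2)) x1 m x2).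
  - ring.
  - intros t Ht. apply (H y2); minmax.
  - intros t Ht. apply (H y2); minmax.
  - intros t Ht. apply (H y1); minmax.
  - intros t Ht. apply (H y1); minmax.
Qed.

Lemma RectInt_split_y (f : C -> C) (x1 x2 y1 m y2 : R) : y1 <= m <= y2 ->
  (forall z, in_rect x1 x2 y1 y2 z -> Ccont f z) ->
  RectInt f x1 x2 y1 y2 = RectInt f x1 x2 y1 m + RectInt f x1 x2 m y2.
Proof.
  intros Hm H. apply Ccont_sides in H. destruct H as [_ H].
  unfold RectInt.
  rewrite <- (CInt_Chasles (fun y => f (x1, y)) y1 m y2), <- (CInt_Chasles (fun y => f (x2, y)) y1 m y2).
  - ring.
  - intros t Ht. apply (H x2); minmax.
  - intros t Ht. apply (H x2); minmax.
  - intros t Ht. apply (H x1); minmax.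
  - intros t Ht. apply (H x1); minmax.
Qed.

Lemma RectInt_swap_x (f : C -> C) (x1 x2 y1 y2 : R) :
  (forall z, in_rect x1 x2 y1 y2 z -> Ccont f z) ->
  RectInt f x2 x1 y1 y2 = - RectInt f x1 x2 y1 y2.
Proof.
  intros H. apply Ccont_sides in H. destruct H as [H _]. unfold RectInt.
  rewrite (CInt_swap (fun x => f (x, y1)) x1 x2), (CInt_swap (fun x => f (x, y2)) x1 x2).
  - ring.
  - apply H. minmax.
  - apply H. minmax.
Qed.

Lemma RectInt_swap_y (f : C -> C) (x1 x2 y1 y2 : R) :
  (forall z, in_rect x1 x2 y1 y2 z -> Ccont f z) ->
  RectInt f x1 x2 y2 y1 = - RectInt f x1 x2 y1 y2.
Proof.
  intros H. apply Ccont_sides in H. destruct H as [_ H]. unfold RectInt.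
  rewrite (CInt_swap (fun y => f (x1, y)) y1 y2), (CInt_swap (fun y => f (x2, y)) y1 y2).
  - ring.
  - apply H. minmax.
  - apply H. minmax.
Qed.

Lemma RectInt_minus (f g : C -> C) (x1 x2 y1 y2 : R) :
  (forall z, in_rect x1 x2 y1 y2 z -> Ccont f z) ->
  (forall z, in_rect x1 x2 y1 y2 z -> Ccont g z) ->
  RectInt (fun z => f z - g z) x1 x2 y1 y2 = RectInt f x1 x2 y1 y2 - RectInt g x1 x2 y1 y2.
Proof.
  intros Hf Hg. apply Ccont_sides in Hf. apply Ccont_sides in Hg.
  destruct Hf as [F1 F2]. destruct Hg as [G1 G2]. unfold RectInt.
  assert (I : Rmin y1 y2 <= y1 <= Rmax y1 y2 /\ Rmin y1 y2 <= y2 <= Rmax y1 y2) by minmax.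
  assert (J : Rmin x1 x2 <= x1 <= Rmax x1 x2 /\ Rmin x1 x2 <= x2 <= Rmax x1 x2) by minmax.
  rewrite (CInt_minus (fun x => f (x, y1))), (CInt_minus (fun x => f (x, y2))),
    (CInt_minus (fun y => f (x1, y))), (CInt_minus (fun y => f (x2, y))).
  ring. apply F2; tauto. apply G2; tauto. apply F2; tauto. apply G2; tauto.
  apply F1; tauto. apply G1; tauto. apply F1; tauto. apply G1; tauto.
Qed.

Lemma RectInt_bound (f : C -> C) (x1 x2 y1 y2 M : R) : x1 <= x2 -> y1 <= y2 ->
  (forall z, in_rect x1 x2 y1 y2 z -> Ccont f z) ->
  (forall z, in_rect x1 x2 y1 y2 z -> Cmod (f z) <= M) ->
  Cmod (RectInt f x1 x2 y1 y2) <= 2 * M * ((x2 - x1) + (y2 - y1)).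
Proof.
  intros Hx Hy Hc Hb. apply Ccont_sides in Hc. destruct Hc as [H1 H2]. unfold RectInt.
  eapply Rle_trans; [apply Cmod_sub_le|].
  eapply Rle_trans; [apply Rplus_le_compat_r; apply Cmod_sub_le|].
  eapply Rle_trans; [apply Rplus_le_compat_r, Rplus_le_compat_r; apply Cmod_triangle|].
  rewrite !Cmod_mult, !Cmod_Ci, !Rmult_1_l.
  assert (B1 : forall y, Rmin y1 y2 <= y <= Rmax y1 y2 -> Cmod (CInt (fun x => f (x, y)) x1 x2) <= M * Rabs (x2 - x1)).
  { intros y Ht. apply CInt_bound; [apply H1; auto|]. intros x Hx'. apply Hb. split; auto. }
  assert (B2 : forall x, Rmin x1 x2 <= x <= Rmax x1 x2 -> Cmod (CInt (fun y => f (x, y)) y1 y2) <= M * Rabs (y2 - y1)).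
  { intros x Ht. apply CInt_bound; [apply H2; auto|]. intros y Hy'. apply Hb. split; auto. }
  rewrite Rabs_pos_eq in B1, B2 by lra.
  pose proof (B1 y1 ltac:(minmax)). pose proof (B1 y2 ltac:(minmax)).
  pose proof (B2 x1 ltac:(minmax)). pose proof (B2 x2 ltac:(minmax)). lra.
Qed.

Lemma is_RCderive_horizontal (s y : R) : is_RCderive (fun x => (x, y) : C) s 1.
Proof.
  apply is_RCderive_iff. intros eps He. exists 1%R. split; [lra|]. intros h _.
  match goal with |- Cmod ?X <= _ => replace X with (RtoC 0) by (apply injective_projections; simpl; ring) end.
  rewrite Cmod_0. apply Rmult_le_pos; [lra|apply Rabs_pos].
Qed.

Lemma is_RCderive_vertical (x s : R) : is_RCderive (fun y => (x, y) : C) s Ci.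
Proof.
  apply is_RCderive_iff. intros eps He. exists 1%R. split; [lra|]. intros h _.
  match goal with |- Cmod ?X <= _ => replace X with (RtoC 0) by (apply injective_projections; simpl; ring) end.
  rewrite Cmod_0. apply Rmult_le_pos; [lra|apply Rabs_pos].
Qed.

Lemma RectInt_primitive (F f : C -> C) (x1 x2 y1 y2 : R) :
  (forall z, in_rect x1 x2 y1 y2 z -> Ccont f z) ->
  (forall z, in_rect x1 x2 y1 y2 z -> cder F z (f z)) ->
  RectInt f x1 x2 y1 y2 = 0.
Proof.
  intros Hc HF. pose proof (Ccont_sides _ _ _ _ _ Hc) as [H1 H2]. unfold RectInt.
  assert (B1 : forall y, Rmin y1 y2 <= y <= Rmax y1 y2 ->
    CInt (fun x => f (x, y)) x1 x2 = F (x2, y) - F (x1, y)).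
  { intros y Hy. apply (CInt_FTC (fun x => F (x, y))); [|apply H1; auto].
    intros x Hx. replace (f (x, y)) with (f (x, y) * 1) by ring.
    apply (cder_along F (fun x => (x, y))). apply is_RCderive_horizontal. apply HF. split; auto. }
  assert (B2 : forall x, Rmin x1 x2 <= x <= Rmax x1 x2 ->
    Ci * CInt (fun y => f (x, y)) y1 y2 = F (x, y2) - F (x, y1)).
  { intros x Hx. rewrite <- CInt_scal by (apply H2; auto).
    apply (CInt_FTC (fun y => F (x, y))).
    - intros y Hy. rewrite Cmult_comm.
      apply (cder_along F (fun y => (x, y))). apply is_RCderive_vertical. apply HF. split; auto.
    - intros y Hy. apply C_continuous_mult. apply C_continuous_const. apply H2; auto. }
  rewrite !B1, !B2 by minmax. ring.
Qed.

(** Bisection for an arbitrary property of rectangles that always passes to one of the four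
    quarters. It serves twice: for a large boundary integral in [Goursat], and for the location of a
    minimum in [rectangle_minimum]. *)
Lemma quad_bisection (P : R -> R -> R -> R -> Prop) (x1 x2 y1 y2 : R) :
  x1 <= x2 -> y1 <= y2 ->
  (forall a b c d, x1 <= a <= b -> b <= x2 -> y1 <= c <= d -> d <= y2 -> P a b c d ->
     P a ((a + b) / 2)%R c ((c + d) / 2)%R \/ P ((a + b) / 2)%R b c ((c + d) / 2)%R \/
     P a ((a + b) / 2)%R ((c + d) / 2)%R d \/ P ((a + b) / 2)%R b ((c + d) / 2)%R d) ->
  P x1 x2 y1 y2 ->
  exists px py, x1 <= px <= x2 /\ y1 <= py <= y2 /\ forall N : nat, exists a b c d,
    x1 <= a <= px /\ px <= b <= x2 /\ y1 <= c <= py /\ py <= d <= y2 /\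
    (b - a = (x2 - x1) / 2 ^ N)%R /\ (d - c = (y2 - y1) / 2 ^ N)%R /\ P a b c d.
Proof.
  intros Hx Hy Hstep H0.
  set (good := fun q : (R * R) * (R * R) =>
    let '((a, b), (c, d)) := q in
    x1 <= a <= b /\ b <= x2 /\ y1 <= c <= d /\ d <= y2 /\ P a b c d).
  assert (step : forall q, good q -> exists q', good q' /\
     fst (fst q) <= fst (fst q') /\ snd (fst q') <= snd (fst q) /\
     fst (snd q) <= fst (snd q') /\ snd (snd q') <= snd (snd q) /\
     (snd (fst q') - fst (fst q') = (snd (fst q) - fst (fst q)) / 2)%R /\
     (snd (snd q') - fst (snd q') = (snd (snd q) - fst (snd q)) / 2)%R).
  { intros [[a b] [c d]] (A1 & A2 & A3 & A4 & A5).
    destruct (Hstep a b c d) as [Q|[Q|[Q|Q]]]; auto;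
    [exists ((a, (a + b) / 2), (c, (c + d) / 2))%R | exists (((a + b) / 2, b), (c, (c + d) / 2))%R
    |exists ((a, (a + b) / 2), ((c + d) / 2, d))%R | exists (((a + b) / 2, b), ((c + d) / 2, d))%R];
    simpl; repeat split; auto; lra. }
  set (nxt := fun q : {q | good q} =>
     let (q', Hq') := constructive_indefinite_description _ (step (proj1_sig q) (proj2_sig q)) in
     exist good q' (proj1 Hq')).
  assert (G0 : good ((x1, x2), (y1, y2))) by (simpl; repeat split; auto; lra).
  set (sq := fix sq n := match n with O => exist good _ G0 | S n => nxt (sq n) end).
  set (A := fun n => fst (fst (proj1_sig (sq n)))). set (B := fun n => snd (fst (proj1_sig (sq n)))).
  set (Cc := fun n => fst (snd (proj1_sig (sq n)))). set (D := fun n => snd (snd (proj1_sig (sq n)))).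
  assert (Hs : forall n, A n <= A (S n) /\ B (S n) <= B n /\ Cc n <= Cc (S n) /\ D (S n) <= D n /\
     (B (S n) - A (S n) = (B n - A n) / 2)%R /\ (D (S n) - Cc (S n) = (D n - Cc n) / 2)%R).
  { intros n. unfold A, B, Cc, D. simpl. unfold nxt at 1 2 3 4 5 6 7 8.
    destruct (constructive_indefinite_description _ _) as [q' Hq']. simpl. tauto. }
  assert (HG : forall n, good ((A n, B n), (Cc n, D n))).
  { intros n. unfold A, B, Cc, D. generalize (proj2_sig (sq n)).
    destruct (proj1_sig (sq n)) as [[? ?] [? ?]]. auto. }
  assert (Mon : forall n k, A n <= A (n + k)%nat /\ B (n + k)%nat <= B n /\
       Cc n <= Cc (n + k)%nat /\ D (n + k)%nat <= D n).
  { intros n k. induction k.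
    - rewrite Nat.add_0_r. lra.
    - rewrite Nat.add_succ_r. specialize (Hs (n + k)%nat). lra. }
  assert (AB : forall n m, A n <= B m).
  { intros n m. pose proof (Mon n m). pose proof (Mon m n). rewrite (Nat.add_comm m n) in H1.
    pose proof (HG (n + m)%nat) as [? _]. lra. }
  assert (CD : forall n m, Cc n <= D m).
  { intros n m. pose proof (Mon n m). pose proof (Mon m n). rewrite (Nat.add_comm m n) in H1.
    pose proof (HG (n + m)%nat) as (_ & _ & ? & _). lra. }
  destruct (completeness (fun r => exists n, r = A n)) as [px [Hpx1 Hpx2]].
  { exists (B 0%nat). intros r [n ->]. apply AB. } { exists (A 0%nat). exists 0%nat. reflexivity. }
  destruct (completeness (fun r => exists n, r = Cc n)) as [py [Hpy1 Hpy2]].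
  { exists (D 0%nat). intros r [n ->]. apply CD. } { exists (Cc 0%nat). exists 0%nat. reflexivity. }
  assert (PX : forall n, A n <= px <= B n).
  { intros n. split. apply Hpx1. exists n; auto. apply Hpx2. intros r [m ->]. apply AB. }
  assert (PY : forall n, Cc n <= py <= D n).
  { intros n. split. apply Hpy1. exists n; auto. apply Hpy2. intros r [m ->]. apply CD. }
  exists px, py. split; [exact (PX 0%nat)|]. split; [exact (PY 0%nat)|].
  assert (Sz : forall n, (B n - A n = (x2 - x1) / 2 ^ n)%R /\ (D n - Cc n = (y2 - y1) / 2 ^ n)%R).
  { induction n.
    - unfold A, B, Cc, D. simpl. split; field.
    - pose proof (pow_lt 2 n ltac:(lra)). destruct IHn as [I1 I2].
      destruct (Hs n) as (_ & _ & _ & _ & E1 & E2). rewrite E1, E2, I1, I2. simpl. split; field; lra. }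
  intros N. exists (A N), (B N), (Cc N), (D N).
  destruct (HG N) as (? & ? & ? & ? & ?). specialize (PX N). specialize (PY N). specialize (Sz N).
  repeat split; try lra. auto.
Qed.

Theorem Goursat (f : C -> C) (x1 x2 y1 y2 : R) : x1 <= x2 -> y1 <= y2 ->
  (forall z, in_rect x1 x2 y1 y2 z -> ex_Cderive f z) ->
  RectInt f x1 x2 y1 y2 = 0.
Proof.
  intros Hx Hy Hf. apply NNPP. intros N. apply Cmod_gt_0 in N.
  assert (Hcont : forall z, in_rect x1 x2 y1 y2 z -> Ccont f z).
  { intros z Hz. apply ex_Cderive_continuous. auto. }
  set (s := ((x2 - x1) + (y2 - y1))%R).
  assert (Hs : 0 < s).
  { destruct (Rle_lt_or_eq_dec 0 s) as [H|H]; auto. { unfold s; lra. }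
    exfalso. assert (E1 : x2 = x1) by (unfold s in H; lra). assert (E2 : y2 = y1) by (unfold s in H; lra).
    subst x2 y2. unfold RectInt in N. rewrite !(RInt_point (V := C_R_CompleteNormedModule)) in N.
    change (@zero C_R_CompleteNormedModule) with (RtoC 0) in N.
    replace (0 + Ci * 0 - 0 - Ci * 0) with (RtoC 0) in N by ring. rewrite Cmod_0 in N. lra. }
  (* Normalized so that the lower bound c (half perimeter)^2 for the integral is an equality on the
     whole rectangle. Halving the sides divides this bound by 4, and one quarter must keep a fourth
     of the integral. *)
  set (c := (Cmod (RectInt f x1 x2 y1 y2) / s ^ 2)%R).
  assert (Hc : 0 < c). { unfold c. apply Rdiv_lt_0_compat; auto. apply pow_lt; auto. }
  destruct (quad_bisection (fun a b c' d => c * ((b - a) + (d - c')) ^ 2 <= Cmod (RectInt f a b c' d)) x1 x2 y1 y2)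
    as (px & py & Hpx & Hpy & HN); auto.
  - intros a b c' d Ha Hb Hc' Hd HP.
    assert (Hr : forall z, in_rect a b c' d z -> Ccont f z).
    { intros z [Z1 Z2]. apply Hcont. split; minmax. }
    rewrite (RectInt_split_x f a ((a + b) / 2) b) in HP; [|lra|auto].
    rewrite (RectInt_split_y f a ((a + b) / 2) c' ((c' + d) / 2) d) in HP;
     [|lra|intros z [Z1 Z2]; apply Hr; split; minmax].
    rewrite (RectInt_split_y f ((a + b) / 2) b c' ((c' + d) / 2) d) in HP;
     [|lra|intros z [Z1 Z2]; apply Hr; split; minmax].
    pose proof (Cmod_triangle (RectInt f a ((a + b) / 2) c' ((c' + d) / 2) + RectInt f a ((a + b) / 2) ((c' + d) / 2) d)
      (RectInt f ((a + b) / 2) b c' ((c' + d) / 2) + RectInt f ((a + b) / 2) b ((c' + d) / 2) d)) as T0.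
    pose proof (Cmod_triangle (RectInt f a ((a + b) / 2) c' ((c' + d) / 2)) (RectInt f a ((a + b) / 2) ((c' + d) / 2) d)) as T1.
    pose proof (Cmod_triangle (RectInt f ((a + b) / 2) b c' ((c' + d) / 2)) (RectInt f ((a + b) / 2) b ((c' + d) / 2) d)) as T2.
    set (q := (c * (((b - a) + (d - c')) / 2) ^ 2)%R).
    assert (E : (c * ((b - a) + (d - c')) ^ 2 = 4 * q)%R) by (unfold q; field).
    replace (c * ((a + b) / 2 - a + ((c' + d) / 2 - c')) ^ 2)%R with q by (unfold q; field).
    replace (c * (b - (a + b) / 2 + ((c' + d) / 2 - c')) ^ 2)%R with q by (unfold q; field).
    replace (c * ((a + b) / 2 - a + (d - (c' + d) / 2)) ^ 2)%R with q by (unfold q; field).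
    replace (c * (b - (a + b) / 2 + (d - (c' + d) / 2)) ^ 2)%R with q by (unfold q; field).
    destruct (Rle_dec q (Cmod (RectInt f a ((a + b) / 2) c' ((c' + d) / 2)))); [left; assumption|].
    destruct (Rle_dec q (Cmod (RectInt f ((a + b) / 2) b c' ((c' + d) / 2)))); [right; left; assumption|].
    destruct (Rle_dec q (Cmod (RectInt f a ((a + b) / 2) ((c' + d) / 2) d))); [right; right; left; assumption|].
    destruct (Rle_dec q (Cmod (RectInt f ((a + b) / 2) b ((c' + d) / 2) d))); [right; right; right; assumption|].
    lra.
  - fold s. unfold c. right. field. lra.
  - set (p := (px, py) : C).
    assert (Hp : in_rect x1 x2 y1 y2 p) by (split; simpl; minmax).
    pose proof (Hf p Hp) as Dp. apply ex_Cderive_cder in Dp. set (l := C_derive f p) in *.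
    destruct (Dp (c / 4)%R ltac:(lra)) as (dl & Hdl & Hdl').
    assert (exists N : nat, s / 2 ^ N < dl) as [N' HN'].
    { destruct (pow_lt_1_zero (/ 2) ltac:(rewrite Rabs_pos_eq; lra) (dl / s)%R
        ltac:(apply Rdiv_lt_0_compat; auto)) as [N' HN']. exists N'.
      specialize (HN' N' (Nat.le_refl _)). rewrite Rabs_pos_eq in HN' by (apply pow_le; lra).
      rewrite pow_inv in HN'. unfold Rdiv.
      apply Rmult_lt_reg_l with (/ s)%R; [apply Rinv_0_lt_compat; auto|].
      replace (/ s * (s * / 2 ^ N'))%R with (/ 2 ^ N')%R by (field; split; [apply pow_nonzero|]; lra).
      unfold Rdiv in HN'. lra. }
    destruct (HN N') as (a & b & c' & d & Ha & Hb & Hc' & Hd & S1 & S2 & HP).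
    set (s' := ((b - a) + (d - c'))%R) in *.
    assert (Es : (s' = s / 2 ^ N')%R).
    { unfold s'. rewrite S1, S2. unfold s. field. apply pow_nonzero; lra. }
    assert (Hs' : 0 < s'). { rewrite Es. apply Rdiv_lt_0_compat; auto. apply pow_lt; lra. }
    assert (Hr : forall z, in_rect a b c' d z -> Ccont f z).
    { intros z [Z1 Z2]. apply Hcont. split; minmax. }
    (* The affine part of f at p has a primitive, so only the o(z - p) remainder contributes. *)
    set (g := fun z => f p + l * (z - p)).
    assert (Cg : forall z, Ccont g z).
    { intros z. unfold g. apply C_continuous_plus. apply C_continuous_const.
      apply C_continuous_mult. apply C_continuous_const. apply C_continuous_minus.
      apply continuous_id. apply C_continuous_const. }
    assert (Zg : RectInt g a b c' d = 0).
    { apply (RectInt_primitive (fun z => f p * z + l / 2 * (z - p) ^ 2)); auto.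
      intros z _. unfold g. eapply cder_val.
      { apply cder_plus. apply cder_scal. apply cder_id. apply cder_scal.
        apply cder_pow. apply cder_minus. apply cder_id. apply cder_const. }
      simpl. rewrite RtoC_plus. field. }
    (* With a remainder of at most (c/4) s' on a boundary of length 2 s', the integral is at most
       (c/2) s'^2, against the lower bound c s'^2. *)
    assert (K : Cmod (RectInt (fun z => f z - g z) a b c' d) <= 2 * (c / 4 * s') * s').
    { apply RectInt_bound; try lra.
      - intros z Hz. apply C_continuous_minus; auto.
      - intros z [Z1 Z2].
        assert (Bz : Cmod (z - p) <= s').
        { eapply Rle_trans; [apply Cmod_le_re_im|]. unfold Cminus. rewrite re_plus, im_plus, re_opp, im_opp.
          simpl (Re p). simpl (Im p). apply Rplus_le_compat; apply Rabs_le; minmax. }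
        specialize (Hdl' (z - p)). replace (p + (z - p)) with z in Hdl' by ring.
        unfold g. replace (f z - (f p + l * (z - p))) with (f z - f p - l * (z - p)) by ring.
        eapply Rle_trans; [apply Hdl'; lra|]. apply Rmult_le_compat_l; lra. }
    rewrite RectInt_minus in K; auto. rewrite Zg in K.
    replace (RectInt f a b c' d - 0) with (RectInt f a b c' d) in K by ring.
    pose proof (Rmult_lt_0_compat _ _ Hc (pow_lt s' 2 Hs')) as Hpos. simpl in HP, Hpos. lra.
Qed.

(** * Primitives on discs *)

Notation disc c r := (fun z : C => Cmod (z - c) < r).

Lemma RectInt_degenerate_x (f : C -> C) (x y1 y2 : R) : RectInt f x x y1 y2 = 0.
Proof.
  unfold RectInt. rewrite !(RInt_point (V := C_R_CompleteNormedModule)).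
  change (@zero C_R_CompleteNormedModule) with (RtoC 0). ring.
Qed.

Lemma RectInt_degenerate_y (f : C -> C) (x1 x2 y : R) : RectInt f x1 x2 y y = 0.
Proof.
  unfold RectInt. rewrite !(RInt_point (V := C_R_CompleteNormedModule)).
  change (@zero C_R_CompleteNormedModule) with (RtoC 0). ring.
Qed.

(** The four rectangles around a small square about z0 fall under [Goursat]. The square itself
    contributes at most a multiple of its side, because f is bounded near z0. *)
Lemma Goursat_except (f : C -> C) (z0 : C) (x1 x2 y1 y2 : R) : x1 <= x2 -> y1 <= y2 ->
  (forall z, in_rect x1 x2 y1 y2 z -> Ccont f z) ->
  (forall z, in_rect x1 x2 y1 y2 z -> z <> z0 -> ex_Cderive f z) ->
  RectInt f x1 x2 y1 y2 = 0.
Proof.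
  intros Hx Hy Hc Hd.
  assert (G : forall a b c d, x1 <= a <= b -> b <= x2 -> y1 <= c <= d -> d <= y2 ->
     ~ in_rect a b c d z0 -> RectInt f a b c d = 0).
  { intros a b c d Ha Hb Hc' Hd' Hz. apply Goursat; try lra. intros z Hz'. apply Hd.
    - destruct Hz' as [Z1 Z2]. split; minmax.
    - intros E. apply Hz. rewrite <- E. exact Hz'. }
  destruct (classic (in_rect x1 x2 y1 y2 z0)) as [Hz0|Hz0]; [|apply G; auto; lra].
  apply NNPP. intros N. apply Cmod_gt_0 in N.
  pose proof (Hc z0 Hz0) as C0. apply C_continuous_iff with (eps := 1%R) in C0; [|lra].
  apply C_locally_Cmod in C0. destruct C0 as (dl & Hdl & C0).
  set (M := (Cmod (f z0) + 1)%R). pose proof (Cmod_ge_0 (f z0)) as M0.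
  assert (HM : 0 < M) by (unfold M; lra).
  (* The remaining square has sides at most 2 eta and |f| <= M on it, so its integral is at most 8 M
     eta; the factor 16 makes this half of the supposed nonzero value. *)
  set (eta := Rmin (dl / 4) (Cmod (RectInt f x1 x2 y1 y2) / (16 * M))).
  assert (Heta : 0 < eta).
  { apply Rmin_pos; [lra|]. apply Rdiv_lt_0_compat; auto; lra. }
  assert (He1 : eta <= dl / 4) by apply Rmin_l.
  assert (He2 : 8 * M * eta < Cmod (RectInt f x1 x2 y1 y2)).
  { apply Rle_lt_trans with (8 * M * (Cmod (RectInt f x1 x2 y1 y2) / (16 * M)))%R.
    - apply Rmult_le_compat_l; [lra|apply Rmin_r].
    - replace (8 * M * (Cmod (RectInt f x1 x2 y1 y2) / (16 * M)))%R
        with (Cmod (RectInt f x1 x2 y1 y2) / 2)%R by (field; lra). lra. }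
  clearbody eta.
  destruct Hz0 as [Zx Zy]. rewrite Rmin_left, Rmax_right in Zx, Zy by auto.
  set (a1 := Rmax x1 (Re z0 - eta)). set (a2 := Rmin x2 (Re z0 + eta)).
  set (b1 := Rmax y1 (Im z0 - eta)). set (b2 := Rmin y2 (Im z0 + eta)).
  assert (A1 : x1 <= a1 /\ Re z0 - eta <= a1 /\ a1 <= Re z0) by (unfold a1; minmax).
  assert (A2 : a2 <= x2 /\ a2 <= Re z0 + eta /\ Re z0 <= a2) by (unfold a2; minmax).
  assert (B1 : y1 <= b1 /\ Im z0 - eta <= b1 /\ b1 <= Im z0) by (unfold b1; minmax).
  assert (B2 : b2 <= y2 /\ b2 <= Im z0 + eta /\ Im z0 <= b2) by (unfold b2; minmax).
  assert (Z1 : RectInt f x1 a1 y1 y2 = 0).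
  { destruct (Req_dec x1 a1) as [E|E]. { rewrite <- E. apply RectInt_degenerate_x. }
    apply G; try lra. intros [Q _]. revert Q E. unfold a1. minmax. }
  assert (Z2 : RectInt f a2 x2 y1 y2 = 0).
  { destruct (Req_dec a2 x2) as [E|E]. { rewrite <- E. apply RectInt_degenerate_x. }
    apply G; try lra. intros [Q _]. revert Q E. unfold a2. minmax. }
  assert (Z3 : RectInt f a1 a2 y1 b1 = 0).
  { destruct (Req_dec y1 b1) as [E|E]. { rewrite <- E. apply RectInt_degenerate_y. }
    apply G; try lra. intros [_ Q]. revert Q E. unfold b1. minmax. }
  assert (Z4 : RectInt f a1 a2 b2 y2 = 0).
  { destruct (Req_dec b2 y2) as [E|E]. { rewrite <- E. apply RectInt_degenerate_y. }
    apply G; try lra. intros [_ Q]. revert Q E. unfold b2. minmax. }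
  clearbody a1 a2 b1 b2.
  assert (K : Cmod (RectInt f a1 a2 b1 b2) <= 2 * M * ((a2 - a1) + (b2 - b1))).
  { apply RectInt_bound; try lra.
    - intros z [Q1 Q2]. apply Hc. split; minmax.
    - intros z [Q1 Q2]. rewrite Rmin_left, Rmax_right in Q1, Q2 by lra.
      assert (Hz : Cmod (z - z0) < dl).
      { eapply Rle_lt_trans; [apply Cmod_le_re_im|]. unfold Cminus. rewrite re_plus, im_plus, re_opp, im_opp.
        apply Rle_lt_trans with (eta + eta)%R; [|lra].
        apply Rplus_le_compat; apply Rabs_le; lra. }
      specialize (C0 z Hz). pose proof (Cmod_reverse_triangle (f z) (f z0)). unfold M. lra. }
  assert (E : RectInt f x1 x2 y1 y2 = RectInt f a1 a2 b1 b2).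
  { rewrite (RectInt_split_x f x1 a1 x2); [|lra|auto].
    rewrite (RectInt_split_x f a1 a2 x2); [|lra|intros z [Q1 Q2]; apply Hc; split; minmax].
    rewrite (RectInt_split_y f a1 a2 y1 b1 y2); [|lra|intros z [Q1 Q2]; apply Hc; split; minmax].
    rewrite (RectInt_split_y f a1 a2 b1 b2 y2); [|lra|intros z [Q1 Q2]; apply Hc; split; minmax].
    rewrite Z1, Z2, Z3, Z4. ring. }
  rewrite E in He2.
  assert (2 * M * ((a2 - a1) + (b2 - b1)) <= 2 * M * (4 * eta)).
  { apply Rmult_le_compat_l; lra. }
  lra.
Qed.

Lemma pow2_Cmod_lt (z : C) (r : R) : 0 <= r -> (Cmod z < r <-> Re z ^ 2 + Im z ^ 2 < r ^ 2).
Proof.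
  intros Hr. rewrite <- Cmod2_alt. pose proof (Cmod_ge_0 z). split; intros H'.
  - simpl. nra.
  - apply Rnot_le_lt. intros L. pose proof (pow_incr r (Cmod z) 2 (conj Hr L)). lra.
Qed.

(** In each coordinate the distance to the centre is largest at an end of the interval, so some
    corner is at least as far away as the point. *)
Lemma disc_convex_rect (c : C) (r : R) (x1 x2 y1 y2 : R) : x1 <= x2 -> y1 <= y2 ->
  disc c r (x1, y1) -> disc c r (x1, y2) -> disc c r (x2, y1) -> disc c r (x2, y2) ->
  forall z, in_rect x1 x2 y1 y2 z -> disc c r z.
Proof.
  intros Hx Hy H11 H12 H21 H22 z [Z1 Z2]. rewrite Rmin_left, Rmax_right in Z1, Z2 by auto.
  assert (Hr : 0 < r) by (eapply Rle_lt_trans; [apply Cmod_ge_0|exact H11]).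
  destruct c as [cx cy]. destruct z as [zx zy]. simpl in Z1, Z2.
  assert (Q : forall a b : R, Cmod ((a, b) - (cx, cy)) < r <-> (a - cx) ^ 2 + (b - cy) ^ 2 < r ^ 2).
  { intros a b. exact (pow2_Cmod_lt ((a, b) - (cx, cy)) r ltac:(lra)). }
  rewrite Q in *.
  assert (Px : (zx - cx) ^ 2 <= (x1 - cx) ^ 2 \/ (zx - cx) ^ 2 <= (x2 - cx) ^ 2).
  { destruct (Rle_dec zx cx); [left|right]; nra. }
  assert (Py : (zy - cy) ^ 2 <= (y1 - cy) ^ 2 \/ (zy - cy) ^ 2 <= (y2 - cy) ^ 2).
  { destruct (Rle_dec zy cy); [left|right]; nra. }
  destruct Px, Py; lra.
Qed.

(** The hypothesis is the vanishing of rectangle integrals rather than differentiability, so that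
    functions with an exceptional point are covered too. The primitive integrates from the centre
    horizontally, then vertically. *)
Lemma disc_primitive (f : C -> C) (c : C) (r : R) :
  (forall z, disc c r z -> Ccont f z) ->
  (forall x1 x2 y1 y2, x1 <= x2 -> y1 <= y2 -> (forall z, in_rect x1 x2 y1 y2 z -> disc c r z) ->
     RectInt f x1 x2 y1 y2 = 0) ->
  exists F : C -> C, forall z, disc c r z -> cder F z (f z).
Proof.
  intros Hc HR.
  assert (HR' : forall x1 x2 y1 y2, disc c r (x1, y1) -> disc c r (x1, y2) -> disc c r (x2, y1) ->
     disc c r (x2, y2) -> (forall z, in_rect x1 x2 y1 y2 z -> disc c r z) /\ RectInt f x1 x2 y1 y2 = 0).
  { intros x1 x2 y1 y2 H11 H12 H21 H22.
    assert (I : forall a b a' b', in_rect a b a' b' = in_rect b a a' b').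
    { intros. unfold in_rect. rewrite (Rmin_comm a b), (Rmax_comm a b). reflexivity. }
    assert (J : forall a b a' b', in_rect a b a' b' = in_rect a b b' a').
    { intros. unfold in_rect. rewrite (Rmin_comm a' b'), (Rmax_comm a' b'). reflexivity. }
    assert (I1 : forall z, in_rect x1 x2 y1 y2 z -> disc c r z).
    { destruct (Rle_dec x1 x2) as [Hx|Hx]; [|rewrite I]; (destruct (Rle_dec y1 y2) as [Hy|Hy]; [|rewrite J]);
      apply disc_convex_rect; auto; lra. }
    split; auto.
    destruct (Rle_dec x1 x2) as [Hx|Hx]; destruct (Rle_dec y1 y2) as [Hy|Hy].
    - apply HR; auto.
    - rewrite J in I1. rewrite RectInt_swap_y; [|intros; apply Hc; auto].
      rewrite HR; auto; try lra. ring.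
    - rewrite I in I1. rewrite RectInt_swap_x; [|intros; apply Hc; auto].
      rewrite HR; auto; try lra. ring.
    - rewrite J in I1. rewrite RectInt_swap_y; [|intros; apply Hc; auto]. rewrite I in I1.
      rewrite RectInt_swap_x; [|intros; apply Hc; auto].
      rewrite HR; auto; try lra. ring. }
  destruct c as [cx cy].
  set (F := fun z : C => CInt (fun x => f (x, cy)) cx (Re z) + Ci * CInt (fun y => f (Re z, y)) cy (Im z)).
  exists F. intros [zx zy] Hz eps He.
  assert (Hz2 := Hc _ Hz). apply C_continuous_iff with (eps := (eps / 2)%R) in Hz2; [|lra].
  apply C_locally_Cmod in Hz2. destruct Hz2 as (dl & Hdl & Hz2).
  set (s := Cmod ((zx, zy) - (cx, cy))) in *.
  exists (Rmin dl (r - s)). split. { apply Rmin_pos; lra. }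
  intros [hx hy] Hh.
  assert (Hh1 : Cmod (hx, hy) < dl) by (eapply Rlt_le_trans; [exact Hh|apply Rmin_l]).
  assert (Hh2 : Cmod (hx, hy) < r - s) by (eapply Rlt_le_trans; [exact Hh|apply Rmin_r]).
  assert (HX : Rabs hx <= Cmod (hx, hy)) by (apply (re_le_Cmod (hx, hy))).
  assert (HY : Rabs hy <= Cmod (hx, hy)) by (apply (im_le_Cmod (hx, hy))).
  assert (N : forall a b : R, Cmod (a, b) <= Cmod (zx - cx, zy - cy)%R -> disc (cx, cy) r (cx + a, cy + b)%R).
  { intros a b Hab.
    replace ((cx + a, cy + b)%R - (cx, cy)) with ((a, b) : C) by (apply injective_projections; simpl; ring).
    eapply Rle_lt_trans; [exact Hab|].
    replace ((zx - cx, zy - cy)%R : C) with ((zx, zy) - (cx, cy)) by (apply injective_projections; simpl; ring).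
    exact Hz. }
  assert (Sq : forall a b a' b' : R, a ^ 2 <= a' ^ 2 -> b ^ 2 <= b' ^ 2 -> Cmod (a, b) <= Cmod (a', b')).
  { intros. unfold Cmod. apply sqrt_le_1_alt. simpl fst; simpl snd. lra. }
  pose proof (pow2_ge_0 (zx - cx)) as P1. pose proof (pow2_ge_0 (zy - cy)) as P2.
  pose proof (pow2_ge_0 hx) as P3. pose proof (pow2_ge_0 hy) as P4.
  assert (D1 : disc (cx, cy) r (cx, cy)).
  { replace (cx, cy) with (cx + 0, cy + 0)%R at 1 by (f_equal; ring). apply N. apply Sq; lra. }
  assert (D2 : disc (cx, cy) r (zx, cy)).
  { replace (zx, cy) with (cx + (zx - cx), cy + 0)%R by (f_equal; ring). apply N. apply Sq; lra. }
  assert (D3 : disc (cx, cy) r (cx, zy)).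
  { replace (cx, zy) with (cx + 0, cy + (zy - cy))%R by (f_equal; ring). apply N. apply Sq; lra. }
  assert (E0 : forall k : C, Cmod k <= Cmod (hx, hy) -> disc (cx, cy) r ((zx, zy) + k)).
  { intros k Hk. replace ((zx, zy) + k - (cx, cy)) with (((zx, zy) - (cx, cy)) + k) by ring.
    eapply Rle_lt_trans; [apply Cmod_triangle|]. fold s. lra. }
  assert (D4 : disc (cx, cy) r (zx + hx, zy)%R).
  { replace ((zx + hx, zy)%R : C) with ((zx, zy) + (hx, 0%R)) by (apply injective_projections; simpl; ring).
    apply E0. apply Sq; lra. }
  assert (D5 : disc (cx, cy) r (zx + hx, zy + hy)%R).
  { replace ((zx + hx, zy + hy)%R : C) with ((zx, zy) + (hx, hy)) by (apply injective_projections; simpl; ring).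
    apply E0. lra. }
  (* The point (zx + hx, cy) lies on the horizontal line through the centre, hence is no farther
     from it than (zx + hx, zy). *)
  assert (D6 : disc (cx, cy) r (zx + hx, cy)%R).
  { destruct (Rle_dec (Cmod (zx + hx - cx, cy - cy)%R) (Cmod (zx + hx - cx, zy - cy)%R)) as [L|L].
    - replace ((zx + hx, cy)%R - (cx, cy)) with ((zx + hx - cx, cy - cy)%R : C) by (apply injective_projections; simpl; ring).
      eapply Rle_lt_trans; [exact L|].
      replace ((zx + hx - cx, zy - cy)%R : C) with ((zx + hx, zy)%R - (cx, cy)) by (apply injective_projections; simpl; ring).
      exact D4.
    - exfalso. apply L. apply Sq; [lra|]. replace (cy - cy)%R with 0%R by ring. lra. }
  destruct (HR' zx (zx + hx)%R cy zy) as [I1 Z1]; auto.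
  destruct (HR' cx (zx + hx)%R cy cy) as [I2 _]; auto.
  destruct (HR' (zx + hx)%R (zx + hx)%R zy (zy + hy)%R) as [I3 _]; auto.
  destruct (HR' zx (zx + hx)%R zy zy) as [I4 _]; auto.
  destruct (HR' (zx + hx)%R (zx + hx)%R cy zy) as [I5 _]; auto.
  destruct (HR' cx zx cy cy) as [I6 _]; auto.
  destruct (HR' zx (zx + hx)%R cy cy) as [I7 _]; auto.
  assert (C3 : continuous_on_seg (fun y => f ((zx + hx)%R, y)) zy (zy + hy)).
  { intros t Ht. apply Ccont_vertical. apply Hc. apply I3. split; simpl; minmax. }
  assert (C4 : continuous_on_seg (fun x => f (x, zy)) zx (zx + hx)).
  { intros t Ht. apply Ccont_horizontal. apply Hc. apply I4. split; simpl; minmax. }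
  assert (C5 : continuous_on_seg (fun y => f ((zx + hx)%R, y)) cy zy).
  { intros t Ht. apply Ccont_vertical. apply Hc. apply I5. split; simpl; minmax. }
  assert (C6 : continuous_on_seg (fun x => f (x, cy)) cx zx).
  { intros t Ht. apply Ccont_horizontal. apply Hc. apply I6. split; simpl; minmax. }
  assert (C7 : continuous_on_seg (fun x => f (x, cy)) zx (zx + hx)).
  { intros t Ht. apply Ccont_horizontal. apply Hc. apply I7. split; simpl; minmax. }
  set (z := (zx, zy) : C).
  assert (Ez : z + (hx, hy) = (zx + hx, zy + hy)%R) by (apply injective_projections; simpl; ring).
  rewrite Ez. unfold F. change (Re (zx + hx, zy + hy)%R) with (zx + hx)%R.
  change (Im (zx + hx, zy + hy)%R) with (zy + hy)%R. change (Re z) with zx. change (Im z) with zy.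
  rewrite <- (CInt_Chasles (fun x => f (x, cy)) cx zx (zx + hx)),
    <- (CInt_Chasles (fun y => f ((zx + hx)%R, y)) cy zy (zy + hy)) by auto.
  unfold RectInt in Z1.
  (* The vanishing integral [Z1] exchanges the path through (zx + hx, cy) for the one through z, so
     the increment of F becomes an integral over the two short sides from z to z + h. *)
  match goal with |- Cmod ?X <= _ => replace X with
    ((CInt (fun x => f (x, zy)) zx (zx + hx) - hx * f z)
     + Ci * (CInt (fun y => f ((zx + hx)%R, y)) zy (zy + hy) - hy * f z)) end.
  2:{ replace ((hx, hy) : C) with (hx + Ci * hy) by (apply injective_projections; simpl; ring).
    symmetry. apply Ceq_minus. etransitivity; [|exact Z1]. ring. }
  eapply Rle_trans; [apply Cmod_triangle|]. rewrite Cmod_mult, Cmod_Ci, Rmult_1_l.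
  assert (B1 : Cmod (CInt (fun x => f (x, zy)) zx (zx + hx) - hx * f z) <= eps / 2 * Cmod (hx, hy)).
  { replace (hx * f z) with (CInt (fun _ => f z) zx (zx + hx)).
    2:{ rewrite CInt_const. do 2 f_equal. ring. }
    rewrite <- CInt_minus; auto. 2:{ intros t _. apply C_continuous_const. }
    eapply Rle_trans; [apply (CInt_bound _ _ _ (eps / 2))|].
    - intros t Ht. apply C_continuous_minus. apply C4; auto. apply C_continuous_const.
    - intros t Ht. left. apply Hz2.
      eapply Rle_lt_trans; [right; apply (Cmod_horizontal zx t zy)|].
      eapply Rle_lt_trans; [|exact Hh1]. eapply Rle_trans; [|exact HX].
      unfold Rabs. repeat destruct Rcase_abs; minmax.
    - replace (zx + hx - zx)%R with hx by ring. apply Rmult_le_compat_l; lra. }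
  assert (B2 : Cmod (CInt (fun y => f ((zx + hx)%R, y)) zy (zy + hy) - hy * f z) <= eps / 2 * Cmod (hx, hy)).
  { replace (hy * f z) with (CInt (fun _ => f z) zy (zy + hy)).
    2:{ rewrite CInt_const. do 2 f_equal. ring. }
    rewrite <- CInt_minus; auto. 2:{ intros t _. apply C_continuous_const. }
    eapply Rle_trans; [apply (CInt_bound _ _ _ (eps / 2))|].
    - intros t Ht. apply C_continuous_minus. apply C3; auto. apply C_continuous_const.
    - intros t Ht. left. apply Hz2.
      replace (((zx + hx)%R, t) - (zx, zy)) with ((hx, (t - zy)%R) : C) by (apply injective_projections; simpl; ring).
      eapply Rle_lt_trans; [|exact Hh1]. apply Sq; [lra|].
      assert (Rabs (t - zy) <= Rabs hy) by (unfold Rabs; repeat destruct Rcase_abs; minmax).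
      apply Rsqr_le_abs_1 in H. unfold Rsqr in H. lra.
    - replace (zy + hy - zy)%R with hy by ring. apply Rmult_le_compat_l; lra. }
  lra.
Qed.

(** * Cauchy's formula and Taylor expansions *)

Definition cis (t : R) : C := (cos t, sin t).

Lemma Cmod_cis (t : R) : Cmod (cis t) = 1%R.
Proof.
  unfold Cmod, cis. simpl fst; simpl snd. rewrite <- sqrt_1. f_equal.
  pose proof (sin2_cos2 t). unfold Rsqr in H. simpl. lra.
Qed.

Lemma is_RCderive_cis (t : R) : is_RCderive cis t (Ci * cis t).
Proof.
  apply is_RCderive_components; simpl.
  - replace (0 * cos t - 1 * sin t)%R with (- sin t)%R by ring. apply is_derive_cos.
  - replace (0 * sin t + 1 * cos t)%R with (cos t) by ring. apply is_derive_sin.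
Qed.

Lemma is_RCderive_continuous (f : R -> C) (t : R) (l : C) : is_RCderive f t l -> Ccont f t.
Proof.
  intros H. apply (ex_derive_continuous (V := C_R_NormedModule)). exists l. exact H.
Qed.

Lemma is_RCderive_circle (c : C) (r t : R) : is_RCderive (fun t => c + r * cis t) t (Ci * (r * cis t)).
Proof.
  replace (Ci * (r * cis t)) with (r * (Ci * cis t)) by ring.
  apply (cder_along (fun z => c + r * z) cis). apply is_RCderive_cis.
  eapply cder_val. apply cder_plus. apply cder_const. apply cder_scal. apply cder_id. ring.
Qed.

Lemma Ccont_circle (c : C) (r t : R) : Ccont (fun t => c + r * cis t) t.
Proof. eapply is_RCderive_continuous. apply is_RCderive_circle. Qed.

Lemma Ccont_comp_circle (f : C -> C) (c : C) (r t : R) :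
  Ccont f (c + r * cis t) -> Ccont (fun t => f (c + r * cis t)) t.
Proof.
  intros H. apply (continuous_comp (V := C_UniformSpace) (fun t : R => c + r * cis t) f); auto.
  apply Ccont_circle.
Qed.

Lemma circle_nonzero (r t : R) : 0 < r -> r * cis t <> 0.
Proof.
  intros Hr E. apply (f_equal Cmod) in E. rewrite Cmod_mult, Cmod_cis, Cmod_R, Cmod_0, Rabs_pos_eq in E; lra.
Qed.

Lemma Cmod_circle (r t : R) : 0 <= r -> Cmod (r * cis t) = r.
Proof. intros Hr. rewrite Cmod_mult, Cmod_cis, Cmod_R, Rabs_pos_eq; lra. Qed.

Lemma cis_period : cis (2 * PI) = cis 0.
Proof. unfold cis. rewrite cos_2PI, sin_2PI, cos_0, sin_0. reflexivity. Qed.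

Lemma Ccont_inv_circle (r t : R) (n : nat) : 0 < r -> Ccont (fun t => (/ (r * cis t)) ^ n) t.
Proof.
  intros Hr. apply C_continuous_pow. apply C_continuous_inv. apply circle_nonzero; auto.
  apply (C_continuous_ext (fun t => 0 + r * cis t)). { intros; ring. } apply Ccont_circle.
Qed.

Lemma CInt_circle_primitive (F k : C -> C) (c : C) (rho r : R) : 0 < r < rho ->
  (forall z, disc c rho z -> Ccont k z) ->
  (forall z, disc c rho z -> cder F z (k z)) ->
  CInt (fun t => k (c + r * cis t) * (r * cis t)) 0 (2 * PI) = 0.
Proof.
  intros Hr Hk HF.
  assert (D : forall t, disc c rho (c + r * cis t)).
  { intros t. replace (c + r * cis t - c) with (r * cis t) by ring. rewrite Cmod_circle; lra. }
  assert (Hc : continuous_on_seg (fun t => k (c + r * cis t) * (r * cis t)) 0 (2 * PI)).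
  { intros t _. apply C_continuous_mult. apply Ccont_comp_circle. apply Hk; auto.
    apply (C_continuous_ext (fun t => 0 + r * cis t)). { intros; ring. } apply Ccont_circle. }
  assert (E : CInt (fun t => Ci * (k (c + r * cis t) * (r * cis t))) 0 (2 * PI) = 0).
  { rewrite (CInt_FTC (fun t => F (c + r * cis t))).
    - rewrite cis_period. ring.
    - intros t _. replace (Ci * (k (c + r * cis t) * (r * cis t)))
        with (k (c + r * cis t) * (Ci * (r * cis t))) by ring.
      apply (cder_along F (fun t => c + r * cis t)). apply is_RCderive_circle. apply HF; auto.
    - intros t Ht. apply C_continuous_mult. apply C_continuous_const. apply Hc; auto. }
  rewrite CInt_scal in E by auto.
  replace (CInt (fun t => k (c + r * cis t) * (r * cis t)) 0 (2 * PI))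
    with (- Ci * (Ci * CInt (fun t => k (c + r * cis t) * (r * cis t)) 0 (2 * PI))).
  - rewrite E. ring.
  - rewrite Cmult_assoc. replace (- Ci * Ci) with (RtoC 1). ring.
    apply injective_projections; simpl; ring.
Qed.

(** Up to a nonzero constant the integrand is the derivative of itself, a periodic function. *)
Lemma CInt_inv_circle_pow (r : R) (n : nat) : 0 < r -> (0 < n)%nat ->
  CInt (fun t => (/ (r * cis t)) ^ n) 0 (2 * PI) = 0.
Proof.
  intros Hr Hn.
  assert (Hc : continuous_on_seg (fun t => (/ (r * cis t)) ^ n) 0 (2 * PI)).
  { intros t _. apply Ccont_inv_circle; auto. }
  assert (Hn' : - (INR n * Ci) <> 0).
  { intros E. apply (f_equal Im) in E. simpl in E. apply lt_INR in Hn. simpl in Hn. lra. }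
  assert (E : CInt (fun t => - (INR n * Ci) * (/ (r * cis t)) ^ n) 0 (2 * PI) = 0).
  { rewrite (CInt_FTC (fun t => (/ (0 + r * cis t)) ^ n)).
    - rewrite cis_period. ring.
    - intros t _. assert (NZ := circle_nonzero r t Hr).
      replace (- (INR n * Ci) * (/ (r * cis t)) ^ n)
        with ((INR n * (/ (0 + r * cis t)) ^ (n - 1) * (- (1) / (0 + r * cis t) ^ 2)) * (Ci * (r * cis t))).
      + apply (cder_along (fun z => (/ z) ^ n) (fun t => 0 + r * cis t)). apply is_RCderive_circle.
        apply cder_pow. apply (cder_inv (fun z => z)).
        * rewrite Cplus_0_l. auto.
        * apply cder_id.
      + rewrite Cplus_0_l. destruct n as [|m]; [lia|]. replace (S m - 1)%nat with m by lia.
        rewrite Cpow_S. simpl. field. split; intros Z; apply NZ; rewrite Z; ring.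
    - intros t Ht. apply C_continuous_mult. apply C_continuous_const. apply Hc; auto. }
  rewrite CInt_scal in E by auto.
  destruct (Ceq_dec (CInt (fun t => (/ (r * cis t)) ^ n) 0 (2 * PI)) 0) as [Z|Z]; auto.
  exfalso. revert E. apply Cmult_neq_0; auto.
Qed.

Fixpoint psum (f : nat -> C) (N : nat) : C :=
  match N with O => 0 | S n => psum f n + f n end.

Lemma psum_ext (f g : nat -> C) (N : nat) : (forall n, (n < N)%nat -> f n = g n) -> psum f N = psum g N.
Proof. induction N; intros H; simpl; auto. rewrite IHN, H; auto. Qed.

Lemma psum_scal (c : C) (f : nat -> C) (N : nat) : psum (fun n => c * f n) N = c * psum f N.
Proof. induction N; simpl. ring. rewrite IHN. ring. Qed.

Lemma continuous_psum (f : nat -> R -> C) (N : nat) (t : R) :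
  (forall n, Ccont (f n) t) -> Ccont (fun t => psum (fun n => f n t) N) t.
Proof.
  intros H. induction N; simpl. apply C_continuous_const. apply C_continuous_plus; auto.
Qed.

Lemma CInt_psum (f : nat -> R -> C) (N : nat) (a b : R) :
  (forall n t, Ccont (f n) t) ->
  CInt (fun t => psum (fun n => f n t) N) a b = psum (fun n => CInt (f n) a b) N.
Proof.
  intros H. induction N; simpl.
  - rewrite CInt_const. ring.
  - rewrite CInt_plus, IHN; auto. intros t _. apply continuous_psum; auto. intros t _; auto.
Qed.

Lemma geometric_expansion (u d : C) (N : nat) : u <> 0 -> u - d <> 0 ->
  u / (u - d) = psum (fun n => d ^ n * (/ u) ^ n) N + d ^ N * (/ u) ^ N * (u / (u - d)).
Proof.
  intros Hu Hd. induction N.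
  - simpl. ring.
  - simpl psum. rewrite !Cpow_S.
    match type of IHN with _ = ?a + ?b => replace (u / (u - d)) with (a + b) at 1 by (rewrite <- IHN; reflexivity) end.
    field. auto.
Qed.

(** With z = c + r cis t, the form dz/(2 pi i (z - c)) becomes dt/(2 pi), so this is Cauchy's
    integral for the n-th Taylor coefficient. The radius stays a parameter. *)
Definition taylor_coef (f : C -> C) (c : C) (r : R) (n : nat) : C :=
  / (2 * PI)%R * CInt (fun t => f (c + r * cis t) * (/ (r * cis t)) ^ n) 0 (2 * PI).

Lemma PI2_pos : 0 < 2 * PI.
Proof. pose proof PI_RGT_0. lra. Qed.

Lemma PI2_nonzero : RtoC (2 * PI) <> 0.
Proof. intros E. apply RtoC_inj in E. pose proof PI2_pos. lra. Qed.

Section circle_kernel.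
Variables (f : C -> C) (c d : C) (r M : R).
Hypothesis Hd : Cmod d < r.
Hypothesis Hf : forall t, Ccont f (c + r * cis t).
Hypothesis HM : forall t, 0 <= t <= 2 * PI -> Cmod (f (c + r * cis t)) <= M.

Let kernel (t : R) : C := f (c + r * cis t) * (r * cis t / (r * cis t - d)).

Lemma kernel_radius_pos : 0 < r.
Proof. pose proof (Cmod_ge_0 d). lra. Qed.

Lemma kernel_denominator t : r - Cmod d <= Cmod (r * cis t - d).
Proof.
  pose proof (Cmod_reverse_triangle (r * cis t) d). rewrite Cmod_circle in H; auto.
  pose proof kernel_radius_pos. lra.
Qed.

Lemma kernel_denominator_nonzero t : r * cis t - d <> 0.
Proof. apply Cmod_gt_0. pose proof (kernel_denominator t). lra. Qed.

Lemma circle_arg_continuous t : Ccont (fun t => r * cis t) t.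
Proof. apply (C_continuous_ext (fun t => 0 + r * cis t)). { intros; ring. } apply Ccont_circle. Qed.

Lemma kernel_continuous t : Ccont kernel t.
Proof.
  apply C_continuous_mult. apply Ccont_comp_circle; auto.
  apply C_continuous_div. apply kernel_denominator_nonzero. apply circle_arg_continuous.
  apply C_continuous_minus. apply circle_arg_continuous. apply C_continuous_const.
Qed.

(** The geometric expansion is finite with an exact remainder, so integration term by term is mere
    linearity and the error is explicit. *)
Lemma kernel_expansion (N : nat) :
  Cmod (/ (2 * PI)%R * CInt kernel 0 (2 * PI) - psum (fun n => taylor_coef f c r n * d ^ n) N)
  <= M * (Cmod d / r) ^ N * (r / (r - Cmod d)).
Proof.
  pose proof kernel_radius_pos as Hr. pose proof PI2_pos as Hpi.
  set (g := fun n t => d ^ n * (f (c + r * cis t) * (/ (r * cis t)) ^ n)).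
  assert (Cg0 : forall n t, Ccont (fun t => f (c + r * cis t) * (/ (r * cis t)) ^ n) t).
  { intros n t. apply C_continuous_mult. apply Ccont_comp_circle; auto. apply Ccont_inv_circle; auto. }
  assert (Cg : forall n t, Ccont (g n) t).
  { intros n t. apply C_continuous_mult. apply C_continuous_const. apply Cg0. }
  replace (psum (fun n => taylor_coef f c r n * d ^ n) N)
    with (/ (2 * PI)%R * CInt (fun t => psum (fun n => g n t) N) 0 (2 * PI)).
  2:{ rewrite CInt_psum by auto. rewrite <- psum_scal. apply psum_ext. intros n _.
      unfold taylor_coef, g. rewrite CInt_scal by (intros t _; apply Cg0). ring. }
  match goal with |- Cmod ?X <= _ => replace X with
    (/ (2 * PI)%R * (CInt kernel 0 (2 * PI) - CInt (fun t => psum (fun n => g n t) N) 0 (2 * PI))) by ring end.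
  rewrite Cmod_mult, Cmod_inv, Cmod_R, Rabs_pos_eq; [|lra|apply PI2_nonzero].
  rewrite <- CInt_minus; [|intros t _; apply kernel_continuous|intros t _; apply continuous_psum; auto].
  apply Rmult_le_reg_l with (2 * PI)%R; auto. rewrite <- Rmult_assoc, Rinv_r, Rmult_1_l by lra.
  eapply Rle_trans; [apply (CInt_bound _ _ _ (M * (Cmod d / r) ^ N * (r / (r - Cmod d))))|].
  - intros t _. apply C_continuous_minus. apply kernel_continuous. apply continuous_psum; auto.
  - intros t Ht. rewrite Rmin_left, Rmax_right in Ht by lra. pose proof (circle_nonzero r t Hr) as NZ. pose proof (kernel_denominator_nonzero t) as ND.
    pose proof (kernel_denominator t) as KD.
    replace (kernel t - psum (fun n => g n t) N)
      with (f (c + r * cis t) * (d ^ N * (/ (r * cis t)) ^ N * (r * cis t / (r * cis t - d)))).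
    + rewrite !Cmod_mult, !Cmod_pow, Cmod_inv, Cmod_div by auto. rewrite !Cmod_circle by lra.
      replace (M * (Cmod d / r) ^ N * (r / (r - Cmod d)))%R
        with (M * ((Cmod d / r) ^ N * (r / (r - Cmod d))))%R by ring.
      apply Rmult_le_compat; auto; try apply Cmod_ge_0.
      * repeat apply Rmult_le_pos; try apply pow_le; try apply Cmod_ge_0; try lra.
        left; apply Rinv_0_lt_compat; lra. left. apply Rinv_0_lt_compat. lra.
      * rewrite <- Rpow_mult_distr. unfold Rdiv. apply Rmult_le_compat_l.
        { apply pow_le. apply Rmult_le_pos; [apply Cmod_ge_0|]. left; apply Rinv_0_lt_compat; lra. }
        apply Rmult_le_compat_l; [lra|]. apply Rinv_le_contravar; lra.
    + unfold kernel, g. rewrite (psum_ext _ (fun n => f (c + r * cis t) * (d ^ n * (/ (r * cis t)) ^ n))) by (intros; ring).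
      rewrite psum_scal. rewrite (geometric_expansion (r * cis t) d N NZ ND) at 2. ring.
  - rewrite Rminus_0_r, Rabs_pos_eq by lra. lra.
Qed.
End circle_kernel.

Lemma Rpow_small (q M eps : R) : 0 <= q < 1 -> 0 < eps -> exists N : nat, M * q ^ N < eps.
Proof.
  intros Hq He. destruct (Rle_dec M 0) as [HM|HM].
  - exists 0%nat. simpl. lra.
  - destruct (pow_lt_1_zero q ltac:(rewrite Rabs_pos_eq; lra) (eps / M)%R) as [N HN].
    { apply Rdiv_lt_0_compat; lra. }
    exists N. specialize (HN N (Nat.le_refl _)). rewrite Rabs_pos_eq in HN by (apply pow_le; lra).
    apply Rmult_lt_compat_l with (r := M) in HN; [|lra].
    replace (M * (eps / M))%R with eps in HN by (field; lra). exact HN.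
Qed.

Lemma Cmod_small_eq (a b : C) (q M : R) : 0 <= q < 1 ->
  (forall N, Cmod (a - b) <= M * q ^ N) -> a = b.
Proof.
  intros Hq H. apply Ceq_minus. apply NNPP. intros N. apply Cmod_gt_0 in N.
  destruct (Rpow_small q M (Cmod (a - b)) Hq N) as [n Hn]. specialize (H n). lra.
Qed.

(** This is [kernel_expansion] for the constant 1: all coefficients but the first vanish, and the
    error tends to 0 geometrically. *)
Lemma CInt_cauchy_kernel (d : C) (r : R) : Cmod d < r ->
  CInt (fun t => r * cis t / (r * cis t - d)) 0 (2 * PI) = (2 * PI)%R.
Proof.
  intros Hd. pose proof (Cmod_ge_0 d) as Hd0. pose proof PI2_nonzero as NZ.
  pose proof (kernel_expansion (fun _ => 1) 0 d r 1 Hd (fun t => C_continuous_const 1 _)) as K.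
  assert (E : / (2 * PI)%R * CInt (fun t => 1 * (r * cis t / (r * cis t - d))) 0 (2 * PI) = 1).
  { apply (Cmod_small_eq _ _ (Cmod d / r) (1 * (Cmod d / r) * (r / (r - Cmod d)))).
    - split. apply Rmult_le_pos; auto. left; apply Rinv_0_lt_compat; lra.
      apply Rmult_lt_reg_r with r; [lra|]. unfold Rdiv. rewrite Rmult_assoc, Rinv_l; lra.
    - intros N. specialize (K (fun _ _ => Req_le _ _ Cmod_1) (S N)). simpl (1 * _ ^ S N)%R in K.
      replace (psum (fun n => taylor_coef (fun _ => 1) 0 r n * d ^ n) (S N)) with (RtoC 1) in K.
      + eapply Rle_trans; [exact K|]. right. simpl. ring.
      + clear K. induction N.
        * simpl. unfold taylor_coef. simpl.
          rewrite (CInt_ext _ (fun _ => 1)) by (intros; ring). rewrite CInt_const.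
          replace (2 * PI - 0)%R with (2 * PI)%R by ring. field. auto.
        * simpl psum in *. rewrite <- IHN. unfold taylor_coef.
          rewrite (CInt_ext _ (fun t => (/ (r * cis t)) ^ S N)) by (intros; ring).
          rewrite CInt_inv_circle_pow; [ring|lra|lia]. }
  rewrite (CInt_ext _ (fun t => r * cis t / (r * cis t - d))) in E by (intros; ring).
  apply (f_equal (fun x => (2 * PI)%R * x)) in E. rewrite Cmult_assoc, Cinv_r, Cmult_1_l, Cmult_1_r in E by auto.
  exact E.
Qed.

(** The quotient is continuous at z0 and differentiable elsewhere, which is what [Goursat_except]
    asks for. *)
Lemma difference_quotient_primitive (f : C -> C) (c z0 : C) (r : R) :
  (forall z, disc c r z -> ex_Cderive f z) -> disc c r z0 ->
  let k := fun w => if Ceq_dec w z0 then C_derive f z0 else (f w - f z0) / (w - z0) in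
  (forall z, disc c r z -> Ccont k z) /\ exists F, forall z, disc c r z -> cder F z (k z).
Proof.
  intros Hf Hz0 k.
  assert (Hk : forall z, z <> z0 -> disc c r z -> ex_Cderive k z).
  { intros z Hz Hz'. specialize (Hf z Hz'). apply ex_Cderive_cder in Hf.
    eapply cder_ex. apply (cder_ext_loc (fun w => (f w - f z0) / (w - z0)) k z _ (Cmod (z - z0))).
    - apply Cmod_gt_0. apply Cminus_eq_contra; auto.
    - intros w Hw. unfold k. destruct (Ceq_dec w z0) as [E|E]; auto.
      subst w. rewrite Cmod_minus_sym in Hw. lra.
    - apply cder_div. apply Cminus_eq_contra; auto. apply cder_minus. exact Hf. apply cder_const.
      apply cder_minus. apply cder_id. apply cder_const. }
  assert (Ck : forall z, disc c r z -> Ccont k z).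
  { intros z Hz. destruct (Ceq_dec z z0) as [E|E].
    - subst z. apply cder_quotient. apply ex_Cderive_cder. auto.
    - apply ex_Cderive_continuous. auto. }
  split; auto. apply disc_primitive; auto.
  intros x1 x2 y1 y2 Hx Hy HR. apply (Goursat_except k z0); auto.
Qed.

Theorem Cauchy_formula (f : C -> C) (c d : C) (rho r : R) : Cmod d < r < rho ->
  (forall z, disc c rho z -> ex_Cderive f z) ->
  / (2 * PI)%R * CInt (fun t => f (c + r * cis t) * (r * cis t / (r * cis t - d))) 0 (2 * PI) = f (c + d).
Proof.
  intros Hd Hf. pose proof (Cmod_ge_0 d) as Hd0.
  set (z0 := c + d).
  assert (Hz0 : disc c rho z0). { unfold z0. replace (c + d - c) with d by ring. lra. }
  destruct (difference_quotient_primitive f c z0 rho Hf Hz0) as [Ck [F HF]].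
  set (k := fun w => if Ceq_dec w z0 then C_derive f z0 else (f w - f z0) / (w - z0)) in *.
  assert (D : forall t, disc c rho (c + r * cis t)).
  { intros t. replace (c + r * cis t - c) with (r * cis t) by ring. rewrite Cmod_circle; lra. }
  assert (Cf : forall t, Ccont f (c + r * cis t)) by (intros; apply ex_Cderive_continuous; auto).
  (* The integral of the difference quotient at z0 vanishes because it has a primitive; what is left
     is f z0 times the kernel integral just computed. *)
  pose proof (CInt_circle_primitive F k c rho r ltac:(lra) Ck HF) as Z.
  rewrite (CInt_ext _ (fun t => f (c + r * cis t) * (r * cis t / (r * cis t - d))
     - f z0 * (1 * (r * cis t / (r * cis t - d))))) in Z.
  - assert (C1 : continuous_on_seg (fun t => 1 * (r * cis t / (r * cis t - d))) 0 (2 * PI)).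
    { intros t _. apply (kernel_continuous (fun _ => 1) 0 d r); [lra|]. intros; apply C_continuous_const. }
    rewrite CInt_minus in Z.
    + rewrite CInt_scal in Z by auto.
      rewrite (CInt_ext (fun t => 1 * (r * cis t / (r * cis t - d))) (fun t => r * cis t / (r * cis t - d))) in Z by (intros; ring).
      rewrite CInt_cauchy_kernel in Z by lra. apply Ceq_minus in Z. rewrite Z. field. apply PI2_nonzero.
    + intros t _. apply (kernel_continuous f c d r); [lra|auto].
    + intros t Ht. apply C_continuous_mult. apply C_continuous_const. apply C1; auto.
  - intros t _. assert (N : r * cis t - d <> 0) by (apply (kernel_denominator_nonzero d r); lra).
    unfold k. destruct (Ceq_dec (c + r * cis t) z0) as [E|E].
    + exfalso. apply N. unfold z0 in E. replace (r * cis t) with (c + r * cis t - c) by ring. rewrite E. ring.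
    + unfold z0. field. intros Z0. apply N. rewrite <- Z0. ring.
Qed.

Theorem Taylor_expansion (f : C -> C) (c d : C) (rho r M : R) (N : nat) : Cmod d < r < rho ->
  (forall z, disc c rho z -> ex_Cderive f z) ->
  (forall t, 0 <= t <= 2 * PI -> Cmod (f (c + r * cis t)) <= M) ->
  Cmod (f (c + d) - psum (fun n => taylor_coef f c r n * d ^ n) N)
  <= M * (Cmod d / r) ^ N * (r / (r - Cmod d)).
Proof.
  intros Hd Hf HM. rewrite <- (Cauchy_formula f c d rho r) by auto.
  apply kernel_expansion; auto; try lra.
  intros t. apply ex_Cderive_continuous. apply Hf. replace (c + r * cis t - c) with (r * cis t) by ring.
  pose proof (Cmod_ge_0 d). rewrite Cmod_circle; lra.
Qed.

(** * Identity theorem and mean value principle *)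

Lemma circle_bounded (f : C -> C) (c : C) (r : R) : (forall t, Ccont f (c + r * cis t)) ->
  exists M, 0 <= M /\ forall t, 0 <= t <= 2 * PI -> Cmod (f (c + r * cis t)) <= M.
Proof.
  intros Hf.
  destruct (continuity_ab_maj (fun t => Cmod (f (c + r * cis t))) 0 (2 * PI)) as [Mx [HM _]].
  - pose proof PI2_pos; lra.
  - intros t _. apply continuity_pt_filterlim.
    intros P [e HP]. pose proof (Ccont_comp_circle f c r t (Hf t)) as H.
    apply C_continuous_iff with (eps := e) in H; [|apply cond_pos].
    unfold filtermap. eapply filter_imp; [|exact H]. intros s Hs. apply HP.
    change (Rabs (Cmod (f (c + r * cis s)) - Cmod (f (c + r * cis t))) < e).
    pose proof (Cmod_reverse_triangle (f (c + r * cis s)) (f (c + r * cis t))) as H1.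
    pose proof (Cmod_reverse_triangle (f (c + r * cis t)) (f (c + r * cis s))) as H2.
    rewrite Cmod_minus_sym in H2. cbv beta in Hs.
    apply Rabs_def1; lra.
  - exists (Cmod (f (c + r * cis Mx))). split. apply Cmod_ge_0. exact HM.
Qed.

Lemma circle_in_disc (c : C) (r rho t : R) : 0 <= r < rho -> disc c rho (c + r * cis t).
Proof.
  intros Hr. cbv beta. replace (c + r * cis t - c) with (r * cis t) by ring. rewrite Cmod_circle; lra.
Qed.

Lemma disc_circle_bounded (f : C -> C) (c : C) (r rho : R) : 0 <= r < rho ->
  (forall z, disc c rho z -> ex_Cderive f z) ->
  exists M, 0 <= M /\ forall t, 0 <= t <= 2 * PI -> Cmod (f (c + r * cis t)) <= M.
Proof.
  intros Hr Hf. apply circle_bounded. intros t. apply ex_Cderive_continuous. apply Hf.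
  apply circle_in_disc; auto.
Qed.

Section disc.
Variables (f : C -> C) (c : C) (rho r M : R).
Hypothesis Hr : 0 < r < rho.
Hypothesis Hf : forall z, disc c rho z -> ex_Cderive f z.
Hypothesis HM : forall t, 0 <= t <= 2 * PI -> Cmod (f (c + r * cis t)) <= M.

Lemma circle_bound_nonneg : 0 <= M.
Proof.
  eapply Rle_trans; [apply Cmod_ge_0|]. apply (HM 0). pose proof PI2_pos; lra.
Qed.

Lemma Taylor_half (d : C) (N : nat) : Cmod d <= r / 2 ->
  Cmod (f (c + d) - psum (fun n => taylor_coef f c r n * d ^ n) N) <= 2 * M * (Cmod d / r) ^ N.
Proof.
  intros Hd. pose proof (Cmod_ge_0 d). pose proof circle_bound_nonneg.
  eapply Rle_trans; [apply (Taylor_expansion f c d rho r M N); auto; lra|].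
  replace (2 * M * (Cmod d / r) ^ N)%R with (M * (Cmod d / r) ^ N * 2)%R by ring.
  apply Rmult_le_compat_l.
  - apply Rmult_le_pos; auto. apply pow_le. apply Rmult_le_pos; auto. left; apply Rinv_0_lt_compat; lra.
  - apply Rmult_le_reg_r with (r - Cmod d)%R; [lra|]. unfold Rdiv. rewrite Rmult_assoc, Rinv_l; lra.
Qed.

Lemma taylor_coef_0 : taylor_coef f c r 0 = f c.
Proof.
  symmetry. apply Ceq_minus. apply Cmod_eq_0.
  pose proof (Taylor_half 0 1) as H. rewrite Cmod_0 in H. specialize (H ltac:(lra)).
  simpl in H. replace (c + 0) with c in H by ring.
  replace (0 + taylor_coef f c r 0 * 1) with (taylor_coef f c r 0) in H by ring.
  replace (2 * M * (0 / r * 1))%R with 0%R in H by (field; lra).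
  pose proof (Cmod_ge_0 (f c - taylor_coef f c r 0)). lra.
Qed.

Lemma taylor_coef_bound (n : nat) : Cmod (taylor_coef f c r n) <= M / r ^ n.
Proof.
  unfold taylor_coef. pose proof PI2_pos as Hpi.
  rewrite Cmod_mult, Cmod_inv, Cmod_R, Rabs_pos_eq; [|lra|apply PI2_nonzero].
  apply Rmult_le_reg_l with (2 * PI)%R; auto. rewrite <- Rmult_assoc, Rinv_r, Rmult_1_l by lra.
  eapply Rle_trans; [apply (CInt_bound _ _ _ (M / r ^ n))|].
  - intros t _. apply C_continuous_mult. apply Ccont_comp_circle. apply ex_Cderive_continuous.
    apply Hf. apply circle_in_disc. lra. apply Ccont_inv_circle. lra.
  - intros t Ht. rewrite Rmin_left, Rmax_right in Ht by lra.
    rewrite Cmod_mult, Cmod_pow, Cmod_inv by (apply circle_nonzero; lra).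
    rewrite Cmod_circle, pow_inv by lra. apply Rmult_le_compat_r; auto.
    left. apply Rinv_0_lt_compat. apply pow_lt; lra.
  - rewrite Rminus_0_r, Rabs_pos_eq by lra. lra.
Qed.

Lemma second_order_bound (d : C) : Cmod d <= r / 2 ->
  Cmod (f (c + d) - f c - taylor_coef f c r 1 * d) <= 2 * M * (Cmod d / r) ^ 2.
Proof.
  intros Hd. pose proof (Taylor_half d 2 Hd) as H. simpl psum in H. rewrite taylor_coef_0 in H.
  replace (f (c + d) - f c - taylor_coef f c r 1 * d)
    with (f (c + d) - (0 + f c * d ^ 0 + taylor_coef f c r 1 * d ^ 1)) by (simpl; ring). exact H.
Qed.

Lemma quadratic_error_cder (g : C -> C) (z l : C) (K d : R) : 0 < d -> 0 <= K ->
  (forall h, Cmod h <= d -> Cmod (g (z + h) - g z - l * h) <= K * Cmod h ^ 2) -> cder g z l.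
Proof.
  intros Hd HK H eps He. exists (Rmin d (eps / (K + 1))). split.
  { apply Rmin_pos; auto. apply Rdiv_lt_0_compat; lra. }
  intros h Hh. assert (H1 : Cmod h < d) by (eapply Rlt_le_trans; [exact Hh|apply Rmin_l]).
  assert (H2 : Cmod h < eps / (K + 1)) by (eapply Rlt_le_trans; [exact Hh|apply Rmin_r]).
  eapply Rle_trans; [apply H; lra|]. pose proof (Cmod_ge_0 h) as H0.
  replace (K * Cmod h ^ 2)%R with ((K * Cmod h) * Cmod h)%R by ring. apply Rmult_le_compat_r; auto.
  apply Rle_trans with ((K + 1) * (eps / (K + 1)))%R.
  - apply Rmult_le_compat; lra.
  - right. field. lra.
Qed.

Lemma taylor_coef_1 : taylor_coef f c r 1 = C_derive f c.
Proof.
  symmetry. apply cder_C_derive. pose proof circle_bound_nonneg.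
  apply (quadratic_error_cder f c _ (2 * M / r ^ 2) (r / 2)); try lra.
  - apply Rmult_le_pos; [lra|]. left. apply Rinv_0_lt_compat. apply pow_lt; lra.
  - intros h Hh. eapply Rle_trans; [apply second_order_bound; auto|]. right. field. lra.
Qed.

Lemma Cauchy_estimate : Cmod (C_derive f c) <= M / r.
Proof. rewrite <- taylor_coef_1. pose proof (taylor_coef_bound 1). rewrite pow_1 in H. exact H. Qed.

Lemma second_order_error (d : C) : Cmod d <= r / 2 ->
  Cmod (f (c + d) - f c - C_derive f c * d) <= 2 * M * (Cmod d / r) ^ 2.
Proof. rewrite <- taylor_coef_1. apply second_order_bound. Qed.
End disc.

(** Subtract the Taylor polynomial of degree 2, which leaves a remainder of size K |d|^3. Cauchy's
    estimate on the circle of radius |h| about c + h bounds its derivative by K (2 |h|)^3/|h| = 8 K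
    |h|^2, so f' is affine at c up to a quadratic error. *)
Lemma derivative_holomorphic (f : C -> C) (c : C) (rho : R) : 0 < rho ->
  (forall z, disc c rho z -> ex_Cderive f z) -> ex_Cderive (C_derive f) c.
Proof.
  intros Hrho Hf. set (r := (rho / 2)%R). assert (Hr : 0 < r < rho) by (unfold r; lra).
  destruct (disc_circle_bounded f c r rho ltac:(lra) Hf) as (M & HM0 & HM).
  set (a := taylor_coef f c r).
  set (rem := fun z => f z - (a 0%nat + a 1%nat * (z - c) + a 2%nat * (z - c) ^ 2)).
  set (K := (2 * M / r ^ 3)%R).
  assert (HK : 0 <= K).
  { apply Rmult_le_pos; [lra|]. left. apply Rinv_0_lt_compat. apply pow_lt; lra. }
  assert (Hrem : forall d, Cmod d <= r / 2 -> Cmod (rem (c + d)) <= K * Cmod d ^ 3).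
  { intros d Hd. pose proof (Taylor_half f c rho r M Hr Hf HM d 3 Hd) as H. unfold rem.
    replace (f (c + d) - (a 0%nat + a 1%nat * (c + d - c) + a 2%nat * (c + d - c) ^ 2))
      with (f (c + d) - psum (fun n => taylor_coef f c r n * d ^ n) 3) by (unfold a; simpl; ring).
    eapply Rle_trans; [exact H|]. right. unfold K. field. lra. }
  assert (Drem : forall z, disc c rho z -> cder rem z (C_derive f z - (a 1%nat + 2 * a 2%nat * (z - c)))).
  { intros z Hz. unfold rem. apply cder_minus. apply ex_Cderive_cder; auto.
    eapply cder_val. apply cder_plus. apply cder_plus. apply cder_const. apply cder_scal.
    apply cder_minus. apply cder_id. apply cder_const. apply cder_scal. apply cder_pow.
    apply cder_minus. apply cder_id. apply cder_const. simpl. rewrite RtoC_plus. ring. }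
  apply (cder_ex _ _ (2 * a 2%nat)).
  apply (quadratic_error_cder _ _ _ (8 * K) (r / 8)); try lra.
  intros h Hh.
  replace (C_derive f c) with (a 1%nat) by (apply (taylor_coef_1 f c rho r M); auto).
  destruct (Ceq_dec h 0) as [E|E].
  - subst h. rewrite Cplus_0_r. replace (C_derive f c) with (a 1%nat) by (apply (taylor_coef_1 f c rho r M); auto).
    replace (a 1%nat - a 1%nat - 2 * a 2%nat * 0) with (RtoC 0) by ring. rewrite Cmod_0. simpl. lra.
  - apply Cmod_gt_0 in E.
    assert (I : forall z, disc (c + h) (2 * Cmod h) z -> disc c rho z).
    { intros z Hz. replace (z - c) with ((z - (c + h)) + h) by ring.
      eapply Rle_lt_trans; [apply Cmod_triangle|]. unfold r in *. lra. }
    replace (C_derive f (c + h) - a 1%nat - 2 * a 2%nat * h) with (C_derive rem (c + h)).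
    2:{ rewrite (cder_C_derive rem (c + h) _ (Drem (c + h) ltac:(apply I; replace (c + h - (c + h)) with (RtoC 0) by ring; rewrite Cmod_0; lra))).
        ring. }
    eapply Rle_trans; [apply (Cauchy_estimate rem (c + h) (2 * Cmod h) (Cmod h) (K * (2 * Cmod h) ^ 3))|].
    + lra.
    + intros z Hz. eapply cder_ex. apply Drem. auto.
    + intros t _. replace (c + h + Cmod h * cis t) with (c + (h + Cmod h * cis t)) by ring.
      assert (B : Cmod (h + Cmod h * cis t) <= 2 * Cmod h).
      { eapply Rle_trans; [apply Cmod_triangle|]. rewrite Cmod_circle; lra. }
      eapply Rle_trans; [apply Hrem; lra|]. apply Rmult_le_compat_l; auto.
      apply pow_incr. split; auto. apply Cmod_ge_0.
    + right. field. lra.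
Qed.

Definition Copen (U : C -> Prop) : Prop := forall z, U z -> exists r, 0 < r /\ forall w, disc z r w -> U w.

Lemma disc_open (c : C) (r : R) : Copen (disc c r).
Proof.
  intros z Hz. exists (r - Cmod (z - c))%R. split; [lra|]. intros w Hw.
  replace (w - c) with ((w - z) + (z - c)) by ring. eapply Rle_lt_trans; [apply Cmod_triangle|]. lra.
Qed.

Lemma holomorphic_derive (U : C -> Prop) (f : C -> C) : Copen U -> holomorphic_on U f ->
  holomorphic_on U (C_derive f).
Proof.
  intros HU Hf z Hz. destruct (HU z Hz) as (r & Hr & HW).
  apply (derivative_holomorphic f z r Hr). intros w Hw. apply Hf; auto.
Qed.

(** Morera's argument: [Goursat_except] gives f a primitive F on the disc, and f = F' is holomorphic
    as a derivative. *)
Lemma removable_singularity (f : C -> C) (c z0 : C) (r : R) :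
  (forall z, disc c r z -> Ccont f z) ->
  (forall z, disc c r z -> z <> z0 -> ex_Cderive f z) ->
  forall z, disc c r z -> ex_Cderive f z.
Proof.
  intros Hc Hd z Hz.
  destruct (disc_primitive f c r) as [F HF]; auto.
  { intros x1 x2 y1 y2 Hx Hy HR. apply (Goursat_except f z0); auto. }
  assert (H : ex_Cderive (C_derive F) z).
  { apply (holomorphic_derive (disc c r)). apply disc_open. intros w Hw. eapply cder_ex. apply HF; auto. auto. }
  apply ex_Cderive_cder in H.
  destruct (disc_open c r z Hz) as (s & Hs & HW).
  eapply cder_ex. apply (cder_ext_loc (C_derive F) f z _ s); [auto| |exact H].
  intros w Hw. apply cder_C_derive. apply HF. auto.
Qed.

(** If a_n is the first nonzero coefficient, then at a zero c + d the term a_n d^n is cancelled by a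
    remainder of size |d|^(n+1), which is impossible for small d <> 0. *)
Lemma taylor_coef_zero (f : C -> C) (c : C) (rho r : R) : 0 < r < rho ->
  (forall z, disc c rho z -> ex_Cderive f z) ->
  (forall eps : R, 0 < eps -> exists d, 0 < Cmod d < eps /\ f (c + d) = 0) ->
  forall n, taylor_coef f c r n = 0.
Proof.
  intros Hr Hf Hz n. destruct (disc_circle_bounded f c r rho ltac:(lra) Hf) as (M & HM0 & HM).
  induction n as [n IH] using lt_wf_ind.
  assert (P : forall d N, (N <= n)%nat -> psum (fun n => taylor_coef f c r n * d ^ n) N = 0).
  { intros d N HN. induction N; simpl; auto. rewrite IHN, IH by lia. ring. }
  apply NNPP. intros E. apply Cmod_gt_0 in E. set (e := Cmod (taylor_coef f c r n)) in *.
  assert (Hrn : 0 < r ^ S n) by (apply pow_lt; lra).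
  destruct (Hz (Rmin (r / 2) (e * r ^ S n / (2 * M + 1)))) as (d & Hd & Hd0).
  { apply Rmin_pos; [lra|]. apply Rdiv_lt_0_compat; [|lra]. apply Rmult_lt_0_compat; auto. }
  assert (H1 : Cmod d < r / 2) by (eapply Rlt_le_trans; [apply Hd|apply Rmin_l]).
  assert (H2 : Cmod d < e * r ^ S n / (2 * M + 1)) by (eapply Rlt_le_trans; [apply Hd|apply Rmin_r]).
  pose proof (Taylor_half f c rho r M Hr Hf HM d (S n) ltac:(lra)) as T.
  simpl psum in T. rewrite P, Hd0 in T by lia.
  replace (0 - (0 + taylor_coef f c r n * d ^ n)) with (- (taylor_coef f c r n * d ^ n)) in T by ring.
  rewrite Cmod_opp, Cmod_mult, Cmod_pow in T. fold e in T.
  assert (Hdn : 0 < Cmod d ^ n) by (apply pow_lt; lra).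
  assert (T' : e * r ^ S n <= 2 * M * Cmod d).
  { apply Rmult_le_reg_r with (Cmod d ^ n)%R; auto.
    replace (2 * M * (Cmod d / r) ^ S n)%R with (2 * M * Cmod d * Cmod d ^ n / r ^ S n)%R in T.
    - apply Rmult_le_compat_r with (r := (r ^ S n)%R) in T; [|lra].
      unfold Rdiv in T. rewrite (Rmult_assoc _ (/ r ^ S n)), Rinv_l in T by lra. lra.
    - unfold Rdiv. rewrite Rpow_mult_distr, pow_inv. simpl. ring. }
  apply Rmult_lt_compat_r with (r := (2 * M + 1)%R) in H2; [|lra].
  unfold Rdiv in H2. rewrite (Rmult_assoc _ (/ (2 * M + 1))), Rinv_l in H2 by lra. nra.
Qed.

Lemma identity_disc (f : C -> C) (c : C) (rho : R) :
  (forall z, disc c rho z -> ex_Cderive f z) ->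
  (forall eps : R, 0 < eps -> exists d, 0 < Cmod d < eps /\ f (c + d) = 0) ->
  forall z, disc c rho z -> f z = 0.
Proof.
  intros Hf Hz z Hzd. pose proof (Cmod_ge_0 (z - c)) as H0.
  set (r := ((Cmod (z - c) + rho) / 2)%R). assert (Hr : 0 < r < rho) by (unfold r; lra).
  destruct (disc_circle_bounded f c r rho ltac:(lra) Hf) as (M & HM0 & HM).
  assert (Hd : Cmod (z - c) < r) by (unfold r; lra).
  apply (Cmod_small_eq _ _ (Cmod (z - c) / r) (M * (r / (r - Cmod (z - c))))).
  - split. apply Rmult_le_pos; auto. left; apply Rinv_0_lt_compat; lra.
    apply Rmult_lt_reg_r with r; [lra|]. unfold Rdiv. rewrite Rmult_assoc, Rinv_l; lra.
  - intros N. pose proof (Taylor_expansion f c (z - c) rho r M N ltac:(lra) Hf HM) as T.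
    replace (c + (z - c)) with z in T by ring.
    replace (psum (fun n => taylor_coef f c r n * (z - c) ^ n) N) with (RtoC 0) in T.
    + eapply Rle_trans; [exact T|]. right. ring.
    + clear T. induction N; simpl; auto. rewrite <- IHN, (taylor_coef_zero f c rho) by auto. ring.
Qed.

Lemma identity_disc_near (f : C -> C) (c : C) (rho e : R) : 0 < e ->
  (forall z, disc c rho z -> ex_Cderive f z) ->
  (forall z, disc c e z -> f z = 0) -> forall z, disc c rho z -> f z = 0.
Proof.
  intros He Hf Hz. apply identity_disc; auto. intros eps Heps.
  exists (RtoC (Rmin e eps / 2)). assert (0 < Rmin e eps) by (apply Rmin_pos; auto).
  rewrite Cmod_R, Rabs_pos_eq by lra. split.
  - pose proof (Rmin_r e eps). lra.
  - apply Hz. match goal with |- Cmod ?X < _ => replace X with (RtoC (Rmin e eps / 2)) by ring end.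
    rewrite Cmod_R, Rabs_pos_eq by lra. pose proof (Rmin_l e eps). lra.
Qed.

(** Supremum argument along the segment for the property of vanishing near a point. The zeros
    accumulating at a start it, and [step] gives around each point of U a radius within which the
    property spreads. *)
Theorem identity_segment (U : C -> Prop) (f : C -> C) (a b : C) : Copen U -> holomorphic_on U f ->
  (forall s : R, 0 <= s <= 1 -> U (a + s * (b - a))) ->
  (forall eps : R, 0 < eps -> exists d, 0 < Cmod d < eps /\ f (a + d) = 0) ->
  f b = 0.
Proof.
  intros HU Hf Hseg Ha.
  set (near0 := fun p : C => exists e, 0 < e /\ forall z, disc p e z -> f z = 0).
  assert (step : forall p, U p -> exists e, 0 < e /\
     forall q, Cmod (q - p) < e -> near0 q -> forall q', Cmod (q' - p) < e -> near0 q').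
  { intros p Hp. destruct (HU p Hp) as (r & Hr & HW). exists (r / 4)%R. split; [lra|].
    intros q Hq (e & He & Hz) q' Hq'. exists (r / 4)%R. split; [lra|]. intros z Hz'.
    apply (identity_disc_near f q (3 * r / 4) e); auto.
    - intros w Hw. apply Hf. apply HW. replace (w - p) with ((w - q) + (q - p)) by ring.
      eapply Rle_lt_trans; [apply Cmod_triangle|]. lra.
    - replace (z - q) with ((z - q') + (q' - p) + (p - q)) by ring.
      rewrite Cmod_minus_sym in Hq.
      eapply Rle_lt_trans; [apply Cmod_triangle|].
      eapply Rle_lt_trans; [apply Rplus_le_compat_r; apply Cmod_triangle|]. lra. }
  assert (N0 : near0 a).
  { destruct (HU a) as (r & Hr & HW).
    { specialize (Hseg 0%R ltac:(lra)). replace (a + 0 * (b - a)) with a in Hseg by ring. exact Hseg. }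
    exists r. split; auto. apply identity_disc; auto. }
  set (E := fun s : R => 0 <= s <= 1 /\ near0 (a + s * (b - a))).
  assert (E0 : E 0%R).
  { split; [lra|]. replace (a + 0 * (b - a)) with a by ring. exact N0. }
  set (L := Cmod (b - a)). pose proof (Cmod_ge_0 (b - a)) as HL. fold L in HL.
  assert (Dist : forall s t : R, Cmod (a + s * (b - a) - (a + t * (b - a))) = (Rabs (s - t) * L)%R).
  { intros s t. unfold L. rewrite <- Cmod_R, <- Cmod_mult. f_equal. rewrite RtoC_minus. ring. }
  destruct (completeness E) as [m [Hm1 Hm2]].
  { exists 1%R. intros s [Hs _]. lra. } { exists 0%R. exact E0. }
  assert (Hm : 0 <= m <= 1).
  { split. apply Hm1. exact E0. apply Hm2. intros s [Hs _]. lra. }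
  destruct (step (a + m * (b - a)) (Hseg m Hm)) as (e & He & Hst).
  set (h := (e / (2 * (L + 1)))%R).
  assert (Hh : 0 < h) by (apply Rdiv_lt_0_compat; lra).
  assert (HhL : h * L < e).
  { apply Rle_lt_trans with (h * (L + 1))%R. apply Rmult_le_compat_l; lra.
    replace (h * (L + 1))%R with (e / 2)%R by (unfold h; field; lra). lra. }
  assert (exists s, E s /\ m - h < s) as (s & [Hs1 Hs2] & Hs).
  { apply NNPP. intros N. assert (m <= m - h); [|lra]. apply Hm2. intros s Hs.
    apply Rnot_lt_le. intros Q. apply N. exists s. auto. }
  assert (Hsm : s <= m) by (apply Hm1; split; auto).
  assert (Key : forall t, Rabs (t - m) <= h -> near0 (a + t * (b - a))).
  { intros t Ht. apply (Hst (a + s * (b - a))); auto; rewrite Dist.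
    - eapply Rle_lt_trans; [|exact HhL]. apply Rmult_le_compat_r; auto. apply Rabs_le. lra.
    - eapply Rle_lt_trans; [|exact HhL]. apply Rmult_le_compat_r; auto. }
  destruct (Req_dec m 1) as [E1|E1].
  - subst m. destruct (Key 1%R) as (e' & He' & Hz).
    { replace (1 - 1)%R with 0%R by ring. rewrite Rabs_R0. lra. }
    apply Hz. replace (b - (a + 1 * (b - a))) with (RtoC 0) by ring. rewrite Cmod_0. lra.
  - exfalso. set (t := Rmin 1 (m + h)).
    assert (Ht : m < t <= 1 /\ t <= m + h) by (unfold t; minmax).
    assert (t <= m); [|lra]. apply Hm1. split; [lra|]. apply Key. rewrite Rabs_pos_eq; lra.
Qed.

(** Applied to f^n with no Taylor term, the expansion estimate gives |f(c + d)|^n <= K M^n with K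
    independent of n; letting n grow removes K. *)
Theorem maximum_modulus (f : C -> C) (c d : C) (rho r M : R) : Cmod d < r < rho ->
  (forall z, disc c rho z -> ex_Cderive f z) ->
  (forall t, 0 <= t <= 2 * PI -> Cmod (f (c + r * cis t)) <= M) ->
  Cmod (f (c + d)) <= M.
Proof.
  intros Hd Hf HM. pose proof (Cmod_ge_0 d) as Hd0.
  assert (HM0 : 0 <= M) by (eapply Rle_trans; [apply Cmod_ge_0|apply (HM 0%R); pose proof PI2_pos; lra]).
  set (K := (r / (r - Cmod d))%R). assert (HK : 0 < K) by (apply Rdiv_lt_0_compat; lra).
  assert (B : forall n, Cmod (f (c + d)) ^ n <= M ^ n * K).
  { intros n. pose proof (Taylor_expansion (fun z => f z ^ n) c d rho r (M ^ n) 0 Hd) as T.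
    simpl in T. rewrite <- Cmod_pow. unfold K.
    replace (f (c + d) ^ n) with (f (c + d) ^ n - 0) by ring.
    eapply Rle_trans; [apply T|].
    - intros z Hz. eapply cder_ex. apply cder_pow. apply ex_Cderive_cder. auto.
    - intros t Ht. rewrite Cmod_pow. apply pow_incr. split; auto. apply Cmod_ge_0.
    - right. ring. }
  apply Rnot_lt_le. intros N. set (x := Cmod (f (c + d))) in *. assert (Hx : 0 < x) by lra.
  destruct (Rpow_small (M / x) K 1) as [n Hn].
  { split. apply Rmult_le_pos; auto. left; apply Rinv_0_lt_compat; auto.
    apply Rmult_lt_reg_r with x; auto. unfold Rdiv. rewrite Rmult_assoc, Rinv_l; lra. }
  { lra. }
  specialize (B n). unfold Rdiv in Hn. rewrite Rpow_mult_distr, pow_inv in Hn.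
  assert (Hxn : 0 < x ^ n) by (apply pow_lt; auto).
  apply Rmult_lt_compat_r with (r := (x ^ n)%R) in Hn; auto.
  replace (K * (M ^ n * / x ^ n) * x ^ n)%R with (M ^ n * K)%R in Hn by (field; lra). lra.
Qed.

(** The conclusion concerns the left end, since the circle of [mean_value_minimum] is parametrized
    from the point of interest. *)
Lemma RInt_nonneg_zero (g : R -> R) (a b : R) : a < b ->
  (forall t, continuous g t) -> (forall t, 0 <= g t) -> RInt g a b = 0%R ->
  g a = 0%R.
Proof.
  intros Hab Hc H0 HI. apply NNPP. intros N.
  assert (Hg : 0 < g a) by (specialize (H0 a); lra).
  assert (ex : forall x y, ex_RInt g x y) by (intros; apply (ex_RInt_continuous (V := R_CompleteNormedModule)); auto).
  destruct (Hc a (fun y => g a / 2 < y)) as [e He].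
  { exists (mkposreal (g a / 2) ltac:(lra)). intros y Hy. change (Rabs (y - g a) < g a / 2) in Hy.
    apply Rabs_def2 in Hy. lra. }
  set (m := Rmin b (a + e / 2)). pose proof (cond_pos e) as Hpe.
  assert (Hm : a < m <= b /\ m <= a + e / 2) by (unfold m; minmax).
  pose proof (RInt_Chasles g a m b (ex _ _) (ex _ _)) as Ch. rewrite HI in Ch.
  assert (I1 : (m - a) * (g a / 2) <= RInt g a m).
  { replace ((m - a) * (g a / 2))%R with (RInt (fun _ => (g a / 2)%R) a m)
      by (rewrite (RInt_const (V := R_CompleteNormedModule)); reflexivity).
    apply RInt_le; auto; try lra. apply ex_RInt_const.
    intros x Hx. left. apply He. change (Rabs (x - a) < e). rewrite Rabs_pos_eq; lra. }
  assert (I2 : 0 <= RInt g m b).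
  { replace 0%R with (RInt (fun _ => 0%R) m b).
    - apply RInt_le; auto; try lra. apply ex_RInt_const.
    - rewrite (RInt_const (V := R_CompleteNormedModule)). apply Rmult_0_r. }
  change (RInt g a m + RInt g m b = 0)%R in Ch. nra.
Qed.

(** The value at the centre is the mean of Re f over one circle on which Re f >= m, and equality
    forces Re f = m on that circle. The bound is asked on this circle alone, which suits a disc
    touching the boundary of a domain. *)
Theorem mean_value_minimum (f : C -> C) (c w : C) (rho m : R) : Cmod w < rho ->
  (forall z, disc c rho z -> ex_Cderive f z) ->
  (forall t, m <= Re (f (c + w * cis t))) ->
  Re (f c) = m -> Re (f (c + w)) = m.
Proof.
  intros Hw Hf Hm Hc.
  destruct (Ceq_dec w 0) as [E|E]. { subst w. rewrite Cplus_0_r. auto. }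
  apply Cmod_gt_0 in E.
  set (g := fun z => f (c + w * z)).
  assert (Hg : forall z, disc 0 (rho / Cmod w) z -> ex_Cderive g z).
  { intros z Hz. replace (z - 0) with z in Hz by ring.
    eapply cder_ex. apply (cder_comp f (fun z => c + w * z)).
    - apply cder_plus. apply cder_const. apply cder_scal. apply cder_id.
    - apply ex_Cderive_cder. apply Hf. replace (c + w * z - c) with (w * z) by ring.
      rewrite Cmod_mult. apply Rmult_lt_compat_l with (r := Cmod w) in Hz; auto.
      replace (Cmod w * (rho / Cmod w))%R with rho in Hz by (field; lra). exact Hz. }
  assert (H1 : 0 < 1 < rho / Cmod w).
  { split; [lra|]. apply Rmult_lt_reg_r with (Cmod w); auto. unfold Rdiv. rewrite Rmult_assoc, Rinv_l; lra. }
  destruct (disc_circle_bounded g 0 1 (rho / Cmod w) ltac:(lra) Hg) as (M & HM0 & HM).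
  pose proof (taylor_coef_0 g 0 (rho / Cmod w) 1 M H1 Hg HM) as T. unfold taylor_coef in T.
  rewrite (CInt_ext _ (fun t => f (c + w * cis t))) in T.
  2:{ intros t _. unfold g. simpl. rewrite Cmult_1_r. do 2 f_equal. ring. }
  assert (Cf : forall t, Ccont (fun t => f (c + w * cis t)) t).
  { intros t. apply (C_continuous_ext (fun t => g (0 + 1 * cis t))).
    - intros s. unfold g. do 2 f_equal. ring.
    - apply (Ccont_comp_circle g 0 1). apply ex_Cderive_continuous. apply Hg. apply circle_in_disc. lra. }
  pose proof (is_CInt_CInt _ 0 (2 * PI) (fun t _ => Cf t)) as I.
  pose proof (is_RInt_Re _ _ _ _ I) as IR.
  assert (E2 : Re (CInt (fun t => f (c + w * cis t)) 0 (2 * PI)) = (2 * PI * m)%R).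
  { rewrite <- Hc. rewrite <- re_scal_l. f_equal.
    apply (f_equal (fun x => (2 * PI)%R * x)) in T. rewrite Cmult_assoc, Cinv_r, Cmult_1_l in T by apply PI2_nonzero.
    rewrite T. unfold g. do 2 f_equal. ring. }
  assert (IR2 : is_RInt (fun t => Re (f (c + w * cis t))) 0 (2 * PI) (2 * PI * m)%R) by (rewrite <- E2; exact IR).
  assert (IR' : is_RInt (fun t => Re (f (c + w * cis t)%C) - m)%R 0 (2 * PI) (2 * PI * m - (2 * PI - 0) * m)%R).
  { apply (is_RInt_minus (V := R_NormedModule)); auto. apply (is_RInt_const (V := R_NormedModule)). }
  apply (is_RInt_unique (V := R_CompleteNormedModule)) in IR'.
  assert (Z : (Re (f (c + w * cis 0)%C) - m = 0)%R).
  { apply (RInt_nonneg_zero (fun t => Re (f (c + w * cis t)%C) - m)%R 0 (2 * PI)).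
    - apply PI2_pos.
    - intros t. apply (continuous_minus (V := R_NormedModule)). 2: apply continuous_const.
      apply (continuous_comp (V := C_UniformSpace) (fun t => f (c + w * cis t)) Re); auto. apply continuous_Re.
    - intros t. specialize (Hm t). lra.
    - etransitivity; [exact IR'|]. change (2 * PI * m - (2 * PI - 0) * m = 0)%R. ring. }
  replace (c + w * cis 0) with (c + w) in Z. lra.
  unfold cis. rewrite cos_0, sin_0. replace ((1, 0)%R : C) with (RtoC 1) by reflexivity. ring.
Qed.

(** * Unordered sums *)

Section unordered_sums.
Context {T : Type}.
Implicit Types (A : T -> Prop) (f g : T -> C) (M : T -> R) (s : list T).

Definition lsum f s : C := fold_right Cplus 0 (map f s).
Definition rsum M s : R := fold_right Rplus 0%R (map M s).

Definition fin_in A s : Prop := NoDup s /\ List.Forall A s.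

Lemma lsum_app f s t : lsum f (s ++ t) = lsum f s + lsum f t.
Proof. unfold lsum. induction s; simpl; [ring|]. rewrite IHs. ring. Qed.

Lemma rsum_app M s t : rsum M (s ++ t) = (rsum M s + rsum M t)%R.
Proof. unfold rsum. induction s; simpl; [ring|]. rewrite IHs. ring. Qed.

Lemma lsum_perm f s t : Permutation s t -> lsum f s = lsum f t.
Proof.
  induction 1; unfold lsum in *; simpl; auto.
  - rewrite IHPermutation; auto.
  - ring.
  - congruence.
Qed.

Lemma rsum_perm M s t : Permutation s t -> rsum M s = rsum M t.
Proof.
  induction 1; unfold rsum in *; simpl; auto.
  - rewrite IHPermutation; auto.
  - ring.
  - congruence.
Qed.

Lemma lsum_ext f g s : (forall i, In i s -> f i = g i) -> lsum f s = lsum g s.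
Proof.
  unfold lsum. induction s; simpl; intros H; auto. rewrite H, IHs; auto.
Qed.

Lemma lsum_plus f g s : lsum (fun i => f i + g i) s = lsum f s + lsum g s.
Proof. unfold lsum. induction s; simpl; [ring|]. rewrite IHs. ring. Qed.

Lemma lsum_scal c f s : lsum (fun i => c * f i) s = c * lsum f s.
Proof. unfold lsum. induction s; simpl; [ring|]. rewrite IHs. ring. Qed.

Lemma lsum_le f M s : (forall i, In i s -> Cmod (f i) <= M i) -> Cmod (lsum f s) <= rsum M s.
Proof.
  unfold lsum, rsum. induction s; simpl; intros H.
  - rewrite Cmod_0. lra.
  - eapply Rle_trans; [apply Cmod_triangle|]. apply Rplus_le_compat; auto.
Qed.

Lemma rsum_scal c M s : rsum (fun i => c * M i)%R s = (c * rsum M s)%R.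
Proof. unfold rsum. induction s; simpl; [ring|]. rewrite IHs. ring. Qed.

Lemma rsum_le M (M' : T -> R) s : (forall i, In i s -> M i <= M' i) -> rsum M s <= rsum M' s.
Proof.
  unfold rsum. induction s; simpl; intros H; [lra|]. apply Rplus_le_compat; auto.
Qed.

Lemma rsum_nonneg M s : (forall i, In i s -> 0 <= M i) -> 0 <= rsum M s.
Proof.
  unfold rsum. induction s; simpl; intros H; [lra|]. apply Rplus_le_le_0_compat; auto.
Qed.

Lemma classic_dec (x y : T) : {x = y} + {x <> y}.
Proof. apply excluded_middle_informative. Qed.

Lemma fin_in_nodup A s : List.Forall A s -> exists t, fin_in A t /\ incl s t.
Proof.
  intros H. exists (nodup classic_dec s). repeat split.
  - apply NoDup_nodup.
  - rewrite Forall_forall in *. intros x Hx. apply H. apply nodup_In in Hx. exact Hx.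
  - intros x Hx. apply nodup_In. exact Hx.
Qed.

Lemma incl_Permutation s t : NoDup s -> NoDup t -> incl s t -> exists r, Permutation t (s ++ r).
Proof.
  revert t. induction s as [|a s IH]; intros t Hs Ht Hi.
  - exists t. simpl. auto.
  - inversion_clear Hs. destruct (in_split a t) as (t1 & t2 & E). { apply Hi. left; auto. }
    subst t. assert (P : Permutation (t1 ++ a :: t2) (a :: t1 ++ t2)) by (symmetry; apply Permutation_middle).
    destruct (IH (t1 ++ t2)) as [r Hr].
    + auto.
    + apply NoDup_remove_1 in Ht. exact Ht.
    + intros x Hx. assert (Hx' : In x (t1 ++ a :: t2)) by (apply Hi; right; auto).
      apply in_app_or in Hx'. apply in_or_app. destruct Hx' as [|[<-|]]; auto. contradiction.
    + exists r. rewrite P. simpl. auto.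
Qed.

Lemma fin_in_split A s t : fin_in A s -> fin_in A t -> incl s t ->
  exists r, Permutation t (s ++ r) /\ fin_in A r /\ forall x, In x r -> ~ In x s.
Proof.
  intros [Hs Hs'] [Ht Ht'] Hi. destruct (incl_Permutation s t Hs Ht Hi) as [r Hr].
  exists r. assert (Hnd : NoDup (s ++ r)) by (eapply Permutation_NoDup; eauto).
  repeat split; auto.
  - apply NoDup_app_remove_l in Hnd. exact Hnd.
  - rewrite Forall_forall in *. intros x Hx. apply Ht'. eapply Permutation_in. symmetry; eauto.
    apply in_or_app; auto.
  - intros x Hx Hx'. clear - Hnd Hx Hx'. induction s; simpl in *; auto. inversion_clear Hnd.
    destruct Hx' as [->|Hx']; auto. apply H. apply in_or_app; auto.
Qed.

#[export] Instance finite_subsets_proper A : ProperFilter (finite_subsets A).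
Proof.
  constructor.
  - intros P (s0 & H0 & H). destruct (fin_in_nodup A s0 H0) as (t & [Ht1 Ht2] & Hi). exists t. apply H; auto.
  - constructor.
    + exists nil. split; auto.
    + intros P Q (s & Hs & HP) (t & Ht & HQ). exists (s ++ t). split.
      * apply Forall_app; auto.
      * intros u Hu Hu' Hi. split; [apply HP|apply HQ]; auto; intros x Hx; apply Hi; apply in_or_app; auto.
    + intros P Q H (s & Hs & HP). exists s. split; auto.
Qed.

Lemma is_sum_over_iff A f l : is_sum_over A f l <->
  forall eps : R, 0 < eps -> exists s0, fin_in A s0 /\
    forall s, fin_in A s -> incl s0 s -> Cmod (lsum f s - l) < eps.
Proof.
  unfold is_sum_over. rewrite (C_filterlim_iff (finite_subsets A)).
  split; intros H eps He; specialize (H eps He).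
  - destruct H as (s0 & H0 & H). destruct (fin_in_nodup A s0 H0) as (t & Ht & Hi). exists t. split; auto.
    intros s [Hs Hs'] Hi'. apply H; auto. intros x Hx; auto.
  - destruct H as (s0 & [H0 H0'] & H). exists s0. split; auto. intros s Hs Hs' Hi. apply (H s); auto. split; auto.
Qed.

Lemma is_sum_over_unique A f l l' : is_sum_over A f l -> is_sum_over A f l' -> l = l'.
Proof.
  rewrite !is_sum_over_iff. intros H H'. apply Ceq_minus. apply NNPP. intros N. apply Cmod_gt_0 in N.
  destruct (H (Cmod (l - l') / 2)%R ltac:(lra)) as (s & [Hs1 Hs2] & Hs).
  destruct (H' (Cmod (l - l') / 2)%R ltac:(lra)) as (t & [Ht1 Ht2] & Ht).
  destruct (fin_in_nodup A (s ++ t)) as (u & Hu & Hi). { apply Forall_app; auto. }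
  specialize (Hs u Hu ltac:(intros x Hx; apply Hi, in_or_app; auto)).
  specialize (Ht u Hu ltac:(intros x Hx; apply Hi, in_or_app; auto)).
  pose proof (Cmod_minus_triangle l (lsum f u) l') as Q. rewrite (Cmod_minus_sym l (lsum f u)) in Q. lra.
Qed.

Lemma sum_over_eq A f l : is_sum_over A f l -> sum_over A f = l.
Proof.
  intros H. apply (iota_unique (V := C_CompleteNormedModule)); auto.
  intros y Hy. eapply is_sum_over_unique; eauto.
Qed.

Definition summable A M : Prop :=
  (forall i, A i -> 0 <= M i) /\ exists B, forall s, fin_in A s -> rsum M s <= B.

(** A finite set whose sum is within eps of the supremum leaves less than eps for every disjoint
    finite set. *)
Lemma summable_tail A M (eps : R) : summable A M -> 0 < eps ->
  exists s0, fin_in A s0 /\ forall r, fin_in A r -> (forall x, In x r -> ~ In x s0) -> rsum M r < eps.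
Proof.
  intros [H0 [B HB]] He.
  destruct (completeness (fun v => exists s, fin_in A s /\ v = rsum M s)) as [S [HS1 HS2]].
  { exists B. intros v (s & Hs & ->). auto. }
  { exists 0%R. exists nil. split; [split; constructor|reflexivity]. }
  assert (exists s, fin_in A s /\ S - eps < rsum M s) as (s0 & Hs0 & Hs0').
  { apply NNPP. intros N. assert (S <= S - eps); [|lra]. apply HS2. intros v (s & Hs & ->).
    apply Rnot_lt_le. intros Q. apply N. exists s; auto. }
  exists s0. split; auto. intros r Hr Hd.
  assert (rsum M (s0 ++ r) <= S).
  { apply HS1. exists (s0 ++ r). split; auto. destruct Hs0, Hr. split.
    - apply NoDup_app; auto. intros x Hx Hx'. apply (Hd x); auto.
    - apply Forall_app; auto. }
  rewrite rsum_app in H. lra.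
Qed.

Lemma summable_le A M (M' : T -> R) : (forall i, A i -> 0 <= M i <= M' i) -> summable A M' -> summable A M.
Proof.
  intros H [H0 [B HB]]. split. { intros i Hi. apply H; auto. }
  exists B. intros s Hs. eapply Rle_trans; [|apply HB; exact Hs]. apply rsum_le.
  intros i Hi. apply H. destruct Hs as [_ Hs]. rewrite Forall_forall in Hs. auto.
Qed.

Lemma summable_scal A M (c : R) : 0 <= c -> summable A M -> summable A (fun i => c * M i)%R.
Proof.
  intros Hc [H0 [B HB]]. split. { intros i Hi. apply Rmult_le_pos; auto. }
  exists (c * B)%R. intros s Hs. rewrite rsum_scal. apply Rmult_le_compat_l; auto.
Qed.

Lemma summable_subset A (A' : T -> Prop) M : (forall i, A' i -> A i) -> summable A M -> summable A' M.
Proof.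
  intros H [H0 [B HB]]. split; auto. exists B. intros s [Hs Hs']. apply HB. split; auto.
  eapply Forall_impl; eauto.
Qed.

(** By the tail estimate the partial sums are Cauchy along the filter of finite subsets, and C is
    complete. As [sum_over] is defined by description, this is what gives a meaning to the theta and
    Eisenstein series. *)
Lemma dominated_is_sum A f M : summable A M -> (forall i, A i -> Cmod (f i) <= M i) ->
  is_sum_over A f (sum_over A f).
Proof.
  intros HM Hf.
  assert (PF : ProperFilter (filtermap (fun s => lsum f s : C_CompleteNormedModule) (finite_subsets A))).
  { apply filtermap_proper_filter. apply finite_subsets_proper. }
  assert (Hc : cauchy (T := C_CompleteNormedModule) (filtermap (fun s => lsum f s : C_CompleteNormedModule) (finite_subsets A))).
  { intros eps. destruct (summable_tail A M eps HM (cond_pos eps)) as (s0 & Hs0 & Ht).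
    exists (lsum f s0). exists s0. split; [apply Hs0|]. intros s Hs1 Hs2 Hi.
    apply C_NormedModule_mixin_compat1.
    destruct (fin_in_split A s0 s Hs0 (conj Hs1 Hs2) Hi) as (r & Hp & Hr & Hd).
    rewrite (lsum_perm f _ _ Hp). rewrite lsum_app.
    change (Cmod (lsum f s0 + lsum f r - lsum f s0) < eps).
    replace (lsum f s0 + lsum f r - lsum f s0) with (lsum f r) by ring.
    eapply Rle_lt_trans; [apply lsum_le|apply Ht; eauto].
    intros i Hi'. apply Hf. destruct Hr as [_ Hr]. rewrite Forall_forall in Hr. auto. }
  pose proof (complete_cauchy _ PF Hc) as H.
  assert (is_sum_over A f (lim (filtermap (fun s => lsum f s : C_CompleteNormedModule) (finite_subsets A)))).
  { intros P [e HP]. eapply filter_imp; [|apply (H e)]. exact HP. }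
  rewrite (sum_over_eq _ _ _ H0). exact H0.
Qed.

Lemma is_sum_bound A f l (B : R) : is_sum_over A f l ->
  (forall s, fin_in A s -> Cmod (lsum f s) <= B) -> Cmod l <= B.
Proof.
  rewrite is_sum_over_iff. intros H HB. apply le_epsilon. intros eps He.
  destruct (H eps He) as (s & Hs & H'). specialize (H' s Hs (incl_refl s)). specialize (HB s Hs).
  pose proof (Cmod_reverse_triangle l (lsum f s)). rewrite Cmod_minus_sym in H0. lra.
Qed.

Lemma is_sum_ext A f g l : (forall i, A i -> f i = g i) -> is_sum_over A f l -> is_sum_over A g l.
Proof.
  rewrite !is_sum_over_iff. intros E H eps He. destruct (H eps He) as (s0 & Hs0 & H').
  exists s0. split; auto. intros s Hs Hi. rewrite <- (lsum_ext f). apply H'; auto.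
  intros i Hi'. apply E. destruct Hs as [_ Hs]. rewrite Forall_forall in Hs. auto.
Qed.

Lemma is_sum_plus A f g a b : is_sum_over A f a -> is_sum_over A g b ->
  is_sum_over A (fun i => f i + g i) (a + b).
Proof.
  intros Hf Hg. unfold is_sum_over in *.
  eapply filterlim_ext. { intros s. symmetry. apply lsum_plus. }
  apply C_filterlim_plus; auto. apply filter_filter.
Qed.

Lemma is_sum_scal A f c a : is_sum_over A f a -> is_sum_over A (fun i => c * f i) (c * a).
Proof.
  intros Hf. unfold is_sum_over in *.
  eapply filterlim_ext. { intros s. symmetry. apply lsum_scal. }
  apply C_filterlim_mult; auto. apply filter_filter. apply filterlim_const.
Qed.

Lemma is_sum_minus A f g a b : is_sum_over A f a -> is_sum_over A g b ->
  is_sum_over A (fun i => f i - g i) (a - b).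
Proof.
  intros Hf Hg. replace (a - b) with (a + (- (1)) * b) by ring.
  apply is_sum_ext with (fun i => f i + (- (1)) * g i). { intros; ring. }
  apply is_sum_plus; auto. apply is_sum_scal; auto.
Qed.

Lemma is_sum_conj A f a : is_sum_over A f a -> is_sum_over A (fun i => Cconj (f i)) (Cconj a).
Proof.
  rewrite !is_sum_over_iff. intros H eps He. destruct (H eps He) as (s0 & Hs0 & H').
  exists s0. split; auto. intros s Hs Hi.
  replace (lsum (fun i => Cconj (f i)) s) with (Cconj (lsum f s)).
  - rewrite <- Cminus_conj, Cmod_conj. auto.
  - unfold lsum. clear. induction s; simpl. { apply injective_projections; simpl; ring. }
    rewrite Cplus_conj, IHs. reflexivity.
Qed.

Lemma is_sum_union A (A' : T -> Prop) f a b : (forall i, A i -> ~ A' i) ->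
  is_sum_over A f a -> is_sum_over A' f b -> is_sum_over (fun i => A i \/ A' i) f (a + b).
Proof.
  rewrite !is_sum_over_iff. intros HD H H' eps He.
  destruct (H (eps / 2)%R ltac:(lra)) as (s & Hs & K). destruct (H' (eps / 2)%R ltac:(lra)) as (s' & Hs' & K').
  exists (s ++ s'). split.
  - destruct Hs as [Hs1 Hs2], Hs' as [Hs1' Hs2']. rewrite Forall_forall in *. split.
    + apply NoDup_app; auto. intros x Hx Hx'. apply (HD x); auto.
    + rewrite Forall_forall. intros x Hx. apply in_app_or in Hx. destruct Hx; auto.
  - intros t [Ht1 Ht2] Hi.
    set (p := fun x => if excluded_middle_informative (A x) then true else false).
    assert (Sp : forall t, lsum f t = lsum f (filter p t) + lsum f (filter (fun x => negb (p x)) t)).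
    { clear. unfold lsum. induction t; simpl; [ring|]. destruct (p a); simpl; rewrite IHt; ring. }
    rewrite Sp. rewrite Forall_forall in Ht2.
    assert (F1 : fin_in A (filter p t)).
    { split. apply NoDup_filter; auto. rewrite Forall_forall. intros x Hx. apply filter_In in Hx.
      destruct Hx as [_ Hx]. unfold p in Hx. destruct (excluded_middle_informative (A x)); auto. discriminate. }
    assert (F2 : fin_in A' (filter (fun x => negb (p x)) t)).
    { split. apply NoDup_filter; auto. rewrite Forall_forall. intros x Hx. apply filter_In in Hx.
      destruct Hx as [Hx1 Hx]. unfold p in Hx. destruct (excluded_middle_informative (A x)); try discriminate.
      destruct (Ht2 x Hx1); auto. contradiction. }
    specialize (K _ F1). specialize (K' _ F2).
    assert (I1 : incl s (filter p t)).
    { intros x Hx. apply filter_In. split. apply Hi, in_or_app; auto. unfold p.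
      destruct (excluded_middle_informative (A x)); auto. destruct Hs as [_ Hs]. rewrite Forall_forall in Hs. exfalso; auto. }
    assert (I2 : incl s' (filter (fun x => negb (p x)) t)).
    { intros x Hx. apply filter_In. split. apply Hi, in_or_app; auto. unfold p.
      destruct (excluded_middle_informative (A x)); auto. destruct Hs' as [_ Hs']. rewrite Forall_forall in Hs'.
      exfalso. apply (HD x); auto. }
    specialize (K I1). specialize (K' I2).
    match goal with |- Cmod (?x + ?y - (a + b)) < _ => replace (x + y - (a + b)) with ((x - a) + (y - b)) by ring end.
    eapply Rle_lt_trans; [apply Cmod_triangle|]. lra.
Qed.

Lemma is_sum_singleton f i : is_sum_over (fun j => j = i) f (f i).
Proof.
  apply is_sum_over_iff. intros eps He. exists [i]. split.
  - split. repeat constructor. simpl; tauto. repeat constructor.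
  - intros s [Hs Hs'] Hi. assert (E : s = [i]).
    { rewrite Forall_forall in Hs'. destruct s as [|a s]. { exfalso. apply (Hi i). left; auto. }
      rewrite (Hs' a) in * by (left; auto). destruct s as [|b s]; auto.
      inversion_clear Hs. exfalso. apply H. rewrite (Hs' b); [left; auto|right; left; auto]. }
    subst s. unfold lsum. simpl. replace (f i + 0 - f i) with (RtoC 0) by ring. rewrite Cmod_0. auto.
Qed.

(** Stated for an arbitrary filter, since it is used along the cusp and, in Polya's argument, along
    the integers. One finite set leaves tails of at most eps/4 for all p at once. *)
Theorem dominated_convergence {P : Type} (F : (P -> Prop) -> Prop) {FF : ProperFilter F} A
  (f : P -> T -> C) g M : summable A M ->
  (forall i, A i -> filterlim (fun p => f p i) F (locally (T := C_UniformSpace) (g i))) ->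
  F (fun p => forall i, A i -> Cmod (f p i) <= M i) ->
  (forall i, A i -> Cmod (g i) <= M i) ->
  filterlim (fun p => sum_over A (f p)) F (locally (T := C_UniformSpace) (sum_over A g)).
Proof.
  intros HM Hl Hb Hg. rewrite (C_filterlim_iff F).
  intros eps He.
  destruct (summable_tail A M (eps / 4) HM ltac:(lra)) as (s0 & Hs0 & Ht).
  assert (Hs : forall h, (forall i, A i -> Cmod (h i) <= M i) -> Cmod (sum_over A h - lsum h s0) <= eps / 4).
  { intros h Hh. pose proof (dominated_is_sum A h M HM Hh) as HS. rewrite is_sum_over_iff in HS.
    apply le_epsilon. intros e He'. destruct (HS e He') as (s1 & Hs1 & H').
    destruct (fin_in_nodup A (s0 ++ s1)) as (u & Hu & Hi). { apply Forall_app; split; [apply Hs0|apply Hs1]. }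
    specialize (H' u Hu ltac:(intros x Hx; apply Hi, in_or_app; auto)).
    destruct (fin_in_split A s0 u Hs0 Hu ltac:(intros x Hx; apply Hi, in_or_app; auto)) as (r & Hp & Hr & Hd).
    rewrite (lsum_perm h _ _ Hp), lsum_app in H'.
    specialize (Ht r Hr Hd).
    assert (Hlr : Cmod (lsum h r) <= rsum M r).
    { apply lsum_le. intros i Hi'. apply Hh. destruct Hr as [_ Hr]. rewrite Forall_forall in Hr. auto. }
    replace (sum_over A h - lsum h s0) with (lsum h r - (lsum h s0 + lsum h r - sum_over A h)) by ring.
    eapply Rle_trans; [apply Cmod_sub_le|]. lra. }
  assert (Hfin : F (fun p => Cmod (lsum (f p) s0 - lsum g s0) < eps / 4)).
  { assert (Hlim : filterlim (fun p => lsum (f p) s0) F (locally (T := C_UniformSpace) (lsum g s0))).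
    { destruct Hs0 as [_ Hs0]. clear - FF Hl Hs0. induction s0 as [|i s0 IH]; unfold lsum in *; simpl.
      - apply filterlim_const.
      - inversion_clear Hs0 as [|? ? Hi Hs1].
        apply C_filterlim_plus; [apply filter_filter|apply Hl; exact Hi|apply IH; exact Hs1]. }
    rewrite (C_filterlim_iff F) in Hlim. apply Hlim. lra. }
  generalize (filter_and _ _ Hb Hfin). apply filter_imp. intros p [H1 H2].
  pose proof (Hs (f p) H1) as B1. pose proof (Hs g Hg) as B2.
  replace (sum_over A (f p) - sum_over A g)
    with ((sum_over A (f p) - lsum (f p) s0) + (lsum (f p) s0 - lsum g s0) - (sum_over A g - lsum g s0)) by ring.
  eapply Rle_lt_trans; [apply Cmod_sub_le|].
  eapply Rle_lt_trans; [apply Rplus_le_compat_r; apply Cmod_triangle|]. lra.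
Qed.

(** Cauchy's estimates bound the second order error of the i-th term by 8 M_i |h|^2/r^2, and these
    errors can be summed. *)
Theorem sum_over_cder A (f : T -> C -> C) M (c : C) (r : R) : 0 < r ->
  summable A M ->
  (forall i, A i -> forall z, disc c r z -> ex_Cderive (f i) z) ->
  (forall i, A i -> forall z, disc c r z -> Cmod (f i z) <= M i) ->
  summable A (fun i => 2 / r * M i)%R /\
  (forall i, A i -> Cmod (C_derive (f i) c) <= 2 / r * M i) /\
  cder (fun z => sum_over A (fun i => f i z)) c (sum_over A (fun i => C_derive (f i) c)).
Proof.
  intros Hr HM Hd Hb.
  assert (Hr2 : 0 < r / 2 < r) by lra.
  assert (Hcirc : forall i, A i -> forall t, 0 <= t <= 2 * PI -> Cmod (f i (c + (r / 2)%R * cis t)) <= M i).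
  { intros i Hi t _. apply Hb; auto. apply circle_in_disc. lra. }
  assert (HM' : summable A (fun i => 2 / r * M i)%R).
  { apply summable_scal; auto. left. apply Rdiv_lt_0_compat; lra. }
  assert (HD : forall i, A i -> Cmod (C_derive (f i) c) <= 2 / r * M i).
  { intros i Hi. replace (2 / r * M i)%R with (M i / (r / 2))%R by (field; lra).
    apply (Cauchy_estimate (f i) c r (r / 2)); auto. }
  split; auto. split; auto.
  pose proof HM as [H0 [B HB]].
  assert (HB0 : 0 <= B). { apply (Rle_trans _ (rsum M [])). unfold rsum; simpl; lra. apply HB. split; constructor. }
  apply (quadratic_error_cder _ c _ (8 * B / r ^ 2) (r / 4)); [lra| |].
  { apply Rmult_le_pos; [lra|]. left. apply Rinv_0_lt_compat. apply pow_lt; auto. }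
  intros h Hh.
  assert (S1 : forall z, disc c r z -> is_sum_over A (fun i => f i z) (sum_over A (fun i => f i z))).
  { intros z Hz. apply (dominated_is_sum A _ M); auto. }
  pose proof (dominated_is_sum A _ _ HM' HD) as S2.
  assert (Dh : disc c r (c + h)). { replace (c + h - c) with h by ring. lra. }
  assert (Dc : disc c r c). { replace (c - c) with (RtoC 0) by ring. rewrite Cmod_0. lra. }
  pose proof (is_sum_minus A _ _ _ _ (is_sum_minus A _ _ _ _ (S1 _ Dh) (S1 _ Dc)) (is_sum_scal A _ h _ S2)) as S3.
  replace (sum_over A (fun i => C_derive (f i) c) * h) with (h * sum_over A (fun i => C_derive (f i) c)) by ring.
  apply (is_sum_bound A _ _ _ S3). intros s Hs.
  eapply Rle_trans; [apply (lsum_le _ (fun i => 8 / r ^ 2 * Cmod h ^ 2 * M i)%R)|].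
  - intros i Hi. destruct Hs as [_ Hs]. rewrite Forall_forall in Hs. specialize (Hs i Hi).
    pose proof (second_order_error (f i) c r (r / 2) (M i) Hr2 (Hd i Hs) (Hcirc i Hs) h ltac:(lra)) as E.
    rewrite (Cmult_comm h). eapply Rle_trans; [exact E|]. right. field. lra.
  - rewrite rsum_scal. replace (8 * B / r ^ 2 * Cmod h ^ 2)%R with (8 / r ^ 2 * Cmod h ^ 2 * B)%R by (field; lra).
    apply Rmult_le_compat_l; auto. apply Rmult_le_pos.
    + left. apply Rdiv_lt_0_compat; [lra|]. apply pow_lt; auto.
    + apply pow_le. apply Cmod_ge_0.
Qed.
End unordered_sums.

(** * Reindexing of unordered sums *)

Lemma lsum_map {T T' : Type} (g : T' -> T) (f : T -> C) (s : list T') :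
  lsum f (map g s) = lsum (fun i => f (g i)) s.
Proof. unfold lsum. rewrite map_map. reflexivity. Qed.

Lemma rsum_map {T T' : Type} (g : T' -> T) (M : T -> R) (s : list T') :
  rsum M (map g s) = rsum (fun i => M (g i)) s.
Proof. unfold rsum. rewrite map_map. reflexivity. Qed.

Definition bijection {T T' : Type} (A' : T' -> Prop) (A : T -> Prop) (g : T' -> T) : Prop :=
  (forall i, A' i -> A (g i)) /\ (forall i j, A' i -> A' j -> g i = g j -> i = j) /\
  (forall k, A k -> exists i, A' i /\ g i = k).

Lemma fin_in_map {T T' : Type} (A' : T' -> Prop) (A : T -> Prop) (g : T' -> T) s :
  bijection A' A g -> fin_in A' s -> fin_in A (map g s).
Proof.
  intros (H1 & H2 & _) [Hs Hs']. split.
  - rewrite Forall_forall in Hs'. induction s; simpl; constructor.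
    + intros Hi. apply in_map_iff in Hi. destruct Hi as (x & E & Hx). inversion_clear Hs.
      apply H. rewrite <- (H2 x a); auto. apply Hs'; right; auto. apply Hs'; left; auto.
    + inversion_clear Hs. apply IHs; auto. intros x Hx. apply Hs'; right; auto.
  - rewrite Forall_forall in *. intros x Hx. apply in_map_iff in Hx. destruct Hx as (y & <- & Hy). auto.
Qed.

Lemma is_sum_bijection {T T' : Type} (A' : T' -> Prop) (A : T -> Prop) (g : T' -> T) (f : T -> C) l :
  bijection A' A g -> is_sum_over A f l -> is_sum_over A' (fun i => f (g i)) l.
Proof.
  intros Hg. rewrite !is_sum_over_iff. intros H eps He. destruct (H eps He) as (s0 & [Hs0 Hs0'] & H').
  assert (exists t, List.Forall A' t /\ incl s0 (map g t)) as (t & Ht & Hi).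
  { destruct Hg as (_ & _ & H3). clear - Hs0' H3. induction s0.
    - exists nil. split; auto. intros x [].
    - inversion_clear Hs0'. destruct (IHs0 H0) as (t & Ht & Hi). destruct (H3 a H) as (i & Hi' & E).
      exists (i :: t). split; auto. intros x [<-|Hx]; simpl; auto. }
  destruct (fin_in_nodup A' t Ht) as (u & Hu & Hi2).
  exists u. split; auto. intros s Hs Hi3. rewrite <- lsum_map. apply H'.
  - apply (fin_in_map A'); auto.
  - intros x Hx. apply Hi in Hx. apply in_map_iff in Hx. destruct Hx as (y & <- & Hy). apply in_map. auto.
Qed.

Lemma lsum_seq (f : nat -> C) (N : nat) : lsum f (seq 0 N) = psum f N.
Proof.
  induction N. reflexivity. rewrite seq_S, lsum_app, IHN. unfold lsum. simpl. ring.
Qed.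

Lemma is_sum_nat (f : nat -> C) (l : C) : is_sum_over (fun _ => True) f l ->
  forall eps : R, 0 < eps -> exists N0, forall N, (N0 <= N)%nat -> Cmod (psum f N - l) < eps.
Proof.
  rewrite is_sum_over_iff. intros H eps He. destruct (H eps He) as (s0 & _ & H').
  exists (S (list_max s0)). intros N HN. rewrite <- lsum_seq. apply H'.
  - split. apply seq_NoDup. apply Forall_forall. auto.
  - intros x Hx. apply in_seq. split; [lia|].
    pose proof (proj1 (list_max_le s0 (list_max s0)) (Nat.le_refl _)) as L. rewrite Forall_forall in L.
    specialize (L x Hx). lia.
Qed.

(** * Summability criteria and the exponential *)

Section sum_bounds.
Context {T : Type}.

(** Keeps the bound explicit, unlike [summable]: the theta constants are shown not to vanish by
    tails smaller than the leading terms. *)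
Definition sum_bounded (A : T -> Prop) (M : T -> R) (B : R) : Prop :=
  forall s, fin_in A s -> rsum M s <= B.

Lemma sum_bounded_summable A M B : (forall i, A i -> 0 <= M i) -> sum_bounded A M B -> summable A M.
Proof. intros H0 H. split; auto. exists B. exact H. Qed.

Lemma sum_bounded_union A A' M B B' : (forall i, A' i -> 0 <= M i) -> (forall i, A i -> 0 <= M i) ->
  sum_bounded A M B -> sum_bounded A' M B' -> sum_bounded (fun i => A i \/ A' i) M (B + B').
Proof.
  intros P' P H H' s [Hs Hs'].
  set (p := fun x => if excluded_middle_informative (A x) then true else false).
  assert (Sp : forall t, rsum M t = (rsum M (filter p t) + rsum M (filter (fun x => negb (p x)) t))%R).
  { clear. unfold rsum. induction t; simpl; [ring|]. destruct (p a); simpl; rewrite IHt; ring. }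
  rewrite Sp. rewrite Forall_forall in Hs'. apply Rplus_le_compat.
  - apply H. split. apply NoDup_filter; auto. rewrite Forall_forall. intros x Hx. apply filter_In in Hx.
    destruct Hx as [_ Hx]. unfold p in Hx. destruct (excluded_middle_informative (A x)); auto. discriminate.
  - apply H'. split. apply NoDup_filter; auto. rewrite Forall_forall. intros x Hx. apply filter_In in Hx.
    destruct Hx as [Hx1 Hx]. unfold p in Hx. destruct (excluded_middle_informative (A x)); try discriminate.
    destruct (Hs' x Hx1); auto. contradiction.
Qed.

Lemma sum_bounded_is_sum A f M B : (forall i, A i -> 0 <= M i) -> sum_bounded A M B ->
  (forall i, A i -> Cmod (f i) <= M i) -> Cmod (sum_over A f) <= B.
Proof.
  intros H0 HB Hf. pose proof (dominated_is_sum A f M (sum_bounded_summable A M B H0 HB) Hf) as HS.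
  apply (is_sum_bound A f _ B HS). intros s Hs. eapply Rle_trans; [apply (lsum_le f M)|apply HB; auto].
  intros i Hi. apply Hf. destruct Hs as [_ Hs]. rewrite Forall_forall in Hs. auto.
Qed.

Lemma sum_bounded_ext A A' M M' B : (forall i, A' i -> A i) -> (forall i, A' i -> M' i <= M i) ->
  sum_bounded A M B -> sum_bounded A' M' B.
Proof.
  intros H1 H2 H s [Hs Hs']. eapply Rle_trans; [apply (rsum_le M' M)|].
  - rewrite Forall_forall in Hs'. auto.
  - apply H. split; auto. eapply Forall_impl; eauto.
Qed.
End sum_bounds.

Lemma sum_bounded_bijection {T T' : Type} (A' : T' -> Prop) (A : T -> Prop) (g : T -> T') (M : T' -> R) B :
  bijection A A' g -> sum_bounded A (fun i => M (g i)) B -> sum_bounded A' M B.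
Proof.
  intros Hg H s [Hs Hs'].
  assert (exists t, fin_in A t /\ map g t = s) as (t & Ht & E).
  { destruct Hg as (H1 & H2 & H3). clear H. induction s as [|a s IH].
    - exists nil. split; [split; constructor|reflexivity].
    - inversion_clear Hs. inversion_clear Hs'. destruct IH as (t & [Ht Ht'] & E); auto.
      destruct (H3 a) as (i & Hi & Ei); auto. exists (i :: t). split.
      + split; [|constructor; auto]. constructor; auto. intros Hin. apply H. rewrite <- E, <- Ei. apply in_map; auto.
      + simpl. congruence. }
  rewrite <- E, rsum_map. auto.
Qed.

Lemma sum_bounded_nat (M : nat -> R) (B : R) : (forall n, 0 <= M n) ->
  (forall N, rsum M (seq 0 N) <= B) -> sum_bounded (fun _ => True) M B.
Proof.
  intros H0 HB s [Hs Hs'].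
  assert (Hi : incl s (seq 0 (S (list_max s)))).
  { intros x Hx. apply in_seq. split; [lia|].
    pose proof (proj1 (list_max_le s (list_max s)) (Nat.le_refl _)) as L. rewrite Forall_forall in L.
    specialize (L x Hx). lia. }
  destruct (incl_Permutation s _ Hs (seq_NoDup _ _) Hi) as [r Hr].
  specialize (HB (S (list_max s))). rewrite (rsum_perm M _ _ Hr), rsum_app in HB.
  pose proof (rsum_nonneg M r (fun i _ => H0 i)). lra.
Qed.

Lemma sum_bounded_geometric (r : R) : 0 <= r < 1 -> sum_bounded (fun _ : nat => True) (fun n => r ^ n)%R (/ (1 - r)).
Proof.
  intros Hr. apply sum_bounded_nat. intros n. apply pow_le; lra.
  intros N. assert (E : (rsum (fun n => r ^ n)%R (seq 0 N) = (1 - r ^ N) / (1 - r))%R).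
  { induction N. { unfold rsum; simpl. field. lra. }
    rewrite seq_S, rsum_app, IHN. unfold rsum; simpl. field. lra. }
  rewrite E. pose proof (pow_le r N ltac:(lra)). unfold Rdiv.
  rewrite <- (Rmult_1_l (/ (1 - r))) at 2. apply Rmult_le_compat_r; [|lra].
  left. apply Rinv_0_lt_compat. lra.
Qed.

Lemma sum_bounded_inv_square : sum_bounded (fun _ : nat => True) (fun n => / (1 + INR n ^ 2))%R 5.
Proof.
  assert (P : forall x : R, 0 < 1 + x ^ 2) by (intros; pose proof (pow2_ge_0 x); lra).
  apply sum_bounded_nat. intros n. left. apply Rinv_0_lt_compat. apply P.
  (* Telescoping: 1/(1 + n^2) <= 4/(n + 1) - 4/(n + 2) for every n >= 0. *)
  intros N. assert (E : (rsum (fun n => / (1 + INR n ^ 2))%R (seq 0 N) <= 5 - 4 / (INR N + 1))).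
  { induction N. { unfold rsum; simpl. lra. }
    rewrite seq_S, rsum_app. unfold rsum at 2. simpl map. simpl fold_right. rewrite S_INR.
    set (x := INR N) in *. assert (0 <= x) by apply pos_INR.
    assert (/ (1 + x ^ 2) <= 4 / (x + 1) - 4 / (x + 1 + 1)); [|]. 2:{ replace (x * (x * 1))%R with (x ^ 2)%R by ring. lra. }
    replace (4 / (x + 1) - 4 / (x + 1 + 1))%R with (/ ((x + 1) * (x + 2) / 4))%R by (field; lra).
    apply Rinv_le_contravar; nra. }
  eapply Rle_trans; [exact E|]. pose proof (pos_INR N).
  assert (0 < 4 / (INR N + 1)) by (apply Rdiv_lt_0_compat; lra). lra.
Qed.

Lemma bijection_nonneg : bijection (fun _ : nat => True) (fun n : Z => (0 <= n)%Z) Z.of_nat.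
Proof. repeat split; intros; try lia. exists (Z.to_nat k). split; [auto|lia]. Qed.

Lemma bijection_neg : bijection (fun _ : nat => True) (fun n : Z => (n < 0)%Z) (fun n => - Z.of_nat (S n))%Z.
Proof. repeat split; intros; try lia. exists (Z.to_nat (- k - 1)). split; [auto|lia]. Qed.

Lemma bijection_pos : bijection (fun _ : nat => True) (fun n : Z => (0 < n)%Z) (fun n => Z.of_nat (S n)).
Proof. repeat split; intros; try lia. exists (Z.to_nat (k - 1)). split; [auto|lia]. Qed.

Lemma sum_bounded_Z (M : Z -> R) (B B' : R) : (forall n, 0 <= M n) ->
  sum_bounded (fun _ => True) (fun n => M (Z.of_nat n)) B ->
  sum_bounded (fun _ => True) (fun n => M (- Z.of_nat (S n))%Z) B' ->
  sum_bounded (fun _ => True) M (B + B').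
Proof.
  intros H0 H H'. apply (sum_bounded_ext (fun n => (0 <= n)%Z \/ (n < 0)%Z) _ M); [intros; lia|intros; lra|].
  apply sum_bounded_union; auto.
  - apply (sum_bounded_bijection _ _ _ M B bijection_nonneg H).
  - apply (sum_bounded_bijection _ _ _ M B' bijection_neg H').
Qed.

Lemma summable_Z_inv_square : summable (fun _ : Z => True) (fun n => / (1 + IZR n ^ 2))%R.
Proof.
  assert (P : forall x : R, 0 < 1 + x ^ 2) by (intros; pose proof (pow2_ge_0 x); lra).
  assert (P' : forall n : Z, 0 <= / (1 + IZR n ^ 2)).
  { intros n. left. apply Rinv_0_lt_compat. apply P. }
  apply (sum_bounded_summable _ _ (5 + 5)); auto. apply sum_bounded_Z; auto.
  - apply (sum_bounded_ext (fun _ => True) _ (fun n => / (1 + INR n ^ 2))%R); auto.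
    + intros i _. rewrite INR_IZR_INZ. lra.
    + apply sum_bounded_inv_square.
  - apply (sum_bounded_ext (fun _ => True) _ (fun n => / (1 + INR n ^ 2))%R); auto.
    + intros i _. rewrite opp_IZR, <- INR_IZR_INZ, S_INR. pose proof (pos_INR i).
      apply Rinv_le_contravar; [apply P|]. nra.
    + apply sum_bounded_inv_square.
Qed.

Lemma rsum_list_prod {T T' : Type} (M : T -> R) (M' : T' -> R) s s' :
  rsum (fun p => M (fst p) * M' (snd p))%R (list_prod s s') = (rsum M s * rsum M' s')%R.
Proof.
  induction s; simpl.
  - unfold rsum; simpl. ring.
  - rewrite rsum_app, IHs, rsum_map. simpl. rewrite rsum_scal. unfold rsum. simpl. ring.
Qed.

Lemma NoDup_list_prod {T T' : Type} (s : list T) (s' : list T') : NoDup s -> NoDup s' -> NoDup (list_prod s s').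
Proof.
  intros H H'. induction H; simpl. constructor.
  apply NoDup_app; auto.
  - apply FinFun.Injective_map_NoDup; auto. intros a b E. congruence.
  - intros [a b] Ha Hb. apply in_map_iff in Ha. destruct Ha as (y & E & _). inversion E; subst.
    apply in_prod_iff in Hb. tauto.
Qed.

(** A finite set of pairs lies in the product of its two projections, over which the sum factors. *)
Lemma summable_prod {T T' : Type} (M : T -> R) (M' : T' -> R) :
  summable (fun _ => True) M -> summable (fun _ => True) M' ->
  summable (fun _ => True) (fun p : T * T' => M (fst p) * M' (snd p))%R.
Proof.
  intros [H0 [B HB]] [H0' [B' HB']]. split. { intros i _. apply Rmult_le_pos; auto. }
  exists (B * B')%R. intros s [Hs _].
  destruct (fin_in_nodup (fun _ => True) (map fst s)) as (t & Ht & Hi). { apply Forall_forall; auto. }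
  destruct (fin_in_nodup (fun _ => True) (map snd s)) as (t' & Ht' & Hi'). { apply Forall_forall; auto. }
  assert (I : incl s (list_prod t t')).
  { intros [a b] Hx. apply in_prod_iff. split.
    - apply Hi. apply in_map_iff. exists (a, b); auto.
    - apply Hi'. apply in_map_iff. exists (a, b); auto. }
  destruct (incl_Permutation s _ Hs (NoDup_list_prod t t' (proj1 Ht) (proj1 Ht')) I) as [r Hr].
  pose proof (rsum_list_prod M M' t t') as E. rewrite (rsum_perm _ _ _ Hr), rsum_app in E.
  pose proof (rsum_nonneg (fun p : T * T' => M (fst p) * M' (snd p))%R r ltac:(intros; apply Rmult_le_pos; auto)).
  assert (rsum M t * rsum M' t' <= B * B'); [|lra].
  apply Rmult_le_compat; auto; apply rsum_nonneg; auto.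
Qed.

Lemma Cexp_cis (z : C) : Cexp z = exp (Re z) * cis (Im z).
Proof. reflexivity. Qed.

Lemma cis_plus (s t : R) : cis (s + t) = cis s * cis t.
Proof. unfold cis. rewrite cos_plus, sin_plus. apply injective_projections; simpl; ring. Qed.

Lemma Cexp_plus (z w : C) : Cexp (z + w) = Cexp z * Cexp w.
Proof. rewrite !Cexp_cis, re_plus, im_plus, exp_plus, cis_plus, RtoC_mult. ring. Qed.

Lemma Cexp_0 : Cexp 0 = 1.
Proof. rewrite Cexp_cis. unfold cis. simpl. rewrite exp_0, cos_0, sin_0. apply injective_projections; simpl; ring. Qed.

Lemma Cmod_Cexp (z : C) : Cmod (Cexp z) = exp (Re z).
Proof. rewrite Cexp_cis, Cmod_circle; auto. left. apply exp_pos. Qed.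

Lemma Cexp_nonzero (z : C) : Cexp z <> 0.
Proof. apply Cmod_gt_0. rewrite Cmod_Cexp. apply exp_pos. Qed.

Lemma Cexp_opp (z : C) : Cexp (- z) = / Cexp z.
Proof.
  pose proof (Cexp_nonzero z). rewrite <- (Cmult_1_l (/ Cexp z)), <- Cexp_0.
  replace (RtoC 0) with (- z + z) by ring. rewrite Cexp_plus. field. auto.
Qed.

Lemma Cexp_minus (z w : C) : Cexp (z - w) = Cexp z / Cexp w.
Proof. unfold Cminus. rewrite Cexp_plus, Cexp_opp. reflexivity. Qed.

Lemma Cexp_pow (z : C) (n : nat) : Cexp z ^ n = Cexp (INR n * z).
Proof.
  induction n. { simpl. replace (0 * z) with (RtoC 0) by ring. rewrite Cexp_0. reflexivity. }
  rewrite S_INR, RtoC_plus. simpl Cpow. rewrite IHn, <- Cexp_plus. f_equal. ring.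
Qed.

Lemma Cexp_RtoC (x : R) : Cexp x = exp x.
Proof. rewrite Cexp_cis. unfold cis. simpl. rewrite cos_0, sin_0. apply injective_projections; simpl; ring. Qed.

Lemma Cexp_conj (z : C) : Cconj (Cexp z) = Cexp (Cconj z).
Proof.
  rewrite !Cexp_cis, re_conj, im_conj. unfold cis. rewrite cos_neg, sin_neg.
  apply injective_projections; simpl; ring.
Qed.

Lemma Cexp_PI_Ci : Cexp (PI * Ci) = - (1).
Proof.
  rewrite Cexp_cis. unfold cis. simpl. replace (PI * 0 - 0 * 1)%R with 0%R by ring.
  replace (PI * 1 + 0 * 0)%R with PI by ring. rewrite exp_0, cos_PI, sin_PI.
  apply injective_projections; simpl; ring.
Qed.

Lemma Cexp_2PI_Z (n : Z) : Cexp (2 * PI * Ci * IZR n) = 1.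
Proof.
  assert (H : forall n : nat, Cexp (2 * PI * Ci * INR n) = 1).
  { intros k. replace (2 * PI * Ci * INR k) with (INR k * (PI * Ci + PI * Ci)) by ring.
    rewrite <- Cexp_pow, Cexp_plus, Cexp_PI_Ci. replace (- (1) * - (1)) with (RtoC 1) by ring. apply Cpow_1_l. }
  destruct (Z.le_ge_cases 0 n) as [L|L].
  - rewrite <- (Z2Nat.id n L), <- INR_IZR_INZ. apply H.
  - replace (2 * PI * Ci * IZR n) with (- (2 * PI * Ci * INR (Z.to_nat (- n)))).
    + rewrite Cexp_opp, H. apply injective_projections; simpl; field.
    + rewrite INR_IZR_INZ, Z2Nat.id, opp_IZR, RtoC_opp by lia. ring.
Qed.

(** The derivative at 0 comes from the real exponential and the circle; the addition formula moves
    it to z. *)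
Lemma cder_Cexp (z : C) : cder Cexp z (Cexp z).
Proof.
  assert (H0 : cder Cexp 0 1).
  { intros eps He. set (e := Rmin (eps / 4) 1). assert (He0 : 0 < e) by (unfold e; minmax).
    assert (He1 : e <= eps / 4 /\ e <= 1) by (unfold e; minmax).
    destruct (proj1 (is_derive_R_iff (V := R_NormedModule) exp 0 (exp 0)) (is_derive_exp 0) e He0) as (d1 & Hd1 & D1).
    destruct (proj1 (is_RCderive_iff cis 0 _) (is_RCderive_cis 0) e He0) as (d2 & Hd2 & D2).
    exists (Rmin (Rmin d1 d2) (e / 2)). split. { repeat apply Rmin_pos; lra. }
    intros h Hh.
    assert (L1 : Cmod h < d1) by (revert Hh; minmax).
    assert (L2 : Cmod h < d2) by (revert Hh; minmax).
    assert (L3 : Cmod h < e / 2) by (revert Hh; minmax).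
    pose proof (re_le_Cmod h) as R1. pose proof (im_le_Cmod h) as R2.
    specialize (D1 (Re h) ltac:(lra)). specialize (D2 (Im h) ltac:(lra)).
    change (Rabs ((exp (0 + Re h) - exp 0) - Re h * exp 0) <= e * Rabs (Re h)) in D1.
    rewrite Rplus_0_l, exp_0 in D1. rewrite Rplus_0_l in D2.
    replace (cis 0) with (RtoC 1) in D2 by (unfold cis; rewrite cos_0, sin_0; reflexivity).
    set (x := Re h) in *. set (y := Im h) in *.
    assert (E1 : Rabs (exp x - 1) <= 2 * Rabs x).
    { replace (exp x - 1)%R with ((exp x - 1 - x * 1) + x)%R by ring.
      eapply Rle_trans; [apply Rabs_triang|]. pose proof (Rabs_pos x). nra. }
    assert (E2 : exp x <= 2). { apply Rabs_le_between in E1. lra. }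
    rewrite Cexp_0, Cplus_0_l, Cexp_cis. fold x y.
    (* The error splits into that of [cis], the product of e^x - 1 with i y, and that of the real
       exponential; each is small compared with |h|. *)
    replace (exp x * cis y - 1 - 1 * h)
      with (exp x * (cis y - 1 - y * (Ci * 1)) + RtoC (exp x - 1) * (y * Ci) + RtoC (exp x - 1 - x * 1)).
    2:{ rewrite (Cdecomp h). fold x y. rewrite !RtoC_minus, RtoC_mult. ring. }
    eapply Rle_trans; [apply Cmod_triangle|].
    eapply Rle_trans; [apply Rplus_le_compat_r; apply Cmod_triangle|].
    rewrite !Cmod_mult, !Cmod_R, Cmod_Ci, (Rabs_pos_eq (exp x)) by (left; apply exp_pos).
    pose proof (Cmod_ge_0 h). pose proof (Rabs_pos x). pose proof (Rabs_pos y). pose proof (exp_pos x).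
    assert (B1 : exp x * Cmod (cis y - 1 - y * (Ci * 1)) <= 2 * (e * Cmod h)).
    { apply Rmult_le_compat; try lra. apply Cmod_ge_0.
      eapply Rle_trans; [exact D2|]. apply Rmult_le_compat_l; lra. }
    assert (B2 : Rabs (exp x - 1) * (Rabs y * 1) <= e * Cmod h).
    { rewrite Rmult_1_r. apply Rmult_le_compat; try apply Rabs_pos; lra. }
    assert (B3 : Rabs (exp x - 1 - x * 1) <= e * Cmod h).
    { eapply Rle_trans; [exact D1|]. apply Rmult_le_compat_l; lra. }
    apply Rle_trans with (4 * e * Cmod h)%R; [lra|]. apply Rmult_le_compat_r; lra. }
  apply (cder_ext (fun w => Cexp z * Cexp (w - z))).
  { intros w. rewrite <- Cexp_plus. f_equal. ring. }
  eapply cder_val.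
  - apply cder_scal. apply (cder_comp Cexp (fun w => w - z)).
    + apply cder_minus. apply cder_id. apply cder_const.
    + replace (z - z) with (RtoC 0) by ring. exact H0.
  - ring.
Qed.

Lemma cder_Cexp_linear (a z : C) : cder (fun w => Cexp (a * w)) z (a * Cexp (a * z)).
Proof.
  eapply cder_val.
  - apply (cder_comp Cexp (fun w => a * w)). apply cder_scal. apply cder_id. apply cder_Cexp.
  - ring.
Qed.

(** * Periodic functions at the cusp *)

Notation UHP := upper_half_plane.

Lemma center_in_disc (c : C) (r : R) : 0 < r -> disc c r c.
Proof. intros Hr. cbv beta. replace (c - c) with (RtoC 0) by ring. rewrite Cmod_0. exact Hr. Qed.

Lemma re_minus (a b : C) : Re (a - b) = (Re a - Re b)%R.
Proof. unfold Cminus. rewrite re_plus, re_opp. reflexivity. Qed.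

Lemma im_minus (a b : C) : Im (a - b) = (Im a - Im b)%R.
Proof. unfold Cminus. rewrite im_plus, im_opp. reflexivity. Qed.

Lemma disc_re_im (c z : C) (r : R) : disc c r z -> Re c - r < Re z < Re c + r /\ Im c - r < Im z < Im c + r.
Proof.
  intros Hz. pose proof (re_le_Cmod (z - c)) as A. pose proof (im_le_Cmod (z - c)) as B.
  rewrite re_minus in A. rewrite im_minus in B.
  apply Rabs_le_between in A. apply Rabs_le_between in B. lra.
Qed.

Lemma UHP_open : Copen UHP.
Proof.
  intros z Hz. exists (Im z). split; auto. intros w Hw. apply disc_re_im in Hw.
  unfold upper_half_plane in *. lra.
Qed.

(** Neighbourhoods of i oo: limits along this filter are uniform in the real part. *)
Definition cusp : (C -> Prop) -> Prop := fun P => exists Y : R, forall tau, Y < Im tau -> P tau.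

#[export] Instance cusp_filter : ProperFilter cusp.
Proof.
  constructor.
  - intros P [Y HY]. exists (0, Y + 1)%R. apply HY. simpl. lra.
  - constructor.
    + exists 0%R. auto.
    + intros P Q [Y HY] [Y' HY']. exists (Rmax Y Y'). intros tau Ht. split; [apply HY|apply HY'];
      revert Ht; minmax.
    + intros P Q HPQ [Y HY]. exists Y. auto.
Qed.

Notation tends_cusp f L := (filterlim f cusp (locally (T := C_UniformSpace) (L : C))).

Lemma cusp_UHP : cusp UHP.
Proof. exists 0%R. auto. Qed.

Lemma tends_cusp_iff (f : C -> C) (L : C) : tends_cusp f L <->
  forall eps : R, 0 < eps -> exists Y, forall tau, Y < Im tau -> Cmod (f tau - L) < eps.
Proof. apply (C_filterlim_iff cusp). Qed.

Lemma tends_cusp_ext (f g : C -> C) (L : C) : (forall tau, UHP tau -> f tau = g tau) ->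
  tends_cusp f L -> tends_cusp g L.
Proof.
  intros E. apply filterlim_ext_loc. generalize cusp_UHP. apply filter_imp. auto.
Qed.

Lemma tends_cusp_plus (f g : C -> C) (a b : C) :
  tends_cusp f a -> tends_cusp g b -> tends_cusp (fun t => f t + g t) (a + b).
Proof. apply (C_filterlim_plus cusp). Qed.

Lemma tends_cusp_mult (f g : C -> C) (a b : C) :
  tends_cusp f a -> tends_cusp g b -> tends_cusp (fun t => f t * g t) (a * b).
Proof. apply (C_filterlim_mult cusp). Qed.

Lemma tends_cusp_const (a : C) : tends_cusp (fun _ => a) a.
Proof. apply filterlim_const. Qed.

Lemma tends_cusp_minus (f g : C -> C) (a b : C) :
  tends_cusp f a -> tends_cusp g b -> tends_cusp (fun t => f t - g t) (a - b).
Proof.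
  intros Hf Hg. apply tends_cusp_ext with (fun t => f t + (- (1)) * g t). { intros; ring. }
  replace (a - b) with (a + (- (1)) * b) by ring. apply tends_cusp_plus; auto.
  apply tends_cusp_mult; auto. apply tends_cusp_const.
Qed.

Lemma tends_cusp_div (f g : C -> C) (a b : C) : b <> 0 ->
  tends_cusp f a -> tends_cusp g b -> tends_cusp (fun t => f t / g t) (a / b).
Proof. intros Hb Hf Hg. apply tends_cusp_mult; auto. apply (C_filterlim_inv cusp); auto. Qed.

Lemma tends_cusp_pow (f : C -> C) (a : C) (n : nat) :
  tends_cusp f a -> tends_cusp (fun t => f t ^ n) (a ^ n).
Proof. intros Hf. induction n; simpl. apply tends_cusp_const. apply tends_cusp_mult; auto. Qed.

Lemma tends_cusp_val (f : C -> C) (a b : C) : tends_cusp f a -> a = b -> tends_cusp f b.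
Proof. intros Hf E. subst. exact Hf. Qed.

(** Cauchy's estimate on a disc of fixed radius, which moves to the cusp together with its
    centre. *)
Lemma tends_cusp_derive (f : C -> C) (L : C) : holomorphic_on UHP f -> tends_cusp f L ->
  tends_cusp (C_derive f) 0.
Proof.
  intros Hf HL. rewrite tends_cusp_iff in *. intros eps He.
  destruct (HL (eps / 2)%R ltac:(lra)) as [Y HY]. exists (Rmax Y 0 + 2)%R. intros tau Ht.
  replace (C_derive f tau - 0) with (C_derive f tau) by ring.
  assert (I : forall z, disc tau 2 z -> UHP z /\ Y < Im z).
  { intros z Hz. apply disc_re_im in Hz. unfold upper_half_plane. revert Ht. minmax. }
  assert (D : forall z, disc tau 2 z -> cder (fun w => f w - L) z (C_derive f z)).
  { intros z Hz. eapply cder_val. apply cder_minus. apply ex_Cderive_cder. apply Hf. apply I; auto.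
    apply cder_const. ring. }
  rewrite <- (cder_C_derive _ _ _ (D tau (center_in_disc tau 2 ltac:(lra)))).
  eapply Rle_lt_trans; [apply (Cauchy_estimate _ tau 2 1 (eps / 2)); [lra| |]|lra].
  - intros z Hz. eapply cder_ex. apply D; auto.
  - intros t _. left. apply HY. apply I. apply circle_in_disc. lra.
Qed.

Lemma C_continuous_pair {T : UniformSpace} (f g : T -> R) (x : T) :
  continuous f x -> continuous g x -> Ccont (fun y => (f y, g y) : C) x.
Proof.
  intros Hf Hg. apply C_continuous_iff. intros eps He.
  assert (He2 : 0 < eps / 2) by lra.
  assert (F1 : locally x (fun y => Rabs (f y - f x) < eps / 2))
    by exact (Hf _ (locally_ball (f x) (mkposreal _ He2))).
  assert (F2 : locally x (fun y => Rabs (g y - g x) < eps / 2))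
    by exact (Hg _ (locally_ball (g x) (mkposreal _ He2))).
  generalize (filter_and _ _ F1 F2). apply filter_imp. intros y [H1 H2].
  eapply Rle_lt_trans; [apply Cmod_le_re_im|]. simpl. unfold Rminus in *. lra.
Qed.

Lemma continuous_Cmod (z : C) : continuous (T := C_UniformSpace) (U := R_UniformSpace) Cmod z.
Proof.
  intros P [e HP]. apply C_locally_Cmod. exists e. split. apply cond_pos. intros w Hw. apply HP.
  change (Rabs (Cmod w - Cmod z) < e).
  pose proof (Cmod_reverse_triangle w z). pose proof (Cmod_reverse_triangle z w) as H2.
  rewrite Cmod_minus_sym in H2. apply Rabs_def1; lra.
Qed.

(* Only a logarithm on the right half-plane. *)
Definition clog (w : C) : C := (ln (Cmod w), atan (Im w / Re w)).

Lemma Cexp_clog (w : C) : 0 < Re w -> Cexp (clog w) = w.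
Proof.
  intros Hw. assert (N : 0 < Cmod w).
  { eapply Rlt_le_trans; [exact Hw|]. eapply Rle_trans; [apply Rle_abs|apply re_le_Cmod]. }
  assert (S : sqrt (1 + (Im w / Re w)²) = (Cmod w / Re w)%R).
  { replace (1 + (Im w / Re w)²)%R with ((Cmod w / Re w) ^ 2)%R.
    - apply sqrt_pow2. apply Rlt_le, Rdiv_lt_0_compat; auto.
    - unfold Rdiv. rewrite Rpow_mult_distr, Cmod2_alt. unfold Rsqr. field. lra. }
  assert (C1 : cos (atan (Im w / Re w)) = (Re w / Cmod w)%R).
  { rewrite cos_atan, S. field. lra. }
  assert (S1 : sin (atan (Im w / Re w)) = (Im w / Cmod w)%R).
  { pose proof (tan_atan (Im w / Re w)) as T. unfold tan in T. rewrite C1 in T.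
    assert (Q : (Re w / Cmod w <> 0)%R) by (apply Rgt_not_eq, Rdiv_lt_0_compat; auto).
    replace (sin (atan (Im w / Re w))) with (sin (atan (Im w / Re w)) / (Re w / Cmod w) * (Re w / Cmod w))%R
      by (field; lra).
    rewrite T. field. lra. }
  rewrite Cexp_cis. unfold clog, cis. simpl Re. simpl Im. rewrite exp_ln by auto. rewrite C1, S1.
  etransitivity; [|symmetry; apply Cdecomp].
  apply injective_projections; simpl; field; lra.
Qed.

Lemma clog_continuous_1 : continuous (T := C_UniformSpace) (U := C_UniformSpace) clog (RtoC 1).
Proof.
  unfold clog. apply (C_continuous_pair (T := C_UniformSpace)).
  - apply (continuous_comp Cmod ln). apply continuous_Cmod. rewrite Cmod_1.
    apply (ex_derive_continuous (V := R_NormedModule)). exists (/ 1)%R. apply is_derive_ln. lra.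
  - apply (continuous_comp (fun w : C => Im w / Re w)%R atan).
    + apply (continuous_mult (K := R_AbsRing)). apply continuous_Im.
      apply (continuous_comp Re Rinv). apply continuous_Re. simpl.
      apply (continuous_Rinv). lra.
    + apply continuity_pt_filterlim. apply derivable_continuous_pt. apply derivable_pt_atan.
Qed.

(** Local surjectivity with control of the size of the preimage; it plays the part of a continuous
    logarithm near 1. *)
Lemma Cexp_local_section (eps : R) : 0 < eps ->
  exists d, 0 < d /\ forall w, Cmod (w - 1) < d -> exists s, Cmod s < eps /\ Cexp s = w.
Proof.
  intros He. pose proof clog_continuous_1 as Hc. apply C_continuous_iff with (eps := eps) in Hc; auto.
  apply C_locally_Cmod in Hc. destruct Hc as (d & Hd & Hc).
  assert (E : clog 1 = 0).
  { unfold clog. rewrite Cmod_1, ln_1. simpl. replace (0 / 1)%R with 0%R by field. rewrite atan_0. reflexivity. }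
  exists (Rmin d 1). split. { apply Rmin_pos; lra. }
  intros w Hw. exists (clog w). split.
  - replace (clog w) with (clog w - clog 1) by (rewrite E; ring). apply Hc.
    eapply Rlt_le_trans; [exact Hw|apply Rmin_l].
  - apply Cexp_clog. assert (Hw' : Cmod (w - 1) < 1) by (eapply Rlt_le_trans; [exact Hw|apply Rmin_r]).
    apply (disc_re_im 1 w 1) in Hw'. simpl in Hw'. lra.
Qed.

(** Multiplication by -1, i or -i brings w into the right half-plane, where [clog] applies. *)
Lemma Cexp_surjective (w : C) : w <> 0 -> exists s, Cexp s = w.
Proof.
  intros N.
  assert (Q : Cexp (PI / 2 * Ci) = Ci).
  { rewrite Cexp_cis. unfold cis. simpl.
    match goal with |- context [exp ?x] => replace x with 0%R by (field; repeat split; lra) end.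
    match goal with |- context [cos ?x] => replace x with (PI / 2)%R by (field; repeat split; lra) end.
    rewrite exp_0, cos_PI2, sin_PI2. apply injective_projections; simpl; ring. }
  destruct (Rtotal_order (Re w) 0) as [L|[L|L]].
  - exists (clog (- w) + PI * Ci). rewrite Cexp_plus, Cexp_PI_Ci, Cexp_clog. ring. rewrite re_opp. lra.
  - destruct (Rtotal_order (Im w) 0) as [M|[M|M]].
    + exists (clog (Ci * w) - PI / 2 * Ci). rewrite Cexp_minus, Q, Cexp_clog. field. apply Ci_nz.
      rewrite re_mult. simpl. lra.
    + exfalso. apply N. rewrite (Cdecomp w), L, M. ring.
    + exists (clog (- (Ci * w)) + PI / 2 * Ci). rewrite Cexp_plus, Q, Cexp_clog.
      * replace (- (Ci * w) * Ci) with (- (Ci * Ci) * w) by ring.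
        replace (Ci * Ci) with (- RtoC 1) by (apply injective_projections; simpl; ring). ring.
      * rewrite re_opp, re_mult. simpl. lra.
  - exists (clog w). apply Cexp_clog. lra.
Qed.

(** The sine vanishes at multiples k pi; for odd k the exponential would be -1. *)
Lemma Cexp_eq_1 (z : C) : Cexp z = 1 -> exists n : Z, z = 2 * PI * Ci * IZR n.
Proof.
  intros E. assert (R0 : Re z = 0%R).
  { pose proof (Cmod_Cexp z) as M. rewrite E, Cmod_1 in M. rewrite <- exp_0 in M. symmetry. apply exp_inv. exact M. }
  rewrite Cexp_cis, R0, exp_0, Cmult_1_l in E. unfold cis in E.
  assert (C1 : cos (Im z) = 1%R) by (apply (f_equal Re) in E; exact E).
  assert (S1 : sin (Im z) = 0%R) by (apply (f_equal Im) in E; exact E).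
  apply sin_eq_0_0 in S1. destruct S1 as [k Hk].
  destruct (Z.Even_or_Odd k) as [[m Hm]|[m Hm]].
  - exists m. rewrite (Cdecomp z), R0, Hk, Hm, mult_IZR. rewrite !RtoC_mult. ring.
  - exfalso. assert (Q : Cexp (Ci * Im z) = - (1)).
    { rewrite Hk, Hm, plus_IZR, mult_IZR. rewrite RtoC_mult, RtoC_plus, RtoC_mult.
      replace (Ci * ((2 * IZR m + 1) * PI)) with (2 * PI * Ci * IZR m + PI * Ci) by ring.
      rewrite Cexp_plus, Cexp_2PI_Z, Cexp_PI_Ci. ring. }
    rewrite Cexp_cis in Q. apply (f_equal Re) in Q. unfold cis in Q. simpl in Q.
    replace (0 * Im z - 1 * 0)%R with 0%R in Q by ring. replace (0 * 0 + 1 * Im z)%R with (Im z) in Q by ring.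
    rewrite exp_0, C1 in Q. lra.
Qed.

Definition kappa : C := 2 * PI * Ci.

Lemma kappa_nonzero : kappa <> 0.
Proof.
  unfold kappa. apply Cmult_neq_0; [apply Cmult_neq_0|apply Ci_nz]; intros E; apply RtoC_inj in E.
  lra. pose proof PI_RGT_0. lra.
Qed.

Definition qexp (tau : C) : C := Cexp (kappa * tau).

Lemma Cmod_qexp (tau : C) : Cmod (qexp tau) = exp (- (2 * PI * Im tau)).
Proof.
  unfold qexp. rewrite Cmod_Cexp. f_equal. unfold kappa. simpl. unfold Im, Re. ring.
Qed.

Lemma qexp_nonzero tau : qexp tau <> 0.
Proof. apply Cexp_nonzero. Qed.

Lemma cder_qexp tau : cder qexp tau (kappa * qexp tau).
Proof. apply cder_Cexp_linear. Qed.

Lemma qexp_UHP tau : Cmod (qexp tau) < 1 -> UHP tau.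
Proof.
  rewrite Cmod_qexp, <- exp_0. intros L. apply exp_lt_inv in L. unfold upper_half_plane.
  pose proof PI_RGT_0. nra.
Qed.

Lemma qexp_surjective (q : C) : q <> 0 -> exists tau, qexp tau = q.
Proof.
  intros N. destruct (Cexp_surjective q N) as [s Hs]. exists (s / kappa). unfold qexp.
  replace (kappa * (s / kappa)) with s by (field; apply kappa_nonzero). exact Hs.
Qed.

Lemma qexp_eq tau tau' : qexp tau = qexp tau' -> exists n : Z, tau = tau' + IZR n.
Proof.
  intros E. destruct (Cexp_eq_1 (kappa * tau - kappa * tau')) as [n Hn].
  - rewrite Cexp_minus. change (qexp tau / qexp tau' = 1). rewrite E. field. apply qexp_nonzero.
  - exists n. fold kappa in Hn. pose proof kappa_nonzero as K.
    replace tau with ((kappa * tau - kappa * tau') / kappa + tau') by (field; auto). rewrite Hn. field. auto.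
Qed.

Lemma qexp_local_section tau0 (eps : R) : 0 < eps -> exists d, 0 < d /\
  forall q, Cmod (q - qexp tau0) < d -> exists tau, Cmod (tau - tau0) < eps /\ qexp tau = q.
Proof.
  intros He. pose proof kappa_nonzero as K. pose proof K as K'. apply Cmod_gt_0 in K'.
  pose proof (qexp_nonzero tau0) as N. pose proof N as N'. apply Cmod_gt_0 in N'.
  destruct (Cexp_local_section (eps * Cmod kappa)) as (d & Hd & HS). { apply Rmult_lt_0_compat; auto. }
  exists (d * Cmod (qexp tau0))%R. split. { apply Rmult_lt_0_compat; auto. }
  intros q Hq. destruct (HS (q / qexp tau0)) as (s & Hs & E).
  - replace (q / qexp tau0 - 1) with ((q - qexp tau0) / qexp tau0) by (field; auto).
    rewrite Cmod_div by auto. apply Rmult_lt_reg_r with (Cmod (qexp tau0)); auto.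
    unfold Rdiv. rewrite Rmult_assoc, Rinv_l, Rmult_1_r by lra. exact Hq.
  - exists (tau0 + s / kappa). split.
    + replace (tau0 + s / kappa - tau0) with (s / kappa) by ring. rewrite Cmod_div by auto.
      apply Rmult_lt_reg_r with (Cmod kappa); auto. unfold Rdiv. rewrite Rmult_assoc, Rinv_l, Rmult_1_r by lra. exact Hs.
    + unfold qexp in *. replace (kappa * (tau0 + s / kappa)) with (kappa * tau0 + s) by (field; auto).
      rewrite Cexp_plus, E. field. exact N.
Qed.

(** Differentiates u, given through f = u o E, when E has no global inverse. Points near E t0 are
    values of E near t0, and the nonzero derivative e makes the two displacements comparable. *)
Lemma cder_descend (E f u : C -> C) (t0 e l : C) : e <> 0 -> cder E t0 e -> cder f t0 l ->
  u (E t0) = f t0 ->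
  (forall eps : R, 0 < eps -> exists d, 0 < d /\
     forall q, Cmod (q - E t0) < d -> exists t, Cmod (t - t0) < eps /\ E t = q /\ u q = f t) ->
  cder u (E t0) (l / e).
Proof.
  intros Ne HE Hf Hu0 Hsec eps He. pose proof Ne as Ne'. apply Cmod_gt_0 in Ne'.
  set (L := (Cmod (l / e) + 1)%R). pose proof (Cmod_ge_0 (l / e)) as HL0.
  assert (HL : 0 < L) by (unfold L; lra).
  set (a := (eps * Cmod e / (4 * L))%R).
  assert (Ha : 0 < a) by (apply Rdiv_lt_0_compat; [apply Rmult_lt_0_compat; auto|lra]).
  destruct (HE (Rmin (Cmod e / 2) a)) as (d1 & Hd1 & H1). { apply Rmin_pos; lra. }
  destruct (Hf a Ha) as (d2 & Hd2 & H2).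
  destruct (Hsec (Rmin d1 d2)) as (d & Hd & HS). { apply Rmin_pos; lra. }
  exists d. split; auto. intros h Hh.
  destruct (HS (E t0 + h)) as (t & Ht & Et & ut). { replace (E t0 + h - E t0) with h by ring. exact Hh. }
  set (s := t - t0) in *.
  assert (Hs1 : Cmod s < d1) by (eapply Rlt_le_trans; [exact Ht|apply Rmin_l]).
  assert (Hs2 : Cmod s < d2) by (eapply Rlt_le_trans; [exact Ht|apply Rmin_r]).
  specialize (H1 s Hs1). specialize (H2 s Hs2).
  replace (t0 + s) with t in H1, H2 by (unfold s; ring).
  rewrite Et in H1. replace (E t0 + h - E t0 - e * s) with (h - e * s) in H1 by ring.
  pose proof (Cmod_ge_0 s) as Hs0.
  assert (H1a : Cmod (h - e * s) <= Cmod e / 2 * Cmod s).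
  { eapply Rle_trans; [exact H1|]. apply Rmult_le_compat_r; auto. apply Rmin_l. }
  assert (H1b : Cmod (h - e * s) <= a * Cmod s).
  { eapply Rle_trans; [exact H1|]. apply Rmult_le_compat_r; auto. apply Rmin_r. }
  assert (Hsh : Cmod e * Cmod s <= 2 * Cmod h).
  { pose proof (Cmod_reverse_triangle (e * s) h) as Q. rewrite Cmod_mult, Cmod_minus_sym in Q. lra. }
  rewrite ut, Hu0.
  replace (f t - f t0 - l / e * h) with ((f t - f t0 - l * s) - (l / e) * (h - e * s)) by (field; auto).
  eapply Rle_trans; [apply Cmod_sub_le|]. rewrite Cmod_mult.
  assert (B : Cmod (l / e) * Cmod (h - e * s) <= Cmod (l / e) * (a * Cmod s)) by (apply Rmult_le_compat_l; auto).
  apply Rle_trans with (L * (a * Cmod s))%R. { unfold L. lra. }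
  replace (L * (a * Cmod s))%R with (eps / 4 * (Cmod e * Cmod s))%R by (unfold a; field; lra).
  apply Rle_trans with (eps / 4 * (2 * Cmod h))%R. { apply Rmult_le_compat_l; lra. }
  pose proof (Cmod_ge_0 h). nra.
Qed.

Lemma periodic_Z (f : C -> C) : (forall tau, UHP tau -> f (tau + 1) = f tau) ->
  forall (n : Z) tau, UHP tau -> f (tau + IZR n) = f tau.
Proof.
  intros Hp.
  assert (HN : forall (n : nat) tau, UHP tau -> f (tau + INR n) = f tau).
  { induction n; intros tau Ht. { simpl. f_equal. ring. }
    rewrite S_INR, RtoC_plus, Cplus_assoc, Hp; auto.
    unfold upper_half_plane in *. rewrite im_plus, im_RtoC. lra. }
  intros n tau Ht. destruct (Z.le_ge_cases 0 n) as [L|L].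
  - rewrite <- (Z2Nat.id n L), <- INR_IZR_INZ. auto.
  - rewrite <- (HN (Z.to_nat (- n)) (tau + IZR n)).
    + f_equal. rewrite INR_IZR_INZ, Z2Nat.id, opp_IZR, RtoC_opp by lia. ring.
    + unfold upper_half_plane in *. rewrite im_plus, im_RtoC. lra.
Qed.

(* The expansion is the removable singularity theorem at q = 0, whence f = u o qexp with u
   holomorphic on the whole disc. *)
Theorem periodic_q_expansion (f : C -> C) (L : C) : holomorphic_on UHP f ->
  (forall tau, UHP tau -> f (tau + 1) = f tau) -> tends_cusp f L ->
  exists u : C -> C, (forall q, disc 0 1 q -> ex_Cderive u q) /\ u 0 = L /\
    forall tau, UHP tau -> f tau = u (qexp tau).
Proof.
  intros Hf Hp HL.
  (* An arbitrary preimage under [qexp], with no continuity: two preimages differ by an integer, and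
     f is periodic. *)
  set (ch := fun q => epsilon (inhabits (RtoC 0)) (fun tau => qexp tau = q)).
  assert (Hch : forall q : C, q <> 0 -> qexp (ch q) = q).
  { intros q N. apply (epsilon_spec (inhabits (RtoC 0)) (fun tau => qexp tau = q)). apply qexp_surjective; auto. }
  set (u := fun q => if Ceq_dec q 0 then L else f (ch q)).
  assert (Hu : forall tau, UHP tau -> f tau = u (qexp tau)).
  { intros tau Ht. unfold u. destruct (Ceq_dec (qexp tau) 0) as [E|E]. { exfalso. apply (qexp_nonzero tau E). }
    destruct (qexp_eq (ch (qexp tau)) tau (Hch _ E)) as [n Hn]. rewrite Hn. symmetry. apply periodic_Z; auto. }
  assert (Hd : forall q : C, disc 0 1 q -> q <> 0 -> ex_Cderive u q).
  { intros q Hq N. destruct (qexp_surjective q N) as [t0 E].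
    assert (Hq1 : Cmod q < 1) by (replace q with (q - 0) by ring; exact Hq).
    assert (Ht0 : UHP t0) by (apply qexp_UHP; rewrite E; exact Hq1).
    rewrite <- E. eapply cder_ex.
    apply (cder_descend qexp f u t0 (kappa * qexp t0)).
    - apply Cmult_neq_0. apply kappa_nonzero. apply qexp_nonzero.
    - apply cder_qexp.
    - apply ex_Cderive_cder. apply Hf; auto.
    - symmetry. apply Hu; auto.
    - intros eps He. destruct (UHP_open t0 Ht0) as (r & Hr & HO).
      destruct (qexp_local_section t0 (Rmin eps r)) as (d & Hd & HS). { apply Rmin_pos; auto. }
      exists d. split; auto. intros q' Hq'. destruct (HS q' Hq') as (t & Ht & Et). exists t. repeat split; auto.
      + eapply Rlt_le_trans; [exact Ht|apply Rmin_l].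
      + rewrite <- Et. symmetry. apply Hu. apply HO. eapply Rlt_le_trans; [exact Ht|apply Rmin_r]. }
  exists u. split; [|split; auto].
  - apply (removable_singularity u 0 0 1); auto.
    intros q Hq. destruct (Ceq_dec q 0) as [E|E]; [|apply ex_Cderive_continuous; auto]. subst q.
    apply C_continuous_iff. intros eps He. rewrite tends_cusp_iff in HL.
    (* As |q| < exp(-2 pi Y) means height above Y, the limit at the cusp is the continuity of u at
       0. *)
    destruct (HL eps He) as [Y HY]. apply C_locally_Cmod. exists (exp (- (2 * PI * Y))). split. apply exp_pos.
    intros q Hq'. unfold u. destruct (Ceq_dec 0 0) as [_|N]; [|congruence].
    destruct (Ceq_dec q 0) as [E|E]. { replace (L - L) with (RtoC 0) by ring. rewrite Cmod_0. auto. }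
    apply HY. rewrite <- (Hch q E) in Hq'. replace (qexp (ch q) - 0) with (qexp (ch q)) in Hq' by ring.
    rewrite Cmod_qexp in Hq'. apply exp_lt_inv in Hq'. pose proof PI_RGT_0. nra.
  - unfold u. destruct (Ceq_dec 0 0); congruence.
Qed.

(** The q-expansion is divided by q through the difference quotient of u at 0, whose singularity is
    removable. *)
Theorem periodic_vanishing_q_expansion (f : C -> C) : holomorphic_on UHP f ->
  (forall tau, UHP tau -> f (tau + 1) = f tau) -> tends_cusp f 0 ->
  exists u : C -> C, (forall q, disc 0 1 q -> ex_Cderive u q) /\
    forall tau, UHP tau -> f tau = qexp tau * u (qexp tau).
Proof.
  intros Hf Hp HL. destruct (periodic_q_expansion f 0 Hf Hp HL) as (u & Hu & Hu0 & E).
  set (k := fun w => if Ceq_dec w 0 then C_derive u 0 else (u w - u 0) / (w - 0)).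
  exists k. split.
  - apply (removable_singularity k 0 0 1).
    + apply (difference_quotient_primitive u 0 0 1 Hu). replace (0 - 0) with (RtoC 0) by ring. rewrite Cmod_0. lra.
    + intros z Hz N. specialize (Hu z Hz). apply ex_Cderive_cder in Hu.
      eapply cder_ex. apply (cder_ext_loc (fun w => (u w - u 0) / (w - 0)) k z _ (Cmod z)).
      * apply Cmod_gt_0; auto.
      * intros w Hw. unfold k. destruct (Ceq_dec w 0) as [E'|E']; auto.
        subst w. rewrite Cmod_minus_sym in Hw. replace (z - 0) with z in Hw by ring. lra.
      * apply cder_div. replace (z - 0) with z by ring; auto. apply cder_minus. exact Hu. apply cder_const.
        apply cder_minus. apply cder_id. apply cder_const.
  - intros tau Ht. rewrite E by auto. unfold k. destruct (Ceq_dec (qexp tau) 0) as [E'|E'].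
    { exfalso. apply (qexp_nonzero tau E'). }
    rewrite Hu0. field. exact E'.
Qed.

Lemma disc_bounded (u : C -> C) (r : R) : 0 < r < 1 -> (forall q, disc 0 1 q -> ex_Cderive u q) ->
  exists K, 0 <= K /\ forall q, Cmod q < r -> Cmod (u q) <= K.
Proof.
  intros Hr Hu. destruct (disc_circle_bounded u 0 r 1 ltac:(lra) Hu) as (M & HM0 & HM).
  exists M. split; auto. intros q Hq. rewrite <- (Cplus_0_l q). apply (maximum_modulus u 0 q 1 r M); auto. lra.
Qed.

(** On |q| < exp(-2 pi y0) the cofactor of q is bounded, so f decays as fast as |q|, uniformly in
    the real part. *)
Lemma periodic_vanishing_decay (f : C -> C) (y0 : R) : 0 < y0 -> holomorphic_on UHP f ->
  (forall tau, UHP tau -> f (tau + 1) = f tau) -> tends_cusp f 0 ->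
  exists K, 0 <= K /\ forall tau, y0 < Im tau -> Cmod (f tau) <= K * exp (- (2 * PI * Im tau)).
Proof.
  intros Hy Hf Hp HL. destruct (periodic_vanishing_q_expansion f Hf Hp HL) as (u & Hu & E).
  destruct (disc_bounded u (exp (- (2 * PI * y0)))) as (K & HK & HB); auto.
  { split. apply exp_pos. rewrite <- exp_0. apply exp_increasing. pose proof PI_RGT_0. nra. }
  exists K. split; auto. intros tau Ht. rewrite E by (unfold upper_half_plane; lra).
  rewrite Cmod_mult, Cmod_qexp, Rmult_comm. apply Rmult_le_compat_r. left; apply exp_pos.
  apply HB. rewrite Cmod_qexp. apply exp_increasing. pose proof PI_RGT_0. nra.
Qed.

(** * Vanishing of modular forms of weight at most 6 *)

Lemma UHP_nonzero (tau : C) : UHP tau -> tau <> 0.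
Proof. intros Ht E. subst tau. unfold upper_half_plane in Ht. simpl in Ht. lra. Qed.

Lemma im_inv_opp (tau : C) : tau <> 0 -> Im (- / tau) = (Im tau / Cmod tau ^ 2)%R.
Proof.
  intros N. rewrite Cmod2_alt. destruct tau as [x y]. simpl.
  assert (x * x + y * y <> 0)%R.
  { intros E. apply N. assert (x = 0)%R by nra. assert (y = 0)%R by nra. subst. reflexivity. }
  unfold Im, Re; simpl. field. lra.
Qed.

Lemma UHP_inv_opp (tau : C) : UHP tau -> UHP (- / tau).
Proof.
  intros Ht. pose proof (UHP_nonzero tau Ht) as N. unfold upper_half_plane in *.
  rewrite im_inv_opp by auto. apply Rdiv_lt_0_compat; auto. apply pow_lt. apply Cmod_gt_0; auto.
Qed.

Lemma UHP_shift (tau : C) (x : R) : UHP tau -> UHP (tau + x).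
Proof. unfold upper_half_plane. rewrite im_plus, im_RtoC. lra. Qed.

Lemma UHP_translate_Z (Q : C -> Prop) : (forall tau, UHP tau -> Q (tau + 1) -> Q tau) ->
  (forall tau, UHP tau -> Q (tau - 1) -> Q tau) ->
  forall (n : Z) tau, UHP tau -> Q (tau + IZR n) -> Q tau.
Proof.
  intros HP HM.
  assert (P : forall (n : nat) tau, UHP tau -> Q (tau + INR n) -> Q tau).
  { induction n; intros tau Ht HQ. { simpl in HQ. rewrite Cplus_0_r in HQ. auto. }
    apply IHn; auto. apply HP. apply UHP_shift; auto.
    rewrite S_INR, RtoC_plus in HQ. replace (tau + INR n + 1) with (tau + (INR n + 1)) by ring. exact HQ. }
  assert (P' : forall (n : nat) tau, UHP tau -> Q (tau - INR n) -> Q tau).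
  { induction n; intros tau Ht HQ. { simpl in HQ. replace (tau - 0) with tau in HQ by ring. auto. }
    apply IHn; auto. apply HM.
    - replace (tau - INR n) with (tau + RtoC (- INR n)) by (rewrite RtoC_opp; ring). apply UHP_shift; auto.
    - rewrite S_INR, RtoC_plus in HQ. replace (tau - INR n - 1) with (tau - (INR n + 1)) by ring. exact HQ. }
  intros n tau Ht HQ. destruct (Z.le_ge_cases 0 n) as [L|L].
  - apply (P (Z.to_nat n)); auto. rewrite INR_IZR_INZ, Z2Nat.id by auto. exact HQ.
  - apply (P' (Z.to_nat (- n))); auto. rewrite INR_IZR_INZ, Z2Nat.id, opp_IZR, RtoC_opp by lia.
    replace (tau - - IZR n) with (tau + IZR n) by ring. exact HQ.
Qed.

Lemma nearest_integer (x : R) : exists n : Z, - (1 / 2) <= x + IZR n <= 1 / 2.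
Proof.
  exists (- (up (x + 1 / 2) - 1))%Z. destruct (archimed (x + 1 / 2)) as [A B].
  rewrite opp_IZR, minus_IZR. lra.
Qed.

(* If Im tau < 3/4 and |Re tau| <= 1/2 then |tau|^2 <= 13/16, so that [- / tau] is higher
   by a factor at least 16/13. *)
Theorem modular_reduction (Q : C -> Prop) : (forall tau, UHP tau -> Q (tau + 1) -> Q tau) ->
  (forall tau, UHP tau -> Q (tau - 1) -> Q tau) ->
  (forall tau, UHP tau -> Q (- / tau) -> Q tau) ->
  (forall tau, 3 / 4 <= Im tau -> Q tau) -> forall tau, UHP tau -> Q tau.
Proof.
  intros HP HM HS H0.
  assert (main : forall (n : nat) tau, UHP tau -> 3 / 4 <= Im tau * (16 / 13) ^ n -> Q tau).
  { induction n; intros tau Ht Hn. { simpl in Hn. apply H0. lra. }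
    destruct (nearest_integer (Re tau)) as [k Hk].
    apply (UHP_translate_Z Q HP HM k); auto.
    set (t := tau + IZR k). assert (Et : Im t = Im tau) by (unfold t; rewrite im_plus, im_RtoC; ring).
    assert (Ret : Re t = (Re tau + IZR k)%R) by (unfold t; rewrite re_plus, re_RtoC; ring).
    assert (Ut : UHP t) by (apply UHP_shift; auto).
    destruct (Rle_dec (3 / 4) (Im t)) as [L|L]; auto.
    apply HS; auto. apply IHn. apply UHP_inv_opp; auto.
    pose proof (UHP_nonzero t Ut) as N. pose proof N as N'. apply Cmod_gt_0 in N'.
    rewrite im_inv_opp by auto.
    assert (B : Cmod t ^ 2 <= 13 / 16). { rewrite Cmod2_alt, Ret. unfold upper_half_plane in Ut. nra. }
    assert (Hp : 0 < Cmod t ^ 2) by (apply pow_lt; auto).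
    assert (Hpn : 0 < (16 / 13) ^ n) by (apply pow_lt; lra).
    eapply Rle_trans; [exact Hn|]. rewrite Et. simpl pow. unfold upper_half_plane in Ht.
    replace (Im tau * (16 / 13 * (16 / 13) ^ n))%R with ((Im tau * (16 / 13) ^ n) * (16 / 13))%R by ring.
    replace (Im tau / (Cmod t * (Cmod t * 1)) * (16 / 13) ^ n)%R
      with ((Im tau * (16 / 13) ^ n) * / Cmod t ^ 2)%R by (simpl; field; lra).
    apply Rmult_le_compat_l. apply Rmult_le_pos; lra.
    replace (16 / 13)%R with (/ (13 / 16))%R by field. apply Rinv_le_contravar; auto. }
  intros tau Ht. destruct (Pow_x_infinity (16 / 13) ltac:(rewrite Rabs_pos_eq; lra) (3 / 4 / Im tau)) as [N HN].
  unfold upper_half_plane in Ht. specialize (HN N (Nat.le_refl _)). rewrite Rabs_pos_eq in HN by (apply pow_le; lra).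
  apply (main N); auto. apply Rge_le in HN. apply Rmult_le_compat_l with (r := Im tau) in HN; [|lra].
  replace (Im tau * (3 / 4 / Im tau))%R with (3 / 4)%R in HN by (field; lra). exact HN.
Qed.

Lemma exp_INR_mult (n : nat) (x : R) : exp (INR n * x) = (exp x ^ n)%R.
Proof.
  induction n. { simpl. rewrite Rmult_0_l, exp_0. reflexivity. }
  rewrite S_INR, Rmult_plus_distr_r, exp_plus, Rmult_1_l, IHn. simpl. ring.
Qed.

Section small_weight.
Variables (f : C -> C) (k : nat).
Hypothesis Hk : (k <= 3)%nat.
Hypothesis Hf : holomorphic_on UHP f.
Hypothesis HT : forall tau, UHP tau -> f (tau + 1) = f tau.
Hypothesis HS : forall tau, UHP tau -> f (- / tau) = tau ^ (2 * k) * f tau.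
Hypothesis H0 : tends_cusp f 0.

(* Invariant under the modular group; this is where the weight 2 k enters. *)
Let m (tau : C) : R := (Im tau ^ k * Cmod (f tau))%R.

Lemma invariant_size_inv tau : UHP tau -> m (- / tau) = m tau.
Proof.
  intros Ht. unfold m. pose proof (UHP_nonzero tau Ht) as N. pose proof N as N'. apply Cmod_gt_0 in N'.
  rewrite HS, im_inv_opp, Cmod_mult, Cmod_pow, pow_mult by auto.
  unfold Rdiv. rewrite Rpow_mult_distr, pow_inv. field. apply pow_nonzero. apply pow_nonzero. lra.
Qed.

Lemma invariant_size_shift tau : UHP tau -> m (tau + 1) = m tau.
Proof. intros Ht. unfold m. rewrite HT, im_plus, im_RtoC by auto. f_equal. f_equal. ring. Qed.

Lemma invariant_size_reduction (B : R) : (forall tau, 3 / 4 <= Im tau -> m tau <= B) ->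
  forall tau, UHP tau -> m tau <= B.
Proof.
  intros HB. apply modular_reduction; auto.
  - intros tau Ht. rewrite invariant_size_shift; auto.
  - intros tau Ht. rewrite <- (invariant_size_shift (tau - 1)).
    + replace (tau - 1 + 1) with tau by ring. auto.
    + unfold upper_half_plane in *. rewrite im_minus, im_RtoC. lra.
  - intros tau Ht. rewrite invariant_size_inv; auto.
Qed.

(** From y^k <= e^(k y) and k <= 3 < 2 pi. *)
Lemma pow_exp_bounded : forall y : R, 0 <= y -> y ^ k * exp (- (2 * PI * y)) <= 1.
Proof.
  intros y Hy. assert (E : y <= exp y) by (pose proof (exp_ineq1_le y); lra).
  assert (E3 : y ^ k <= exp (INR k * y)).
  { replace (exp (INR k * y)) with (exp y ^ k)%R.
    - apply pow_incr. lra.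
    - symmetry. apply exp_INR_mult. }
  assert (K3 : INR k <= 3) by (apply le_INR in Hk; simpl in Hk; lra).
  pose proof PI2_3_2. unfold PI2 in H.
  apply Rle_trans with (exp (INR k * y) * exp (- (2 * PI * y)))%R.
  - apply Rmult_le_compat_r; auto. left; apply exp_pos.
  - rewrite <- exp_plus, <- exp_0.
    destruct (Rle_lt_or_eq_dec (INR k * y + - (2 * PI * y)) 0) as [L|L]; [nra|left; apply exp_increasing; auto|].
    rewrite L. lra.
Qed.

(* The supremum S of [m] is nearly attained at a point of height y >= 3/4.  The maximum
   principle for f / q on the half-plane above 9 y / 10 then gives m <= (10/9)^k exp(-2 pi y/10) S < S. *)
Theorem small_weight_vanishing : forall tau, UHP tau -> f tau = 0.
Proof.
  destruct (periodic_vanishing_q_expansion f Hf HT H0) as (u & Hu & Eu).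
  destruct (periodic_vanishing_decay f (1 / 2) ltac:(lra) Hf HT H0) as (K & HK & HKb).
  assert (mpos : forall tau, UHP tau -> 0 <= m tau).
  { intros tau Ht. unfold upper_half_plane in Ht. apply Rmult_le_pos. apply pow_le; lra. apply Cmod_ge_0. }
  assert (Hbd : forall tau, UHP tau -> m tau <= K).
  { apply invariant_size_reduction. intros tau Ht. unfold m.
    apply Rle_trans with (Im tau ^ k * (K * exp (- (2 * PI * Im tau))))%R.
    - apply Rmult_le_compat_l. apply pow_le; lra. apply HKb; lra.
    - pose proof (pow_exp_bounded (Im tau) ltac:(lra)) as P.
      replace (Im tau ^ k * (K * exp (- (2 * PI * Im tau))))%R
        with (K * (Im tau ^ k * exp (- (2 * PI * Im tau))))%R by ring.
      rewrite <- (Rmult_1_r K) at 2. apply Rmult_le_compat_l; auto. }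
  destruct (completeness (fun v => exists tau, UHP tau /\ v = m tau)) as [S [HS1 HS2]].
  { exists K. intros v (tau & Ht & ->). auto. }
  { exists (m Ci). exists Ci. split; auto. unfold upper_half_plane. simpl. lra. }
  assert (HmS : forall tau, UHP tau -> m tau <= S) by (intros tau Ht; apply HS1; exists tau; auto).
  assert (HSpos : 0 <= S).
  { assert (UHP Ci) by (unfold upper_half_plane; simpl; lra). eapply Rle_trans; [apply (mpos Ci)|]; auto. }
  assert (HS0 : S = 0%R).
  { apply NNPP. intros N. assert (HSp : 0 < S) by lra.
    (* Were [m] at most 9/10 S at all heights from 3/4 on, its invariance would spread this bound to
       the whole half-plane. *)
    assert (exists tau, 3 / 4 <= Im tau /\ 9 / 10 * S < m tau) as (t0 & Hy0 & Ht0).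
    { apply NNPP. intros Q. assert (S <= 9 / 10 * S); [|lra]. apply HS2. intros v (tau & Ht & ->).
      apply invariant_size_reduction; auto. intros t Hy. apply Rnot_lt_le. intros L. apply Q. exists t; auto. }
    set (y0 := Im t0) in *. set (y1 := (9 / 10 * y0)%R).
    pose proof PI2_3_2 as HPI. unfold PI2 in HPI.
    assert (U0 : UHP t0) by (unfold upper_half_plane; fold y0; lra).
    assert (Hr : Cmod (qexp t0) < exp (- (2 * PI * y1)) < 1).
    { rewrite Cmod_qexp. fold y0. split; [apply exp_increasing; unfold y1; nra|].
      rewrite <- exp_0. apply exp_increasing. unfold y1; nra. }
    assert (MM : Cmod (u (0 + qexp t0)) <= S / y1 ^ k * exp (2 * PI * y1)).
    { apply (maximum_modulus u 0 (qexp t0) 1 (exp (- (2 * PI * y1)))); auto.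
      intros t _. set (q := 0 + exp (- (2 * PI * y1)) * cis t).
      assert (Hq : Cmod q = exp (- (2 * PI * y1))).
      { unfold q. rewrite Cplus_0_l, Cmod_circle; auto. left; apply exp_pos. }
      destruct (qexp_surjective q) as [t1 E1].
      { apply Cmod_gt_0. rewrite Hq. apply exp_pos. }
      assert (I1 : Im t1 = y1).
      { rewrite <- E1, Cmod_qexp in Hq. apply exp_inv in Hq. nra. }
      assert (U1 : UHP t1) by (unfold upper_half_plane; rewrite I1; unfold y1; lra).
      assert (Hy1 : 0 < y1 ^ k) by (apply pow_lt; unfold y1; lra).
      pose proof (HmS t1 U1) as B. unfold m in B. rewrite Eu, E1, I1, Cmod_mult, Hq in B by auto.
      apply Rmult_le_reg_l with (y1 ^ k * exp (- (2 * PI * y1)))%R.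
      { apply Rmult_lt_0_compat; auto. apply exp_pos. }
      replace (y1 ^ k * exp (- (2 * PI * y1)) * (S / y1 ^ k * exp (2 * PI * y1)))%R
        with (S * (exp (- (2 * PI * y1)) * exp (2 * PI * y1)))%R by (field; lra).
      rewrite <- exp_plus. replace (- (2 * PI * y1) + 2 * PI * y1)%R with 0%R by ring. rewrite exp_0. lra. }
    rewrite Cplus_0_l in MM. unfold m in Ht0. rewrite Eu, Cmod_mult, Cmod_qexp in Ht0 by auto. fold y0 in Ht0.
    assert (Hy1 : 0 < y1 ^ k) by (apply pow_lt; unfold y1; lra).
    assert (P : y0 ^ k * (exp (- (2 * PI * y0)) * Cmod (u (qexp t0)))
       <= y0 ^ k * (exp (- (2 * PI * y0)) * (S / y1 ^ k * exp (2 * PI * y1)))).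
    { apply Rmult_le_compat_l. apply pow_le; lra. apply Rmult_le_compat_l; auto. left; apply exp_pos. }
    replace (y0 ^ k * (exp (- (2 * PI * y0)) * (S / y1 ^ k * exp (2 * PI * y1))))%R
      with ((10 / 9) ^ k * (S * exp (- (2 * PI * (y0 / 10)))))%R in P.
    2:{ replace (exp (- (2 * PI * (y0 / 10)))) with (exp (- (2 * PI * y0)) * exp (2 * PI * y1))%R.
        - unfold y1. rewrite Rpow_mult_distr. replace ((10 / 9) ^ k)%R with (/ (9 / 10) ^ k)%R.
          field. split. apply pow_nonzero; lra. apply pow_nonzero; lra.
          rewrite <- pow_inv. f_equal. field.
        - rewrite <- exp_plus. f_equal. unfold y1. field. }
    (* Numerically (10/9)^3/1.55 < 0.89 < 9/10. Here 1.55 < 1.05^9 <= e^(0.45), and 2 pi y0/10 >=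
       0.45 because pi > 3 and y0 >= 3/4. *)
    assert (E1 : (10 / 9) ^ k <= (10 / 9) ^ 3) by (apply Rle_pow; auto; lra).
    assert (E2 : exp (- (2 * PI * (y0 / 10))) <= / (155 / 100)).
    { rewrite exp_Ropp. apply Rinv_le_contravar; [lra|].
      apply Rle_trans with (exp (45 / 100)).
      - replace (45 / 100)%R with (INR 9 * (5 / 100))%R by (simpl; field). rewrite exp_INR_mult.
        apply Rle_trans with ((105 / 100) ^ 9)%R; [lra|]. apply pow_incr.
        pose proof (exp_ineq1_le (5 / 100)). lra.
      - left. apply exp_increasing. nra. }
    pose proof (exp_pos (- (2 * PI * (y0 / 10)))).
    assert (E3 : (10 / 9) ^ k * (S * exp (- (2 * PI * (y0 / 10)))) <= (10 / 9) ^ 3 * (S * / (155 / 100))).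
    { apply Rmult_le_compat; auto. apply pow_le; lra. apply Rmult_le_pos; lra. apply Rmult_le_compat_l; lra. }
    simpl in E3. lra. }
  intros tau Ht. pose proof (HmS tau Ht) as B. rewrite HS0 in B. unfold m in B.
  apply Cmod_eq_0. pose proof (Cmod_ge_0 (f tau)). unfold upper_half_plane in Ht.
  assert (0 < Im tau ^ k) by (apply pow_lt; auto). nra.
Qed.
End small_weight.

(** * Theta constants *)

Lemma is_sum_finite_support {T : Type} (A : T -> Prop) (f : T -> C) (s0 : list T) : fin_in A s0 ->
  (forall i, A i -> ~ In i s0 -> f i = 0) -> is_sum_over A f (lsum f s0).
Proof.
  intros Hs0 Hz. apply is_sum_over_iff. intros eps He. exists s0. split; auto. intros s Hs Hi.
  destruct (fin_in_split A s0 s Hs0 Hs Hi) as (r & Hp & Hr & Hd).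
  rewrite (lsum_perm f _ _ Hp), lsum_app. replace (lsum f r) with (RtoC 0).
  - replace (lsum f s0 + 0 - lsum f s0) with (RtoC 0) by ring. rewrite Cmod_0. exact He.
  - destruct Hr as [_ Hr]. rewrite Forall_forall in Hr. symmetry.
    rewrite (lsum_ext f (fun _ => 0)). clear; unfold lsum; induction r; simpl; auto; rewrite IHr; ring.
    intros i Hir. apply Hz; auto.
Qed.

Definition theta_term (p q n : Z) (tau : C) : C :=
  Cexp (PI * Ci * (IZR n + IZR p / 2) ^ 2 * tau + 2 * PI * Ci * (IZR n + IZR p / 2) * (IZR q / 2)).

Lemma theta_index_real (p n : Z) : IZR n + IZR p / 2 = RtoC (IZR n + IZR p / 2).
Proof. rewrite RtoC_plus, RtoC_div by lra. reflexivity. Qed.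

Lemma Cmod_theta_term (p q n : Z) (tau : C) :
  Cmod (theta_term p q n tau) = exp (- (PI * (IZR n + IZR p / 2) ^ 2 * Im tau)).
Proof.
  unfold theta_term. rewrite Cmod_Cexp. f_equal. rewrite theta_index_real, <- RtoC_pow.
  replace (RtoC (IZR q) / 2) with (RtoC (IZR q / 2)) by (rewrite RtoC_div by lra; reflexivity).
  rewrite re_plus. rewrite !re_mult, !im_mult. simpl. unfold Re, Im; simpl. ring.
Qed.

(** A majorant uniform on Im tau >= eta. It comes from exp(-x) <= 1/(1 + x) and, with a = p/2, from
    n^2 <= 2 a^2 + 2 (n + a)^2, which trades the shift by a for a constant. *)
Definition theta_bound (p : Z) (eta : R) (n : Z) : R :=
  ((1 + IZR p ^ 2 / 2 + 2 / (PI * eta)) * / (1 + IZR n ^ 2))%R.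

Lemma theta_bound_summable (p : Z) (eta : R) : 0 < eta -> summable (fun _ => True) (theta_bound p eta).
Proof.
  intros He. apply summable_scal; [|apply summable_Z_inv_square].
  pose proof (pow2_ge_0 (IZR p)). assert (0 < 2 / (PI * eta)); [|lra].
  apply Rdiv_lt_0_compat; [lra|]. apply Rmult_lt_0_compat; auto. apply PI_RGT_0.
Qed.

Lemma theta_term_bound (p q n : Z) (eta : R) (tau : C) : 0 < eta -> eta <= Im tau ->
  Cmod (theta_term p q n tau) <= theta_bound p eta n.
Proof.
  intros He Ht. rewrite Cmod_theta_term. unfold theta_bound. pose proof PI_RGT_0 as HPI.
  set (x := IZR n). set (a := (IZR p / 2)%R). replace (IZR p ^ 2 / 2)%R with (2 * a ^ 2)%R by (unfold a; field).
  pose proof (pow2_ge_0 (x + a)) as P1. pose proof (pow2_ge_0 x) as P2. pose proof (pow2_ge_0 a) as P3.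
  assert (HPe : 0 < PI * eta) by (apply Rmult_lt_0_compat; auto).
  assert (P4 : 0 < 2 / (PI * eta)) by (apply Rdiv_lt_0_compat; lra).
  apply Rle_trans with (/ (1 + PI * eta * (x + a) ^ 2))%R.
  - rewrite exp_Ropp. apply Rinv_le_contravar. { assert (0 <= PI * eta * (x + a) ^ 2) by (apply Rmult_le_pos; lra). lra. }
    eapply Rle_trans; [|apply exp_ineq1_le]. apply Rplus_le_compat_l.
    replace (PI * (x + a) ^ 2 * Im tau)%R with ((PI * Im tau) * (x + a) ^ 2)%R by ring.
    apply Rmult_le_compat_r; auto. apply Rmult_le_compat_l; lra.
  - assert (Q : 0 <= PI * eta * (x + a) ^ 2) by (apply Rmult_le_pos; lra).
    apply Rmult_le_reg_r with ((1 + PI * eta * (x + a) ^ 2) * (1 + x ^ 2))%R.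
    { apply Rmult_lt_0_compat; lra. }
    replace (/ (1 + PI * eta * (x + a) ^ 2) * ((1 + PI * eta * (x + a) ^ 2) * (1 + x ^ 2)))%R
      with (1 + x ^ 2)%R by (field; lra).
    replace ((1 + 2 * a ^ 2 + 2 / (PI * eta)) * / (1 + x ^ 2) * ((1 + PI * eta * (x + a) ^ 2) * (1 + x ^ 2)))%R
      with (1 + 2 * a ^ 2 + 2 / (PI * eta) + (1 + 2 * a ^ 2) * (PI * eta * (x + a) ^ 2) + 2 * (x + a) ^ 2)%R by (field; lra).
    assert (0 <= (1 + 2 * a ^ 2) * (PI * eta * (x + a) ^ 2)) by (apply Rmult_le_pos; lra).
    assert (x ^ 2 <= 2 * a ^ 2 + 2 * (x + a) ^ 2).
    { pose proof (pow2_ge_0 (x + 2 * a)). nra. }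
    lra.
Qed.

Lemma theta_is_sum (p q : Z) (tau : C) : UHP tau ->
  is_sum_over (fun _ => True) (fun n => theta_term p q n tau) (theta p q tau).
Proof.
  intros Ht. apply (dominated_is_sum _ _ (theta_bound p (Im tau))).
  - apply theta_bound_summable. exact Ht.
  - intros n _. apply theta_term_bound; [exact Ht|lra].
Qed.

Lemma theta_eq (p q : Z) (tau l : C) :
  is_sum_over (fun _ => True) (fun n => theta_term p q n tau) l -> theta p q tau = l.
Proof. apply sum_over_eq. Qed.

Lemma cder_theta_term (p q n : Z) (tau : C) : ex_Cderive (theta_term p q n) tau.
Proof.
  eapply cder_ex. unfold theta_term.
  apply (cder_comp Cexp (fun tau => PI * Ci * (IZR n + IZR p / 2) ^ 2 * tau + 2 * PI * Ci * (IZR n + IZR p / 2) * (IZR q / 2))).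
  - apply cder_plus. apply cder_scal. apply cder_id. apply cder_const.
  - apply cder_Cexp.
Qed.

Lemma theta_holomorphic (p q : Z) : holomorphic_on UHP (theta p q).
Proof.
  intros c Hc. unfold upper_half_plane in Hc.
  destruct (sum_over_cder (fun _ => True) (theta_term p q) (theta_bound p (Im c / 2)) c (Im c / 2)) as (_ & _ & D).
  - lra.
  - apply theta_bound_summable. lra.
  - intros n _ z _. apply cder_theta_term.
  - intros n _ z Hz. apply disc_re_im in Hz. apply theta_term_bound; lra.
  - eapply cder_ex. exact D.
Qed.

Lemma Cexp_shift_even (z w : C) (n : Z) : z = w + 2 * PI * Ci * IZR n -> Cexp z = Cexp w.
Proof. intros E. rewrite E, Cexp_plus, Cexp_2PI_Z. ring. Qed.

(** As n^2 + n is even, exp(pi i n^2) = (-1)^n. Hence translation by 1 exchanges [theta] 0 0 and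
    [theta] 0 1; for p = 1 only the factor exp(pi i/4) remains. *)
Lemma Z_consecutive_even (n : Z) : exists m, (n * n + n = 2 * m)%Z.
Proof.
  destruct (Z.Even_or_Odd n) as [[m Hm]|[m Hm]]; subst n.
  - exists (2 * m * m + m)%Z. ring.
  - exists ((2 * m + 1) * (m + 1))%Z. ring.
Qed.

Lemma IZR_sq_plus (n m : Z) : (n * n + n = 2 * m)%Z -> RtoC (IZR n) ^ 2 + IZR n = 2 * IZR m.
Proof.
  intros E. apply (f_equal IZR) in E. rewrite plus_IZR, !mult_IZR in E. apply (f_equal RtoC) in E.
  rewrite RtoC_plus, !RtoC_mult in E. simpl. rewrite Cmult_1_r. exact E.
Qed.

Lemma theta00_shift tau : UHP tau -> theta 0 0 (tau + 1) = theta 0 1 tau.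
Proof.
  intros Ht. apply theta_eq. eapply is_sum_ext; [|apply theta_is_sum; exact Ht].
  intros n _. unfold theta_term. destruct (Z_consecutive_even n) as [m Hm]. apply IZR_sq_plus in Hm.
  apply (Cexp_shift_even _ _ (n - m)). rewrite minus_IZR, RtoC_minus.
  replace (RtoC (IZR m)) with ((RtoC (IZR n) ^ 2 + IZR n) / 2) by (rewrite Hm; field). simpl. field.
Qed.

Lemma theta01_shift tau : UHP tau -> theta 0 1 (tau + 1) = theta 0 0 tau.
Proof.
  intros Ht. apply theta_eq. eapply is_sum_ext; [|apply theta_is_sum; exact Ht].
  intros n _. unfold theta_term. destruct (Z_consecutive_even n) as [m Hm]. apply IZR_sq_plus in Hm.
  apply (Cexp_shift_even _ _ (- m)). rewrite opp_IZR, RtoC_opp.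
  replace (RtoC (IZR m)) with ((RtoC (IZR n) ^ 2 + IZR n) / 2) by (rewrite Hm; field). simpl. field.
Qed.

Lemma theta10_shift tau : UHP tau -> theta 1 0 (tau + 1) = Cexp (PI * Ci / 4) * theta 1 0 tau.
Proof.
  intros Ht. apply theta_eq. eapply is_sum_ext; [|apply is_sum_scal; apply theta_is_sum; exact Ht].
  intros n _. simpl. unfold theta_term. destruct (Z_consecutive_even n) as [m Hm]. apply IZR_sq_plus in Hm.
  rewrite <- Cexp_plus. apply (Cexp_shift_even _ _ (- m)). rewrite opp_IZR, RtoC_opp.
  replace (RtoC (IZR m)) with ((RtoC (IZR n) ^ 2 + IZR n) / 2) by (rewrite Hm; field). simpl. field.
Qed.

(** The exponents of the two sides differ by 2 pi i (n + p/2) q, an integer multiple of 2 pi i when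
    p = 0 or q = 0; for p = q = 1 a sign would appear. *)
Lemma theta_conj (p q : Z) (tau : C) : p = 0%Z \/ q = 0%Z -> UHP tau ->
  theta p q (- Cconj tau) = Cconj (theta p q tau).
Proof.
  intros Hpq Ht. apply theta_eq. eapply is_sum_ext; [|apply is_sum_conj; apply theta_is_sum; exact Ht].
  intros n _. simpl. unfold theta_term. rewrite Cexp_conj.
  apply (Cexp_shift_even _ _ (- (n * q))). rewrite theta_index_real.
  rewrite opp_IZR, mult_IZR, RtoC_opp, RtoC_mult.
  assert (E : IZR n * IZR q = RtoC (IZR n + IZR p / 2) * IZR q).
  { rewrite RtoC_plus. destruct Hpq as [-> | ->].
    - replace (0 / 2)%R with 0%R by field. ring.
    - ring. }
  rewrite E.
  replace (IZR q / 2) with (RtoC (IZR q / 2)) by (rewrite RtoC_div by lra; reflexivity).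
  set (a := (IZR n + IZR p / 2)%R). set (b := (IZR q / 2)%R).
  replace (RtoC (IZR q)) with (2 * RtoC b) by (unfold b; rewrite RtoC_div by lra; field).
  rewrite <- RtoC_pow. destruct tau as [x y]. apply injective_projections; simpl; ring.
Qed.

Lemma Cmod_theta_term_small (p q n : Z) : IZR n + IZR p / 2 <> 0 ->
  tends_cusp (theta_term p q n) 0.
Proof.
  intros Hn. rewrite theta_index_real in Hn.
  assert (Hn' : (IZR n + IZR p / 2 <> 0)%R) by (intros E; apply Hn; rewrite E; reflexivity).
  apply tends_cusp_iff. intros eps He.
  set (a := ((IZR n + IZR p / 2) ^ 2)%R) in *. assert (Ha : 0 < a) by (unfold a; apply pow2_gt_0; auto).
  exists (/ (PI * a * eps))%R. intros tau Ht.
  replace (theta_term p q n tau - 0) with (theta_term p q n tau) by ring.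
  rewrite Cmod_theta_term. fold a. pose proof PI_RGT_0 as HPI.
  assert (HPa : 0 < PI * a) by (apply Rmult_lt_0_compat; auto).
  assert (Hpos : 0 < / (PI * a * eps)) by (apply Rinv_0_lt_compat; apply Rmult_lt_0_compat; auto).
  rewrite exp_Ropp. rewrite <- (Rinv_inv eps). apply Rinv_lt_contravar.
  { apply Rmult_lt_0_compat. apply Rinv_0_lt_compat; auto. apply exp_pos. }
  apply Rlt_le_trans with (1 + PI * a * Im tau)%R; [|apply exp_ineq1_le].
  apply Rmult_lt_compat_l with (r := (PI * a)%R) in Ht; auto.
  replace (PI * a * / (PI * a * eps))%R with (/ eps)%R in Ht by (field; lra). lra.
Qed.

Lemma theta_cusp (p q : Z) (l : C) (g : Z -> C) (s0 : list Z) :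
  (forall n, tends_cusp (theta_term p q n) (g n)) -> NoDup s0 ->
  (forall n, ~ In n s0 -> g n = 0) -> lsum g s0 = l -> (forall n, Cmod (g n) <= theta_bound p 1 n) ->
  tends_cusp (theta p q) l.
Proof.
  intros Hg Hs Hz Hl Hb.
  assert (E : sum_over (fun _ => True) g = l).
  { apply sum_over_eq. rewrite <- Hl. apply is_sum_finite_support.
    split; auto. apply Forall_forall; auto. intros i _. apply Hz. }
  rewrite <- E. apply (dominated_convergence cusp (fun _ => True) (fun tau n => theta_term p q n tau) g (theta_bound p 1)).
  - apply theta_bound_summable. lra.
  - intros n _. apply Hg.
  - exists 1%R. intros tau Ht n _. apply theta_term_bound; lra.
  - intros n _. apply Hb.
Qed.

Lemma theta_bound_0 (p : Z) : 1 <= theta_bound p 1 0.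
Proof.
  unfold theta_bound. simpl. pose proof PI_RGT_0. pose proof (pow2_ge_0 (IZR p)).
  assert (0 < 2 / (PI * 1)) by (apply Rdiv_lt_0_compat; lra). simpl in H0.
  replace (/ (1 + 0 * (0 * 1)))%R with 1%R by field. lra.
Qed.

Lemma theta_bound_nonneg (p n : Z) : 0 <= theta_bound p 1 n.
Proof. apply (proj1 (theta_bound_summable p 1 ltac:(lra))). auto. Qed.

Lemma theta0_cusp (q : Z) : tends_cusp (theta 0 q) 1.
Proof.
  apply (theta_cusp 0 q 1 (fun n => if Z.eq_dec n 0 then 1 else 0) [0%Z]).
  - intros n. destruct (Z.eq_dec n 0) as [->|N].
    + apply (tends_cusp_ext (fun _ => 1)); [|apply tends_cusp_const]. intros tau _. unfold theta_term.
      rewrite <- Cexp_0. f_equal. simpl. field.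
    + apply Cmod_theta_term_small. replace (IZR n + 0 / 2) with (RtoC (IZR n)) by field.
      intros E. apply RtoC_inj in E. apply eq_IZR in E. contradiction.
  - repeat constructor. simpl; tauto.
  - intros n Hn. destruct (Z.eq_dec n 0); auto. subst. exfalso. apply Hn. left; auto.
  - unfold lsum. simpl. ring.
  - intros n. destruct (Z.eq_dec n 0) as [->|N]; [rewrite Cmod_1; apply theta_bound_0|rewrite Cmod_0; apply theta_bound_nonneg].
Qed.

(** [theta] 1 0 divided by q^(1/8), so that its limit at the cusp is not 0. *)
Definition theta10_reduced (tau : C) : C := Cexp (- (PI * Ci / 4) * tau) * theta 1 0 tau.

Definition theta10_reduced_term (n : Z) (tau : C) : C := Cexp (PI * Ci * (IZR n ^ 2 + IZR n) * tau).

Lemma theta10_reduced_is_sum tau : UHP tau ->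
  is_sum_over (fun _ => True) (fun n => theta10_reduced_term n tau) (theta10_reduced tau).
Proof.
  intros Ht. eapply is_sum_ext; [|apply is_sum_scal; apply theta_is_sum; exact Ht].
  intros n _. simpl. unfold theta_term, theta10_reduced_term. rewrite <- Cexp_plus. f_equal. simpl. field.
Qed.

Lemma theta10_factor tau : theta 1 0 tau = Cexp (PI * Ci / 4 * tau) * theta10_reduced tau.
Proof.
  unfold theta10_reduced. rewrite Cmult_assoc, <- Cexp_plus.
  replace (PI * Ci / 4 * tau + - (PI * Ci / 4) * tau) with (RtoC 0) by ring. rewrite Cexp_0. ring.
Qed.

Lemma Cmod_theta10_reduced_term (n : Z) (tau : C) :
  Cmod (theta10_reduced_term n tau) = exp (- (PI * (IZR n ^ 2 + IZR n) * Im tau)).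
Proof.
  unfold theta10_reduced_term. rewrite Cmod_Cexp. f_equal. rewrite <- RtoC_pow, <- RtoC_plus.
  rewrite !re_mult, !im_mult. simpl. unfold Re, Im; simpl. ring.
Qed.

(** From pi y >= 9/4 and e^(9/4) >= (1 + 3/4)^3 > 5. *)
Lemma exp_quadratic_decay (m : nat) (e y : R) : INR m <= e -> 3 / 4 <= y ->
  exp (- (PI * e * y)) <= (1 / 5) ^ m.
Proof.
  intros He Hy. pose proof PI2_3_2 as HPI. unfold PI2 in HPI. pose proof (pos_INR m).
  replace (1 / 5)%R with (/ 5)%R by field. rewrite pow_inv, exp_Ropp.
  apply Rinv_le_contravar. { apply pow_lt; lra. }
  apply Rle_trans with (exp (INR m * (9 / 4))).
  - rewrite exp_INR_mult. apply pow_incr. split; [lra|].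
    replace (9 / 4)%R with (INR 3 * (3 / 4))%R by (simpl; field). rewrite exp_INR_mult.
    apply Rle_trans with ((1 + 3 / 4) ^ 3)%R; [lra|]. apply pow_incr. pose proof (exp_ineq1_le (3 / 4)). lra.
  - destruct (Rle_lt_or_eq_dec (INR m * (9 / 4)) (PI * e * y)) as [L|L]; [|left; apply exp_increasing; auto|rewrite L; lra].
    apply Rle_trans with (e * (3 * (3 / 4)))%R. { lra. }
    replace (PI * e * y)%R with (e * (PI * y))%R by ring. apply Rmult_le_compat_l; [lra|].
    apply Rmult_le_compat; lra.
Qed.

Lemma sum_bounded_Z_nonzero : sum_bounded (fun n : Z => n <> 0%Z) (fun n => (1 / 5) ^ Z.abs_nat n)%R (1 / 2).
Proof.
  assert (G : sum_bounded (fun _ : nat => True) (fun n => (1 / 5) ^ S n)%R (1 / 4)).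
  { intros s Hs. change (fun n => (1 / 5) ^ S n)%R with (fun n => 1 / 5 * (1 / 5) ^ n)%R.
    rewrite rsum_scal. pose proof (sum_bounded_geometric (1 / 5) ltac:(lra) s Hs).
    replace (/ (1 - 1 / 5))%R with (5 / 4)%R in H by field. change (fun n : nat => ((1 / 5) ^ n)%R) with (pow (1 / 5)) in H. lra. }
  assert (P : forall n : Z, 0 <= (1 / 5) ^ Z.abs_nat n) by (intros; apply pow_le; lra).
  replace (1 / 2)%R with (1 / 4 + 1 / 4)%R by field.
  apply (sum_bounded_ext (fun n => (0 < n)%Z \/ (n < 0)%Z) _ (fun n => (1 / 5) ^ Z.abs_nat n)%R); [intros; lia|intros; lra|].
  apply sum_bounded_union; auto.
  - apply (sum_bounded_bijection _ _ _ _ _ bijection_pos).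
    apply (sum_bounded_ext (fun _ => True) _ (fun n => (1 / 5) ^ S n)%R); auto.
    intros n _. replace (Z.abs_nat (Z.of_nat (S n))) with (S n) by lia. lra.
  - apply (sum_bounded_bijection _ _ _ _ _ bijection_neg).
    apply (sum_bounded_ext (fun _ => True) _ (fun n => (1 / 5) ^ S n)%R); auto.
    intros n _. replace (Z.abs_nat (- Z.of_nat (S n))) with (S n) by lia. lra.
Qed.

Lemma IZR_sq_abs (n : Z) : n <> 0%Z -> INR (Z.abs_nat n) <= IZR n ^ 2.
Proof.
  intros Hn. rewrite INR_IZR_INZ, Zabs2Nat.id_abs. replace (IZR n ^ 2)%R with (IZR (n * n)) by (rewrite mult_IZR; ring).
  apply IZR_le. nia.
Qed.

Lemma IZR_sq_plus_abs (n : Z) : n <> 0%Z -> n <> (-1)%Z -> INR (Z.abs_nat n) <= IZR n ^ 2 + IZR n.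
Proof.
  intros Hn Hn'. rewrite INR_IZR_INZ, Zabs2Nat.id_abs.
  replace (IZR n ^ 2 + IZR n)%R with (IZR (n * n + n)) by (rewrite plus_IZR, mult_IZR; ring).
  apply IZR_le. nia.
Qed.

(** At these heights the term n = 0 is 1 and all the others together are at most 1/2. The height 3/4
    is the one reached by [modular_reduction]. *)
Lemma theta0_nonzero (q : Z) (tau : C) : 3 / 4 <= Im tau -> theta 0 q tau <> 0.
Proof.
  intros Ht E. assert (U : UHP tau) by (unfold upper_half_plane; lra).
  set (f := fun n => theta_term 0 q n tau).
  assert (B : forall n : Z, n <> 0%Z -> Cmod (f n) <= (1 / 5) ^ Z.abs_nat n).
  { intros n Hn. unfold f. rewrite Cmod_theta_term.
    replace (IZR n + 0 / 2)%R with (IZR n) by field. apply exp_quadratic_decay; auto. apply IZR_sq_abs; auto. }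
  assert (P : forall n : Z, 0 <= (1 / 5) ^ Z.abs_nat n) by (intros; apply pow_le; lra).
  pose proof (sum_bounded_is_sum _ f _ _ (fun n _ => P n) sum_bounded_Z_nonzero B) as Hb.
  pose proof (dominated_is_sum _ f _ (sum_bounded_summable _ _ _ (fun n _ => P n) sum_bounded_Z_nonzero) B) as HS.
  pose proof (is_sum_union _ _ f _ _ (fun i (Hi : i = 0%Z) (Hn : i <> 0%Z) => Hn Hi) (is_sum_singleton f 0%Z) HS) as HU.
  pose proof (theta_is_sum 0 q tau U) as HT. fold f in HT.
  assert (HU' : is_sum_over (fun _ => True) f (f 0%Z + sum_over (fun n : Z => n <> 0%Z) f)).
  { apply (is_sum_bijection (fun _ => True) (fun i => i = 0%Z \/ i <> 0%Z) (fun i => i)); auto.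
    repeat split; auto. intros i _. destruct (Z.eq_dec i 0); auto. intros k _. exists k; auto. }
  pose proof (is_sum_over_unique _ _ _ _ HT HU') as EE. rewrite E in EE.
  assert (F0 : f 0%Z = 1). { unfold f, theta_term. rewrite <- Cexp_0. f_equal. simpl. field. }
  rewrite F0 in EE. assert (EE' : sum_over (fun n : Z => n <> 0%Z) f = - (1)).
  { replace (sum_over (fun n : Z => n <> 0%Z) f) with ((1 + sum_over (fun n : Z => n <> 0%Z) f) - 1) by ring.
    rewrite <- EE. ring. }
  rewrite EE', Cmod_m1 in Hb. lra.
Qed.

(** After division by q^(1/8) the terms n = 0 and n = -1 are both 1, and the others add up to at
    most 1/2. *)
Lemma theta10_nonzero (tau : C) : 3 / 4 <= Im tau -> theta 1 0 tau <> 0.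
Proof.
  intros Ht E. assert (U : UHP tau) by (unfold upper_half_plane; lra).
  assert (E' : theta10_reduced tau = 0) by (unfold theta10_reduced; rewrite E; ring). clear E.
  set (f := fun n => theta10_reduced_term n tau).
  set (A := fun n : Z => n <> 0%Z /\ n <> (-1)%Z).
  assert (B : forall n : Z, A n -> Cmod (f n) <= (1 / 5) ^ Z.abs_nat n).
  { intros n [Hn Hn']. unfold f. rewrite Cmod_theta10_reduced_term. apply exp_quadratic_decay; auto.
    apply IZR_sq_plus_abs; auto. }
  assert (P : forall n : Z, 0 <= (1 / 5) ^ Z.abs_nat n) by (intros; apply pow_le; lra).
  assert (SB : sum_bounded A (fun n => (1 / 5) ^ Z.abs_nat n)%R (1 / 2)).
  { apply (sum_bounded_ext (fun n => n <> 0%Z) _ (fun n => (1 / 5) ^ Z.abs_nat n)%R).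
    intros i [Hi _]; auto. intros; lra. apply sum_bounded_Z_nonzero. }
  pose proof (sum_bounded_is_sum _ f _ _ (fun n _ => P n) SB B) as Hb.
  pose proof (dominated_is_sum _ f _ (sum_bounded_summable _ _ _ (fun n _ => P n) SB) B) as HS.
  assert (HU1 : is_sum_over (fun i => i = 0%Z \/ i = (-1)%Z) f (f 0%Z + f (-1)%Z)).
  { apply is_sum_union; try apply is_sum_singleton. intros; lia. }
  assert (HU2 : is_sum_over (fun i => (i = 0%Z \/ i = (-1)%Z) \/ A i) f ((f 0%Z + f (-1)%Z) + sum_over A f)).
  { apply is_sum_union; auto. unfold A. intros; lia. }
  pose proof (theta10_reduced_is_sum tau U) as HT. fold f in HT.
  assert (HU' : is_sum_over (fun _ => True) f ((f 0%Z + f (-1)%Z) + sum_over A f)).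
  { apply (is_sum_bijection (fun _ => True) (fun i => (i = 0%Z \/ i = (-1)%Z) \/ A i) (fun i => i)); auto.
    repeat split; auto. intros i _. unfold A. lia. intros k _. exists k; auto. }
  pose proof (is_sum_over_unique _ _ _ _ HT HU') as EE. rewrite E' in EE.
  assert (F0 : f 0%Z = 1). { unfold f, theta10_reduced_term. rewrite <- Cexp_0. f_equal. simpl. ring. }
  assert (F1 : f (-1)%Z = 1). { unfold f, theta10_reduced_term. rewrite <- Cexp_0. f_equal. simpl. ring. }
  rewrite F0, F1 in EE. assert (EE' : sum_over A f = - (2)).
  { replace (sum_over A f) with ((1 + 1 + sum_over A f) - 2) by ring. rewrite <- EE. ring. }
  rewrite EE', Cmod_opp, Cmod_R, Rabs_pos_eq in Hb; lra.
Qed.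

(** The factor 5 lets the majorant reach 1 at n = -1, where the reduced term of [theta] 1 0 is equal
    to 1. *)
Lemma summable_Z_geometric : summable (fun _ : Z => True) (fun n => 5 * (1 / 5) ^ Z.abs_nat n)%R.
Proof.
  assert (P : forall n : Z, 0 <= (1 / 5) ^ Z.abs_nat n) by (intros; apply pow_le; lra).
  pose proof (sum_bounded_geometric (1 / 5) ltac:(lra)) as G.
  apply summable_scal; [lra|].
  apply (sum_bounded_summable _ _ (/ (1 - 1 / 5) + / (1 - 1 / 5))); auto. apply sum_bounded_Z; auto.
  - apply (sum_bounded_ext (fun _ => True) _ (fun n => (1 / 5) ^ n)%R); auto.
    intros n _. rewrite Zabs2Nat.id. lra.
  - apply (sum_bounded_ext (fun _ => True) _ (fun n => (1 / 5) ^ n)%R); auto.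
    intros n _. replace (Z.abs_nat (- Z.of_nat (S n))) with (S n) by lia.
    pose proof (pow_le (1 / 5) n ltac:(lra)). simpl. lra.
Qed.

Lemma theta10_reduced_cusp : tends_cusp theta10_reduced 2.
Proof.
  set (g := fun n : Z => if Z.eq_dec n 0 then RtoC 1 else if Z.eq_dec n (-1) then RtoC 1 else RtoC 0).
  set (M := fun n : Z => (5 * (1 / 5) ^ Z.abs_nat n)%R).
  assert (P : forall n : Z, 0 <= (1 / 5) ^ Z.abs_nat n) by (intros; apply pow_le; lra).
  assert (E : sum_over (fun _ => True) g = 2).
  { apply sum_over_eq. replace (RtoC 2) with (lsum g [0%Z; (-1)%Z]).
    - apply is_sum_finite_support.
      + split. repeat constructor; simpl; lia. apply Forall_forall; auto.
      + intros i _ Hi. unfold g. destruct (Z.eq_dec i 0). { exfalso; apply Hi; left; auto. }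
        destruct (Z.eq_dec i (-1)); auto. exfalso; apply Hi; right; left; auto.
    - unfold lsum, g. simpl. ring. }
  assert (T0 : forall n tau, n = 0%Z \/ n = (-1)%Z -> theta10_reduced_term n tau = 1).
  { intros n tau [-> | ->]; unfold theta10_reduced_term; rewrite <- Cexp_0; f_equal; simpl; ring. }
  rewrite <- E. apply (tends_cusp_ext (fun tau => sum_over (fun _ => True) (fun n => theta10_reduced_term n tau))).
  { intros tau Ht. apply sum_over_eq. apply theta10_reduced_is_sum; auto. }
  apply (dominated_convergence cusp (fun _ => True) (fun tau n => theta10_reduced_term n tau) g M).
  - apply summable_Z_geometric.
  - intros n _. unfold g. destruct (Z.eq_dec n 0) as [E0|N0].
    { apply (tends_cusp_ext (fun _ => 1)); [|apply tends_cusp_const]. intros; symmetry; auto. }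
    destruct (Z.eq_dec n (-1)) as [E1|N1].
    { apply (tends_cusp_ext (fun _ => 1)); [|apply tends_cusp_const]. intros; symmetry; auto. }
    (* Through [theta_term] 1 0 n the modulus is compared with that of exp(pi i tau), the term n = 1
       of [theta] 0 0; this uses n^2 + n >= 1. *)
    apply (tends_cusp_ext (fun tau => Cexp (- (PI * Ci / 4) * tau) * theta_term 1 0 n tau)).
    { intros tau _. unfold theta_term, theta10_reduced_term. rewrite <- Cexp_plus. f_equal. simpl. field. }
    apply tends_cusp_iff. intros eps He.
    assert (Q : tends_cusp (theta_term 0 0 1) 0).
    { apply Cmod_theta_term_small. intros E1. apply (f_equal Re) in E1. simpl in E1. lra. }
    rewrite tends_cusp_iff in Q. destruct (Q eps He) as [Y HY]. exists (Rmax Y 0). intros tau Ht.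
    assert (Ht' : Y < Im tau /\ 0 < Im tau) by (revert Ht; minmax).
    specialize (HY tau (proj1 Ht')).
    match goal with |- Cmod (?x - RtoC 0) < _ => replace (x - RtoC 0) with x by ring end.
    replace (theta_term 0 0 1 tau - 0) with (theta_term 0 0 1 tau) in HY by ring.
    eapply Rle_lt_trans; [|exact HY]. rewrite Cmod_mult, !Cmod_theta_term, Cmod_Cexp, <- exp_plus.
    assert (E3 : Re (- (PI * Ci / 4) * tau) = (PI / 4 * Im tau)%R).
    { replace (- (PI * Ci / 4) * tau) with (RtoC (PI / 4) * (- Ci * tau)) by (rewrite RtoC_div by lra; field).
      rewrite re_scal_l. f_equal. rewrite re_mult. simpl. ring. }
    rewrite E3. pose proof (IZR_sq_plus_abs n N0 N1) as A.
    assert (A1 : 1 <= INR (Z.abs_nat n)). { change 1%R with (INR 1). apply le_INR. lia. }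
    pose proof PI_RGT_0 as HPI.
    match goal with |- exp ?x <= exp ?y => destruct (Rle_lt_or_eq_dec x y) as [L|L]; [|left; apply exp_increasing; auto|rewrite L; lra] end.
    assert (PI * Im tau * 1 <= PI * Im tau * (IZR n ^ 2 + IZR n)).
    { apply Rmult_le_compat_l; [|lra]. apply Rmult_le_pos; lra. }
    simpl in *. lra.
  - exists 1%R. intros tau Ht n _. unfold M.
    destruct (Z.eq_dec n 0) as [E0|N0]. { rewrite T0, Cmod_1 by auto. subst n. simpl. lra. }
    destruct (Z.eq_dec n (-1)) as [E1|N1]. { rewrite T0, Cmod_1 by auto. subst n. simpl. lra. }
    rewrite Cmod_theta10_reduced_term. eapply Rle_trans; [apply exp_quadratic_decay; [apply IZR_sq_plus_abs; auto|lra]|].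
    specialize (P n). lra.
  - intros n _. unfold g, M. destruct (Z.eq_dec n 0) as [E0|N0]. { rewrite Cmod_1. subst n. simpl. lra. }
    destruct (Z.eq_dec n (-1)) as [E1|N1]. { rewrite Cmod_1. subst n. simpl. lra. }
    rewrite Cmod_0. specialize (P n). lra.
Qed.

(** * Lazy random walk on the integers *)

(* walk m j = binomial (2 m) (m + j) / 4 ^ m. *)
Fixpoint walk (m : nat) (j : Z) : R :=
  match m with
  | O => if Z.eq_dec j 0 then 1%R else 0%R
  | S m => ((walk m (j - 1) + 2 * walk m j + walk m (j + 1)) / 4)%R
  end.

(** The quotient of neighbouring binomial coefficients, cross-multiplied so that it holds for every
    integer j, also off the support. *)
Lemma walk_ratio (m : nat) : forall j : Z,
  ((INR m + 1 + IZR j) * walk m (j + 1) = (INR m - IZR j) * walk m j)%R.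
Proof.
  induction m; intros j.
  - simpl. destruct (Z.eq_dec (j + 1) 0) as [E|E]; destruct (Z.eq_dec j 0) as [E'|E']; try lia.
    + replace j with (-1)%Z by lia. lra.
    + subst. lra.
    + lra.
  - simpl walk. rewrite S_INR. pose proof (IHm (j - 1)%Z) as R1. pose proof (IHm j) as R2. pose proof (IHm (j + 1)%Z) as R3.
    rewrite minus_IZR in R1. rewrite plus_IZR in R3.
    replace (j - 1 + 1)%Z with j in R1 by ring.
    replace (j + 1 - 1)%Z with j by ring.
    set (x := INR m) in *. set (t := IZR j) in *.
    set (a := walk m (j - 1)) in *. set (b := walk m j) in *. set (c := walk m (j + 1)) in *. set (d := walk m (j + 1 + 1)) in *.
    lra.
Qed.

Lemma walk_nonneg (m : nat) : forall j, 0 <= walk m j.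
Proof.
  induction m; intros j; simpl.
  - destruct (Z.eq_dec j 0); lra.
  - pose proof (IHm (j - 1)%Z). pose proof (IHm j). pose proof (IHm (j + 1)%Z). lra.
Qed.

Lemma walk_support (m : nat) : forall j, (Z.of_nat m < Z.abs j)%Z -> walk m j = 0%R.
Proof.
  induction m; intros j Hj; simpl walk.
  - destruct (Z.eq_dec j 0); auto. lia.
  - rewrite !IHm by lia. field.
Qed.

Lemma walk_even (m : nat) : forall j, walk m (- j) = walk m j.
Proof.
  induction m; intros j; simpl walk.
  - destruct (Z.eq_dec (- j) 0); destruct (Z.eq_dec j 0); auto; lia.
  - replace (- j - 1)%Z with (- (j + 1))%Z by ring. replace (- j + 1)%Z with (- (j - 1))%Z by ring.
    rewrite !IHm. field.
Qed.

Lemma walk_center_succ (m : nat) : (walk (S m) 0 = walk m 0 * ((2 * INR m + 1) / (2 * INR m + 2)))%R.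
Proof.
  simpl walk. replace (-1)%Z with (- (1))%Z by ring. rewrite walk_even.
  pose proof (walk_ratio m 0) as Q. simpl in Q. pose proof (pos_INR m).
  replace (walk m 1) with (INR m * walk m 0 / (INR m + 1))%R. field. lra.
  apply Rmult_eq_reg_l with (INR m + 1)%R; [|lra].
  replace ((INR m + 1) * (INR m * walk m 0 / (INR m + 1)))%R with (INR m * walk m 0)%R by (field; lra). lra.
Qed.

Lemma walk_center_pos (m : nat) : 0 < walk m 0.
Proof.
  induction m. simpl; lra. rewrite walk_center_succ. pose proof (pos_INR m).
  apply Rmult_lt_0_compat; auto. apply Rdiv_lt_0_compat; lra.
Qed.

(** With w the central value, m w^2 increases and stays below (m + 1/2) w^2, which decreases. The
    value 1/pi of the limit comes later, from [wallis_constant]. *)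
Lemma wallis_limit : ex_finite_lim_seq (fun m => INR m * walk m 0 ^ 2)%R.
Proof.
  apply (ex_finite_lim_seq_incr _ (1 / 2)).
  - intros m. rewrite walk_center_succ, S_INR. pose proof (pos_INR m) as P. set (x := INR m) in *.
    pose proof (pow2_ge_0 (walk m 0)). set (w := walk m 0) in *.
    replace ((x + 1) * (w * ((2 * x + 1) / (2 * x + 2))) ^ 2)%R with (w ^ 2 * (x + / (4 * (x + 1))))%R by (field; lra).
    rewrite Rmult_comm. apply Rmult_le_compat_l; auto.
    assert (0 < / (4 * (x + 1))) by (apply Rinv_0_lt_compat; lra). lra.
  - intros m. apply Rle_trans with ((INR m + 1 / 2) * walk m 0 ^ 2)%R.
    + apply Rmult_le_compat_r. apply pow2_ge_0. lra.
    + induction m. { simpl. lra. }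
      eapply Rle_trans; [|exact IHm]. rewrite walk_center_succ, S_INR. pose proof (pos_INR m) as P. set (x := INR m) in *.
      pose proof (pow2_ge_0 (walk m 0)). set (w := walk m 0) in *.
      replace ((x + 1 + 1 / 2) * (w * ((2 * x + 1) / (2 * x + 2))) ^ 2)%R
        with (w ^ 2 * ((x + 1 / 2) * (1 - / (2 * x + 2) ^ 2)))%R by (field; lra).
      rewrite (Rmult_comm (x + 1 / 2) (w ^ 2)). apply Rmult_le_compat_l; auto.
      assert (0 < / (2 * x + 2) ^ 2) by (apply Rinv_0_lt_compat; apply pow_lt; lra). nra.
Qed.

(** The ratio of consecutive values is 1 - (2 t + 1)/(m + 1 + t), at most exp(-(2 t + 1)/(m + J)),
    and the first j odd numbers add up to j^2. *)
Lemma walk_upper (m J j : nat) : (j <= J)%nat -> (J <= m)%nat ->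
  walk m (Z.of_nat j) <= walk m 0 * exp (- (INR j ^ 2 / (INR m + INR J))).
Proof.
  intros Hj HJ. induction j.
  - simpl. replace (- (0 * (0 * 1) / (INR m + INR J)))%R with 0%R by (unfold Rdiv; ring). rewrite exp_0. simpl. lra.
  - specialize (IHj ltac:(lia)). pose proof (walk_ratio m (Z.of_nat j)) as Q.
    replace (Z.of_nat (S j)) with (Z.of_nat j + 1)%Z by lia. rewrite <- INR_IZR_INZ in Q. rewrite S_INR.
    apply le_INR in Hj. apply le_INR in HJ. rewrite S_INR in Hj. pose proof (pos_INR j). pose proof (pos_INR m).
    set (x := INR m) in *. set (t := INR j) in *. set (s := INR J) in *.
    set (w := walk m (Z.of_nat j)) in *. set (w' := walk m (Z.of_nat j + 1)) in *.
    assert (E : w' = (w * (1 - (2 * t + 1) / (x + 1 + t)))%R).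
    { apply Rmult_eq_reg_l with (x + 1 + t)%R; [|lra]. rewrite Q. field. lra. }
    rewrite E. replace (- ((t + 1) ^ 2 / (x + s)))%R with (- (t ^ 2 / (x + s)) + - ((2 * t + 1) / (x + s)))%R by (field; lra).
    rewrite exp_plus, <- Rmult_assoc.
    assert (B : 1 - (2 * t + 1) / (x + 1 + t) <= exp (- ((2 * t + 1) / (x + s)))).
    { eapply Rle_trans; [|apply exp_ineq1_le]. unfold Rminus. apply Rplus_le_compat_l. apply Ropp_le_contravar.
      apply Rmult_le_compat_l; [lra|]. apply Rinv_le_contravar; lra. }
    apply Rmult_le_compat; auto. apply walk_nonneg.
    apply Rmult_le_reg_r with (x + 1 + t)%R; [lra|].
    replace ((1 - (2 * t + 1) / (x + 1 + t)) * (x + 1 + t))%R with (x - t)%R by (field; lra). lra.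
Qed.

(** The same product from below: the inverse ratio is 1 + (2 t + 1)/(m - t), at most exp((2 t +
    1)/(m - J)). *)
Lemma walk_lower (m J j : nat) : (j <= J)%nat -> (J < m)%nat ->
  walk m 0 * exp (- (INR j ^ 2 / (INR m - INR J))) <= walk m (Z.of_nat j).
Proof.
  intros Hj HJ. induction j.
  - simpl. replace (- (0 * (0 * 1) / (INR m - INR J)))%R with 0%R by (unfold Rdiv; ring). rewrite exp_0. simpl. lra.
  - specialize (IHj ltac:(lia)). pose proof (walk_ratio m (Z.of_nat j)) as Q.
    replace (Z.of_nat (S j)) with (Z.of_nat j + 1)%Z by lia. rewrite <- INR_IZR_INZ in Q. rewrite S_INR.
    apply le_INR in Hj. apply lt_INR in HJ. rewrite S_INR in Hj. pose proof (pos_INR j). pose proof (pos_INR m).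
    set (x := INR m) in *. set (t := INR j) in *. set (s := INR J) in *.
    set (w := walk m (Z.of_nat j)) in *. set (w' := walk m (Z.of_nat j + 1)) in *.
    assert (E : w' = (w * / (1 + (2 * t + 1) / (x - t)))%R).
    { apply Rmult_eq_reg_l with (x + 1 + t)%R; [|lra]. rewrite Q. field. split; lra. }
    rewrite E. replace (- ((t + 1) ^ 2 / (x - s)))%R with (- (t ^ 2 / (x - s)) + - ((2 * t + 1) / (x - s)))%R by (field; lra).
    rewrite exp_plus, <- Rmult_assoc.
    assert (P : 0 < (2 * t + 1) / (x - t)) by (apply Rdiv_lt_0_compat; lra).
    assert (B : exp (- ((2 * t + 1) / (x - s))) <= / (1 + (2 * t + 1) / (x - t))).
    { rewrite exp_Ropp. apply Rinv_le_contravar; [lra|].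
      eapply Rle_trans; [|apply exp_ineq1_le]. apply Rplus_le_compat_l.
      apply Rmult_le_compat_l; [lra|]. apply Rinv_le_contravar; lra. }
    apply Rmult_le_compat; auto.
    + apply Rmult_le_pos. apply walk_nonneg. left; apply exp_pos.
    + left; apply exp_pos.
Qed.

Definition zrange (h : nat) : list Z := map (fun n => Z.of_nat n - Z.of_nat h)%Z (seq 0 (2 * h + 1)).

Lemma in_zrange (h : nat) (n : Z) : In n (zrange h) <-> (Z.abs n <= Z.of_nat h)%Z.
Proof.
  unfold zrange. rewrite in_map_iff. split.
  - intros (k & <- & Hk). apply in_seq in Hk. lia.
  - intros Hn. exists (Z.to_nat (n + Z.of_nat h)). split; [lia|]. apply in_seq. lia.
Qed.

Lemma zrange_fin (h : nat) : fin_in (fun _ => True) (zrange h).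
Proof.
  split; [|apply Forall_forall; auto]. unfold zrange. apply FinFun.Injective_map_NoDup; [|apply seq_NoDup].
  intros a b E. lia.
Qed.

(** Dirichlet kernel, multiplied out so that sin(th/2) = 0 is allowed. *)
Lemma cos_sum (h : nat) (th : R) :
  RtoC (2 * sin (th / 2)) * lsum (fun n : Z => RtoC (cos (IZR n * th))) (zrange h) = RtoC (2 * sin ((2 * INR h + 1) * th / 2)).
Proof.
  unfold zrange. rewrite lsum_map, lsum_seq.
  assert (E : forall N, RtoC (2 * sin (th / 2)) * psum (fun n => RtoC (cos (IZR (Z.of_nat n - Z.of_nat h) * th))) N
    = RtoC (sin ((INR N - INR h - 1 / 2) * th) + sin ((INR h + 1 / 2) * th))).
  { induction N.
    - simpl psum. rewrite Cmult_0_r. f_equal. simpl INR.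
      replace ((0 - INR h - 1 / 2) * th)%R with (- ((INR h + 1 / 2) * th))%R by field. rewrite sin_neg. ring.
    - simpl psum. rewrite Cmult_plus_distr_l, IHN, <- RtoC_mult, <- RtoC_plus. f_equal.
      rewrite minus_IZR, <- !INR_IZR_INZ, S_INR. set (x := ((INR N - INR h) * th)%R).
      replace ((INR N - INR h - 1 / 2) * th)%R with (x - th / 2)%R by (unfold x; field).
      replace ((INR N + 1 - INR h - 1 / 2) * th)%R with (x + th / 2)%R by (unfold x; field).
      rewrite sin_plus, sin_minus. ring. }
  rewrite E. f_equal. rewrite plus_INR, mult_INR. simpl INR.
  replace ((2 * INR h + 1) * th / 2)%R with ((INR h + 1 / 2) * th)%R by field.
  replace (((1 + 1) * INR h + 1 - INR h - 1 / 2) * th)%R with ((INR h + 1 / 2) * th)%R by field. ring.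
Qed.

Section periodized_walk.
Variable h : nat.
Let l : Z := (2 * Z.of_nat h + 1)%Z.

(* Characters of Z / l Z diagonalize the step of the walk; the eigenvalues are the cos ^ 2. *)
Definition walk_fourier (m : nat) (j n : Z) : R :=
  ((cos (PI * IZR n / IZR l) ^ 2) ^ m * cos (2 * PI * IZR n * IZR j / IZR l))%R.

Lemma period_pos : 0 < IZR l.
Proof. apply IZR_lt. unfold l. lia. Qed.

Lemma IZR_period : IZR l = (2 * INR h + 1)%R.
Proof. unfold l. rewrite plus_IZR, mult_IZR, <- INR_IZR_INZ. reflexivity. Qed.

Lemma walk_fourier_succ (m : nat) (j n : Z) :
  walk_fourier (S m) j n = ((walk_fourier m (j - 1) n + 2 * walk_fourier m j n + walk_fourier m (j + 1) n) / 4)%R.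
Proof.
  unfold walk_fourier. pose proof period_pos. rewrite minus_IZR, plus_IZR.
  set (x := (PI * IZR n / IZR l)%R).
  replace (2 * PI * IZR n * (IZR j - 1) / IZR l)%R with (2 * PI * IZR n * IZR j / IZR l - 2 * x)%R by (unfold x; field; lra).
  replace (2 * PI * IZR n * (IZR j + 1) / IZR l)%R with (2 * PI * IZR n * IZR j / IZR l + 2 * x)%R by (unfold x; field; lra).
  rewrite cos_plus, cos_minus, cos_2a_cos. simpl. field.
Qed.

Lemma sin_Z_PI (j : Z) : sin (IZR j * PI) = 0%R.
Proof. apply sin_eq_0_1. exists j. reflexivity. Qed.

(** Finite Poisson summation. Both sides obey the recursion of the walk in m; for m = 0 it is the
    orthogonality of the characters modulo l, with the case l | j apart. *)
Lemma walk_periodization (m : nat) : forall j : Z,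
  is_sum_over (fun _ => True) (fun k => RtoC (walk m (j + k * l)))
    (/ IZR l * lsum (fun n => RtoC (walk_fourier m j n)) (zrange h)).
Proof.
  pose proof period_pos as HL. assert (HL' : RtoC (IZR l) <> 0) by (intros E; apply RtoC_inj in E; lra).
  induction m; intros j.
  - assert (EF : forall n, walk_fourier 0 j n = cos (IZR n * (2 * PI * IZR j / IZR l))).
    { intros n. unfold walk_fourier. simpl. rewrite Rmult_1_l. f_equal. field. lra. }
    destruct (classic (exists k, j = (k * l)%Z)) as [[k Hk]|Hk].
    + replace (/ IZR l * lsum (fun n => RtoC (walk_fourier 0 j n)) (zrange h))
        with (lsum (fun k => RtoC (walk 0 (j + k * l))) [(- k)%Z]).
      * apply is_sum_finite_support. { split. repeat constructor; simpl; tauto. apply Forall_forall; auto. }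
        intros i _ Hi. simpl. destruct (Z.eq_dec (j + i * l) 0) as [E|E]; auto.
        exfalso. apply Hi. left. subst j. assert (Q : ((k + i) * l = 0)%Z) by lia.
        apply Z.mul_eq_0 in Q. unfold l in Q. lia.
      * unfold lsum at 1. simpl. destruct (Z.eq_dec (j + - k * l) 0) as [E|E]; [|lia].
        rewrite (lsum_ext _ (fun _ => RtoC 1)).
        -- replace (lsum (fun _ : Z => RtoC 1) (zrange h)) with (RtoC (IZR l)). field. auto.
           unfold zrange. rewrite lsum_map, lsum_seq. rewrite IZR_period.
           assert (Q : forall N, psum (fun _ => 1) N = INR N).
           { induction N; [reflexivity|]. rewrite S_INR, RtoC_plus. simpl psum. rewrite IHN. reflexivity. }
           rewrite Q, plus_INR, mult_INR. simpl INR. apply (f_equal RtoC). ring.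
        -- intros n _. f_equal. rewrite EF, Hk, mult_IZR.
           replace (IZR n * (2 * PI * (IZR k * IZR l) / IZR l))%R with (2 * (IZR (n * k) * PI))%R by (rewrite mult_IZR; field; lra).
           rewrite cos_2a_sin, sin_Z_PI. ring.
    + replace (/ IZR l * lsum (fun n => RtoC (walk_fourier 0 j n)) (zrange h))
        with (lsum (fun k => RtoC (walk 0 (j + k * l))) []).
      * apply is_sum_finite_support. { split. constructor. constructor. }
        intros i _ _. simpl. destruct (Z.eq_dec (j + i * l) 0) as [E|E]; auto.
        exfalso. apply Hk. exists (- i)%Z. lia.
      * unfold lsum at 1. simpl. pose proof (cos_sum h (2 * PI * IZR j / IZR l)) as Q.
        replace ((2 * INR h + 1) * (2 * PI * IZR j / IZR l) / 2)%R with (IZR j * PI)%R in Q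
          by (rewrite <- IZR_period; field; lra).
        rewrite sin_Z_PI, Rmult_0_r in Q.
        assert (N : RtoC (2 * sin (2 * PI * IZR j / IZR l / 2)) <> 0).
        { intros E. apply RtoC_inj in E. assert (E' : sin (2 * PI * IZR j / IZR l / 2) = 0%R) by lra.
          apply sin_eq_0_0 in E'. destruct E' as [k E']. apply Hk. exists k.
          apply eq_IZR. rewrite mult_IZR. pose proof PI_RGT_0.
          apply Rmult_eq_reg_r with (PI / IZR l)%R; [|apply Rgt_not_eq, Rdiv_lt_0_compat; auto].
          replace (IZR j * (PI / IZR l))%R with (2 * PI * IZR j / IZR l / 2)%R by (field; lra). rewrite E'. field. lra. }
        rewrite (lsum_ext _ (fun n => RtoC (cos (IZR n * (2 * PI * IZR j / IZR l))))) by (intros; rewrite EF; reflexivity).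
        set (X := lsum (fun n => RtoC (cos (IZR n * (2 * PI * IZR j / IZR l)))) (zrange h)) in *.
        destruct (Ceq_dec X 0) as [Z|Z]. rewrite Z; ring.
        exfalso. revert Q. apply Cmult_neq_0; auto.
  - pose proof (is_sum_scal _ _ (/ 4) _ (is_sum_plus _ _ _ _ _
      (is_sum_plus _ _ _ _ _ (IHm (j - 1)%Z) (is_sum_scal _ _ 2 _ (IHm j))) (IHm (j + 1)%Z))) as Q.
    match type of Q with is_sum_over _ _ ?v => replace (/ IZR l * lsum (fun n => RtoC (walk_fourier (S m) j n)) (zrange h)) with v end.
    + revert Q. apply is_sum_ext. intros k _. simpl walk.
      replace (j - 1 + k * l)%Z with (j + k * l - 1)%Z by ring. replace (j + 1 + k * l)%Z with (j + k * l + 1)%Z by ring.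
      rewrite RtoC_div, !RtoC_plus, RtoC_mult by lra. field.
    + rewrite (lsum_ext (fun n => RtoC (walk_fourier (S m) j n))
        (fun n => / 4 * ((RtoC (walk_fourier m (j - 1) n) + 2 * RtoC (walk_fourier m j n)) + RtoC (walk_fourier m (j + 1) n)))).
      * rewrite lsum_scal, !lsum_plus, lsum_scal. field. auto.
      * intros n _. rewrite walk_fourier_succ. rewrite RtoC_div, !RtoC_plus, RtoC_mult by lra. field.
Qed.
End periodized_walk.

(** * Inversion of the theta constant *)

Lemma exp_sq_decay_summable (c : R) : 0 < c ->
  summable (fun _ : Z => True) (fun n => exp (- (c * IZR n ^ 2))).
Proof.
  intros Hc. apply (summable_le _ _ (fun n => (1 + / c) * / (1 + IZR n ^ 2))%R).
  - intros n _. split. left; apply exp_pos. pose proof (pow2_ge_0 (IZR n)) as P. set (x := (IZR n ^ 2)%R) in *.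
    pose proof (Rinv_0_lt_compat c Hc) as Hic.
    assert (Q : 0 <= c * x) by (apply Rmult_le_pos; lra).
    apply Rle_trans with (/ (1 + c * x))%R.
    + rewrite exp_Ropp. apply Rinv_le_contravar; [lra|]. apply exp_ineq1_le.
    + apply Rmult_le_reg_r with ((1 + c * x) * (1 + x))%R. { apply Rmult_lt_0_compat; lra. }
      replace (/ (1 + c * x) * ((1 + c * x) * (1 + x)))%R with (1 + x)%R by (field; lra).
      replace ((1 + / c) * / (1 + x) * ((1 + c * x) * (1 + x)))%R with (1 + / c + c * x + x)%R by (field; lra). lra.
  - apply summable_scal; [|apply summable_Z_inv_square]. pose proof (Rinv_0_lt_compat c Hc). lra.
Qed.

Lemma theta00_term_imag (y : R) (n : Z) : theta_term 0 0 n (y * Ci) = RtoC (exp (- (PI * y * IZR n ^ 2))).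
Proof.
  unfold theta_term. rewrite <- Cexp_RtoC. f_equal.
  rewrite RtoC_opp, !RtoC_mult, RtoC_pow.
  replace (IZR n + 0 / 2) with (RtoC (IZR n)) by field.
  replace (PI * Ci * RtoC (IZR n) ^ 2 * (y * Ci) + 2 * PI * Ci * RtoC (IZR n) * (0 / 2))
    with ((Ci * Ci) * (PI * y * RtoC (IZR n) ^ 2)) by field.
  replace (Ci * Ci) with (- RtoC 1) by (apply injective_projections; simpl; ring). ring.
Qed.

Lemma UHP_imag (y : R) : 0 < y -> UHP (y * Ci).
Proof. intros Hy. unfold upper_half_plane. simpl. lra. Qed.

Lemma theta00_imag_sum (y : R) : 0 < y ->
  sum_over (fun _ : Z => True) (fun n => RtoC (exp (- (PI * y * IZR n ^ 2)))) = theta 0 0 (y * Ci).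
Proof.
  intros Hy. apply sum_over_eq. eapply is_sum_ext; [|apply theta_is_sum; apply UHP_imag; exact Hy].
  intros n _. exact (theta00_term_imag y n).
Qed.

(** Positivity selects the square root in [theta00_inversion_imag], and r >= 1 allows the division
    in [wallis_constant]. *)
Lemma theta00_imag_pos (y : R) : 0 < y -> exists r, 1 <= r /\ theta 0 0 (y * Ci) = RtoC r.
Proof.
  intros Hy. set (th := theta 0 0 (y * Ci)). exists (Re th).
  pose proof (theta_is_sum 0 0 (y * Ci) (UHP_imag y Hy)) as HS. fold th in HS.
  assert (E : th = RtoC (Re th)).
  { pose proof (theta_conj 0 0 (y * Ci) (or_introl eq_refl) (UHP_imag y Hy)) as Q.
    replace (- Cconj (y * Ci)) with (y * Ci) in Q by (apply injective_projections; simpl; ring).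
    fold th in Q. apply (f_equal Im) in Q. rewrite im_conj in Q.
    apply injective_projections; simpl; auto. change (Im th = 0)%R. lra. }
  split; auto. rewrite is_sum_over_iff in HS. apply le_epsilon. intros eps He.
  destruct (HS eps He) as (s0 & Hs0 & H').
  destruct (fin_in_nodup (fun _ => True) (0%Z :: s0)) as (s & Hs & Hi). { apply Forall_forall; auto. }
  specialize (H' s Hs ltac:(intros x Hx; apply Hi; right; auto)).
  assert (L : forall t, (forall z, In z t -> True) -> 0 <= Re (lsum (fun n => theta_term 0 0 n (y * Ci)) t)).
  { induction t; intros _. { unfold lsum; simpl. lra. }
    unfold lsum in *. simpl map. simpl fold_right. rewrite re_plus, theta00_term_imag, re_RtoC.
    pose proof (exp_pos (- (PI * y * IZR a ^ 2))). specialize (IHt ltac:(auto)). lra. }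
  destruct (in_split 0%Z s) as (t1 & t2 & Es). { apply Hi. left; auto. }
  assert (P : 1 <= Re (lsum (fun n => theta_term 0 0 n (y * Ci)) s)).
  { assert (Hp : Permutation s (0%Z :: t1 ++ t2)) by (rewrite Es; symmetry; apply Permutation_middle).
    rewrite (lsum_perm _ _ _ Hp). specialize (L (t1 ++ t2) ltac:(auto)). unfold lsum in *. simpl map. simpl fold_right.
    rewrite re_plus, theta00_term_imag, re_RtoC. simpl IZR.
    replace (- (PI * y * 0 ^ 2))%R with 0%R by ring. rewrite exp_0. lra. }
  pose proof (re_le_Cmod (lsum (fun n => theta_term 0 0 n (y * Ci)) s - th)) as Q. rewrite re_minus in Q.
  apply Rabs_le_between in Q. lra.
Qed.

Lemma is_lim_seq_RtoC (u : nat -> R) (l : R) : is_lim_seq u l ->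
  filterlim (fun n => RtoC (u n)) eventually (locally (T := C_UniformSpace) (RtoC l)).
Proof.
  intros Hu. apply is_lim_seq_spec in Hu. apply C_filterlim_iff. apply eventually_filter.
  intros eps He. destruct (Hu (mkposreal eps He)) as [N HN]. exists N. intros n Hn.
  rewrite <- RtoC_minus, Cmod_R. apply HN; auto.
Qed.

Lemma is_lim_seq_Ropp (u : nat -> R) (l : R) :
  is_lim_seq u l -> is_lim_seq (fun n => - u n)%R (- l)%R.
Proof. intros Hu. apply (is_lim_seq_opp u l). exact Hu. Qed.

(** As long as x <= 2 one has x - x^3/6 >= x/3, and pi/2 <= 2. *)
Lemma sin_lower (x : R) : 0 <= x <= PI / 2 -> x / 3 <= sin x.
Proof.
  intros Hx. pose proof PI_4. destruct (pre_sin_bound x 0) as [A _]; try lra.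
  eapply Rle_trans; [|exact A]. unfold sin_approx, sin_term. simpl. nra.
Qed.

Section polya.
Variable y : R.
Hypothesis Hy : 0 < y.

Let L (h : nat) : R := (2 * INR h + 1)%R.
(* After m ~ y l^2 / pi steps the walk folded modulo l = 2 h + 1 is, in the limit, a theta
   series of parameter 1 / y on the side of positions and of parameter y on the side of
   frequencies. *)
Let m (h : nat) : nat := Z.to_nat (up (y * L h ^ 2 / PI)).

Lemma polya_L_pos h : 1 <= L h.
Proof. unfold L. pose proof (pos_INR h). lra. Qed.

Lemma polya_arg_pos h : 0 < y * L h ^ 2 / PI.
Proof.
  pose proof (polya_L_pos h). pose proof PI_RGT_0. apply Rdiv_lt_0_compat; auto.
  apply Rmult_lt_0_compat; auto. apply pow_lt. lra.
Qed.

Lemma polya_m_bounds h : y / PI <= INR (m h) / L h ^ 2 <= y / PI + / L h ^ 2.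
Proof.
  pose proof (polya_L_pos h) as HL. pose proof (polya_arg_pos h) as HA. pose proof PI_RGT_0 as HPI.
  destruct (archimed (y * L h ^ 2 / PI)) as [A B].
  assert (E : INR (m h) = IZR (up (y * L h ^ 2 / PI))).
  { unfold m. rewrite INR_IZR_INZ, Z2Nat.id; auto. apply le_IZR. lra. }
  rewrite E. assert (HL2 : 0 < L h ^ 2) by (apply pow_lt; lra).
  split.
  - apply Rmult_le_reg_r with (L h ^ 2)%R; auto. unfold Rdiv at 2. rewrite Rmult_assoc, Rinv_l by lra.
    replace (y / PI * L h ^ 2)%R with (y * L h ^ 2 / PI)%R by (field; lra). lra.
  - apply Rmult_le_reg_r with (L h ^ 2)%R; auto. unfold Rdiv at 1. rewrite Rmult_assoc, Rinv_l by lra.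
    replace ((y / PI + / L h ^ 2) * L h ^ 2)%R with (y * L h ^ 2 / PI + 1)%R by (field; lra). lra.
Qed.

Lemma polya_m_pos h : 0 < INR (m h).
Proof.
  pose proof (polya_m_bounds h) as [A _]. pose proof (polya_L_pos h). pose proof PI_RGT_0.
  assert (0 < y / PI) by (apply Rdiv_lt_0_compat; auto).
  assert (HL2 : 0 < L h ^ 2) by (apply pow_lt; lra).
  replace (INR (m h)) with (INR (m h) / L h ^ 2 * L h ^ 2)%R by (field; lra). apply Rmult_lt_0_compat; lra.
Qed.

Lemma polya_L_lim : is_lim_seq L p_infty.
Proof.
  apply (is_lim_seq_le_p_loc INR); [|apply is_lim_seq_INR]. exists 0%nat. intros n _. unfold L. pose proof (pos_INR n). lra.
Qed.

Lemma polya_L_inv_lim : is_lim_seq (fun h => / L h)%R 0.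
Proof. apply (is_lim_seq_inv L p_infty). apply polya_L_lim. discriminate. Qed.

Lemma polya_m_lim : is_lim_seq (fun h => INR (m h) / L h ^ 2)%R (y / PI)%R.
Proof.
  apply (is_lim_seq_le_le (fun _ => (y / PI)%R) _ (fun h => (y / PI + / L h * / L h)%R)).
  - intros h. pose proof (polya_m_bounds h). pose proof (polya_L_pos h).
    replace (/ L h * / L h)%R with (/ L h ^ 2)%R by (field; lra). auto.
  - apply is_lim_seq_const.
  - pose proof (is_lim_seq_plus' _ _ _ _ (is_lim_seq_const (y / PI)%R)
      (is_lim_seq_mult' _ _ _ _ polya_L_inv_lim polya_L_inv_lim)) as K.
    replace (y / PI + 0 * 0)%R with (y / PI)%R in K by ring. exact K.
Qed.

Lemma polya_m_infty : filterlim m eventually eventually.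
Proof.
  intros P [N HN].
  pose proof (proj2 (is_lim_seq_spec _ _) polya_L_lim) as HLi.
  destruct (HLi (INR N * PI / y)%R) as [H0 HH0]. exists H0. intros h Hh. apply HN.
  specialize (HH0 h Hh). pose proof (polya_m_bounds h) as [A _]. pose proof (polya_L_pos h) as HL. pose proof PI_RGT_0 as HPI.
  apply INR_le. assert (HL2 : 0 < L h ^ 2) by (apply pow_lt; lra).
  apply Rmult_le_compat_r with (r := (L h ^ 2)%R) in A; [|lra].
  replace (INR (m h) / L h ^ 2 * L h ^ 2)%R with (INR (m h)) in A by (field; lra).
  apply Rmult_lt_compat_r with (r := (y / PI)%R) in HH0; [|apply Rdiv_lt_0_compat; auto].
  replace (INR N * PI / y * (y / PI))%R with (INR N) in HH0 by (field; lra).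
  assert (0 < y / PI) by (apply Rdiv_lt_0_compat; auto).
  assert (L h * (y / PI) <= y / PI * L h ^ 2). { rewrite Rmult_comm. apply Rmult_le_compat_l; [lra|]. simpl. nra. }
  lra.
Qed.

(** Residues are represented by |n| <= h, so that the angle stays in (-pi/2, pi/2), where |sin x| >=
    |x|/3 yields a majorant independent of h. *)
Definition polya_fourier (h : nat) (n : Z) : R :=
  if excluded_middle_informative (Z.abs n <= Z.of_nat h)%Z then ((cos (PI * IZR n / L h) ^ 2) ^ m h)%R else 0%R.

Lemma polya_angle h n : (Z.abs n <= Z.of_nat h)%Z -> Rabs (PI * IZR n / L h) < PI / 2.
Proof.
  intros Hn. pose proof (polya_L_pos h) as HL. pose proof PI_RGT_0 as HPI.
  unfold Rdiv. rewrite !Rabs_mult, (Rabs_pos_eq PI), (Rabs_pos_eq (/ L h)); [| |lra].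
  2:{ left. apply Rinv_0_lt_compat; lra. }
  rewrite Rmult_assoc. apply Rmult_lt_compat_l; auto. apply Rmult_lt_reg_r with (L h); [lra|].
  rewrite Rmult_assoc, Rinv_l, Rmult_1_r by lra. rewrite <- abs_IZR. apply IZR_le in Hn. rewrite <- INR_IZR_INZ in Hn.
  unfold L. lra.
Qed.

(** From cos^2 = 1 - sin^2 <= exp(- sin^2). *)
Lemma pow_cos_upper (x : R) (N : nat) : (cos x ^ 2) ^ N <= exp (- (INR N * sin x ^ 2)).
Proof.
  replace (- (INR N * sin x ^ 2))%R with (INR N * (- sin x ^ 2))%R by ring. rewrite exp_INR_mult.
  apply pow_incr. split. apply pow2_ge_0. eapply Rle_trans; [|apply exp_ineq1_le].
  pose proof (sin2_cos2 x) as Q. unfold Rsqr in Q. simpl. lra.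
Qed.

(** From 1/cos^2 = 1 + tan^2 <= exp(tan^2). *)
Lemma pow_cos_lower (x : R) (N : nat) : cos x <> 0%R -> exp (- (INR N * sin x ^ 2 / cos x ^ 2)) <= (cos x ^ 2) ^ N.
Proof.
  intros Hx. replace (- (INR N * sin x ^ 2 / cos x ^ 2))%R with (INR N * (- (sin x ^ 2 / cos x ^ 2)))%R by (field; auto).
  rewrite exp_INR_mult. apply pow_incr. split. left; apply exp_pos.
  assert (P : 0 < cos x ^ 2) by (apply pow2_gt_0; auto).
  rewrite exp_Ropp. rewrite <- (Rinv_inv (cos x ^ 2)) at 2. apply Rinv_le_contravar. apply Rinv_0_lt_compat; auto.
  eapply Rle_trans; [|apply exp_ineq1_le]. right.
  pose proof (sin2_cos2 x) as Q. unfold Rsqr in Q. replace (sin x ^ 2)%R with (1 - cos x ^ 2)%R by (simpl; lra). field. auto.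
Qed.

Lemma polya_sin_lim (n : Z) : is_lim_seq (fun h => L h * sin (PI * IZR n / L h))%R (PI * IZR n)%R.
Proof.
  apply is_lim_seq_spec. intros eps. set (a := (Rabs (PI * IZR n) + 1)%R).
  assert (Ha : 0 < a) by (unfold a; pose proof (Rabs_pos (PI * IZR n)); lra).
  pose proof (cond_pos eps) as He.
  destruct (proj1 (is_derive_R_iff (V := R_NormedModule) sin 0 (cos 0)) (is_derive_sin 0) (eps / a)%R) as (d & Hd & D).
  { apply Rdiv_lt_0_compat; auto. }
  pose proof (proj2 (is_lim_seq_spec _ _) polya_L_lim (a / d)%R) as [N HN].
  exists N. intros h Hh. specialize (HN h Hh). pose proof (polya_L_pos h) as HL.
  set (x := (PI * IZR n / L h)%R).
  assert (Ex : Rabs x = (Rabs (PI * IZR n) / L h)%R).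
  { unfold x, Rdiv. rewrite Rabs_mult, (Rabs_pos_eq (/ L h)); auto. left. apply Rinv_0_lt_compat; lra. }
  assert (Hxd : Rabs x < d).
  { rewrite Ex. apply Rmult_lt_reg_r with (L h); [lra|]. unfold Rdiv. rewrite Rmult_assoc, Rinv_l, Rmult_1_r by lra.
    apply Rmult_lt_compat_r with (r := d) in HN; auto. replace (a / d * d)%R with a in HN by (field; lra).
    unfold a in HN. lra. }
  specialize (D x Hxd). change (Rabs ((sin (0 + x) - sin 0) - x * cos 0) <= eps / a * Rabs x) in D.
  rewrite Rplus_0_l, sin_0, cos_0 in D.
  replace (L h * sin x - PI * IZR n)%R with (L h * (sin x - 0 - x * 1))%R by (unfold x; field; lra).
  rewrite Rabs_mult, (Rabs_pos_eq (L h)) by lra.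
  apply Rle_lt_trans with (L h * (eps / a * Rabs x))%R. { apply Rmult_le_compat_l; lra. }
  rewrite Ex. replace (L h * (eps / a * (Rabs (PI * IZR n) / L h)))%R with (eps * (Rabs (PI * IZR n) / a))%R by (field; lra).
  rewrite <- (Rmult_1_r eps) at 2. apply Rmult_lt_compat_l; auto.
  apply Rmult_lt_reg_r with a; auto. unfold Rdiv. rewrite Rmult_assoc, Rinv_l by lra. unfold a. lra.
Qed.

Lemma exp_continuity (x : R) : continuity_pt exp x.
Proof. apply derivable_continuous_pt. apply derivable_pt_exp. Qed.

Lemma polya_fourier_lim (n : Z) : is_lim_seq (fun h => polya_fourier h n) (exp (- (PI * y * IZR n ^ 2))).
Proof.
  pose proof PI_RGT_0 as HPI.
  assert (A : is_lim_seq (fun h => INR (m h) * sin (PI * IZR n / L h) ^ 2)%R (PI * y * IZR n ^ 2)%R).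
  { apply (is_lim_seq_ext (fun h => INR (m h) / L h ^ 2 * ((L h * sin (PI * IZR n / L h)) * (L h * sin (PI * IZR n / L h))))%R).
    - intros h. pose proof (polya_L_pos h). field. lra.
    - replace (PI * y * IZR n ^ 2)%R with (y / PI * ((PI * IZR n) * (PI * IZR n)))%R by (field; lra).
      apply is_lim_seq_mult'. apply polya_m_lim. apply is_lim_seq_mult'; apply polya_sin_lim. }
  assert (Cl : is_lim_seq (fun h => cos (PI * IZR n / L h))%R 1).
  { rewrite <- cos_0. apply is_lim_seq_continuous. apply continuity_cos.
    replace 0%R with (PI * IZR n * 0)%R by ring. apply is_lim_seq_mult'. apply is_lim_seq_const. apply polya_L_inv_lim. }
  apply (is_lim_seq_le_le_loc (fun h => exp (- (INR (m h) * sin (PI * IZR n / L h) ^ 2 / cos (PI * IZR n / L h) ^ 2))) _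
     (fun h => exp (- (INR (m h) * sin (PI * IZR n / L h) ^ 2)))).
  - exists (Z.to_nat (Z.abs n)). intros h Hh. assert (Hn : (Z.abs n <= Z.of_nat h)%Z) by lia.
    unfold polya_fourier. destruct (excluded_middle_informative _) as [_|N]; [|contradiction].
    split; [|apply pow_cos_upper]. apply pow_cos_lower. apply Rgt_not_eq. apply cos_gt_0.
    + pose proof (polya_angle h n Hn) as Q. apply Rabs_def2 in Q. lra.
    + pose proof (polya_angle h n Hn) as Q. apply Rabs_def2 in Q. lra.
  - apply (is_lim_seq_continuous exp). apply exp_continuity. apply is_lim_seq_Ropp.
    replace (PI * y * IZR n ^ 2)%R with (PI * y * IZR n ^ 2 / (1 * 1))%R by field.
    apply is_lim_seq_div'; auto.
    apply (is_lim_seq_ext (fun h => cos (PI * IZR n / L h) * cos (PI * IZR n / L h))%R). { intros; ring. }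
    apply is_lim_seq_mult'; auto.
  - apply (is_lim_seq_continuous exp). apply exp_continuity. apply is_lim_seq_Ropp. auto.
Qed.

Lemma polya_fourier_bound (h : nat) (n : Z) : 0 <= polya_fourier h n <= exp (- (PI * y / 9 * IZR n ^ 2)).
Proof.
  unfold polya_fourier. destruct (excluded_middle_informative _) as [Hn|Hn].
  2:{ split; [lra|]. left; apply exp_pos. }
  split. { apply pow_le. apply pow2_ge_0. }
  eapply Rle_trans; [apply pow_cos_upper|].
  set (x := (PI * IZR n / L h)%R). pose proof (polya_angle h n Hn) as Hx. fold x in Hx. pose proof PI_RGT_0 as HPI.
  pose proof (polya_L_pos h) as HL. pose proof (polya_m_bounds h) as [A _].
  assert (S : (x / 3) ^ 2 <= sin x ^ 2).
  { assert (K : Rabs x / 3 <= sin (Rabs x)) by (apply sin_lower; split; [apply Rabs_pos|lra]).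
    assert (K' : (Rabs x / 3) ^ 2 <= sin (Rabs x) ^ 2).
    { apply pow_incr. split; auto. apply Rmult_le_pos; [apply Rabs_pos|lra]. }
    unfold Rabs in K'. destruct (Rcase_abs x).
    - rewrite sin_neg in K'. replace ((- x / 3) ^ 2)%R with ((x / 3) ^ 2)%R in K' by field.
      replace ((- sin x) ^ 2)%R with (sin x ^ 2)%R in K' by ring. auto.
    - auto. }
  (* The bound m >= y l^2/pi turns m (x/3)^2, with x = pi n/l, into pi y n^2/9. *)
  assert (B : PI * y / 9 * IZR n ^ 2 <= INR (m h) * sin x ^ 2).
  { apply Rle_trans with (INR (m h) * (x / 3) ^ 2)%R.
    - unfold x. replace (INR (m h) * (PI * IZR n / L h / 3) ^ 2)%R with (PI ^ 2 * IZR n ^ 2 / 9 * (INR (m h) / L h ^ 2))%R by (field; lra).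
      replace (PI * y / 9 * IZR n ^ 2)%R with (PI ^ 2 * IZR n ^ 2 / 9 * (y / PI))%R by (field; lra).
      apply Rmult_le_compat_l; auto. pose proof (pow2_ge_0 PI). pose proof (pow2_ge_0 (IZR n)).
      apply Rmult_le_pos; [apply Rmult_le_pos; auto|lra].
    - apply Rmult_le_compat_l; auto. apply pos_INR. }
  destruct (Rle_lt_or_eq_dec _ _ B) as [Q|Q]. left; apply exp_increasing; lra. rewrite Q; lra.
Qed.

Definition polya_walk (h : nat) (k : Z) : R :=
  (walk (m h) (k * (2 * Z.of_nat h + 1)) / walk (m h) 0)%R.

Lemma polya_walk_abs (h : nat) (k : Z) :
  polya_walk h k = (walk (m h) (Z.of_nat (Z.abs_nat k * (2 * h + 1))) / walk (m h) 0)%R.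
Proof.
  unfold polya_walk. f_equal. destruct (Z.le_ge_cases 0 k).
  - f_equal. nia.
  - rewrite <- walk_even. f_equal. nia.
Qed.

Lemma polya_index (h : nat) (k : Z) : INR (Z.abs_nat k * (2 * h + 1)) = (Rabs (IZR k) * L h)%R.
Proof.
  rewrite mult_INR, plus_INR, mult_INR. rewrite (INR_IZR_INZ (Z.abs_nat k)), Zabs2Nat.id_abs, abs_IZR. unfold L. simpl. ring.
Qed.

(** Up to distance m, [walk_upper] with J = m gives exp(- j^2/(2 m)), where m <= l^2 (y/pi + 1)
    because l >= 1; beyond m the walk vanishes. *)
Lemma polya_walk_bound (h : nat) (k : Z) : 0 <= polya_walk h k <= exp (- (/ (2 * (y / PI + 1)) * IZR k ^ 2)).
Proof.
  pose proof (walk_center_pos (m h)) as W0. pose proof PI_RGT_0 as HPI. pose proof (polya_L_pos h) as HL.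
  split. { apply Rmult_le_pos. apply walk_nonneg. left. apply Rinv_0_lt_compat; auto. }
  rewrite polya_walk_abs. set (j := (Z.abs_nat k * (2 * h + 1))%nat).
  destruct (le_lt_dec j (m h)) as [Hj|Hj].
  - pose proof (walk_upper (m h) (m h) j Hj (Nat.le_refl _)) as U.
    apply Rle_trans with (exp (- (INR j ^ 2 / (INR (m h) + INR (m h))))).
    + apply Rmult_le_reg_r with (walk (m h) 0); auto. unfold Rdiv at 1. rewrite Rmult_assoc, Rinv_l by lra. lra.
    + assert (B : / (2 * (y / PI + 1)) * IZR k ^ 2 <= INR j ^ 2 / (INR (m h) + INR (m h))).
      { unfold j. rewrite polya_index. rewrite Rpow_mult_distr, pow2_abs.
        pose proof (polya_m_bounds h) as [A B]. pose proof (polya_m_pos h) as Hm.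
        assert (HL2 : 0 < L h ^ 2) by (apply pow_lt; lra).
        assert (HL1 : / L h ^ 2 <= 1). { rewrite <- Rinv_1. apply Rinv_le_contravar; [lra|]. simpl. nra. }
        replace (IZR k ^ 2 * L h ^ 2 / (INR (m h) + INR (m h)))%R with (/ (2 * (INR (m h) / L h ^ 2)) * IZR k ^ 2)%R by (field; lra).
        apply Rmult_le_compat_r. apply pow2_ge_0. apply Rinv_le_contravar; [|lra].
        apply Rmult_lt_0_compat; [lra|]. apply Rdiv_lt_0_compat; auto. }
      destruct (Rle_lt_or_eq_dec _ _ B) as [Q|Q]. left; apply exp_increasing; lra. rewrite Q; lra.
  - rewrite walk_support by lia. unfold Rdiv. rewrite Rmult_0_l. left; apply exp_pos.
Qed.

Lemma polya_walk_lim (k : Z) : is_lim_seq (fun h => polya_walk h k) (exp (- (PI * / y * IZR k ^ 2))).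
Proof.
  pose proof PI_RGT_0 as HPI. set (a := Rabs (IZR k)).
  (* Treats both squeezing exponents at once: j^2/(m + s j) with j = |k| l, for s = 1 and s = -1. *)
  assert (Lim : forall s : R, is_lim_seq (fun h => - ((a * L h) ^ 2 / (INR (m h) + s * (a * L h))))%R (- (PI * / y * IZR k ^ 2))%R).
  { intros s. apply is_lim_seq_Ropp.
    apply (is_lim_seq_ext (fun h => (a * a) / (INR (m h) / L h ^ 2 + s * a * / L h))%R).
    - intros h. pose proof (polya_L_pos h).
      (* For s = -1 the denominator may vanish at some h; both sides are then 0, as division by 0
         yields 0. *)
      destruct (Req_dec (INR (m h) + s * (a * L h)) 0) as [E|E].
      + rewrite E. replace (INR (m h) / L h ^ 2 + s * a * / L h)%R with ((INR (m h) + s * (a * L h)) / L h ^ 2)%R by (field; lra).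
        rewrite E. unfold Rdiv. rewrite Rmult_0_l, Rinv_0. ring.
      + field. split; [exact E|lra].
    - replace (PI * / y * IZR k ^ 2)%R with ((a * a) / (y / PI + s * a * 0))%R.
      + apply is_lim_seq_div'. apply is_lim_seq_const.
        * apply is_lim_seq_plus'. apply polya_m_lim. apply is_lim_seq_mult'. apply is_lim_seq_const. apply polya_L_inv_lim.
        * rewrite Rmult_0_r, Rplus_0_r. apply Rgt_not_eq. apply Rdiv_lt_0_compat; auto.
      + replace (IZR k ^ 2)%R with (a * a)%R. field. lra. unfold a. rewrite <- (pow2_abs (IZR k)). ring. }
  apply (is_lim_seq_le_le_loc (fun h => exp (- ((a * L h) ^ 2 / (INR (m h) + (-1) * (a * L h))))) _
     (fun h => exp (- ((a * L h) ^ 2 / (INR (m h) + 1 * (a * L h)))))).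
  - pose proof (proj2 (is_lim_seq_spec _ _) polya_L_lim (a * PI / y)%R) as [N HN]. exists N. intros h Hh. specialize (HN h Hh).
    pose proof (polya_L_pos h) as HL. rewrite polya_walk_abs. set (j := (Z.abs_nat k * (2 * h + 1))%nat).
    assert (Ej : INR j = (a * L h)%R) by apply polya_index.
    pose proof (polya_m_bounds h) as [A _]. assert (HL2 : 0 < L h ^ 2) by (apply pow_lt; lra).
    apply Rmult_le_compat_r with (r := (L h ^ 2)%R) in A; [|lra].
    replace (INR (m h) / L h ^ 2 * L h ^ 2)%R with (INR (m h)) in A by (field; lra).
    assert (Hjm : (j < m h)%nat).
    { apply INR_lt. rewrite Ej. eapply Rlt_le_trans; [|exact A].
      apply Rmult_lt_compat_r with (r := (y / PI * L h)%R) in HN.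
      - replace (a * PI / y * (y / PI * L h))%R with (a * L h)%R in HN by (field; lra).
        replace (y / PI * L h ^ 2)%R with (L h * (y / PI * L h))%R by (field; lra). exact HN.
      - apply Rmult_lt_0_compat; [|lra]. apply Rdiv_lt_0_compat; auto. }
    pose proof (walk_center_pos (m h)) as W0.
    pose proof (walk_upper (m h) j j (Nat.le_refl _) (Nat.lt_le_incl _ _ Hjm)) as U.
    pose proof (walk_lower (m h) j j (Nat.le_refl _) Hjm) as D. rewrite Ej in U, D.
    replace (INR (m h) + -1 * (a * L h))%R with (INR (m h) - a * L h)%R by ring.
    replace (INR (m h) + 1 * (a * L h))%R with (INR (m h) + a * L h)%R by ring.
    split; apply Rmult_le_reg_r with (walk (m h) 0); auto; unfold Rdiv at 2; rewrite ?Rmult_assoc, ?Rinv_l by lra.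
    + lra.
    + unfold Rdiv at 1. rewrite ?Rmult_assoc, ?Rinv_l by lra. lra.
  - apply (is_lim_seq_continuous exp). apply exp_continuity. apply (Lim (-1)%R).
  - apply (is_lim_seq_continuous exp). apply exp_continuity. apply (Lim 1%R).
Qed.

(** This is [walk_periodization] at j = 0, where all characters are 1, divided by the central value
    of the walk. *)
Lemma polya_identity (h : nat) :
  sum_over (fun _ : Z => True) (fun n => RtoC (polya_fourier h n))
  = RtoC (L h * walk (m h) 0) * sum_over (fun _ : Z => True) (fun k => RtoC (polya_walk h k)).
Proof.
  pose proof (polya_L_pos h) as HL. pose proof (walk_center_pos (m h)) as W0.
  assert (EL : IZR (2 * Z.of_nat h + 1) = L h). { rewrite plus_IZR, mult_IZR, <- INR_IZR_INZ. reflexivity. }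
  apply sum_over_eq.
  replace (RtoC (L h * walk (m h) 0) * sum_over (fun _ : Z => True) (fun k => RtoC (polya_walk h k)))
    with (lsum (fun n => RtoC (polya_fourier h n)) (zrange h)).
  - apply is_sum_finite_support. apply zrange_fin. intros n _ Hn. rewrite in_zrange in Hn. unfold polya_fourier.
    destruct (excluded_middle_informative _); [contradiction|reflexivity].
  - pose proof (walk_periodization h (m h) 0) as Q.
    apply (is_sum_scal _ _ (/ RtoC (walk (m h) 0))) in Q.
    rewrite (sum_over_eq _ (fun k => RtoC (polya_walk h k)) _ (is_sum_ext _ _ (fun k => RtoC (polya_walk h k)) _
      (fun k _ => eq_sym (eq_trans (RtoC_div _ _ (Rgt_not_eq _ _ W0)) (Cmult_comm _ _))) Q)).
    rewrite EL, RtoC_mult.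
    rewrite (lsum_ext (fun n => RtoC (walk_fourier h (m h) 0 n)) (fun n => RtoC (polya_fourier h n))).
    + field. split; intros E; apply RtoC_inj in E; lra.
    + intros n Hn. apply in_zrange in Hn. f_equal. unfold walk_fourier, polya_fourier.
      destruct (excluded_middle_informative _); [|contradiction]. rewrite EL, Rmult_0_r. unfold Rdiv at 2.
      rewrite Rmult_0_l, cos_0, Rmult_1_r. reflexivity.
Qed.

(** Squared, because the limit known to exist is that of m w^2: the factor (l w)^2 is m w^2 divided
    by m/l^2, which tends to y/pi. *)
Lemma theta00_polya (kap : R) : is_lim_seq (fun n => INR n * walk n 0 ^ 2)%R kap ->
  theta 0 0 (y * Ci) ^ 2 = RtoC (PI * kap / y) * theta 0 0 (/ y * Ci) ^ 2.
Proof.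
  intros Hk. pose proof PI_RGT_0 as HPI. pose proof (Rinv_0_lt_compat y Hy) as Hiy.
  set (E := fun h => sum_over (fun _ : Z => True) (fun n => RtoC (polya_fourier h n))).
  set (W := fun h => sum_over (fun _ : Z => True) (fun k => RtoC (polya_walk h k))).
  assert (HE : filterlim E eventually (locally (T := C_UniformSpace) (theta 0 0 (y * Ci)))).
  { rewrite <- theta00_imag_sum by auto.
    apply (dominated_convergence eventually _ (fun h n => RtoC (polya_fourier h n)) _ (fun n => exp (- (PI * y / 9 * IZR n ^ 2)))).
    - apply exp_sq_decay_summable. apply Rdiv_lt_0_compat; [apply Rmult_lt_0_compat; auto|lra].
    - intros n _. apply is_lim_seq_RtoC. apply polya_fourier_lim.
    - exists 0%nat. intros h _ n _. pose proof (polya_fourier_bound h n). rewrite Cmod_R, Rabs_pos_eq; lra.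
    - intros n _. rewrite Cmod_R, Rabs_pos_eq by (left; apply exp_pos).
      assert (B : PI * y / 9 * IZR n ^ 2 <= PI * y * IZR n ^ 2).
      { apply Rmult_le_compat_r. apply pow2_ge_0. assert (0 < PI * y) by (apply Rmult_lt_0_compat; auto). lra. }
      destruct (Rle_lt_or_eq_dec _ _ B) as [Q|Q]. left; apply exp_increasing; lra. rewrite Q; lra. }
  assert (HW : filterlim W eventually (locally (T := C_UniformSpace) (theta 0 0 (/ y * Ci)))).
  { rewrite <- RtoC_inv by lra. rewrite <- theta00_imag_sum by auto.
    set (c := Rmin (/ (2 * (y / PI + 1))) (PI * / y)).
    assert (Hc0 : 0 < / (2 * (y / PI + 1))). { apply Rinv_0_lt_compat. assert (0 < y / PI) by (apply Rdiv_lt_0_compat; auto). lra. }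
    assert (Hc1 : 0 < PI * / y) by (apply Rmult_lt_0_compat; auto).
    assert (Hc : 0 < c) by (apply Rmin_pos; auto).
    assert (mono : forall c' n, c <= c' -> exp (- (c' * IZR n ^ 2)) <= exp (- (c * IZR n ^ 2))).
    { intros c' n Hcc. assert (B : c * IZR n ^ 2 <= c' * IZR n ^ 2) by (apply Rmult_le_compat_r; auto; apply pow2_ge_0).
      destruct (Rle_lt_or_eq_dec _ _ B) as [Q|Q]. left; apply exp_increasing; lra. rewrite Q; lra. }
    apply (dominated_convergence eventually _ (fun h n => RtoC (polya_walk h n)) _ (fun n => exp (- (c * IZR n ^ 2)))).
    - apply exp_sq_decay_summable. auto.
    - intros n _. apply is_lim_seq_RtoC. apply polya_walk_lim.
    - exists 0%nat. intros h _ n _. pose proof (polya_walk_bound h n) as [B1 B2]. rewrite Cmod_R, Rabs_pos_eq by auto.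
      eapply Rle_trans; [exact B2|]. apply mono. apply Rmin_l.
    - intros n _. rewrite Cmod_R, Rabs_pos_eq by (left; apply exp_pos). apply mono. apply Rmin_r. }
  assert (HA : filterlim (fun h => RtoC ((L h * walk (m h) 0) ^ 2)) eventually (locally (T := C_UniformSpace) (RtoC (PI * kap / y)))).
  { apply is_lim_seq_RtoC.
    apply (is_lim_seq_ext (fun h => (INR (m h) * walk (m h) 0 ^ 2) / (INR (m h) / L h ^ 2))%R).
    - intros h. pose proof (polya_L_pos h). pose proof (polya_m_pos h). field. lra.
    - replace (PI * kap / y)%R with (kap / (y / PI))%R by (field; lra).
      apply is_lim_seq_div'. 2: apply polya_m_lim. 2: apply Rgt_not_eq, Rdiv_lt_0_compat; auto.
      apply (is_lim_seq_subseq (fun n => INR n * walk n 0 ^ 2)%R kap m); auto. apply polya_m_infty. }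
  assert (H1 : filterlim (fun h => E h ^ 2) eventually (locally (T := C_UniformSpace) (theta 0 0 (y * Ci) ^ 2))).
  { simpl. apply C_filterlim_mult; auto. apply eventually_filter. apply C_filterlim_mult; auto. apply eventually_filter. apply filterlim_const. }
  assert (H2 : filterlim (fun h => E h ^ 2) eventually (locally (T := C_UniformSpace) (RtoC (PI * kap / y) * theta 0 0 (/ y * Ci) ^ 2))).
  { apply (filterlim_ext (fun h => RtoC ((L h * walk (m h) 0) ^ 2) * W h ^ 2)).
    - intros h. unfold E. rewrite polya_identity. fold (W h). rewrite RtoC_pow. simpl. ring.
    - apply C_filterlim_mult; auto. apply eventually_filter.
      simpl. apply C_filterlim_mult; auto. apply eventually_filter. apply C_filterlim_mult; auto. apply eventually_filter. apply filterlim_const. }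
  apply (filterlim_locally_unique (K := C_AbsRing) (V := C_NormedModule) _ _ _ H1 H2).
Qed.
End polya.

(* The fixed point y = 1 determines the constant, so Stirling's formula is not needed. *)
Lemma wallis_constant (kap : R) : is_lim_seq (fun n => INR n * walk n 0 ^ 2)%R kap -> (PI * kap = 1)%R.
Proof.
  intros Hk. pose proof (theta00_polya 1 ltac:(lra) kap Hk) as E.
  replace (/ 1 * Ci) with (1 * Ci) in E by (rewrite <- RtoC_inv by lra; do 2 f_equal; field).
  destruct (theta00_imag_pos 1 ltac:(lra)) as (r & Hr & Er). rewrite Er in E.
  rewrite <- RtoC_pow, <- RtoC_mult in E. apply RtoC_inj in E.
  replace (PI * kap / 1)%R with (PI * kap)%R in E by field.
  apply Rmult_eq_reg_r with (r ^ 2)%R; [lra|]. apply pow_nonzero. lra.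
Qed.

Theorem theta00_inversion_imag (y : R) : 0 < y ->
  theta 0 0 (/ y * Ci) = RtoC (sqrt y) * theta 0 0 (y * Ci).
Proof.
  intros Hy. destruct wallis_limit as [kap Hk]. pose proof (theta00_polya y Hy kap Hk) as E.
  rewrite (wallis_constant kap Hk) in E. pose proof (Rinv_0_lt_compat y Hy) as Hiy.
  destruct (theta00_imag_pos y Hy) as (r & Hr & Er). destruct (theta00_imag_pos (/ y) Hiy) as (s & Hs & Es).
  rewrite RtoC_inv in Es by lra. rewrite Er, Es in *. rewrite <- !RtoC_pow, <- RtoC_mult in E. apply RtoC_inj in E.
  rewrite <- RtoC_mult. f_equal. apply Rsqr_inj; [lra| |].
  - apply Rmult_le_pos; [apply sqrt_pos|lra].
  - unfold Rsqr. replace (sqrt y * r * (sqrt y * r))%R with ((sqrt y * sqrt y) * r ^ 2)%R by ring.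
    rewrite sqrt_sqrt, E by lra. field. lra.
Qed.

(** * Jacobi's identity and Ramanujan's differential equations *)

Lemma UHP_scale (tau : C) (x : R) : 0 < x -> UHP tau -> UHP (x * tau).
Proof. intros Hx Ht. unfold upper_half_plane in *. rewrite im_scal_l. apply Rmult_lt_0_compat; auto. Qed.

(** Even n = 2 a give a^2 (4 tau), odd n = 2 a + 1 give (a + 1/2)^2 (4 tau). With [theta01_split]
    this carries the inversion of [theta] 0 0 over to the pair [theta] 1 0, [theta] 0 1. *)
Lemma theta00_split (tau : C) : UHP tau -> theta 0 0 tau = theta 0 0 (4 * tau) + theta 1 0 (4 * tau).
Proof.
  intros Ht. assert (H4 : UHP (4 * tau)) by (apply UHP_scale; [lra|auto]).
  apply theta_eq.
  assert (Be : bijection (fun n => Z.Even n) (fun _ => True) (fun n => (n / 2)%Z)).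
  { repeat split; auto.
    - intros i j [a ->] [b ->]. rewrite !(Z.mul_comm 2), !Z.div_mul by lia. lia.
    - intros k _. exists (2 * k)%Z. split. exists k; auto. rewrite Z.mul_comm, Z.div_mul; lia. }
  assert (Bo : bijection (fun n => Z.Odd n) (fun _ => True) (fun n => (n / 2)%Z)).
  { assert (Q : forall a, ((2 * a + 1) / 2 = a)%Z) by (intros a; symmetry; apply (Z.div_unique _ 2 a 1); lia).
    repeat split; auto.
    - intros i j [a ->] [b ->]. rewrite !Q. lia.
    - intros k _. exists (2 * k + 1)%Z. split. exists k; auto. apply Q. }
  pose proof (is_sum_bijection _ _ _ _ _ Be (theta_is_sum 0 0 _ H4)) as Se.
  pose proof (is_sum_bijection _ _ _ _ _ Bo (theta_is_sum 1 0 _ H4)) as So.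
  assert (Se' : is_sum_over (fun n => Z.Even n) (fun n => theta_term 0 0 n tau) (theta 0 0 (4 * tau))).
  { revert Se. apply is_sum_ext. intros n [a ->]. rewrite (Z.mul_comm 2), Z.div_mul by lia. unfold theta_term. f_equal.
    rewrite mult_IZR, RtoC_mult. simpl. field. }
  assert (So' : is_sum_over (fun n => Z.Odd n) (fun n => theta_term 0 0 n tau) (theta 1 0 (4 * tau))).
  { revert So. apply is_sum_ext. intros n [a ->].
    replace ((2 * a + 1) / 2)%Z with a by (apply (Z.div_unique _ 2 a 1); lia). unfold theta_term. f_equal.
    rewrite plus_IZR, mult_IZR, RtoC_plus, RtoC_mult. simpl. field. }
  apply (is_sum_bijection (fun _ => True) (fun n => Z.Even n \/ Z.Odd n) (fun n => n) _ _).
  - repeat split; auto. intros i _. apply Z.Even_or_Odd. intros k _. exists k; auto.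
  - apply is_sum_union; auto. intros i He Ho. apply (Z.Even_Odd_False i He Ho).
Qed.

(** Translating [theta00_split] by 1 moves 4 tau by 4, which multiplies [theta] 1 0 by exp(pi i/4)^4
    = -1. *)
Lemma theta01_split (tau : C) : UHP tau -> theta 0 1 tau = theta 0 0 (4 * tau) - theta 1 0 (4 * tau).
Proof.
  intros Ht. assert (H4 : UHP (4 * tau)) by (apply UHP_scale; [lra|auto]).
  assert (S : forall x : R, UHP (4 * tau + x)) by (intros; apply UHP_shift; auto).
  rewrite <- theta00_shift by auto. rewrite theta00_split by (apply (UHP_shift tau 1); auto).
  replace (4 * (tau + 1)) with (4 * tau + 1 + 1 + 1 + 1) by ring.
  assert (E : forall z, UHP z -> theta 0 0 (z + 1 + 1) = theta 0 0 z).
  { intros z Hz. rewrite theta00_shift, theta01_shift; auto. apply (UHP_shift z 1); auto. }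
  assert (K : Cexp (PI * Ci / 4) * (Cexp (PI * Ci / 4) * (Cexp (PI * Ci / 4) * Cexp (PI * Ci / 4))) = - (1)).
  { rewrite <- !Cexp_plus, <- Cexp_PI_Ci. f_equal. field. }
  assert (S1 : forall z, UHP z -> UHP (z + 1)) by (intros z; apply (UHP_shift z 1)).
  rewrite !E by auto. rewrite !theta10_shift by auto.
  match goal with |- _ + ?x = _ => match x with context [theta 1 0 ?w] => set (t := theta 1 0 w) end end.
  match goal with |- ?a + ?x = ?a - t => replace x with ((Cexp (PI * Ci / 4) * (Cexp (PI * Ci / 4) * (Cexp (PI * Ci / 4) * Cexp (PI * Ci / 4)))) * t) by ring end.
  rewrite K. ring.
Qed.

(** Split [theta] 0 0 at i/(4 y): both its value there and its part [theta] 0 0 at i/y are known by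
    inversion, and their difference is the split of [theta] 0 1 at i y, times sqrt y. *)
Theorem theta10_inversion_imag (y : R) : 0 < y ->
  theta 1 0 (/ y * Ci) = RtoC (sqrt y) * theta 0 1 (y * Ci).
Proof.
  intros Hy. pose proof (Rinv_0_lt_compat y Hy) as Hiy.
  assert (Ny : RtoC y <> 0) by (intros E; apply RtoC_inj in E; lra).
  assert (H4 : 0 < 4 * y) by lra.
  pose proof (theta00_inversion_imag (4 * y) H4) as E4y.
  rewrite sqrt_mult in E4y by lra. replace (sqrt 4) with 2%R in E4y.
  2:{ replace 4%R with (2 * 2)%R by ring. rewrite sqrt_square; lra. }
  assert (U : UHP (/ RtoC (4 * y) * Ci)).
  { rewrite <- RtoC_inv by lra. apply UHP_imag. apply Rinv_0_lt_compat; lra. }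
  pose proof (theta00_split _ U) as Sp.
  replace (4 * (/ RtoC (4 * y) * Ci)) with (/ y * Ci) in Sp by (rewrite RtoC_mult; field; auto).
  rewrite E4y, theta00_inversion_imag in Sp by auto.
  pose proof (theta00_split (y * Ci) (UHP_imag y Hy)) as S0. pose proof (theta01_split (y * Ci) (UHP_imag y Hy)) as S1.
  replace (4 * (y * Ci)) with (RtoC (4 * y) * Ci) in S0, S1 by (rewrite RtoC_mult; ring).
  rewrite S1. rewrite S0 in Sp. rewrite RtoC_mult in Sp.
  set (a := theta 0 0 (RtoC (4 * y) * Ci)) in *. set (b := theta 1 0 (RtoC (4 * y) * Ci)) in *. set (s := RtoC (sqrt y)) in *.
  replace (theta 1 0 (/ y * Ci)) with (s * (a + b) + theta 1 0 (/ y * Ci) - s * (a + b)) by ring.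
  rewrite <- Sp. ring.
Qed.

Lemma cder_inv_opp (tau : C) : tau <> 0 -> cder (fun t => - / t) tau (/ tau ^ 2).
Proof.
  intros N. eapply cder_val. { apply cder_opp. apply cder_inv. exact N. apply cder_id. } simpl. field. auto.
Qed.

Lemma UHP_segment (a b : C) (s : R) : 0 <= s <= 1 -> UHP a -> UHP b -> UHP (a + s * (b - a)).
Proof.
  intros Hs Ha Hb. unfold upper_half_plane in *. rewrite im_plus, im_scal_l, im_minus.
  destruct (Req_dec s 1) as [->|N]; [lra|].
  apply Rlt_le_trans with ((1 - s) * Im a)%R; [apply Rmult_lt_0_compat; lra|].
  assert (0 <= s * Im b) by (apply Rmult_le_pos; lra). lra.
Qed.

Lemma UHP_identity_imag (f : C -> C) : holomorphic_on UHP f ->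
  (forall y : R, 0 < y -> f (y * Ci) = 0) -> forall tau, UHP tau -> f tau = 0.
Proof.
  intros Hf Hz tau Ht. assert (H1 : UHP Ci) by (unfold upper_half_plane; simpl; lra).
  apply (identity_segment UHP f Ci tau UHP_open Hf).
  - intros s Hs. apply UHP_segment; auto.
  - intros eps He. exists (RtoC (eps / 2) * Ci). rewrite Cmod_mult, Cmod_Ci, Cmod_R, Rabs_pos_eq by lra.
    split; [lra|]. replace (Ci + RtoC (eps / 2) * Ci) with (RtoC (1 + eps / 2) * Ci) by (rewrite RtoC_plus; ring).
    apply Hz. lra.
Qed.

Lemma imag_inversion (y : R) : 0 < y -> - / (y * Ci) = / y * Ci.
Proof.
  intros Hy. assert (Ny : RtoC y <> 0) by (intros E; apply RtoC_inj in E; lra). pose proof Ci_nz.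
  replace (/ (y * Ci)) with (/ y * / Ci) by (field; auto). rewrite Ci_inv. ring.
Qed.

(** Squaring replaces sqrt(- i tau), which would need a branch, by - i tau. Both sides are then
    holomorphic and agree on the imaginary axis. *)
Lemma theta_inversion_square (p q p' q' : Z) :
  (forall y : R, 0 < y -> theta p q (/ y * Ci) = RtoC (sqrt y) * theta p' q' (y * Ci)) ->
  forall tau, UHP tau -> theta p q (- / tau) ^ 2 = - Ci * tau * theta p' q' tau ^ 2.
Proof.
  intros Him tau Ht.
  apply Ceq_minus. apply (UHP_identity_imag (fun tau => theta p q (- / tau) ^ 2 - - Ci * tau * theta p' q' tau ^ 2)); auto.
  - intros z Hz. eapply cder_ex. apply cder_minus.
    + apply cder_pow. apply (cder_comp (theta p q) (fun t => - / t)). apply cder_inv_opp. apply UHP_nonzero; auto.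
      apply ex_Cderive_cder. apply theta_holomorphic. apply UHP_inv_opp; auto.
    + apply cder_mult. apply cder_scal. apply cder_id. apply cder_pow. apply ex_Cderive_cder. apply theta_holomorphic; auto.
  - intros y Hy. rewrite imag_inversion, Him by auto.
    replace ((RtoC (sqrt y) * theta p' q' (y * Ci)) ^ 2) with (RtoC (sqrt y) ^ 2 * theta p' q' (y * Ci) ^ 2) by (simpl; ring).
    rewrite <- RtoC_pow. replace (sqrt y ^ 2)%R with y by (simpl; rewrite Rmult_1_r, sqrt_sqrt; lra).
    replace (- Ci * (y * Ci)) with (- (Ci * Ci) * y) by ring.
    replace (Ci * Ci) with (- RtoC 1) by (apply injective_projections; simpl; ring). ring.
Qed.

(** * Fourth powers of the theta constants and Jacobi's identity *)

Definition thA (tau : C) : C := theta 0 0 tau ^ 4.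
Definition thB (tau : C) : C := theta 0 1 tau ^ 4.
Definition thC (tau : C) : C := theta 1 0 tau ^ 4.

Lemma thA_inversion tau : UHP tau -> thA (- / tau) = - tau ^ 2 * thA tau.
Proof.
  intros Ht. unfold thA. replace 4%nat with (2 * 2)%nat by reflexivity. rewrite !Cpow_mult_r.
  rewrite (theta_inversion_square 0 0 0 0 theta00_inversion_imag) by auto.
  replace ((- Ci * tau * theta 0 0 tau ^ 2) ^ 2) with ((Ci * Ci) * tau ^ 2 * (theta 0 0 tau ^ 2) ^ 2) by (simpl; ring).
  replace (Ci * Ci) with (- RtoC 1) by (apply injective_projections; simpl; ring). ring.
Qed.

Lemma thC_inversion tau : UHP tau -> thC (- / tau) = - tau ^ 2 * thB tau.
Proof.
  intros Ht. unfold thC, thB. replace 4%nat with (2 * 2)%nat by reflexivity. rewrite !Cpow_mult_r.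
  rewrite (theta_inversion_square 1 0 0 1 theta10_inversion_imag) by auto.
  replace ((- Ci * tau * theta 0 1 tau ^ 2) ^ 2) with ((Ci * Ci) * tau ^ 2 * (theta 0 1 tau ^ 2) ^ 2) by (simpl; ring).
  replace (Ci * Ci) with (- RtoC 1) by (apply injective_projections; simpl; ring). ring.
Qed.

Lemma thB_inversion tau : UHP tau -> thB (- / tau) = - tau ^ 2 * thC tau.
Proof.
  intros Ht. pose proof (UHP_nonzero tau Ht) as N. pose proof (thC_inversion (- / tau) (UHP_inv_opp tau Ht)) as E.
  replace (- / - / tau) with tau in E.
  2:{ field. repeat split; auto. }
  rewrite E. simpl. field. auto.
Qed.

Lemma thA_shift tau : UHP tau -> thA (tau + 1) = thB tau.
Proof. intros Ht. unfold thA, thB. rewrite theta00_shift; auto. Qed.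

Lemma thB_shift tau : UHP tau -> thB (tau + 1) = thA tau.
Proof. intros Ht. unfold thA, thB. rewrite theta01_shift; auto. Qed.

Lemma thC_shift tau : UHP tau -> thC (tau + 1) = - thC tau.
Proof.
  intros Ht. unfold thC. rewrite theta10_shift by auto. rewrite Cpow_mult_l, Cexp_pow.
  replace (INR 4 * (PI * Ci / 4)) with (PI * Ci) by (simpl; rewrite !RtoC_plus; field).
  rewrite Cexp_PI_Ci. ring.
Qed.

Lemma holomorphic_cder (f : C -> C) tau : holomorphic_on UHP f -> UHP tau -> cder f tau (C_derive f tau).
Proof. intros Hf Ht. apply ex_Cderive_cder. apply Hf; auto. Qed.

Lemma thA_holomorphic : holomorphic_on UHP thA.
Proof. intros tau Ht. eapply cder_ex. apply cder_pow. apply holomorphic_cder; auto. apply theta_holomorphic. Qed.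
Lemma thB_holomorphic : holomorphic_on UHP thB.
Proof. intros tau Ht. eapply cder_ex. apply cder_pow. apply holomorphic_cder; auto. apply theta_holomorphic. Qed.
Lemma thC_holomorphic : holomorphic_on UHP thC.
Proof. intros tau Ht. eapply cder_ex. apply cder_pow. apply holomorphic_cder; auto. apply theta_holomorphic. Qed.

Section holomorphic_algebra.
Variables (U : C -> Prop) (f g : C -> C).
Hypotheses (Hf : holomorphic_on U f) (Hg : holomorphic_on U g).
Lemma holomorphic_plus : holomorphic_on U (fun z => f z + g z).
Proof. intros z Hz. eapply cder_ex. apply cder_plus; apply ex_Cderive_cder; auto. Qed.
Lemma holomorphic_minus : holomorphic_on U (fun z => f z - g z).
Proof. intros z Hz. eapply cder_ex. apply cder_minus; apply ex_Cderive_cder; auto. Qed.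
Lemma holomorphic_mult : holomorphic_on U (fun z => f z * g z).
Proof. intros z Hz. eapply cder_ex. apply cder_mult; apply ex_Cderive_cder; auto. Qed.
Lemma holomorphic_div : (forall z, U z -> g z <> 0) -> holomorphic_on U (fun z => f z / g z).
Proof. intros Hn z Hz. eapply cder_ex. apply cder_div; auto; apply ex_Cderive_cder; auto. Qed.
Lemma holomorphic_pow (n : nat) : holomorphic_on U (fun z => f z ^ n).
Proof. intros z Hz. eapply cder_ex. apply cder_pow. apply ex_Cderive_cder; auto. Qed.
Lemma holomorphic_const (c : C) : holomorphic_on U (fun _ => c).
Proof. intros z Hz. eapply cder_ex. apply cder_const. Qed.
End holomorphic_algebra.

Definition thC_reduced (tau : C) : C := theta10_reduced tau ^ 4.

Lemma thC_factor tau : thC tau = Cexp (PI * Ci * tau) * thC_reduced tau.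
Proof.
  unfold thC, thC_reduced. rewrite theta10_factor, Cpow_mult_l, Cexp_pow. do 2 f_equal.
  simpl. rewrite !RtoC_plus. field.
Qed.

Lemma thA_cusp : tends_cusp thA 1.
Proof. eapply tends_cusp_val. apply tends_cusp_pow. apply theta0_cusp. simpl; ring. Qed.
Lemma thB_cusp : tends_cusp thB 1.
Proof. eapply tends_cusp_val. apply tends_cusp_pow. apply theta0_cusp. simpl; ring. Qed.
Lemma thC_reduced_cusp : tends_cusp thC_reduced 16.
Proof.
  eapply tends_cusp_val. apply tends_cusp_pow. apply theta10_reduced_cusp.
  rewrite <- RtoC_pow. f_equal. ring.
Qed.

Lemma Cexp_PI_Ci_cusp : tends_cusp (fun tau => Cexp (PI * Ci * tau)) 0.
Proof.
  assert (N : IZR 1 + 0 / 2 <> 0).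
  { intros E. apply (f_equal Re) in E. simpl in E. lra. }
  apply (tends_cusp_ext (theta_term 0 0 1)); [|apply (Cmod_theta_term_small 0 0 1 N)].
  intros tau _. unfold theta_term. f_equal. simpl. field.
Qed.

Lemma thC_cusp : tends_cusp thC 0.
Proof.
  apply (tends_cusp_ext (fun tau => Cexp (PI * Ci * tau) * thC_reduced tau)). { intros; symmetry; apply thC_factor. }
  eapply tends_cusp_val. apply tends_cusp_mult. apply Cexp_PI_Ci_cusp. apply thC_reduced_cusp. ring.
Qed.

Theorem Jacobi_identity tau : UHP tau -> thA tau = thB tau + thC tau.
Proof.
  intros Ht. apply Ceq_minus.
  assert (E : (thA tau - thB tau - thC tau) ^ 2 = 0).
  { apply (small_weight_vanishing (fun tau => (thA tau - thB tau - thC tau) ^ 2) 2); auto.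
    - apply (holomorphic_pow UHP (fun tau => thA tau - thB tau - thC tau)).
      apply (holomorphic_minus UHP (fun tau => thA tau - thB tau) thC); [|apply thC_holomorphic].
      apply (holomorphic_minus UHP thA thB). apply thA_holomorphic. apply thB_holomorphic.
    - intros t Hh. rewrite thA_shift, thB_shift, thC_shift by auto. simpl; ring.
    - intros t Hh. rewrite thA_inversion, thB_inversion, thC_inversion by auto. simpl; ring.
    - eapply tends_cusp_val.
      + apply tends_cusp_pow. apply tends_cusp_minus. apply tends_cusp_minus. apply thA_cusp. apply thB_cusp. apply thC_cusp.
      + simpl; ring. }
  replace (thA tau - (thB tau + thC tau)) with (thA tau - thB tau - thC tau) by ring.
  destruct (Ceq_dec (thA tau - thB tau - thC tau) 0) as [Z|Z]; auto.
  exfalso. apply (Cpow_nz _ 2 Z). exact E.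
Qed.

Definition thABC (tau : C) : C := thA tau * thB tau * thC tau.

Lemma thABC_shift tau : UHP tau -> thABC (tau + 1) = - thABC tau.
Proof. intros Ht. unfold thABC. rewrite thA_shift, thB_shift, thC_shift by auto. ring. Qed.

Lemma thABC_inversion tau : UHP tau -> thABC (- / tau) = - tau ^ 6 * thABC tau.
Proof. intros Ht. unfold thABC. rewrite thA_inversion, thB_inversion, thC_inversion by auto. simpl; ring. Qed.

Lemma thABC_holomorphic : holomorphic_on UHP thABC.
Proof.
  apply (holomorphic_mult UHP (fun t => thA t * thB t) thC); [|apply thC_holomorphic].
  apply (holomorphic_mult UHP thA thB). apply thA_holomorphic. apply thB_holomorphic.
Qed.

(** Zeros are carried along by both generators, and from height 3/4 on each theta constant is
    nonzero by direct estimate. *)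
Theorem thABC_nonzero tau : UHP tau -> thABC tau <> 0.
Proof.
  revert tau. apply modular_reduction.
  - intros tau Ht N E. apply N. rewrite thABC_shift, E by auto. ring.
  - intros tau Ht N E. apply N.
    assert (U : UHP (tau - 1)) by (unfold upper_half_plane in *; rewrite im_minus, im_RtoC; lra).
    pose proof (thABC_shift (tau - 1) U) as Q. replace (tau - 1 + 1) with tau in Q by ring. rewrite E in Q.
    replace (thABC (tau - 1)) with (- - thABC (tau - 1)) by ring. rewrite <- Q. ring.
  - intros tau Ht N E. apply N. rewrite thABC_inversion, E by auto. ring.
  - intros tau Ht. unfold thABC, thA, thB, thC.
    assert (T0 := theta0_nonzero 0 tau Ht). assert (T1 := theta0_nonzero 1 tau Ht). assert (T2 := theta10_nonzero tau Ht).
    auto using Cmult_neq_0, Cpow_nz.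
Qed.

(** * Theta expressions of E4, E6 and the discriminant, and their differential equations *)

Definition thE4 (tau : C) : C := (thA tau ^ 2 + thB tau ^ 2 + thC tau ^ 2) / 2.
(** The classical factorization of E6 by theta constants. *)
Definition thE6 (tau : C) : C := (thA tau + thB tau) * (thA tau + thC tau) * (thB tau - thC tau) / 2.
(** This is 256 eta^24; with this normalization E4^3 - E6^2 carries 27/4 in place of 1728. *)
Definition thDelta (tau : C) : C := thABC tau ^ 2.

Lemma two_nonzero : RtoC 2 <> 0.
Proof. intros E. apply RtoC_inj in E. lra. Qed.

Lemma thE4_holomorphic : holomorphic_on UHP thE4.
Proof.
  apply (holomorphic_div UHP (fun t => thA t ^ 2 + thB t ^ 2 + thC t ^ 2) (fun _ => 2)).
  - apply (holomorphic_plus UHP (fun t => thA t ^ 2 + thB t ^ 2) (fun t => thC t ^ 2)).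
    + apply (holomorphic_plus UHP (fun t => thA t ^ 2) (fun t => thB t ^ 2)); apply holomorphic_pow.
      apply thA_holomorphic. apply thB_holomorphic.
    + apply holomorphic_pow. apply thC_holomorphic.
  - apply holomorphic_const.
  - intros; apply two_nonzero.
Qed.

Lemma thE6_holomorphic : holomorphic_on UHP thE6.
Proof.
  pose proof thA_holomorphic as HA. pose proof thB_holomorphic as HB. pose proof thC_holomorphic as HC.
  apply (holomorphic_div UHP (fun t => (thA t + thB t) * (thA t + thC t) * (thB t - thC t)) (fun _ => 2)).
  - apply (holomorphic_mult UHP (fun t => (thA t + thB t) * (thA t + thC t)) (fun t => thB t - thC t)).
    + apply (holomorphic_mult UHP (fun t => thA t + thB t) (fun t => thA t + thC t)); apply holomorphic_plus; auto.
    + apply holomorphic_minus; auto.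
  - apply holomorphic_const.
  - intros; apply two_nonzero.
Qed.

Lemma thDelta_holomorphic : holomorphic_on UHP thDelta.
Proof. apply holomorphic_pow. apply thABC_holomorphic. Qed.

Lemma thE4_shift tau : UHP tau -> thE4 (tau + 1) = thE4 tau.
Proof. intros Ht. unfold thE4. rewrite thA_shift, thB_shift, thC_shift by auto. simpl. field. Qed.

Lemma thE6_shift tau : UHP tau -> thE6 (tau + 1) = thE6 tau.
Proof. intros Ht. unfold thE6. rewrite thA_shift, thB_shift, thC_shift by auto. rewrite Jacobi_identity by auto. simpl. field. Qed.

Lemma thDelta_shift tau : UHP tau -> thDelta (tau + 1) = thDelta tau.
Proof. intros Ht. unfold thDelta. rewrite thABC_shift by auto. simpl. ring. Qed.

Lemma thE4_inversion tau : UHP tau -> thE4 (- / tau) = tau ^ 4 * thE4 tau.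
Proof. intros Ht. unfold thE4. rewrite thA_inversion, thB_inversion, thC_inversion by auto. simpl. field. Qed.

Lemma thE6_inversion tau : UHP tau -> thE6 (- / tau) = tau ^ 6 * thE6 tau.
Proof. intros Ht. unfold thE6. rewrite thA_inversion, thB_inversion, thC_inversion by auto. simpl. field. Qed.

Lemma thDelta_inversion tau : UHP tau -> thDelta (- / tau) = tau ^ 12 * thDelta tau.
Proof. intros Ht. unfold thDelta. rewrite thABC_inversion by auto. simpl. ring. Qed.

Lemma thDelta_nonzero tau : UHP tau -> thDelta tau <> 0.
Proof. intros Ht. apply Cpow_nz. apply thABC_nonzero; auto. Qed.

Lemma thE4_cusp : tends_cusp thE4 1.
Proof.
  eapply tends_cusp_val.
  - apply (tends_cusp_div (fun t => thA t ^ 2 + thB t ^ 2 + thC t ^ 2) (fun _ => 2)). apply two_nonzero.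
    apply tends_cusp_plus. apply tends_cusp_plus.
    apply tends_cusp_pow, thA_cusp. apply tends_cusp_pow, thB_cusp. apply tends_cusp_pow, thC_cusp. apply tends_cusp_const.
  - simpl. field.
Qed.

Lemma thE6_cusp : tends_cusp thE6 1.
Proof.
  eapply tends_cusp_val.
  - apply (tends_cusp_div (fun t => (thA t + thB t) * (thA t + thC t) * (thB t - thC t)) (fun _ => 2)). apply two_nonzero.
    apply tends_cusp_mult. apply tends_cusp_mult.
    apply tends_cusp_plus. apply thA_cusp. apply thB_cusp. apply tends_cusp_plus. apply thA_cusp. apply thC_cusp.
    apply tends_cusp_minus. apply thB_cusp. apply thC_cusp. apply tends_cusp_const.
  - field.
Qed.

Lemma discriminant_identity tau : UHP tau -> thE4 tau ^ 3 - thE6 tau ^ 2 = 27 / 4 * thDelta tau.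
Proof.
  intros Ht. unfold thE4, thE6, thDelta, thABC. rewrite Jacobi_identity by auto. simpl. field.
Qed.

(* 2 pi i times the quasi-modular E2. *)
Definition logderiv_Delta (tau : C) : C := C_derive thDelta tau / thDelta tau.

Lemma logderiv_Delta_holomorphic : holomorphic_on UHP logderiv_Delta.
Proof.
  apply (holomorphic_div UHP (C_derive thDelta) thDelta).
  - apply holomorphic_derive. apply UHP_open. apply thDelta_holomorphic.
  - apply thDelta_holomorphic.
  - apply thDelta_nonzero.
Qed.

Lemma cder_unique_on (U : C -> Prop) (f g : C -> C) (z a b : C) : Copen U -> U z ->
  (forall w, U w -> f w = g w) -> cder f z a -> cder g z b -> a = b.
Proof.
  intros HU Hz E Hf Hg. destruct (HU z Hz) as (r & Hr & HO).
  rewrite <- (cder_C_derive g z b Hg). symmetry. apply cder_C_derive.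
  apply (cder_ext_loc f g z a r); auto.
Qed.

Lemma cder_shift (f : C -> C) (c z : C) (l : C) : cder f (z + c) l -> cder (fun w => f (w + c)) z l.
Proof.
  intros Hf. eapply cder_val.
  - apply (cder_comp f (fun w => w + c)). apply cder_plus. apply cder_id. apply cder_const. exact Hf.
  - ring.
Qed.

Lemma derive_shift (f : C -> C) : holomorphic_on UHP f -> (forall tau, UHP tau -> f (tau + 1) = f tau) ->
  forall tau, UHP tau -> C_derive f (tau + 1) = C_derive f tau.
Proof.
  intros Hf Hs tau Ht. apply (cder_unique_on UHP (fun w => f (w + 1)) f tau); auto. apply UHP_open.
  - apply cder_shift. apply holomorphic_cder; auto. apply (UHP_shift tau 1); auto.
  - apply holomorphic_cder; auto.
Qed.

Lemma cder_inversion (f : C -> C) tau : holomorphic_on UHP f -> UHP tau ->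
  cder (fun t => f (- / t)) tau (C_derive f (- / tau) / tau ^ 2).
Proof.
  intros Hf Ht. apply (cder_comp f (fun t => - / t)). apply cder_inv_opp. apply UHP_nonzero; auto.
  apply holomorphic_cder; auto. apply UHP_inv_opp; auto.
Qed.

Lemma derive_inversion (f g : C -> C) (l : C) tau : holomorphic_on UHP f -> UHP tau ->
  (forall t, UHP t -> f (- / t) = g t) -> cder g tau l -> C_derive f (- / tau) = tau ^ 2 * l.
Proof.
  intros Hf Ht E Hg. pose proof (UHP_nonzero tau Ht) as N.
  rewrite <- (cder_unique_on UHP _ _ tau _ _ UHP_open Ht E (cder_inversion f tau Hf Ht) Hg).
  field. auto.
Qed.

Lemma derive_weight (f : C -> C) (n : nat) tau : holomorphic_on UHP f ->
  (forall t, UHP t -> f (- / t) = t ^ n * f t) -> UHP tau ->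
  C_derive f (- / tau) = tau ^ 2 * (INR n * tau ^ (n - 1) * f tau + tau ^ n * C_derive f tau).
Proof.
  intros Hf HS Ht. apply (derive_inversion f (fun t => t ^ n * f t)); auto.
  eapply cder_val.
  - apply cder_mult. apply cder_pow. apply cder_id. apply holomorphic_cder; auto.
  - simpl. rewrite Nat.sub_1_r. ring.
Qed.

Lemma logderiv_Delta_inversion tau : UHP tau ->
  logderiv_Delta (- / tau) = tau ^ 2 * logderiv_Delta tau + 12 * tau.
Proof.
  intros Ht. unfold logderiv_Delta.
  rewrite (derive_weight thDelta 12 tau thDelta_holomorphic thDelta_inversion Ht), thDelta_inversion by auto.
  pose proof (thDelta_nonzero tau Ht). pose proof (UHP_nonzero tau Ht).
  replace (INR 12) with 12%R by (simpl; ring). simpl. field. auto.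
Qed.

Lemma logderiv_Delta_shift tau : UHP tau -> logderiv_Delta (tau + 1) = logderiv_Delta tau.
Proof.
  intros Ht. unfold logderiv_Delta. rewrite (derive_shift thDelta thDelta_holomorphic thDelta_shift), thDelta_shift; auto.
Qed.

Lemma theta10_reduced_holomorphic : holomorphic_on UHP theta10_reduced.
Proof.
  intros tau Ht. eapply cder_ex. apply cder_mult. apply cder_Cexp_linear.
  apply holomorphic_cder; auto. apply theta_holomorphic.
Qed.

(** Since Delta = q U with U tending to 256, the logarithmic derivative is kappa + U'/U, and U'
    tends to 0. *)
Lemma logderiv_Delta_cusp : tends_cusp logderiv_Delta kappa.
Proof.
  set (U := fun t => (thA t * thB t * thC_reduced t) ^ 2).
  assert (HU : holomorphic_on UHP U).
  { apply (holomorphic_pow UHP (fun t => thA t * thB t * thC_reduced t)).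
    apply (holomorphic_mult UHP (fun t => thA t * thB t) thC_reduced).
    - apply (holomorphic_mult UHP thA thB). apply thA_holomorphic. apply thB_holomorphic.
    - apply holomorphic_pow. apply theta10_reduced_holomorphic. }
  assert (EU : forall t, thDelta t = qexp t * U t).
  { intros t. unfold thDelta, thABC, U, qexp. rewrite thC_factor.
    replace (kappa * t) with (PI * Ci * t + PI * Ci * t) by (unfold kappa; ring). rewrite Cexp_plus. simpl. ring. }
  assert (NU : forall t, UHP t -> U t <> 0).
  { intros t Ht E. apply (thDelta_nonzero t Ht). rewrite EU, E. ring. }
  apply (tends_cusp_ext (fun t => kappa + C_derive U t / U t)).
  - intros t Ht. unfold logderiv_Delta.
    rewrite (cder_C_derive thDelta t (kappa * qexp t * U t + qexp t * C_derive U t)).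
    + rewrite EU. pose proof (NU t Ht). pose proof (qexp_nonzero t). field. auto.
    + apply (cder_ext (fun t => qexp t * U t)). { intros; symmetry; apply EU. }
      apply cder_mult. apply cder_qexp. apply holomorphic_cder; auto.
  - assert (LU : tends_cusp U 256).
    { eapply tends_cusp_val.
      - apply tends_cusp_pow. apply tends_cusp_mult. apply tends_cusp_mult. apply thA_cusp. apply thB_cusp. apply thC_reduced_cusp.
      - rewrite <- !RtoC_mult, <- RtoC_pow. f_equal. ring. }
    eapply tends_cusp_val.
    + apply tends_cusp_plus. apply tends_cusp_const. apply (tends_cusp_div (C_derive U) U).
      2: apply (tends_cusp_derive U 256); auto. 2: exact LU. intros E. apply RtoC_inj in E. lra.
    + field.
Qed.

(** The anomaly 12 tau of P, multiplied by E4, cancels the derivative of tau^4 taken 3 times. The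
    difference is a form of weight 6, and it vanishes at the cusp because E4 P and kappa E6 both
    tend to kappa. *)
Theorem Ramanujan_E4 tau : UHP tau ->
  3 * C_derive thE4 tau = thE4 tau * logderiv_Delta tau - kappa * thE6 tau.
Proof.
  intros Ht. symmetry. apply Ceq_minus.
  pose proof (holomorphic_derive UHP thE4 UHP_open thE4_holomorphic) as HD.
  rewrite <- (small_weight_vanishing (fun t => (thE4 t * logderiv_Delta t - kappa * thE6 t) - 3 * C_derive thE4 t) 3 (le_n 3)) with (tau := tau); auto.
  - apply (holomorphic_minus UHP (fun t => thE4 t * logderiv_Delta t - kappa * thE6 t) (fun t => 3 * C_derive thE4 t)).
    + apply (holomorphic_minus UHP (fun t => thE4 t * logderiv_Delta t) (fun t => kappa * thE6 t)).
      * apply holomorphic_mult. apply thE4_holomorphic. apply logderiv_Delta_holomorphic.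
      * apply (holomorphic_mult UHP (fun _ => kappa) thE6). apply holomorphic_const. apply thE6_holomorphic.
    + apply (holomorphic_mult UHP (fun _ => 3) (C_derive thE4)). apply holomorphic_const. exact HD.
  - intros t Hh. rewrite thE4_shift, thE6_shift, logderiv_Delta_shift, (derive_shift thE4 thE4_holomorphic thE4_shift); auto.
  - intros t Hh. rewrite thE4_inversion, thE6_inversion, logderiv_Delta_inversion by auto.
    rewrite (derive_weight thE4 4 t thE4_holomorphic thE4_inversion Hh).
    replace (INR 4) with 4%R by (simpl; ring). simpl. ring.
  - eapply tends_cusp_val.
    + apply tends_cusp_minus. apply tends_cusp_minus. apply tends_cusp_mult. apply thE4_cusp. apply logderiv_Delta_cusp.
      apply tends_cusp_mult. apply tends_cusp_const. apply thE6_cusp.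
      apply tends_cusp_mult. apply tends_cusp_const. apply (tends_cusp_derive thE4 1). apply thE4_holomorphic. apply thE4_cusp.
    + ring.
Qed.

(** Besides the factor tau^4, inversion adds 24 tau^3 P + 144 tau^2 both to 12 P' and to P^2. The
    difference is thus a form of weight 4 that vanishes at the cusp. *)
Theorem Ramanujan_E2 tau : UHP tau ->
  12 * C_derive logderiv_Delta tau = logderiv_Delta tau ^ 2 - kappa ^ 2 * thE4 tau.
Proof.
  intros Ht. apply Ceq_minus.
  pose proof logderiv_Delta_holomorphic as HP.
  pose proof (holomorphic_derive UHP logderiv_Delta UHP_open HP) as HD.
  rewrite <- (small_weight_vanishing (fun t => 12 * C_derive logderiv_Delta t - (logderiv_Delta t ^ 2 - kappa ^ 2 * thE4 t)) 2 ltac:(lia)) with (tau := tau); auto.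
  - apply (holomorphic_minus UHP (fun t => 12 * C_derive logderiv_Delta t) (fun t => logderiv_Delta t ^ 2 - kappa ^ 2 * thE4 t)).
    + apply (holomorphic_mult UHP (fun _ => 12) (C_derive logderiv_Delta)). apply holomorphic_const. exact HD.
    + apply (holomorphic_minus UHP (fun t => logderiv_Delta t ^ 2) (fun t => kappa ^ 2 * thE4 t)).
      * apply holomorphic_pow. exact HP.
      * apply (holomorphic_mult UHP (fun _ => kappa ^ 2) thE4). apply holomorphic_const. apply thE4_holomorphic.
  - intros t Hh. rewrite thE4_shift, logderiv_Delta_shift, (derive_shift logderiv_Delta HP logderiv_Delta_shift); auto.
  - intros t Hh. rewrite thE4_inversion, logderiv_Delta_inversion by auto.
    rewrite (derive_inversion logderiv_Delta (fun t => t ^ 2 * logderiv_Delta t + 12 * t)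
      (2 * t * logderiv_Delta t + t ^ 2 * C_derive logderiv_Delta t + 12) t HP Hh).
    + simpl. ring.
    + intros; apply logderiv_Delta_inversion; auto.
    + eapply cder_val.
      * apply cder_plus. apply cder_mult. apply cder_pow. apply cder_id. apply holomorphic_cder; auto.
        apply cder_scal. apply cder_id.
      * simpl. rewrite RtoC_plus. ring.
  - eapply tends_cusp_val.
    + apply tends_cusp_minus.
      * apply tends_cusp_mult. apply tends_cusp_const. apply (tends_cusp_derive logderiv_Delta kappa HP). apply logderiv_Delta_cusp.
      * apply tends_cusp_minus. apply tends_cusp_pow. apply logderiv_Delta_cusp.
        apply tends_cusp_mult. apply tends_cusp_const. apply thE4_cusp.
    + simpl. ring.
Qed.

(** * Power series on the unit disc *)

(* Radius of convergence at least 1. *)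
Definition bounded_growth (a : nat -> C) : Prop :=
  forall r : R, 0 < r < 1 -> exists K : R, 0 <= K /\ forall n, Cmod (a n) * r ^ n <= K.

Definition power_series (a : nat -> C) (w : C) : C := sum_over (fun _ : nat => True) (fun n => a n * w ^ n).

(** With r halfway between s and 1, the majorant is geometric of ratio s/r. *)
Lemma power_series_majorant (a : nat -> C) (s : R) : bounded_growth a -> 0 <= s < 1 ->
  exists M, summable (fun _ : nat => True) M /\ forall n w, Cmod w <= s -> Cmod (a n * w ^ n) <= M n.
Proof.
  intros Ha Hs. set (r := ((1 + s) / 2)%R). assert (Hr : 0 < r < 1) by (unfold r; lra).
  assert (Hq : 0 <= s / r < 1).
  { split. apply Rmult_le_pos; [lra|]. left; apply Rinv_0_lt_compat; lra.
    apply Rmult_lt_reg_r with r; [lra|]. unfold Rdiv. rewrite Rmult_assoc, Rinv_l by lra. unfold r; lra. }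
  destruct (Ha r Hr) as (K & HK & HB).
  exists (fun n => K * (s / r) ^ n)%R. split.
  - apply summable_scal; auto. apply (sum_bounded_summable _ _ (/ (1 - s / r))).
    + intros n _. apply pow_le; lra.
    + apply sum_bounded_geometric; auto.
  - intros n w Hw. rewrite Cmod_mult, Cmod_pow. pose proof (Cmod_ge_0 w).
    apply Rle_trans with (Cmod (a n) * s ^ n)%R.
    { apply Rmult_le_compat_l. apply Cmod_ge_0. apply pow_incr; auto. }
    replace (s ^ n)%R with (r ^ n * (s / r) ^ n)%R.
    2:{ rewrite <- Rpow_mult_distr. f_equal. field. lra. }
    rewrite <- Rmult_assoc. apply Rmult_le_compat_r. apply pow_le; lra. apply HB.
Qed.

Lemma power_series_is_sum (a : nat -> C) (w : C) : bounded_growth a -> Cmod w < 1 ->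
  is_sum_over (fun _ : nat => True) (fun n => a n * w ^ n) (power_series a w).
Proof.
  intros Ha Hw. destruct (power_series_majorant a (Cmod w) Ha) as (M & HM & HB).
  { pose proof (Cmod_ge_0 w); lra. }
  apply (dominated_is_sum _ _ M HM). intros n _. apply HB. lra.
Qed.

Lemma power_series_eq (a : nat -> C) (w l : C) :
  is_sum_over (fun _ : nat => True) (fun n => a n * w ^ n) l -> power_series a w = l.
Proof. apply sum_over_eq. Qed.

Lemma power_series_ext (a b : nat -> C) (w : C) : bounded_growth a -> Cmod w < 1 -> (forall n, a n = b n) ->
  power_series a w = power_series b w.
Proof.
  intros Ha Hw E. symmetry. apply power_series_eq. eapply is_sum_ext; [|apply (power_series_is_sum a w Ha Hw)].
  intros n _. cbv beta. rewrite E. reflexivity.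
Qed.

Lemma power_series_scal (a : nat -> C) (c w : C) : bounded_growth a -> Cmod w < 1 ->
  power_series (fun n => c * a n) w = c * power_series a w.
Proof.
  intros Ha Hw. apply power_series_eq. eapply is_sum_ext; [|apply is_sum_scal, (power_series_is_sum a w Ha Hw)].
  intros n _. cbv beta. ring.
Qed.

Lemma power_series_plus (a b : nat -> C) (w : C) : bounded_growth a -> bounded_growth b -> Cmod w < 1 ->
  power_series (fun n => a n + b n) w = power_series a w + power_series b w.
Proof.
  intros Ha Hb Hw. apply power_series_eq.
  eapply is_sum_ext; [|apply is_sum_plus; [apply (power_series_is_sum a w Ha Hw)|apply (power_series_is_sum b w Hb Hw)]].
  intros n _. cbv beta. ring.
Qed.

Lemma is_sum_nat_succ (f : nat -> C) (l : C) : is_sum_over (fun _ : nat => True) (fun n => f (S n)) l ->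
  is_sum_over (fun _ : nat => True) f (f 0%nat + l).
Proof.
  intros Hf.
  assert (B : bijection (fun n => n <> 0%nat) (fun _ : nat => True) pred).
  { repeat split; auto. intros; lia. intros k _. exists (S k). split; auto. }
  pose proof (is_sum_bijection _ _ _ _ _ B Hf) as S1. cbv beta in S1.
  apply (is_sum_bijection (fun _ => True) (fun n => n = 0%nat \/ n <> 0%nat) (fun n => n)).
  { repeat split; auto. intros i _. lia. intros k _; exists k; auto. }
  apply is_sum_union. tauto. apply (is_sum_singleton f 0%nat).
  eapply is_sum_ext; [|exact S1]. intros n Hn. cbv beta. f_equal. lia.
Qed.

Lemma bounded_growth_shift (a : nat -> C) : bounded_growth a -> bounded_growth (fun n => a (S n)).
Proof.
  intros Ha r Hr. destruct (Ha r Hr) as (K & HK & HB). exists (K / r)%R. split.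
  { apply Rmult_le_pos; auto. left; apply Rinv_0_lt_compat; lra. }
  intros n. specialize (HB (S n)). simpl in HB. apply Rmult_le_reg_r with r; [lra|].
  unfold Rdiv. rewrite (Rmult_assoc K), Rinv_l by lra. lra.
Qed.

Lemma power_series_shift (a : nat -> C) (w : C) : bounded_growth a -> Cmod w < 1 ->
  power_series a w = a 0%nat + w * power_series (fun n => a (S n)) w.
Proof.
  intros Ha Hw. apply power_series_eq.
  pose proof (is_sum_scal _ _ w _ (power_series_is_sum _ w (bounded_growth_shift a Ha) Hw)) as S1.
  replace (a 0%nat) with (a 0%nat * w ^ 0) at 1 by (simpl; ring).
  apply (is_sum_nat_succ (fun n => a n * w ^ n)).
  eapply is_sum_ext; [|exact S1]. intros n _. simpl. ring.
Qed.

Lemma bounded_growth_derive (a : nat -> C) : bounded_growth a -> bounded_growth (fun n => INR (S n) * a (S n)).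
Proof.
  intros Ha r Hr. set (s := ((1 + r) / 2)%R). assert (Hs : 0 < s < 1) by (unfold s; lra).
  assert (Hrs : r < s) by (unfold s; lra).
  destruct (Ha s Hs) as (K & HK & HB).
  (* Bernoulli's inequality, n x <= (1 + x)^n = (s/r)^n, absorbs the factor brought by the
     derivative. *)
  set (x := (s / r - 1)%R). assert (Hx : 0 < x).
  { unfold x. assert (1 < s / r); [|lra]. apply Rmult_lt_reg_r with r; [lra|]. unfold Rdiv. rewrite Rmult_assoc, Rinv_l; lra. }
  exists (K / r / x)%R. split.
  { repeat apply Rmult_le_pos; auto; left; apply Rinv_0_lt_compat; lra. }
  intros n. specialize (HB (S n)). rewrite Cmod_mult, Cmod_R, Rabs_pos_eq by apply pos_INR.
  assert (Bn : INR (S n) * x <= (s / r) ^ S n).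
  { pose proof (poly (S n) x Hx). unfold x in H at 2. replace (1 + (s / r - 1))%R with (s / r)%R in H by ring. lra. }
  assert (E : (s ^ S n)%R = (r ^ S n * (s / r) ^ S n)%R) by (rewrite <- Rpow_mult_distr; f_equal; field; lra).
  pose proof (pow_lt r (S n) ltac:(lra)) as Pr. pose proof (Cmod_ge_0 (a (S n))) as Pa.
  apply Rmult_le_reg_r with (r * x)%R. { apply Rmult_lt_0_compat; lra. }
  replace (K / r / x * (r * x))%R with K by (field; lra).
  eapply Rle_trans; [|apply HB]. rewrite E.
  replace (INR (S n) * Cmod (a (S n)) * r ^ n * (r * x))%R with (Cmod (a (S n)) * (r ^ S n * (INR (S n) * x)))%R by (simpl pow; ring).
  apply Rmult_le_compat_l; auto. apply Rmult_le_compat_l; lra.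
Qed.

Lemma power_series_cder (a : nat -> C) (w : C) : bounded_growth a -> Cmod w < 1 ->
  cder (power_series a) w (power_series (fun n => INR (S n) * a (S n)) w).
Proof.
  intros Ha Hw. pose proof (Cmod_ge_0 w) as Hw0.
  set (s := ((1 + Cmod w) / 2)%R). destruct (power_series_majorant a s Ha) as (M & HM & HB). { unfold s; lra. }
  assert (D : forall n z, cder (fun z => a n * z ^ n) z (a n * (INR n * z ^ (n - 1)))).
  { intros n z. apply cder_scal. eapply cder_val. apply cder_pow. apply cder_id. apply Cmult_1_r. }
  assert (Hr : 0 < (1 - Cmod w) / 2) by lra.
  destruct (sum_over_cder (fun _ : nat => True) (fun n z => a n * z ^ n) M w _ Hr HM) as (HM' & HB' & HD).
  - intros n _ z _. eapply cder_ex. apply D.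
  - intros n _ z Hz. apply HB. cbv beta in Hz.
    replace z with (w + (z - w)) by ring. eapply Rle_trans; [apply Cmod_triangle|]. unfold s; lra.
  - eapply cder_val. exact HD. apply sum_over_eq.
    pose proof (is_sum_nat_succ (fun n => a n * (INR n * w ^ (n - 1))) (power_series (fun n => INR (S n) * a (S n)) w)) as Q.
    replace (power_series (fun n => INR (S n) * a (S n)) w) with
      (a 0%nat * (INR 0 * w ^ (0 - 1)) + power_series (fun n => INR (S n) * a (S n)) w) by (simpl; ring).
    eapply is_sum_ext; [|apply Q].
    + intros n _. symmetry. apply cder_C_derive. apply D.
    + eapply is_sum_ext; [|apply power_series_is_sum; auto; apply bounded_growth_derive; auto].
      intros n _. cbv beta. replace (S n - 1)%nat with n by lia. ring.
Qed.

Lemma C_filterlim_unique {T : Type} (F : (T -> Prop) -> Prop) {FF : ProperFilter F} (f : T -> C) (a b : C) :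
  filterlim f F (locally (T := C_UniformSpace) a) -> filterlim f F (locally (T := C_UniformSpace) b) -> a = b.
Proof.
  rewrite !(C_filterlim_iff F). intros Ha Hb. apply Ceq_minus. apply NNPP. intros N. apply Cmod_gt_0 in N.
  assert (He : 0 < Cmod (a - b) / 2) by lra.
  destruct (filter_ex _ (filter_and _ _ (Ha _ He) (Hb _ He))) as (x & H1 & H2).
  pose proof (Cmod_minus_triangle a (f x) b) as T1. rewrite (Cmod_minus_sym a (f x)) in T1. lra.
Qed.

(** * A quadratic transformation *)

(* The coefficients h_n of the solution of (1 + w)^2 (w H'' + H') = 5/36 H satisfy a three term
   recurrence, split into two first order ones by the coefficients
   e_n = (n + 1)^2 h_(n+1) + n^2 h_n of (1 + w) (w H'' + H'). *)
Fixpoint landen_state (n : nat) : R * R :=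
  match n with
  | O => (1, 5 / 36)
  | S m => let (h, e) := landen_state m in
           let h' := ((e - INR m ^ 2 * h) / INR (S m) ^ 2)%R in (h', 5 / 36 * h' - e)
  end%R.

Definition landen_coef (n : nat) : R := fst (landen_state n).
Definition landen_aux (n : nat) : R := snd (landen_state n).

Lemma landen_coef_succ (n : nat) : (INR (S n) ^ 2 * landen_coef (S n) = landen_aux n - INR n ^ 2 * landen_coef n)%R.
Proof.
  unfold landen_coef, landen_aux. cbn [landen_state]. destruct (landen_state n) as [h e].
  cbv beta iota zeta delta [fst snd]. field. apply not_0_INR. lia.
Qed.

Lemma landen_aux_succ (n : nat) : landen_aux (S n) = (5 / 36 * landen_coef (S n) - landen_aux n)%R.
Proof. unfold landen_coef, landen_aux. cbn [landen_state]. destruct (landen_state n) as [h e]. reflexivity. Qed.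

(** The third bound drives the induction: from n to n + 1 its right side grows by 5/36 (n + 1),
    exactly the bound of e_n. For n >= 1 it implies the first one, while |e_n| grows by at most 5/36
    per step. *)
Lemma landen_bounds (n : nat) : Rabs (landen_coef n) <= 1 /\ Rabs (landen_aux n) <= 5 / 36 * (INR n + 1) /\
  INR n ^ 2 * Rabs (landen_coef n) <= 5 / 72 * (INR n * (INR n + 1)).
Proof.
  induction n as [|n (IH1 & IH2 & IH3)].
  - unfold landen_coef, landen_aux. simpl. rewrite !Rabs_pos_eq by lra. lra.
  - pose proof (pos_INR n) as Hn. pose proof (landen_coef_succ n) as E.
    assert (B3 : INR (S n) ^ 2 * Rabs (landen_coef (S n)) <= 5 / 72 * (INR (S n) * (INR (S n) + 1))).
    { rewrite <- (Rabs_pos_eq (INR (S n) ^ 2)) by apply pow2_ge_0. rewrite <- Rabs_mult, E.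
      unfold Rminus. eapply Rle_trans; [apply Rabs_triang|]. rewrite Rabs_Ropp, Rabs_mult, (Rabs_pos_eq (INR n ^ 2)) by apply pow2_ge_0.
      rewrite S_INR. nra. }
    assert (B1 : Rabs (landen_coef (S n)) <= 1).
    { rewrite S_INR in *. set (x := Rabs (landen_coef (S n))) in *. clearbody x. nra. }
    repeat split; auto.
    rewrite landen_aux_succ. unfold Rminus. eapply Rle_trans; [apply Rabs_triang|].
    rewrite Rabs_Ropp, Rabs_mult, (Rabs_pos_eq (5 / 36)) by lra. rewrite S_INR. lra.
Qed.

Lemma bounded_growth_linear (a : nat -> C) (K : R) : (forall n, Cmod (a n) <= K * (INR n + 1)) -> bounded_growth a.
Proof.
  intros Ha r Hr. assert (HK : 0 <= K). { specialize (Ha 0%nat). simpl in Ha. pose proof (Cmod_ge_0 (a 0%nat)). lra. }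
  set (x := (/ r - 1)%R). assert (Hx : 0 < x). { unfold x. assert (1 < / r); [|lra]. rewrite <- Rinv_1. apply Rinv_lt_contravar; lra. }
  exists (K / x + K)%R. split.
  { apply Rplus_le_le_0_compat; auto. apply Rmult_le_pos; auto. left; apply Rinv_0_lt_compat; lra. }
  intros n. pose proof (pow_lt r n ltac:(lra)) as Pr.
  assert (Bn : INR n * x <= (/ r) ^ n).
  { pose proof (poly n x Hx). unfold x in H at 2. replace (1 + (/ r - 1))%R with (/ r)%R in H by ring. lra. }
  assert (Bn' : INR n * r ^ n <= / x).
  { apply Rmult_le_reg_r with x; auto. rewrite Rinv_l by lra.
    replace 1%R with (r ^ n * (/ r) ^ n)%R. 2:{ rewrite <- Rpow_mult_distr, Rinv_r, pow1; lra. }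
    replace (INR n * r ^ n * x)%R with (r ^ n * (INR n * x))%R by ring. apply Rmult_le_compat_l; lra. }
  assert (r ^ n <= 1). { rewrite <- (pow1 n). apply pow_incr. lra. }
  apply Rle_trans with (K * (INR n + 1) * r ^ n)%R. apply Rmult_le_compat_r; auto. lra.
  replace (K * (INR n + 1) * r ^ n)%R with (K * (INR n * r ^ n) + K * r ^ n)%R by ring. unfold Rdiv.
  apply Rplus_le_compat. apply Rmult_le_compat_l; auto. rewrite <- (Rmult_1_r K) at 2. apply Rmult_le_compat_l; auto.
Qed.

Lemma landen_coef_growth : bounded_growth (fun n => RtoC (landen_coef n)).
Proof.
  apply (bounded_growth_linear _ 1). intros n. rewrite Cmod_R. pose proof (landen_bounds n). pose proof (pos_INR n). lra.
Qed.

Lemma landen_aux_growth : bounded_growth (fun n => RtoC (landen_aux n)).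
Proof. apply (bounded_growth_linear _ (5 / 36)). intros n. rewrite Cmod_R. apply landen_bounds. Qed.

Definition landen_series : C -> C := power_series (fun n => RtoC (landen_coef n)).
Definition landen_series' : C -> C := power_series (fun n => INR (S n) * landen_coef (S n)).
Definition landen_series'' : C -> C := power_series (fun n => INR (S n) * (INR (S (S n)) * landen_coef (S (S n)))).

Lemma cder_landen_series w : Cmod w < 1 -> cder landen_series w (landen_series' w).
Proof. intros Hw. apply (power_series_cder (fun n => RtoC (landen_coef n))); auto. apply landen_coef_growth. Qed.

Lemma cder_landen_series' w : Cmod w < 1 -> cder landen_series' w (landen_series'' w).
Proof.
  intros Hw. apply (power_series_cder (fun n => INR (S n) * landen_coef (S n))); auto.
  apply (bounded_growth_derive _ landen_coef_growth).
Qed.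

Lemma landen_series_0 : landen_series 0 = 1.
Proof.
  unfold landen_series. rewrite power_series_shift by (try apply landen_coef_growth; rewrite Cmod_0; lra).
  unfold landen_coef. simpl. ring.
Qed.

Lemma power_series_1_plus (a b : nat -> C) (w : C) : Cmod w < 1 -> bounded_growth a -> bounded_growth b ->
  a 0%nat = b 0%nat -> (forall n, b (S n) = a (S n) + a n) -> power_series b w = (1 + w) * power_series a w.
Proof.
  intros Hw Ha Hb E0 ES. pose proof (bounded_growth_shift a Ha) as Ha'.
  rewrite (power_series_shift b), (power_series_ext _ (fun n => a (S n) + a n)) by auto using bounded_growth_shift.
  rewrite power_series_plus by auto. rewrite <- E0.
  transitivity ((a 0%nat + w * power_series (fun n => a (S n)) w) + w * power_series a w). ring.
  rewrite <- power_series_shift by auto. ring.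
Qed.

(** The coefficients of w H'' + H' are (n + 1)^2 h_(n+1). One factor 1 + w turns them into e_n by
    [landen_coef_succ], a second one into 5/36 h_n by [landen_aux_succ]. *)
Lemma landen_equation w : Cmod w < 1 ->
  (1 + w) ^ 2 * (w * landen_series'' w + landen_series' w) = 5 / 36 * landen_series w.
Proof.
  intros Hw. pose proof landen_coef_growth as G0. pose proof (bounded_growth_derive _ G0) as G1.
  pose proof (bounded_growth_derive _ G1) as G2. cbv beta in G1, G2.
  set (d := fun n => RtoC (INR (S n) ^ 2 * landen_coef (S n))).
  assert (Gd : bounded_growth d).
  { intros r Hr. destruct (bounded_growth_derive (fun n => INR n * landen_coef n)) with (r := r) as (K & HK & HB); auto.
    - apply (bounded_growth_linear _ 1). intros n. rewrite Cmod_mult, !Cmod_R, (Rabs_pos_eq (INR n)) by apply pos_INR.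
      destruct (landen_bounds n) as [B _]. pose proof (pos_INR n). pose proof (Rabs_pos (landen_coef n)). nra.
    - exists K. split; auto. intros n. eapply Rle_trans; [|apply (HB n)]. right. f_equal. f_equal.
      unfold d. rewrite RtoC_mult, RtoC_pow. ring. }
  assert (Q : w * landen_series'' w + landen_series' w = power_series d w).
  { unfold landen_series'. rewrite power_series_shift by auto. unfold landen_series''.
    rewrite (power_series_shift d) by auto.
    rewrite (power_series_ext (fun n => d (S n)) (fun n => INR (S n) * (INR (S (S n)) * landen_coef (S (S n))) + INR (S (S n)) * landen_coef (S (S n)))).
    - rewrite power_series_plus; auto. 2: apply (bounded_growth_shift _ G1).
      unfold d. replace (INR 1 ^ 2 * landen_coef 1)%R with (INR 1 * landen_coef 1)%R by (simpl; ring). rewrite RtoC_mult. ring.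
    - apply bounded_growth_shift; auto.
    - auto.
    - intros n. unfold d. rewrite (S_INR (S n)), !RtoC_mult, RtoC_plus, RtoC_pow, RtoC_plus. simpl. ring. }
  rewrite Q. simpl Cpow.
  assert (E : power_series (fun n => RtoC (landen_aux n)) w = (1 + w) * power_series d w).
  { apply power_series_1_plus; auto. apply landen_aux_growth.
    - unfold d. rewrite landen_coef_succ. f_equal. simpl. ring.
    - intros n. unfold d. rewrite <- RtoC_plus. f_equal. rewrite landen_coef_succ. ring. }
  unfold landen_series. rewrite <- (power_series_scal _ (5 / 36) w G0 Hw).
  rewrite (power_series_1_plus (fun n => RtoC (landen_aux n)) (fun n => 5 / 36 * landen_coef n)); auto.
  - rewrite E. ring.
  - apply landen_aux_growth.
  - apply (bounded_growth_linear _ 1). intros n. rewrite Cmod_mult, Cmod_R.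
    replace (5 / 36) with (RtoC (5 / 36)) by (rewrite RtoC_div by lra; auto). rewrite Cmod_R, Rabs_pos_eq by lra.
    pose proof (landen_bounds n). pose proof (Rabs_pos (landen_coef n)). pose proof (pos_INR n). lra.
  - unfold landen_aux, landen_coef. simpl. rewrite RtoC_div by lra. ring.
  - intros n. cbv beta. rewrite <- RtoC_plus, landen_aux_succ. replace (5 / 36) with (RtoC (5 / 36)) by (rewrite RtoC_div by lra; auto).
    rewrite <- RtoC_mult. f_equal. ring.
Qed.

(** * The principal square root off the negative half line *)

Definition csqrt (u : C) : C :=
  let s := sqrt ((Cmod u + Re u) / 2) in (s, Im u / (2 * s))%R.

Definition slit_negative (u : C) : Prop := ~ (Im u = 0%R /\ (Re u <= 0)%R).

Lemma slit_negative_iff u : slit_negative u <-> 0 < Cmod u + Re u.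
Proof.
  pose proof (re_le_Cmod u) as L. pose proof (Cmod_ge_0 u) as L0. split.
  - intros Hu. apply Rnot_le_lt. intros N. apply Hu.
    assert (R1 : Re u <= 0) by lra. assert (EM : Cmod u = (- Re u)%R). { rewrite Rabs_left1 in L; lra. }
    split; auto. unfold Cmod in EM. assert (E2 : (Re u ^ 2 + Im u ^ 2 = Re u ^ 2)%R).
    { replace (Re u ^ 2)%R with ((- Re u) ^ 2)%R at 2 by ring. rewrite <- EM.
      change (fst u) with (Re u). change (snd u) with (Im u). rewrite pow2_sqrt; auto.
      pose proof (pow2_ge_0 (Re u)). pose proof (pow2_ge_0 (Im u)). lra. }
    nra.
  - intros Hp [HI HR].
    assert (Cmod u <= Rabs (Re u)). { eapply Rle_trans; [apply Cmod_le_re_im|]. rewrite HI, Rabs_R0. lra. }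
    rewrite Rabs_left1 in H by auto. lra.
Qed.

Lemma re_csqrt_pos u : slit_negative u -> 0 < Re (csqrt u).
Proof. intros Hu. apply slit_negative_iff in Hu. simpl. apply sqrt_lt_R0. lra. Qed.

Lemma csqrt_square u : slit_negative u -> csqrt u * csqrt u = u.
Proof.
  intros Hu. pose proof (re_csqrt_pos u Hu) as Hs. apply slit_negative_iff in Hu. simpl in Hs.
  unfold csqrt. set (s := sqrt ((Cmod u + Re u) / 2)) in *.
  assert (E : (s * s = (Cmod u + Re u) / 2)%R) by (apply sqrt_sqrt; lra).
  assert (M : (Cmod u * Cmod u = Re u * Re u + Im u * Im u)%R).
  { unfold Cmod. rewrite sqrt_sqrt. simpl. unfold Re, Im. ring. pose proof (pow2_ge_0 (fst u)). pose proof (pow2_ge_0 (snd u)). lra. }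
  apply injective_projections; simpl.
  - replace (Im u / (2 * s) * (Im u / (2 * s)))%R with (Im u * Im u / (4 * (s * s)))%R by (field; lra).
    replace (Im u * Im u)%R with (Cmod u * Cmod u - Re u * Re u)%R by lra. rewrite E. change (fst u) with (Re u). field. lra.
  - change (snd u) with (Im u). field. lra.
Qed.

(* As s + t has real part at least Re s, the identity (t - s) (t + s) = h makes [csqrt] Lipschitz. *)
Lemma cder_csqrt u r : 0 < r -> (forall z, disc u r z -> slit_negative z) -> cder csqrt u (1 / (2 * csqrt u)).
Proof.
  intros Hr HO. assert (Hu : slit_negative u) by (apply HO, center_in_disc; auto).
  set (s := csqrt u). pose proof (re_csqrt_pos u Hu) as Hs. fold s in Hs. set (a := Re s) in *.
  assert (Ns : s <> 0). { intros E. unfold a in Hs. rewrite E in Hs. simpl in Hs. lra. }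
  assert (La : a <= Cmod s). { pose proof (re_le_Cmod s). pose proof (Rle_abs (Re s)). unfold a. lra. }
  apply (quadratic_error_cder _ _ _ (/ (2 * a * (a * a))) (r / 2)). lra.
  { left. apply Rinv_0_lt_compat. repeat apply Rmult_lt_0_compat; lra. }
  intros h Hh. assert (Hv : slit_negative (u + h)). { apply HO. cbv beta. replace (u + h - u) with h by ring. lra. }
  fold s. set (t := csqrt (u + h)). pose proof (re_csqrt_pos _ Hv) as Ht. fold t in Ht.
  assert (Lst : a <= Cmod (t + s)).
  { pose proof (re_le_Cmod (t + s)). rewrite re_plus in H. pose proof (Rle_abs (Re t + Re s)). unfold a. lra. }
  assert (Nst : t + s <> 0) by (apply Cmod_gt_0; lra).
  assert (E : (t - s) * (t + s) = h).
  { transitivity (t * t - s * s). ring. unfold t, s. rewrite !csqrt_square by auto. ring. }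
  assert (L1 : a * Cmod (t - s) <= Cmod h).
  { rewrite <- E, Cmod_mult, Rmult_comm. apply Rmult_le_compat_l; auto. apply Cmod_ge_0. }
  assert (F : (t - s - 1 / (2 * s) * h) * (2 * s * (t + s) * (t + s)) = - (h * h)).
  { rewrite <- E. field. auto. }
  apply (f_equal Cmod) in F. rewrite Cmod_opp, !Cmod_mult, Cmod_R, Rabs_pos_eq in F by lra.
  set (X := Cmod (t - s - 1 / (2 * s) * h)) in *. pose proof (Cmod_ge_0 (t - s - 1 / (2 * s) * h)) as HX. fold X in HX.
  apply Rmult_le_reg_r with (2 * a * (a * a))%R. { repeat apply Rmult_lt_0_compat; lra. }
  replace (/ (2 * a * (a * a)) * Cmod h ^ 2 * (2 * a * (a * a)))%R with (Cmod h * Cmod h)%R by (field; lra).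
  rewrite <- F. apply Rmult_le_compat_l; auto. rewrite !Rmult_assoc. apply Rmult_le_compat_l; [lra|].
  apply Rmult_le_compat; try lra. nra. nra.
Qed.

(** * The hypergeometric function on the slit plane *)

Section taylor_coefficients.
Variables (c : C) (r rho : R).
Hypothesis Hr : 0 < r < rho.

Lemma taylor_coef_continuous (f : C -> C) (n : nat) : (forall z, disc c rho z -> ex_Cderive f z) ->
  continuous_on_seg (fun t => f (c + r * cis t) * (/ (r * cis t)) ^ n) 0 (2 * PI).
Proof.
  intros Hf t _. apply C_continuous_mult. apply Ccont_comp_circle. apply ex_Cderive_continuous, Hf, circle_in_disc. lra.
  apply Ccont_inv_circle. lra.
Qed.

Lemma taylor_coef_ext (f g : C -> C) (n : nat) : (forall z, disc c rho z -> f z = g z) ->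
  taylor_coef f c r n = taylor_coef g c r n.
Proof.
  intros E. unfold taylor_coef. f_equal. apply CInt_ext. intros t _. rewrite E; auto. apply circle_in_disc. lra.
Qed.

Lemma taylor_coef_plus (f g : C -> C) (n : nat) : (forall z, disc c rho z -> ex_Cderive f z) ->
  (forall z, disc c rho z -> ex_Cderive g z) ->
  taylor_coef (fun z => f z + g z) c r n = taylor_coef f c r n + taylor_coef g c r n.
Proof.
  intros Hf Hg. unfold taylor_coef. rewrite <- Cmult_plus_distr_l, <- (CInt_plus _ _ _ _ (taylor_coef_continuous f n Hf) (taylor_coef_continuous g n Hg)).
  f_equal. apply CInt_ext. intros t _. ring.
Qed.

Lemma taylor_coef_scal (f : C -> C) (k : C) (n : nat) : (forall z, disc c rho z -> ex_Cderive f z) ->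
  taylor_coef (fun z => k * f z) c r n = k * taylor_coef f c r n.
Proof.
  intros Hf. unfold taylor_coef.
  transitivity (/ (2 * PI)%R * (k * CInt (fun t => f (c + r * cis t) * (/ (r * cis t)) ^ n) 0 (2 * PI))); [|ring].
  rewrite <- (CInt_scal k _ _ _ (taylor_coef_continuous f n Hf)). f_equal. apply CInt_ext. intros t _. ring.
Qed.

Lemma taylor_coef_mul_id (f : C -> C) (n : nat) :
  taylor_coef (fun z => (z - c) * f z) c r (S n) = taylor_coef f c r n.
Proof.
  unfold taylor_coef. f_equal. apply CInt_ext. intros t _.
  assert (N : r * cis t <> 0) by (apply circle_nonzero; lra). set (u := r * cis t) in *.
  replace ((/ u) ^ S n) with (/ u * (/ u) ^ n) by reflexivity. field. auto.
Qed.

(** The derivative of f(c + u) u^(-n) has integral 0 along the closed circle; this gives the action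
    of the Euler operator on coefficients. *)
Lemma taylor_coef_euler (f f' : C -> C) (n : nat) : (forall z, disc c rho z -> cder f z (f' z)) ->
  (forall z, disc c rho z -> ex_Cderive f' z) ->
  taylor_coef (fun z => (z - c) * f' z) c r n = INR n * taylor_coef f c r n.
Proof.
  intros Hf Hf'.
  assert (Hfe : forall z, disc c rho z -> ex_Cderive f z) by (intros z Hz; eapply cder_ex; apply Hf; auto).
  assert (Hg : forall z, disc c rho z -> ex_Cderive (fun z => (z - c) * f' z) z).
  { intros z Hz. eapply cder_ex. apply cder_mult. apply cder_minus. apply cder_id. apply cder_const. apply ex_Cderive_cder; auto. }
  unfold taylor_coef.
  assert (E : CInt (fun t => Ci * (((c + r * cis t - c) * f' (c + r * cis t)) * (/ (r * cis t)) ^ n - INR n * (f (c + r * cis t) * (/ (r * cis t)) ^ n))) 0 (2 * PI) = 0).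
  { rewrite (CInt_FTC (fun t => f (c + r * cis t) * (/ (r * cis t)) ^ n)).
    - rewrite cis_period. ring.
    - intros t _. assert (N : r * cis t <> 0) by (apply circle_nonzero; lra).
      set (G := fun u => f (c + u) * (/ u) ^ n).
      assert (DG : cder G (r * cis t) (f' (c + r * cis t) * (/ (r * cis t)) ^ n - f (c + r * cis t) * (INR n * (/ (r * cis t)) ^ n * / (r * cis t)))).
      { set (u := r * cis t) in *. eapply cder_val.
        - apply cder_mult. apply (cder_comp f (fun u => c + u)). apply cder_plus. apply cder_const. apply cder_id.
          apply Hf. apply circle_in_disc. lra. apply cder_pow. apply cder_inv. exact N. apply cder_id.
        - destruct n as [|n]; [simpl; ring|]. replace (S n - 1)%nat with n by lia.
          replace ((/ u) ^ S n) with (/ u * (/ u) ^ n) by reflexivity. field. auto. }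
      replace (Ci * _) with ((f' (c + r * cis t) * (/ (r * cis t)) ^ n - f (c + r * cis t) * (INR n * (/ (r * cis t)) ^ n * / (r * cis t))) * (Ci * (r * cis t))).
      + apply (cder_along G (fun t => r * cis t)); auto.
        pose proof (is_RCderive_circle 0 r t) as D. eapply (is_derive_ext (K := R_AbsRing) (V := C_R_NormedModule)); [|exact D].
        intros s. apply Cplus_0_l.
      + set (u := r * cis t) in *. field. auto.
    - intros t Ht. apply C_continuous_mult. apply C_continuous_const. apply C_continuous_minus.
      apply (taylor_coef_continuous (fun z => (z - c) * f' z) n Hg t Ht).
      apply C_continuous_mult. apply C_continuous_const. apply (taylor_coef_continuous f n Hfe t Ht). }
  assert (C1 := taylor_coef_continuous _ n Hg). assert (C2 := taylor_coef_continuous _ n Hfe). cbv beta in C1.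
  rewrite CInt_scal, CInt_minus, CInt_scal in E; auto.
  - apply (f_equal (fun z => - Ci * z)) in E. rewrite Cmult_assoc in E.
    replace (- Ci * Ci) with (RtoC 1) in E by (apply injective_projections; simpl; ring).
    rewrite Cmult_1_l, Cmult_0_r in E. apply Ceq_minus in E. rewrite E. ring.
  - intros t Ht. apply C_continuous_mult. apply C_continuous_const. apply C2; auto.
  - intros t Ht. apply C_continuous_minus. apply C1; auto. apply C_continuous_mult. apply C_continuous_const. apply C2; auto.
Qed.
End taylor_coefficients.

Lemma slit_plane_negative z : slit_plane z -> slit_negative (1 - z).
Proof.
  unfold slit_plane, slit_negative. rewrite im_minus, re_minus, im_RtoC, re_RtoC. intros H [H1 H2]. apply H. split; lra.
Qed.

Lemma slit_plane_open : Copen slit_plane.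
Proof.
  intros z Hz. apply slit_plane_negative, slit_negative_iff in Hz.
  set (u := 1 - z) in *. exists ((Cmod u + Re u) / 2)%R. split. lra.
  intros w Hw [H1 H2]. cbv beta in Hw.
  assert (Hn : slit_negative (1 - w)).
  { apply slit_negative_iff. pose proof (Cmod_reverse_triangle u (w - z)) as T.
    replace (u - (w - z)) with (1 - w) in T by (unfold u; ring).
    pose proof (re_le_Cmod (w - z)) as T2. apply Rabs_le_between in T2. rewrite re_minus in T2.
    assert (Re u = 1 - Re z)%R by (unfold u; rewrite re_minus, re_RtoC; reflexivity).
    rewrite re_minus, re_RtoC. lra. }
  apply Hn. rewrite im_minus, re_minus, im_RtoC, re_RtoC. split; lra.
Qed.

Lemma disc_slit_plane z : Cmod z < 1 -> slit_plane z.
Proof. intros Hz [_ H]. pose proof (re_le_Cmod z). pose proof (Rle_abs (Re z)). lra. Qed.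

(** The slit plane is star-shaped about 0, which lets [identity_segment] start there. *)
Lemma slit_plane_star z (s : R) : 0 <= s <= 1 -> slit_plane z -> slit_plane (0 + s * (z - 0)).
Proof.
  intros Hs Hz [H1 H2]. rewrite Cplus_0_l in H1, H2. replace (z - 0) with z in H1, H2 by ring.
  rewrite im_scal_l in H1. rewrite re_scal_l in H2. apply Hz.
  assert (s <> 0%R) by (intros ->; lra). split. nra. nra.
Qed.

Definition root (z : C) : C := csqrt (1 - z).
(* The inverse of w |-> 4 w / (1 + w)^2 with values in the unit disc. *)
Definition landen (z : C) : C := (1 - root z) / (1 + root z).

Lemma root_square z : slit_plane z -> z = 1 - root z * root z.
Proof. intros Hz. unfold root. rewrite csqrt_square by (apply slit_plane_negative; auto). ring. Qed.

Lemma re_root_pos z : slit_plane z -> 0 < Re (root z).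
Proof. intros Hz. apply re_csqrt_pos, slit_plane_negative; auto. Qed.

Lemma root_nonzero z : slit_plane z -> root z <> 0.
Proof. intros Hz E. pose proof (re_root_pos z Hz). rewrite E in H. simpl in H. lra. Qed.

Lemma root_1_nonzero z : slit_plane z -> 1 + root z <> 0.
Proof. intros Hz E. pose proof (re_root_pos z Hz). apply (f_equal Re) in E. rewrite re_plus in E. simpl in E. simpl in H. lra. Qed.

Lemma cder_root z : slit_plane z -> cder root z (- (1) / (2 * root z)).
Proof.
  intros Hz. destruct (slit_plane_open z Hz) as (r & Hr & HO).
  eapply cder_val.
  - apply (cder_comp csqrt (fun z => 1 - z)). apply cder_minus. apply cder_const. apply cder_id.
    apply (cder_csqrt (1 - z) r Hr). intros w Hw. cbv beta in Hw.
    replace w with (1 - (1 - w)) by ring. apply slit_plane_negative. apply HO. cbv beta.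
    rewrite Cmod_minus_sym. replace (z - (1 - w)) with (w - (1 - z)) by ring. exact Hw.
  - fold (root z). field. apply root_nonzero; auto.
Qed.

(** A root with positive real part is nearer to 1 than to -1. *)
Lemma Cmod_landen z : slit_plane z -> Cmod (landen z) < 1.
Proof.
  intros Hz. pose proof (re_root_pos z Hz) as Hs. pose proof (root_1_nonzero z Hz) as N. unfold landen. set (s := root z) in *.
  rewrite Cmod_div by auto. apply Cmod_gt_0 in N.
  apply Rmult_lt_reg_r with (Cmod (1 + s)); auto. unfold Rdiv. rewrite Rmult_assoc, Rinv_l, Rmult_1_l, Rmult_1_r by lra.
  apply sqrt_lt_1_alt. destruct s as [a b]. simpl in *. split.
  - apply Rplus_le_le_0_compat; rewrite Rmult_1_r; apply Rle_0_sqr.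
  - nra.
Qed.

Lemma cder_landen z : slit_plane z -> cder landen z (1 / (root z * (1 + root z) ^ 2)).
Proof.
  intros Hz. pose proof (root_nonzero z Hz). pose proof (root_1_nonzero z Hz). eapply cder_val.
  - apply cder_div. auto. apply cder_minus. apply cder_const. apply cder_root; auto. apply cder_plus. apply cder_const. apply cder_root; auto.
  - cbv beta. field. auto.
Qed.

(** The candidate for F(1/12, 5/12, 1; z) on the slit plane. Its derivatives [hyp'] and [hyp''] are
    written out so that the differential equation becomes field arithmetic in the root. *)
Definition hyp (z : C) : C := landen_series (landen z).
Definition hyp' (z : C) : C := landen_series' (landen z) * (1 / (root z * (1 + root z) ^ 2)).
Definition hyp'' (z : C) : C :=
  landen_series'' (landen z) * (1 / (root z * (1 + root z) ^ 2)) ^ 2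
  + landen_series' (landen z) * ((1 + 3 * root z) / (2 * root z ^ 3 * (1 + root z) ^ 3)).

Lemma cder_hyp z : slit_plane z -> cder hyp z (hyp' z).
Proof.
  intros Hz. apply (cder_comp landen_series landen). apply cder_landen; auto. apply cder_landen_series. apply Cmod_landen; auto.
Qed.

Lemma cder_hyp' z : slit_plane z -> cder hyp' z (hyp'' z).
Proof.
  intros Hz. pose proof (root_nonzero z Hz). pose proof (root_1_nonzero z Hz). eapply cder_val.
  - apply cder_mult.
    + apply (cder_comp landen_series' landen). apply cder_landen; auto. apply cder_landen_series'. apply Cmod_landen; auto.
    + apply cder_div. 2: apply cder_const. 2: apply cder_mult; [apply cder_root; auto|].
      2: apply cder_pow; apply cder_plus; [apply cder_const|apply cder_root; auto].
      apply Cmult_neq_0; auto. apply Cpow_nz; auto.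
  - unfold hyp''. simpl. rewrite RtoC_plus. field. auto.
Qed.

(** Gauss's equation with a + b + 1 = 3/2 and a b = 5/144. For s = [root] z, z = 1 - s^2 and w = (1
    - s)/(1 + s), it is one quarter of [landen_equation]. *)
Lemma hypergeometric_equation z : slit_plane z ->
  z * (1 - z) * hyp'' z + (1 - 3 / 2 * z) * hyp' z = 5 / 144 * hyp z.
Proof.
  intros Hz. pose proof (root_nonzero z Hz). pose proof (root_1_nonzero z Hz).
  pose proof (landen_equation (landen z) (Cmod_landen z Hz)) as E.
  unfold hyp, hyp', hyp''. pose proof (root_square z Hz) as Ez.
  set (h0 := landen_series (landen z)) in *. set (h1 := landen_series' (landen z)) in *. set (h2 := landen_series'' (landen z)) in *.
  assert (Ew : landen z = (1 - root z) / (1 + root z)) by reflexivity. rewrite Ew in E.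
  set (s := root z) in *. rewrite Ez.
  replace (5 / 144 * h0) with (1 / 4 * (5 / 36 * h0)) by field. rewrite <- E. field. auto.
Qed.

Lemma hyp_0 : hyp 0 = 1.
Proof.
  unfold hyp. replace (landen 0) with (RtoC 0). apply landen_series_0.
  unfold landen, root, csqrt. replace (1 - 0) with (RtoC 1) by ring. rewrite Cmod_1, re_RtoC, im_RtoC.
  replace ((1 + 1) / 2)%R with 1%R by field. rewrite sqrt_1. replace (1, 0 / (2 * 1))%R with (RtoC 1).
  field.
  apply injective_projections; simpl; field.
Qed.

Lemma hyp_holomorphic : holomorphic_on slit_plane hyp.
Proof. intros z Hz. eapply cder_ex. apply cder_hyp; auto. Qed.

(* The hypergeometric equation in the form th^2 f = z (th + 1/12) (th + 5/12) f, th = z d/dz. *)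
Lemma taylor_coef_hyp_succ (r : R) (n : nat) : 0 < r < 1 ->
  (INR (S n)) ^ 2 * taylor_coef hyp 0 r (S n) = (INR n + 1 / 12) * (INR n + 5 / 12) * taylor_coef hyp 0 r n.
Proof.
  intros Hr.
  assert (D : forall z, disc 0 1 z -> slit_plane z).
  { intros z Hz. apply disc_slit_plane. cbv beta in Hz. replace (z - 0) with z in Hz by ring. exact Hz. }
  assert (H0 : forall z, disc 0 1 z -> ex_Cderive hyp z) by (intros z Hz; apply hyp_holomorphic; auto).
  set (th := fun z => (z - 0) * hyp' z). set (th' := fun z => hyp' z + (z - 0) * hyp'' z).
  assert (H1 : forall z, disc 0 1 z -> cder th z (th' z)).
  { intros z Hz. eapply cder_val.
    - apply cder_mult. apply cder_minus. apply cder_id. apply cder_const. apply cder_hyp'; auto.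
    - unfold th'. ring. }
  assert (H1' : forall z, disc 0 1 z -> ex_Cderive th z) by (intros z Hz; eapply cder_ex; apply H1; auto).
  assert (E : forall z, disc 0 1 z -> C_derive hyp' z = hyp'' z) by (intros z Hz; apply cder_C_derive, cder_hyp'; auto).
  assert (H2 : forall z, disc 0 1 z -> ex_Cderive hyp'' z).
  { intros z Hz. apply ex_Cderive_cder.
    assert (HD : ex_Cderive (C_derive hyp') z).
    { apply (holomorphic_derive (disc 0 1)); auto. apply disc_open. intros w Hw. eapply cder_ex. apply cder_hyp'; auto. }
    destruct (disc_open 0 1 z Hz) as (s & Hs & HW). apply ex_Cderive_cder, cder_ex with (C_derive (C_derive hyp') z).
    apply (cder_ext_loc (C_derive hyp') hyp'' z _ s); auto. apply ex_Cderive_cder; auto. }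
  assert (H1p : forall z, disc 0 1 z -> ex_Cderive hyp' z) by (intros z Hz; eapply cder_ex; apply cder_hyp'; auto).
  assert (H3 : forall z, disc 0 1 z -> ex_Cderive th' z).
  { intros z Hz. eapply cder_ex. apply cder_plus. apply ex_Cderive_cder; auto. apply cder_mult. apply cder_minus. apply cder_id. apply cder_const.
    apply ex_Cderive_cder; auto. }
  pose proof (taylor_coef_euler 0 r 1 Hr hyp hyp' (S n) (fun z Hz => cder_hyp z (D z Hz)) H1p) as T1.
  pose proof (taylor_coef_euler 0 r 1 Hr hyp hyp' n (fun z Hz => cder_hyp z (D z Hz)) H1p) as T1'.
  pose proof (taylor_coef_euler 0 r 1 Hr th th' (S n) H1 H3) as T2.
  pose proof (taylor_coef_euler 0 r 1 Hr th th' n H1 H3) as T2'.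
  fold th in T1, T1'. rewrite T1 in T2. rewrite T1' in T2'.
  set (g := fun z => (z - 0) * th' z) in *.
  assert (Hg : forall z, disc 0 1 z -> ex_Cderive g z).
  { intros z Hz. eapply cder_ex. apply cder_mult. apply cder_minus. apply cder_id. apply cder_const. apply ex_Cderive_cder; auto. }
  set (g1 := fun z : C => 1 / 2 * th z). set (g2 := fun z : C => 5 / 144 * hyp z). set (g3 := fun z : C => g1 z + g2 z).
  assert (Hs1 : forall z, disc 0 1 z -> ex_Cderive g1 z).
  { intros z Hz. eapply cder_ex. apply cder_scal. apply ex_Cderive_cder; auto. }
  assert (Hs2 : forall z, disc 0 1 z -> ex_Cderive g2 z).
  { intros z Hz. eapply cder_ex. apply cder_scal. apply ex_Cderive_cder; auto. }
  assert (Hs3 : forall z, disc 0 1 z -> ex_Cderive g3 z).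
  { intros z Hz. eapply cder_ex. apply cder_plus; apply ex_Cderive_cder; auto. }
  (* As 1/12 + 5/12 = 1/2 and the product of the two is 5/144, the equation reads th^2 f = z (th^2 f
     + th f/2 + 5/144 f). *)
  assert (F : taylor_coef g 0 r (S n) = taylor_coef (fun z => (z - 0) * (g z + g3 z)) 0 r (S n)).
  { apply (taylor_coef_ext 0 r 1 Hr). intros z Hz. unfold g3, g2, g1. rewrite <- (hypergeometric_equation z) by auto.
    unfold g, th', th. field. }
  rewrite (taylor_coef_mul_id 0 r 1 Hr (fun z => g z + g3 z)) in F.
  rewrite (taylor_coef_plus 0 r 1 Hr g g3 n Hg Hs3) in F. unfold g3 in F.
  rewrite (taylor_coef_plus 0 r 1 Hr g1 g2 n Hs1 Hs2) in F. unfold g1, g2 in F.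
  rewrite (taylor_coef_scal 0 r 1 Hr th (1 / 2) n H1') in F.
  rewrite (taylor_coef_scal 0 r 1 Hr hyp (5 / 144) n H0) in F.
  rewrite T2, T2', T1' in F.
  transitivity (INR (S n) * (INR (S n) * taylor_coef hyp 0 r (S n))).
  { set (x := RtoC (INR (S n))). simpl. ring. }
  rewrite F. field.
Qed.

Lemma pochhammer_1_nonzero (n : nat) : pochhammer 1 n <> 0.
Proof.
  induction n; simpl. apply C1_nz. apply Cmult_neq_0; auto. intros E. apply (f_equal Re) in E.
  rewrite re_plus, !re_RtoC in E. pose proof (pos_INR n). lra.
Qed.

Lemma taylor_coef_hyp (r : R) (n : nat) : 0 < r < 1 ->
  taylor_coef hyp 0 r n = pochhammer (1 / 12) n * pochhammer (5 / 12) n / (pochhammer 1 n * pochhammer 1 n).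
Proof.
  intros Hr. induction n as [|n IH].
  - destruct (disc_circle_bounded hyp 0 r 1 ltac:(lra)) as (M & HM0 & HM).
    { intros z Hz. apply hyp_holomorphic, disc_slit_plane. replace (z - 0) with z in Hz by ring. exact Hz. }
    rewrite (taylor_coef_0 hyp 0 1 r M Hr); auto.
    + rewrite hyp_0. simpl. field.
    + intros z Hz. apply hyp_holomorphic, disc_slit_plane. replace (z - 0) with z in Hz by ring. exact Hz.
  - pose proof (taylor_coef_hyp_succ r n Hr) as E. rewrite IH in E. pose proof (pochhammer_1_nonzero n) as Np.
    pose proof (pochhammer_1_nonzero (S n)) as NS. simpl in NS.
    assert (N1 : 1 + INR n <> 0). { intros Z. apply NS. rewrite Z. ring. }
    rewrite S_INR, RtoC_plus in E.
    transitivity ((INR n + 1) ^ 2 * taylor_coef hyp 0 r (S n) / (1 + INR n) ^ 2). { field. auto. }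
    rewrite E. simpl pochhammer. field. auto.
Qed.

Lemma sum_n_psum (a : nat -> C) (n : nat) : sum_n (G := C_AbelianMonoid) a n = psum a (S n).
Proof.
  induction n. rewrite sum_O. simpl. ring. rewrite sum_Sn, IHn. reflexivity.
Qed.

(** The series converges because it is the Taylor series of [hyp], which is holomorphic on the unit
    disc. *)
Lemma is_series_hyp z : Cmod z < 1 ->
  is_series (K := C_AbsRing) (V := C_NormedModule)
    (fun n => pochhammer (1 / 12) n * pochhammer (5 / 12) n / (pochhammer 1 n * pochhammer 1 n) * z ^ n) (hyp z).
Proof.
  intros Hz. pose proof (Cmod_ge_0 z) as Hz0. set (r := ((1 + Cmod z) / 2)%R). assert (Hr : 0 < r < 1) by (unfold r; lra).
  assert (Hd : forall w, disc 0 1 w -> ex_Cderive hyp w).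
  { intros w Hw. apply hyp_holomorphic, disc_slit_plane. replace (w - 0) with w in Hw by ring. exact Hw. }
  destruct (disc_circle_bounded hyp 0 r 1 ltac:(lra) Hd) as (M & HM0 & HM).
  apply (C_filterlim_iff eventually). intros eps He.
  destruct (Rpow_small (Cmod z / r) (M * (r / (r - Cmod z))) eps) as (N & HN); auto.
  { split. apply Rmult_le_pos; auto. left; apply Rinv_0_lt_compat; lra.
    apply Rmult_lt_reg_r with r; [lra|]. unfold Rdiv. rewrite Rmult_assoc, Rinv_l by lra. unfold r; lra. }
  exists N. intros n Hn. rewrite sum_n_psum.
  rewrite (psum_ext _ (fun k => taylor_coef hyp 0 r k * z ^ k)).
  2:{ intros k _. rewrite (taylor_coef_hyp r k Hr). reflexivity. }
  rewrite Cmod_minus_sym. replace z with (0 + z) at 1 by ring.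
  assert (Hzr : Cmod z < r < 1) by (unfold r; lra).
  eapply Rle_lt_trans. apply (Taylor_expansion hyp 0 z 1 r M (S n) Hzr Hd HM).
  eapply Rle_lt_trans; [|exact HN].
  assert (Hq : 0 <= Cmod z / r <= 1).
  { split. apply Rmult_le_pos; auto. left; apply Rinv_0_lt_compat; lra.
    apply Rmult_le_reg_r with r; [lra|]. unfold Rdiv. rewrite Rmult_assoc, Rinv_l by lra. unfold r; lra. }
  assert (P : (Cmod z / r) ^ S n <= (Cmod z / r) ^ N) .
  { replace (S n) with (N + (S n - N))%nat by lia. rewrite pow_add. rewrite <- (Rmult_1_r ((Cmod z / r) ^ N)) at 2.
    apply Rmult_le_compat_l. apply pow_le; lra. rewrite <- (pow1 (S n - N)). apply pow_incr; lra. }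
  assert (Hf : 0 <= r / (r - Cmod z)). { apply Rmult_le_pos; [lra|]. left; apply Rinv_0_lt_compat; lra. }
  rewrite Rmult_assoc, (Rmult_comm _ (r / _)), <- Rmult_assoc. apply Rmult_le_compat_l; auto. apply Rmult_le_pos; auto.
Qed.

Lemma hypergeometric_series_hyp z : Cmod z < 1 -> hypergeometric_series (1 / 12) (5 / 12) 1 z = hyp z.
Proof.
  intros Hz. pose proof (is_series_hyp z Hz) as HS. unfold hypergeometric_series.
  apply (iota_unique (V := C_CompleteNormedModule)); auto.
  intros y Hy. apply (C_filterlim_unique eventually _ _ _ Hy HS).
Qed.

(** The existence of [hyp] makes the choice inside [hypergeometric] a genuine continuation; the
    identity theorem from 0 then determines it on the slit plane. *)
Theorem hypergeometric_hyp z : slit_plane z -> hypergeometric (1 / 12) (5 / 12) 1 z = hyp z.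
Proof.
  intros Hz.
  assert (HC : is_continuation (fun z => Cmod z < 1) slit_plane (hypergeometric_series (1 / 12) (5 / 12) 1)
    (hypergeometric (1 / 12) (5 / 12) 1)).
  { unfold hypergeometric. apply epsilon_spec. exists hyp. split. apply hyp_holomorphic.
    intros w Hw. symmetry. apply hypergeometric_series_hyp; auto. }
  destruct HC as [Hh Hs]. apply Ceq_minus.
  apply (identity_segment slit_plane (fun z => hypergeometric (1 / 12) (5 / 12) 1 z - hyp z) 0 z).
  - apply slit_plane_open.
  - apply (holomorphic_minus slit_plane (hypergeometric (1 / 12) (5 / 12) 1) hyp Hh hyp_holomorphic).
  - intros s Hs'. apply slit_plane_star; auto.
  - intros eps He. exists (RtoC (Rmin (eps / 2) (1 / 2))).
    assert (0 < Rmin (eps / 2) (1 / 2)) by (apply Rmin_pos; lra).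
    pose proof (Rmin_l (eps / 2) (1 / 2)). pose proof (Rmin_r (eps / 2) (1 / 2)).
    assert (Em : Cmod (Rmin (eps / 2) (1 / 2)) = Rmin (eps / 2) (1 / 2)) by (rewrite Cmod_R, Rabs_pos_eq; lra).
    split. rewrite Em. lra. rewrite Cplus_0_l.
    rewrite Hs, hypergeometric_series_hyp; [ring| |]; rewrite Em; lra.
Qed.

(** * The Eisenstein series as a modular form *)

Notation nonzero_pair := (fun n : Z * Z => n <> (0%Z, 0%Z)).

Definition lattice_term (n : Z * Z) (tau : C) : C := 1 / (IZR (fst n) * tau + IZR (snd n)) ^ 4.
Definition eisenstein_sum (tau : C) : C := sum_over nonzero_pair (fun n => lattice_term n tau).

Lemma Cmod_sq (z : C) : (Cmod z ^ 2 = Re z ^ 2 + Im z ^ 2)%R.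
Proof.
  unfold Cmod. rewrite pow2_sqrt. reflexivity.
  apply Rplus_le_le_0_compat; apply pow2_ge_0.
Qed.

(** Makes m^2 + n^2 <= const |m tau + n|^2 hold for |Re tau| <= X and Im tau >= eta. With tau = x +
    i y, n is controlled by n^2 <= 2 (m x + n)^2 + 2 m^2 x^2, and m by m^2 <= (m y)^2/eta^2. *)
Definition lattice_const (X eta : R) : R := (2 + (1 + 2 * X ^ 2) / eta ^ 2)%R.

Lemma lattice_const_pos X eta : 0 < eta -> 0 < lattice_const X eta.
Proof.
  intros He. unfold lattice_const. pose proof (pow2_ge_0 X).
  assert (0 < (1 + 2 * X ^ 2) / eta ^ 2); [|lra]. apply Rdiv_lt_0_compat; [lra|]. apply pow_lt; auto.
Qed.

Lemma Cmod_lattice_lower (m n : Z) (tau : C) (X eta : R) : 0 < eta -> eta <= Im tau -> Rabs (Re tau) <= X ->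
  IZR m ^ 2 + IZR n ^ 2 <= lattice_const X eta * Cmod (IZR m * tau + IZR n) ^ 2.
Proof.
  intros He Hi Hr. rewrite Cmod_sq, re_plus, im_plus, re_scal_l, im_scal_l, re_RtoC, im_RtoC, Rplus_0_r.
  set (x := Re tau) in *. set (y := Im tau) in *. generalize (IZR m) (IZR n). clear m n. intros m n.
  assert (Hx : x ^ 2 <= X ^ 2). { rewrite <- (pow2_abs x). apply pow_incr. split; auto. apply Rabs_pos. }
  assert (Hy : eta ^ 2 <= y ^ 2) by (apply pow_incr; lra).
  assert (He2 : 0 < eta ^ 2) by (apply pow_lt; auto).
  set (Q := ((1 + 2 * X ^ 2) / eta ^ 2)%R).
  assert (HQ : (Q * eta ^ 2 = 1 + 2 * X ^ 2)%R) by (unfold Q; field; lra).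
  assert (HQ0 : 0 <= Q). { apply Rmult_le_pos. pose proof (pow2_ge_0 X); lra. left; apply Rinv_0_lt_compat; auto. }
  unfold lattice_const. fold Q.
  assert (A1 : n ^ 2 <= 2 * (m * x + n) ^ 2 + 2 * (m * x) ^ 2).
  { pose proof (pow2_ge_0 (2 * (m * x) + n)). nra. }
  assert (A2 : (m * x) ^ 2 <= m ^ 2 * X ^ 2).
  { rewrite Rpow_mult_distr. apply Rmult_le_compat_l; auto. apply pow2_ge_0. }
  assert (A3 : m ^ 2 * (1 + 2 * X ^ 2) <= Q * (m * y) ^ 2).
  { rewrite <- HQ, Rpow_mult_distr. replace (Q * (m ^ 2 * y ^ 2))%R with (m ^ 2 * (Q * y ^ 2))%R by ring.
    apply Rmult_le_compat_l. apply pow2_ge_0. apply Rmult_le_compat_l; auto. }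
  pose proof (Rmult_le_pos _ _ HQ0 (pow2_ge_0 (m * x + n))). pose proof (pow2_ge_0 (m * y)).
  lra.
Qed.

Lemma nonzero_pair_sq (p : Z * Z) : nonzero_pair p -> 1 <= IZR (fst p) ^ 2 + IZR (snd p) ^ 2.
Proof.
  destruct p as [m n]. simpl fst; simpl snd. intros N.
  replace (IZR m ^ 2 + IZR n ^ 2)%R with (IZR (m * m + n * n)) by (rewrite plus_IZR, !mult_IZR; ring).
  apply IZR_le. assert (m <> 0 \/ n <> 0)%Z by (destruct (Z.eq_dec m 0) as [->|]; auto; right; intros ->; auto). nia.
Qed.

(** For a, b >= 0 with a + b >= 1 one has (1 + a) (1 + b) <= 4 (a + b)^2; this bounds |m tau +
    n|^(-4) by a product of terms of two convergent series. *)
Definition lattice_bound (X eta : R) (p : Z * Z) : R :=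
  (4 * lattice_const X eta ^ 2 * (/ (1 + IZR (fst p) ^ 2) * / (1 + IZR (snd p) ^ 2)))%R.

Lemma lattice_bound_summable X eta : 0 < eta -> summable nonzero_pair (lattice_bound X eta).
Proof.
  intros He. apply summable_scal.
  - apply Rmult_le_pos; [lra|apply pow2_ge_0].
  - apply (summable_subset (fun _ => True)); auto.
    apply (summable_prod (fun n => / (1 + IZR n ^ 2)) (fun n => / (1 + IZR n ^ 2)))%R; apply summable_Z_inv_square.
Qed.

Lemma lattice_term_denominator (p : Z * Z) tau : nonzero_pair p -> UHP tau -> IZR (fst p) * tau + IZR (snd p) <> 0.
Proof.
  intros Hp Ht E. pose proof (nonzero_pair_sq p Hp) as H1.
  pose proof (Cmod_lattice_lower (fst p) (snd p) tau (Rabs (Re tau)) (Im tau) Ht (Rle_refl _) (Rle_refl _)) as H2.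
  rewrite E, Cmod_0 in H2. simpl in H1, H2. rewrite Rmult_0_l, Rmult_0_r in H2. lra.
Qed.

Lemma Cmod_lattice_term (p : Z * Z) tau X eta : nonzero_pair p -> 0 < eta -> eta <= Im tau -> Rabs (Re tau) <= X ->
  Cmod (lattice_term p tau) <= lattice_bound X eta p.
Proof.
  intros Hp He Hi Hr. assert (Ht : UHP tau) by (unfold upper_half_plane; lra).
  pose proof (lattice_term_denominator p tau Hp Ht) as N. pose proof (nonzero_pair_sq p Hp) as H1.
  pose proof (Cmod_lattice_lower (fst p) (snd p) tau X eta He Hi Hr) as H2.
  pose proof (lattice_const_pos X eta He) as HK.
  unfold lattice_term, lattice_bound. rewrite Cmod_div by (apply Cpow_nz; auto). rewrite Cmod_1, Cmod_pow.
  apply Cmod_gt_0 in N. set (c := Cmod (IZR (fst p) * tau + IZR (snd p))) in *. set (K := lattice_const X eta) in *.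
  set (a := (IZR (fst p) ^ 2)%R) in *. set (b := (IZR (snd p) ^ 2)%R) in *.
  assert (Ha : 0 <= a) by apply pow2_ge_0. assert (Hb : 0 <= b) by apply pow2_ge_0.
  assert (P : (1 + a) * (1 + b) <= 4 * K ^ 2 * c ^ 4).
  { apply Rle_trans with (4 * (a + b) ^ 2)%R. nra.
    replace (4 * K ^ 2 * c ^ 4)%R with (4 * (K * c ^ 2) ^ 2)%R by ring.
    apply Rmult_le_compat_l; [lra|]. apply pow_incr. lra. }
  assert (Pc : 0 < c ^ 4) by (apply pow_lt; auto).
  rewrite <- Rinv_mult. apply Rmult_le_reg_r with (c ^ 4)%R; auto.
  unfold Rdiv. rewrite Rmult_1_l, Rinv_l by lra.
  assert (Pab : 0 < (1 + a) * (1 + b)) by (apply Rmult_lt_0_compat; lra).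
  apply Rmult_le_reg_r with ((1 + a) * (1 + b))%R; auto.
  replace (4 * K ^ 2 * / ((1 + a) * (1 + b)) * c ^ 4 * ((1 + a) * (1 + b)))%R with (4 * K ^ 2 * c ^ 4)%R by (field; lra).
  lra.
Qed.

Lemma cder_lattice_term (p : Z * Z) tau : nonzero_pair p -> UHP tau -> ex_Cderive (lattice_term p) tau.
Proof.
  intros Hp Ht. eapply cder_ex. apply cder_div. apply Cpow_nz, lattice_term_denominator; auto. apply cder_const.
  apply cder_pow. apply cder_plus. apply cder_scal. apply cder_id. apply cder_const.
Qed.

Lemma eisenstein_is_sum tau : UHP tau -> is_sum_over nonzero_pair (fun n => lattice_term n tau) (eisenstein_sum tau).
Proof.
  intros Ht. apply (dominated_is_sum _ _ (lattice_bound (Rabs (Re tau)) (Im tau))).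
  - apply lattice_bound_summable; auto.
  - intros p Hp. apply Cmod_lattice_term; auto; apply Rle_refl.
Qed.

Lemma eisenstein_holomorphic : holomorphic_on UHP eisenstein_sum.
Proof.
  intros c Hc. unfold upper_half_plane in Hc.
  destruct (sum_over_cder nonzero_pair lattice_term (lattice_bound (Rabs (Re c) + Im c / 2) (Im c / 2)) c (Im c / 2)) as (_ & _ & D).
  - lra.
  - apply lattice_bound_summable. lra.
  - intros p Hp z Hz. apply disc_re_im in Hz. apply cder_lattice_term; auto. unfold upper_half_plane. lra.
  - intros p Hp z Hz. apply disc_re_im in Hz. apply Cmod_lattice_term; auto; try lra.
    pose proof (Rle_abs (Re c)). pose proof (Rle_abs (- Re c)). rewrite Rabs_Ropp in H0. apply Rabs_le. lra.
  - eapply cder_ex. exact D.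
Qed.

Lemma eisenstein_shift tau : UHP tau -> eisenstein_sum (tau + 1) = eisenstein_sum tau.
Proof.
  intros Ht. apply sum_over_eq.
  assert (B : bijection nonzero_pair nonzero_pair (fun p => (fst p, fst p + snd p)%Z)).
  { repeat split.
    - intros [m n] N E. simpl in E. injection E as E1 E2. apply N. f_equal; lia.
    - intros [m n] [m' n'] _ _ E. simpl in E. injection E as E1 E2. f_equal; lia.
    - intros [m n] N. exists (m, n - m)%Z. simpl. split. intros E. injection E as E1 E2. apply N. f_equal; lia. f_equal; lia. }
  eapply is_sum_ext; [|exact (is_sum_bijection _ _ _ _ _ B (eisenstein_is_sum tau Ht))].
  intros [m n] _. unfold lattice_term. simpl fst. simpl snd. rewrite plus_IZR, RtoC_plus. do 2 f_equal. ring.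
Qed.

Lemma eisenstein_inversion tau : UHP tau -> eisenstein_sum (- / tau) = tau ^ 4 * eisenstein_sum tau.
Proof.
  intros Ht. apply sum_over_eq.
  assert (B : bijection nonzero_pair nonzero_pair (fun p => (snd p, - fst p)%Z)).
  { repeat split.
    - intros [m n] N E. simpl in E. injection E as E1 E2. apply N. f_equal; lia.
    - intros [m n] [m' n'] _ _ E. simpl in E. injection E as E1 E2. f_equal; lia.
    - intros [m n] N. exists (- n, m)%Z. simpl. split. intros E. injection E as E1 E2. apply N. f_equal; lia. f_equal; lia. }
  eapply is_sum_ext; [|exact (is_sum_scal _ _ (tau ^ 4) _ (is_sum_bijection _ _ _ _ _ B (eisenstein_is_sum tau Ht)))].
  intros p Hp. cbv beta. pose proof (UHP_nonzero tau Ht) as N.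
  assert (Hq : nonzero_pair (snd p, - fst p)%Z) by (apply B; auto).
  pose proof (lattice_term_denominator _ tau Hq Ht) as D. unfold lattice_term.
  destruct p as [m n]. simpl fst in *. simpl snd in *. rewrite opp_IZR, RtoC_opp in *.
  replace (IZR m * - / tau + IZR n) with ((IZR n * tau + - IZR m) / tau) by (field; auto).
  field. auto.
Qed.

(** The number [zeta] 4 as an unordered complex sum, which can be reindexed by lattice points. *)
Definition zeta4_sum : C := sum_over (fun _ : nat => True) (fun n => RtoC (/ INR (S n) ^ 4)).

Lemma zeta4_is_sum : is_sum_over (fun _ : nat => True) (fun n => RtoC (/ INR (S n) ^ 4)) zeta4_sum.
Proof.
  apply (dominated_is_sum _ _ (fun n => / (1 + INR n ^ 2))%R).
  - apply (sum_bounded_summable _ _ 5); [|apply sum_bounded_inv_square].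
    intros n _. left. apply Rinv_0_lt_compat. pose proof (pow2_ge_0 (INR n)); lra.
  - intros n _. pose proof (pos_INR n). rewrite Cmod_R, S_INR, Rabs_pos_eq.
    + apply Rinv_le_contravar. pose proof (pow2_ge_0 (INR n)); lra.
      replace ((INR n + 1) ^ 4)%R with (((INR n + 1) ^ 2) ^ 2)%R by ring. set (x := ((INR n + 1) ^ 2)%R).
      assert (1 + INR n ^ 2 <= x) by (unfold x; nra). pose proof (pow2_ge_0 (INR n)). nra.
    + left. apply Rinv_0_lt_compat. apply pow_lt; lra.
Qed.

Lemma zeta4_sum_eq : zeta4_sum = RtoC (zeta 4).
Proof.
  pose proof zeta4_is_sum as HS.
  assert (Er : zeta4_sum = RtoC (Re zeta4_sum)).
  { assert (E : Cconj zeta4_sum = zeta4_sum).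
    { eapply is_sum_over_unique; [|exact HS]. eapply is_sum_ext; [|apply is_sum_conj, HS].
      intros n _. apply injective_projections; simpl; ring. }
    apply (f_equal Im) in E. rewrite im_conj in E. assert (E0 : Im zeta4_sum = 0%R) by lra.
    rewrite (Cdecomp zeta4_sum) at 1. rewrite E0. ring. }
  rewrite Er. f_equal. symmetry. apply is_series_unique.
  change (is_lim_seq (sum_n (fun n => / INR (S n) ^ 4)%R) (Re zeta4_sum)).
  apply is_lim_seq_spec. intros eps.
  destruct (is_sum_nat _ _ HS eps (cond_pos eps)) as [N HN]. exists N. intros n Hn.
  assert (Ep : psum (fun n => RtoC (/ INR (S n) ^ 4)) (S n) = RtoC (sum_n (fun n => / INR (S n) ^ 4)%R n)).
  { clear. induction n. rewrite sum_O. simpl. ring. rewrite sum_Sn. simpl psum in *. rewrite IHn. rewrite <- RtoC_plus. reflexivity. }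
  specialize (HN (S n) ltac:(lia)). rewrite Ep, Er, <- RtoC_minus, Cmod_R in HN. exact HN.
Qed.

(** Makes the division by 2 zeta(4) in [E4] genuine. *)
Lemma zeta4_pos : 0 < zeta 4.
Proof.
  pose proof zeta4_is_sum as HS. destruct (is_sum_nat _ _ HS (1 / 2)%R ltac:(lra)) as [N HN].
  specialize (HN (S N) ltac:(lia)). rewrite zeta4_sum_eq in HN.
  assert (P : forall n, 1 <= Re (psum (fun n => RtoC (/ INR (S n) ^ 4)) (S n))).
  { induction n. simpl. lra. cbn [psum] in *. rewrite re_plus, re_RtoC.
    assert (0 < / INR (S (S n)) ^ 4). { apply Rinv_0_lt_compat. apply pow_lt. apply lt_0_INR; lia. } lra. }
  specialize (P N). pose proof (re_le_Cmod (psum (fun n => RtoC (/ INR (S n) ^ 4)) (S N) - RtoC (zeta 4))) as L.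
  rewrite re_minus, re_RtoC in L. pose proof (Rle_abs (Re (psum (fun n => RtoC (/ INR (S n) ^ 4)) (S N)) - zeta 4)). lra.
Qed.

(** The termwise limit at the cusp: only the pairs with m = 0 survive, and each n occurs with both
    signs, whence 2 zeta(4). *)
Definition lattice_limit (p : Z * Z) : C := if Z.eq_dec (fst p) 0 then RtoC (/ IZR (snd p) ^ 4) else 0.

Lemma lattice_limit_is_sum : is_sum_over nonzero_pair lattice_limit (2 * zeta 4).
Proof.
  pose proof zeta4_is_sum as HS. rewrite zeta4_sum_eq in HS.
  assert (Ip : bijection (fun p : Z * Z => fst p = 0%Z /\ (0 < snd p)%Z) (fun _ : nat => True) (fun p => Z.to_nat (snd p - 1))).
  { repeat split; auto.
    - intros [m n] [m' n'] [Hm Hn] [Hm' Hn'] E. cbn [fst snd] in *. f_equal; lia.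
    - intros k _. exists (0, Z.of_nat (S k))%Z. cbn [fst snd]. split. split; [auto|lia]. lia. }
  assert (In : bijection (fun p : Z * Z => fst p = 0%Z /\ (snd p < 0)%Z) (fun _ : nat => True) (fun p => Z.to_nat (- snd p - 1))).
  { repeat split; auto.
    - intros [m n] [m' n'] [Hm Hn] [Hm' Hn'] E. cbn [fst snd] in *. f_equal; lia.
    - intros k _. exists (0, - Z.of_nat (S k))%Z. cbn [fst snd]. split. split; [auto|lia]. lia. }
  pose proof (is_sum_bijection _ _ _ _ _ Ip HS) as Sp. pose proof (is_sum_bijection _ _ _ _ _ In HS) as Sn. cbv beta in Sp, Sn.
  assert (Sp' : is_sum_over (fun p : Z * Z => fst p = 0%Z /\ (0 < snd p)%Z) lattice_limit (zeta 4)).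
  { eapply is_sum_ext; [|exact Sp]. intros [m n] [Hm Hn]. simpl in Hm, Hn. unfold lattice_limit. cbn [fst snd]. subst m. simpl Z.eq_dec. cbn [fst snd].
    rewrite INR_IZR_INZ. do 4 f_equal. lia. }
  assert (Sn' : is_sum_over (fun p : Z * Z => fst p = 0%Z /\ (snd p < 0)%Z) lattice_limit (zeta 4)).
  { eapply is_sum_ext; [|exact Sn]. intros [m n] [Hm Hn]. simpl in Hm, Hn. unfold lattice_limit. cbn [fst snd]. subst m. simpl Z.eq_dec. cbn [fst snd].
    rewrite INR_IZR_INZ. replace (Z.of_nat (S (Z.to_nat (- n - 1)))) with (- n)%Z by lia. rewrite opp_IZR. do 2 f_equal. ring. }
  assert (S0 : is_sum_over (fun p : Z * Z => fst p <> 0%Z) lattice_limit 0).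
  { apply is_sum_over_iff. intros eps He. exists []. split. split; constructor. intros s [_ Hs] _.
    replace (lsum lattice_limit s) with (RtoC 0). replace (RtoC 0 - 0) with (RtoC 0) by ring. rewrite Cmod_0; auto.
    clear -Hs. unfold lsum. induction Hs as [|p s Hp Hs IH]; simpl; auto. rewrite <- IH. unfold lattice_limit.
    destruct (Z.eq_dec (fst p) 0). contradiction. ring. }
  replace (2 * zeta 4) with (zeta 4 + zeta 4 + 0) by ring.
  apply (is_sum_bijection _ (fun p : Z * Z => ((fst p = 0%Z /\ (0 < snd p)%Z) \/ (fst p = 0%Z /\ (snd p < 0)%Z)) \/ fst p <> 0%Z) (fun p => p)).
  { repeat split; auto.
    - intros [m n] N. cbn [fst snd]. destruct (Z.eq_dec m 0) as [->|Nm]; auto. left.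
      assert (n <> 0)%Z by (intros ->; auto). lia.
    - intros [m n] H. exists (m, n). split; auto. cbn [fst snd] in H. intros E. injection E as -> ->. lia. }
  apply is_sum_union. lia. apply is_sum_union; auto. lia. auto.
Qed.

(** The translation by N tau is there because [lattice_bound] requires a bounded real part:
    [eisenstein_cusp] first moves tau into |Re tau| <= 1/2. For m <> 0 the estimate |m tau + n| >=
    Im tau is insensitive to it. *)
Lemma lattice_term_cusp (p : Z * Z) (N : C -> Z) : nonzero_pair p ->
  tends_cusp (fun tau => lattice_term p (tau + IZR (N tau))) (lattice_limit p).
Proof.
  intros Hp. unfold lattice_term, lattice_limit. destruct p as [m n]. cbn [fst snd].
  destruct (Z.eq_dec m 0) as [->|Nm].
  - eapply (tends_cusp_ext (fun _ => RtoC (/ IZR n ^ 4))); [|apply tends_cusp_const].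
    assert (Nn : IZR n <> 0%R) by (apply not_0_IZR; intros ->; auto).
    intros tau _. rewrite Cmult_0_l, Cplus_0_l, RtoC_inv, RtoC_pow by (apply pow_nonzero; auto). field.
    intros E. apply RtoC_inj in E. auto.
  - apply tends_cusp_iff. intros eps He. exists (1 + / eps)%R. intros tau Ht.
    assert (Pe : 0 < / eps) by (apply Rinv_0_lt_compat; auto).
    set (w := IZR m * (tau + IZR (N tau)) + IZR n).
    assert (L : Im tau <= Cmod w).
    { eapply Rle_trans; [|apply im_le_Cmod]. unfold w. rewrite im_plus, im_scal_l, im_plus, !im_RtoC, !Rplus_0_r, Rabs_mult.
      rewrite (Rabs_pos_eq (Im tau)) by lra. rewrite <- (Rmult_1_l (Im tau)) at 1. apply Rmult_le_compat_r. lra.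
      rewrite <- abs_IZR. apply (IZR_le 1). lia. }
    assert (Nw : w <> 0) by (apply Cmod_gt_0; lra).
    replace (1 / w ^ 4 - 0) with (/ w ^ 4) by (field; auto).
    rewrite Cmod_inv by (apply Cpow_nz; auto). rewrite Cmod_pow. set (c := Cmod w) in *.
    rewrite <- (Rinv_inv eps). apply Rinv_lt_contravar. apply Rmult_lt_0_compat; auto. apply pow_lt; lra.
    apply Rlt_le_trans with c. lra. rewrite <- (pow_1 c) at 1. apply Rle_pow. lra. lia.
Qed.

Lemma eisenstein_shift_Z (n : Z) tau : UHP tau -> eisenstein_sum (tau + IZR n) = eisenstein_sum tau.
Proof.
  intros Ht. symmetry. revert n tau Ht.
  intros n tau0 Ht0. apply (UHP_translate_Z (fun tau => eisenstein_sum tau = eisenstein_sum (tau0 + IZR n))) with (n := n); auto.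
  - intros tau Ht E. rewrite <- eisenstein_shift; auto.
  - intros tau Ht E. rewrite <- E. replace tau with (tau - 1 + 1) at 1 by ring. apply eisenstein_shift.
    unfold upper_half_plane in *. rewrite im_minus, im_RtoC. lra.
Qed.

Lemma eisenstein_cusp : tends_cusp eisenstein_sum (2 * zeta 4).
Proof.
  assert (exists N : C -> Z, forall tau, - (1 / 2) <= Re tau + IZR (N tau) <= 1 / 2) as [N HN].
  { exists (fun tau => proj1_sig (constructive_indefinite_description _ (nearest_integer (Re tau)))).
    intros tau. apply proj2_sig. }
  apply (tends_cusp_ext (fun tau => sum_over nonzero_pair (fun p => lattice_term p (tau + IZR (N tau))))).
  { intros tau Ht. apply (eisenstein_shift_Z (N tau) tau Ht). }
  rewrite <- (sum_over_eq _ _ _ lattice_limit_is_sum).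
  apply (dominated_convergence cusp nonzero_pair (fun tau p => lattice_term p (tau + IZR (N tau))) lattice_limit (lattice_bound (1 / 2) 1)).
  - apply lattice_bound_summable. lra.
  - intros p Hp. apply lattice_term_cusp; auto.
  - exists 1%R. intros tau Ht p Hp. apply Cmod_lattice_term; auto. lra.
    + rewrite im_plus, im_RtoC. lra.
    + rewrite re_plus, re_RtoC. apply Rabs_le. specialize (HN tau). lra.
  (* The limit inherits the majorant: it is compared with the term at one point high enough for both
     estimates. *)
  - intros p Hp. apply le_epsilon. intros eps He.
    pose proof (lattice_term_cusp p N Hp) as HL. rewrite tends_cusp_iff in HL. destruct (HL eps He) as [Y HY].
    set (tau := (0, Rmax Y 1 + 1)%R : C).
    assert (Hi : Y < Im tau /\ 1 < Im tau). { unfold tau; simpl. pose proof (Rmax_l Y 1). pose proof (Rmax_r Y 1). lra. }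
    specialize (HY tau (proj1 Hi)).
    pose proof (Cmod_reverse_triangle (lattice_limit p) (lattice_term p (tau + IZR (N tau)))) as T. rewrite Cmod_minus_sym in T.
    assert (Cmod (lattice_term p (tau + IZR (N tau))) <= lattice_bound (1 / 2) 1 p); [|lra].
    apply Cmod_lattice_term; auto. lra.
    + rewrite im_plus, im_RtoC. lra.
    + rewrite re_plus, re_RtoC. apply Rabs_le. specialize (HN tau). lra.
Qed.

Theorem E4_theta tau : UHP tau -> E4 tau = thE4 tau.
Proof.
  intros Ht. assert (Nz : 2 * zeta 4 <> 0).
  { rewrite <- RtoC_mult. intros E. apply RtoC_inj in E. pose proof zeta4_pos. lra. }
  change (E4 tau) with (1 / (2 * zeta 4) * eisenstein_sum tau).
  apply Ceq_minus.
  apply (small_weight_vanishing (fun t => 1 / (2 * zeta 4) * eisenstein_sum t - thE4 t) 2); auto.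
  - apply (holomorphic_minus UHP (fun t => 1 / (2 * zeta 4) * eisenstein_sum t) thE4); [|apply thE4_holomorphic].
    apply (holomorphic_mult UHP (fun _ => 1 / (2 * zeta 4)) eisenstein_sum). apply holomorphic_const. apply eisenstein_holomorphic.
  - intros t Hh. rewrite eisenstein_shift, thE4_shift; auto.
  - intros t Hh. rewrite eisenstein_inversion, thE4_inversion by auto. simpl. ring.
  - eapply tends_cusp_val.
    + apply tends_cusp_minus. apply tends_cusp_mult. apply tends_cusp_const. apply eisenstein_cusp. apply thE4_cusp.
    + field. intros E. apply Nz. rewrite E. ring.
Qed.

(** * The square root of j - 1 on the fundamental domain *)

(** Bisection keeps the property that, for each point of T, the rectangle contains a point of T
    where f is no larger. If all four quarters failed, the least of the four witnesses would
    contradict it. At the limit point closedness and continuity conclude. *)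
Lemma rectangle_minimum (T : C -> Prop) (f : C -> R) (x1 x2 y1 y2 : R) :
  x1 <= x2 -> y1 <= y2 ->
  (forall z, T z -> x1 <= Re z <= x2 /\ y1 <= Im z <= y2) -> (exists z, T z) ->
  (forall p, (forall eps, 0 < eps -> exists z, T z /\ Cmod (z - p) < eps) -> T p) ->
  (forall p, T p -> forall eps, 0 < eps -> exists d, 0 < d /\ forall z, Cmod (z - p) < d -> Rabs (f z - f p) < eps) ->
  exists p, T p /\ forall q, T q -> f p <= f q.
Proof.
  intros Hx Hy HT [z0 Hz0] Hcl Hf.
  set (P := fun a b c d => forall q, T q -> exists r, T r /\ a <= Re r <= b /\ c <= Im r <= d /\ f r <= f q).
  assert (min2 : forall q q', T q -> T q' -> exists q'', T q'' /\ f q'' <= f q /\ f q'' <= f q').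
  { intros q q' Hq Hq'. destruct (Rle_dec (f q) (f q')); [exists q|exists q']; repeat split; auto; lra. }
  assert (bad : forall a b c d, ~ P a b c d -> exists q, T q /\ forall r, T r -> a <= Re r <= b -> c <= Im r <= d -> f q < f r).
  { intros a b c d N. apply not_all_ex_not in N. destruct N as [q N]. apply imply_to_and in N. destruct N as [Hq N].
    exists q. split; auto. intros r Hr Hre Him. apply Rnot_le_lt. intros L. apply N. exists r. auto. }
  destruct (quad_bisection P x1 x2 y1 y2) as (px & py & Hpx & Hpy & HN); auto.
  - intros a b c d _ _ _ _ HP. apply NNPP. intros N.
    apply not_or_and in N. destruct N as [N1 N]. apply not_or_and in N. destruct N as [N2 N]. apply not_or_and in N. destruct N as [N3 N4].
    apply bad in N1, N2, N3, N4. destruct N1 as (q1 & T1 & B1). destruct N2 as (q2 & T2 & B2).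
    destruct N3 as (q3 & T3 & B3). destruct N4 as (q4 & T4 & B4).
    destruct (min2 q1 q2 T1 T2) as (q5 & T5 & L1 & L2). destruct (min2 q3 q4 T3 T4) as (q6 & T6 & L3 & L4).
    destruct (min2 q5 q6 T5 T6) as (q & Tq & L5 & L6).
    destruct (HP q Tq) as (r & Tr & Rr & Ir & Lr).
    destruct (Rle_dec (Re r) ((a + b) / 2)), (Rle_dec (Im r) ((c + d) / 2)).
    + specialize (B1 r Tr ltac:(lra) ltac:(lra)). lra.
    + specialize (B3 r Tr ltac:(lra) ltac:(lra)). lra.
    + specialize (B2 r Tr ltac:(lra) ltac:(lra)). lra.
    + specialize (B4 r Tr ltac:(lra) ltac:(lra)). lra.
  - intros q Hq. exists q. split; auto. destruct (HT q Hq). repeat split; try tauto. lra.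
  - set (p := (px, py) : C).
    assert (near : forall eps, 0 < eps -> forall q, T q -> exists r, T r /\ Cmod (r - p) < eps /\ f r <= f q).
    { intros eps He q Hq. destruct (Rpow_small (/ 2) ((x2 - x1) + (y2 - y1)) eps ltac:(lra) He) as [N HNe].
      destruct (HN N) as (a & b & c & d & Ha & Hb & Hc & Hd & Eb & Ed & HP).
      destruct (HP q Hq) as (r & Tr & Rr & Ir & Lr). exists r. repeat split; auto.
      eapply Rle_lt_trans; [apply Cmod_le_re_im|]. rewrite re_minus, im_minus. simpl Re; simpl Im.
      eapply Rle_lt_trans; [|exact HNe]. rewrite pow_inv.
      assert (Rabs (Re r - px) <= b - a) by (apply Rabs_le; lra). assert (Rabs (Im r - py) <= d - c) by (apply Rabs_le; lra).
      unfold Rdiv in Eb, Ed. lra. }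
    assert (Tp : T p). { apply Hcl. intros eps He. destruct (near eps He z0 Hz0) as (r & Tr & Lr & _). exists r; auto. }
    exists p. split; auto. intros q Hq. apply le_epsilon. intros eps He.
    destruct (Hf p Tp eps He) as (d & Hd & Hc). destruct (near d Hd q Hq) as (r & Tr & Lr & Lf).
    specialize (Hc r Lr). apply Rabs_lt_between in Hc. lra.
Qed.

Lemma cder_zero_segment (f : C -> C) (a b : C) : (forall s : R, 0 <= s <= 1 -> cder f (a + s * (b - a)) 0) -> f b = f a.
Proof.
  intros Hf. assert (E : CInt (fun _ => RtoC 0) 0 1 = f (a + RtoC 1 * (b - a)) - f (a + RtoC 0 * (b - a))).
  { apply (CInt_FTC (fun s => f (a + RtoC s * (b - a)))).
    - intros s Hs. replace (RtoC 0) with (0 * (b - a)) by ring. apply (cder_along f (fun s => a + RtoC s * (b - a))).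
      + apply is_RCderive_iff. intros eps He. exists 1%R. split; [lra|]. intros h _.
        replace (a + RtoC (s + h)%R * (b - a) - (a + RtoC s * (b - a)) - h * (b - a)) with (RtoC 0) by (rewrite RtoC_plus; ring).
        rewrite Cmod_0. apply Rmult_le_pos; [lra|apply Rabs_pos].
      + apply Hf. minmax.
    - intros s _. apply C_continuous_const. }
  rewrite CInt_const in E. replace (a + RtoC 1 * (b - a)) with b in E by ring. replace (a + RtoC 0 * (b - a)) with a in E by ring.
  rewrite Cmult_0_r in E. symmetry in E. apply Ceq_minus in E. exact E.
Qed.

(** A step s u with |u| = 1 keeps Re f at 0, so Re (l u) = 0; take u = 1 and u = i. *)
Lemma cder_re_zero (f : C -> C) (c l : C) (r : R) : 0 < r -> (forall z, disc c r z -> Re (f z) = 0%R) -> cder f c l -> l = 0.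
Proof.
  intros Hr H0 Hf.
  assert (key : forall u : C, Cmod u = 1%R -> Re (l * u) = 0%R).
  { intros u Hu. apply Rabs_eq_0. apply Rle_antisym; [|apply Rabs_pos]. apply le_epsilon. intros eps He. rewrite Rplus_0_l.
    destruct (Hf eps He) as (d & Hd & HD). set (s := (Rmin d r / 2)%R).
    assert (Hs : 0 < s /\ s < d /\ s < r).
    { unfold s. pose proof (Rmin_pos d r Hd Hr). pose proof (Rmin_l d r). pose proof (Rmin_r d r). lra. }
    assert (Ms : Cmod (s * u) = s) by (rewrite Cmod_mult, Hu, Cmod_R, Rabs_pos_eq; lra).
    specialize (HD (s * u)). rewrite Ms in HD. specialize (HD ltac:(lra)).
    pose proof (re_le_Cmod (f (c + s * u) - f c - l * (s * u))) as L.
    rewrite !re_minus, !H0 in L.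
    - replace (l * (s * u)) with (s * (l * u)) in L, HD by ring. rewrite re_scal_l in L.
      replace (0 - 0 - s * Re (l * u))%R with (- (s * Re (l * u)))%R in L by ring. rewrite Rabs_Ropp, Rabs_mult, (Rabs_pos_eq s) in L by lra.
      apply Rmult_le_reg_l with s; [lra|]. lra.
    - apply center_in_disc; auto.
    - cbv beta. replace (c + s * u - c) with (s * u) by ring. lra. }
  pose proof (key 1 Cmod_1) as K1. pose proof (key Ci Cmod_Ci) as K2.
  rewrite Cmult_1_r in K1. replace (Re (l * Ci)) with (- Im l)%R in K2 by (simpl; unfold Re, Im; ring).
  rewrite (Cdecomp l), K1. replace (Im l) with 0%R by lra. ring.
Qed.

(* R^2 = 27/4 (j - 1). *)
Definition thR (tau : C) : C := thE6 tau / thABC tau.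

Lemma thR_holomorphic : holomorphic_on UHP thR.
Proof. apply (holomorphic_div UHP thE6 thABC thE6_holomorphic thABC_holomorphic thABC_nonzero). Qed.

Lemma thR_shift tau : UHP tau -> thR (tau + 1) = - thR tau.
Proof. intros Ht. unfold thR. rewrite thE6_shift, thABC_shift by auto. field. apply thABC_nonzero; auto. Qed.

Lemma thR_inversion tau : UHP tau -> thR (- / tau) = - thR tau.
Proof.
  intros Ht. unfold thR. rewrite thE6_inversion, thABC_inversion by auto.
  pose proof (thABC_nonzero tau Ht). pose proof (UHP_nonzero tau Ht). field. auto.
Qed.

Lemma Cconj_pow (z : C) (n : nat) : Cconj (z ^ n) = Cconj z ^ n.
Proof. induction n; simpl. apply injective_projections; simpl; ring. rewrite Cmult_conj, IHn. reflexivity. Qed.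

Lemma thR_conj tau : UHP tau -> thR (- Cconj tau) = Cconj (thR tau).
Proof.
  intros Ht. pose proof (thABC_nonzero tau Ht) as N.
  assert (EA : thA (- Cconj tau) = Cconj (thA tau)) by (unfold thA; rewrite theta_conj by auto; symmetry; apply Cconj_pow).
  assert (EB : thB (- Cconj tau) = Cconj (thB tau)) by (unfold thB; rewrite theta_conj by auto; symmetry; apply Cconj_pow).
  assert (EC : thC (- Cconj tau) = Cconj (thC tau)) by (unfold thC; rewrite theta_conj by auto; symmetry; apply Cconj_pow).
  unfold thR. unfold Cdiv. rewrite Cmult_conj, Cinv_conj by auto. unfold thE6, thABC. unfold Cdiv. rewrite EA, EB, EC.
  rewrite !Cmult_conj, !Cplus_conj, Cminus_conj. do 2 f_equal.
  rewrite Cinv_conj by apply two_nonzero. f_equal. apply injective_projections; simpl; ring.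
Qed.

Lemma re_opp_conj (z : C) : - z = Cconj z -> Re z = 0%R.
Proof. intros E. apply (f_equal Re) in E. rewrite re_opp, re_conj in E. lra. Qed.

(** On the unit circle - 1/tau = - conj tau, so R is minus its own conjugate. *)
Lemma re_thR_unit_circle tau : UHP tau -> Cmod tau = 1%R -> Re (thR tau) = 0%R.
Proof.
  intros Ht Hm. apply re_opp_conj. rewrite <- thR_inversion, <- thR_conj by auto. do 2 f_equal.
  pose proof (UHP_nonzero tau Ht) as N.
  assert (E : tau * Cconj tau = 1). { rewrite <- Cmod2_conj, Hm. apply injective_projections; simpl; ring. }
  rewrite <- (Cmult_1_l (Cconj tau)), <- (Cinv_l tau N), <- Cmult_assoc, E. ring.
Qed.

(** On these lines - conj tau is tau - 1 or tau + 1, and translation changes the sign of R. *)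
Lemma re_thR_half tau : UHP tau -> Re tau = (1 / 2)%R \/ Re tau = (- (1 / 2))%R -> Re (thR tau) = 0%R.
Proof.
  intros Ht Hx.
  assert (U : UHP (- Cconj tau)).
  { unfold upper_half_plane in *. rewrite im_opp, im_conj. lra. }
  apply re_opp_conj. rewrite <- thR_conj by auto.
  destruct Hx as [Hx|Hx].
  - replace tau with (- Cconj tau + 1) at 1.
    + rewrite thR_shift by auto. ring.
    + apply injective_projections; simpl. change (fst tau) with (Re tau). rewrite Hx. lra. ring.
  - replace (- Cconj tau) with (tau + 1). rewrite thR_shift; auto.
    apply injective_projections; simpl. change (fst tau) with (Re tau). rewrite Hx. lra. ring.
Qed.

Definition thR_reduced (tau : C) : C := Cexp (PI * Ci * tau) * thR tau.

Lemma thR_reduced_eq tau : UHP tau -> thR_reduced tau = thE6 tau / (thA tau * thB tau * thC_reduced tau).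
Proof.
  intros Ht. pose proof (thABC_nonzero tau Ht) as N. unfold thR_reduced, thR, thABC in *. rewrite thC_factor in *.
  pose proof (Cexp_nonzero (PI * Ci * tau)). field. repeat split; auto; intros E; apply N; rewrite E; ring.
Qed.

Lemma thR_reduced_cusp : tends_cusp thR_reduced (/ 16).
Proof.
  eapply (tends_cusp_ext (fun t => thE6 t / (thA t * thB t * thC_reduced t))). { intros; symmetry; apply thR_reduced_eq; auto. }
  eapply tends_cusp_val.
  - apply (tends_cusp_div thE6 (fun t => thA t * thB t * thC_reduced t)). 2: apply thE6_cusp.
    2: apply tends_cusp_mult; [apply tends_cusp_mult|]; [apply thA_cusp|apply thB_cusp|apply thC_reduced_cusp].
    rewrite !Cmult_1_l. intros E. apply RtoC_inj in E. lra.
  - field.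
Qed.

Lemma thR_reduced_holomorphic : holomorphic_on UHP thR_reduced.
Proof.
  apply (holomorphic_mult UHP (fun t => Cexp (PI * Ci * t)) thR). intros t Ht. eapply cder_ex. apply cder_Cexp_linear.
  apply thR_holomorphic.
Qed.

Lemma thR_reduced_shift tau : UHP tau -> thR_reduced (tau + 1) = thR_reduced tau.
Proof.
  intros Ht. unfold thR_reduced. rewrite thR_shift by auto.
  replace (PI * Ci * (tau + 1)) with (PI * Ci * tau + PI * Ci) by ring. rewrite Cexp_plus, Cexp_PI_Ci. ring.
Qed.

(** Near the cusp R = exp(- pi i tau)/16 (1 + O(q)). The main term has argument - pi Re tau, within
    [-pi/2, pi/2] on the strip, hence nonnegative real part. The error has size e^(pi y) e^(-2 pi
    y), which tends to 0. *)
Lemma re_thR_lower : forall eps, 0 < eps -> exists Y, forall tau, Y < Im tau -> Rabs (Re tau) <= 1 / 2 -> - eps <= Re (thR tau).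
Proof.
  intros eps He.
  destruct (periodic_vanishing_decay (fun t => 16 * thR_reduced t - 1) 1 Rlt_0_1) as (K & HK & HB).
  - apply (holomorphic_minus UHP (fun t => 16 * thR_reduced t) (fun _ => 1)).
    + apply (holomorphic_mult UHP (fun _ => 16) thR_reduced). apply holomorphic_const. apply thR_reduced_holomorphic.
    + apply holomorphic_const.
  - intros t Ht. rewrite thR_reduced_shift; auto.
  - eapply tends_cusp_val.
    + apply tends_cusp_minus. apply tends_cusp_mult. apply tends_cusp_const. apply thR_reduced_cusp. apply tends_cusp_const.
    + field.
  - pose proof PI_RGT_0 as Hpi. exists (Rmax 1 (K / (eps * PI))). intros tau Ht Hr.
    assert (H1 : 1 < Im tau /\ K / (eps * PI) < Im tau).
    { pose proof (Rmax_l 1 (K / (eps * PI))). pose proof (Rmax_r 1 (K / (eps * PI))). lra. }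
    destruct H1 as [H1 H2]. specialize (HB tau H1).
    set (y := Im tau) in *. set (g := 16 * thR_reduced tau - 1) in *.
    set (e := Cexp (- (PI * Ci * tau))).
    assert (Eg : thR tau = / 16 * (e + e * g)).
    { unfold g, thR_reduced, e. rewrite Cexp_opp. pose proof (Cexp_nonzero (PI * Ci * tau)). field. auto. }
    assert (Rarg : Re (- (PI * Ci * tau)) = (PI * y)%R /\ Im (- (PI * Ci * tau)) = (- (PI * Re tau))%R).
    { split; simpl; unfold y, Re, Im; ring. }
    destruct Rarg as [Ra Ia].
    assert (Me : Cmod e = exp (PI * y)) by (unfold e; rewrite Cmod_Cexp, Ra; auto).
    assert (Re_e : 0 <= Re e).
    { unfold e. rewrite Cexp_cis, re_scal_l, Ra, Ia. apply Rmult_le_pos. left; apply exp_pos. simpl. rewrite cos_neg.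
      apply Rabs_le_between in Hr. apply cos_ge_0; nra. }
    assert (Mg : Cmod (e * g) <= K * exp (- (PI * y))).
    { rewrite Cmod_mult, Me. apply Rle_trans with (exp (PI * y) * (K * exp (- (2 * PI * y))))%R.
      apply Rmult_le_compat_l; auto. left; apply exp_pos.
      right. replace (- (PI * y))%R with (PI * y + - (2 * PI * y))%R by ring. rewrite exp_plus. ring. }
    assert (Ke : K * exp (- (PI * y)) <= eps).
    { assert (Py : 0 < PI * y) by (apply Rmult_lt_0_compat; lra).
      pose proof (exp_ineq1 (PI * y) ltac:(lra)) as Ex. rewrite exp_Ropp.
      apply Rmult_le_reg_r with (exp (PI * y)). apply exp_pos. rewrite Rmult_assoc, Rinv_l, Rmult_1_r by (pose proof (exp_pos (PI * y)); lra).
      assert (K < eps * (PI * y)).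
      { apply Rmult_lt_compat_r with (r := (eps * PI)%R) in H2. 2: apply Rmult_lt_0_compat; lra.
        unfold Rdiv in H2. rewrite Rmult_assoc, Rinv_l in H2. lra. apply Rgt_not_eq. apply Rmult_lt_0_compat; lra. }
      nra. }
    pose proof (re_le_Cmod (e * g)) as L. pose proof (Rle_abs (- Re (e * g))) as L'. rewrite Rabs_Ropp in L'.
    rewrite Eg. replace (/ 16) with (RtoC (/ 16)) by (apply RtoC_inv; lra). rewrite re_scal_l, re_plus. lra.
Qed.

(** * The minimum principle on the fundamental domain *)

Definition strip_domain (tau : C) : Prop := UHP tau /\ Rabs (Re tau) <= 1 / 2 /\ 1 <= Cmod tau.
Definition open_domain (tau : C) : Prop := UHP tau /\ Rabs (Re tau) < 1 / 2 /\ 1 < Cmod tau.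

(** The lowest points of the domain have height sqrt(3)/2 > 4/5. *)
Lemma strip_domain_im tau : strip_domain tau -> 4 / 5 < Im tau.
Proof.
  intros (Ht & Hr & Hm). unfold upper_half_plane in Ht. apply Rnot_le_lt. intros L.
  assert (H : 1 <= Cmod tau ^ 2) by (rewrite <- (pow1 2); apply pow_incr; lra).
  rewrite Cmod2_alt in H. change (fst tau) with (Re tau) in H. change (snd tau) with (Im tau) in H.
  apply Rabs_le_between in Hr. nra.
Qed.

Lemma strip_domain_closed p : (forall eps, 0 < eps -> exists z, strip_domain z /\ Cmod (z - p) < eps) -> strip_domain p.
Proof.
  intros H. assert (HI : 4 / 5 <= Im p).
  { apply le_epsilon. intros eps He. destruct (H eps He) as (z & Hz & L). apply strip_domain_im in Hz. apply disc_re_im in L. lra. }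
  repeat split.
  - unfold upper_half_plane. lra.
  - apply le_epsilon. intros eps He. destruct (H eps He) as (z & (_ & Hz & _) & L). apply disc_re_im in L.
    apply Rabs_le_between in Hz. apply Rabs_le. lra.
  - apply le_epsilon. intros eps He. destruct (H eps He) as (z & (_ & _ & Hz) & L).
    pose proof (Cmod_reverse_triangle z p). lra.
Qed.

Lemma strip_domain_disc p w : strip_domain p -> Cmod w <= 1 / 2 - Rabs (Re p) -> Cmod w <= Cmod p - 1 -> strip_domain (p + w).
Proof.
  intros Hp H1 H2. pose proof (strip_domain_im p Hp) as Hi. pose proof (Rabs_pos (Re p)) as P0.
  pose proof (re_le_Cmod w) as Lr. pose proof (im_le_Cmod w) as Li. repeat split.
  - unfold upper_half_plane. rewrite im_plus. apply Rabs_le_between in Li. lra.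
  - rewrite re_plus. eapply Rle_trans; [apply Rabs_triang|]. lra.
  - pose proof (Cmod_reverse_triangle p (- w)) as T. rewrite Cmod_opp in T. replace (p - - w) with (p + w) in T by ring. lra.
Qed.

Lemma mean_value_thR p w m : strip_domain p -> Cmod w <= 1 / 2 - Rabs (Re p) -> Cmod w <= Cmod p - 1 ->
  (forall q, strip_domain q -> m <= Re (thR q)) -> Re (thR p) = m -> Re (thR (p + w)) = m.
Proof.
  intros Hp H1 H2 Hm E. pose proof (strip_domain_im p Hp) as Hi. pose proof (Rabs_pos (Re p)) as P0.
  apply (mean_value_minimum thR p w (4 / 5)); auto. lra.
  - intros z Hz. apply disc_re_im in Hz. apply thR_holomorphic. unfold upper_half_plane. lra.
  - intros t. apply Hm. apply strip_domain_disc; auto; rewrite Cmod_mult, Cmod_cis, Rmult_1_r; auto.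
Qed.

(** A negative value would make the minimum negative and attained at some p. The largest disc about
    p inside the domain touches a boundary line or the unit circle, where Re R = 0, while the mean
    value property puts the negative minimum there too. *)
Theorem re_thR_nonneg tau : strip_domain tau -> 0 <= Re (thR tau).
Proof.
  intros Ht. apply Rnot_lt_le. intros Hneg.
  (* Above height Y the real part exceeds its value at tau, so the minimum over heights up to Y is
     the minimum over the whole domain. *)
  destruct (re_thR_lower (- Re (thR tau) / 2) ltac:(lra)) as [Y HY].
  assert (Hlow : Im tau <= Y). { apply Rnot_lt_le. intros L. specialize (HY tau L (proj1 (proj2 Ht))). lra. }
  pose proof (strip_domain_im tau Ht) as Hi.
  destruct (rectangle_minimum (fun z => strip_domain z /\ Im z <= Y) (fun z => Re (thR z)) (- (1 / 2)) (1 / 2) (4 / 5) Y)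
    as (p & [Hp HpY] & Hmin); try lra.
  - intros z [Hz HzY]. pose proof (strip_domain_im z Hz). destruct Hz as (_ & Hr & _). apply Rabs_le_between in Hr. lra.
  - exists tau. auto.
  - intros p Hp. split.
    + apply strip_domain_closed. intros eps He. destruct (Hp eps He) as (z & [Hz _] & L). exists z; auto.
    + apply le_epsilon. intros eps He. destruct (Hp eps He) as (z & [_ HzY] & L). apply disc_re_im in L. lra.
  - intros p [Hp _] eps He.
    pose proof (ex_Cderive_continuous thR p (thR_holomorphic p (proj1 Hp))) as Hc.
    apply (proj1 (C_continuous_iff (T := C_UniformSpace) thR p)) with (2 := He) in Hc. apply C_locally_Cmod in Hc. destruct Hc as (d & Hd & Hc).
    exists d. split; auto. intros z Hz. rewrite <- re_minus. eapply Rle_lt_trans; [apply re_le_Cmod|]. apply Hc; auto.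
  - assert (Hall : forall q, strip_domain q -> Re (thR p) <= Re (thR q)).
    { intros q Hq. destruct (Rle_dec (Im q) Y) as [L|L]. apply Hmin; auto.
      pose proof (HY q ltac:(lra) (proj1 (proj2 Hq))). assert (Re (thR p) <= Re (thR tau)) by (apply (Hmin tau); auto). lra. }
    pose proof (Hall tau Ht) as Hpt.
    assert (touch : forall w, Cmod w <= 1 / 2 - Rabs (Re p) -> Cmod w <= Cmod p - 1 -> Re (thR (p + w)) <> 0%R).
    { intros w H1 H2 E. rewrite (mean_value_thR p w (Re (thR p)) Hp H1 H2 Hall eq_refl) in E. lra. }
    pose proof Hp as (Up & Hr & Hm).
    (* The nearer of the vertical side and the unit circle is reached: the side by the horizontal
       step x, the circle by the radial step s p. *)
    destruct (Rle_dec (1 / 2 - Rabs (Re p)) (Cmod p - 1)) as [L|L].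
    + set (x := if Rle_dec 0 (Re p) then (1 / 2 - Re p)%R else (- (1 / 2) - Re p)%R).
      assert (Mx : Cmod x = (1 / 2 - Rabs (Re p))%R).
      { rewrite Cmod_R. unfold x. destruct (Rle_dec 0 (Re p)).
        - rewrite (Rabs_pos_eq (Re p)) in * by auto. apply Rabs_pos_eq. lra.
        - rewrite (Rabs_left (Re p)) in * by lra. rewrite Rabs_left1; lra. }
      apply (touch x); [lra|lra|]. apply re_thR_half.
      * unfold upper_half_plane in *. rewrite im_plus, im_RtoC. lra.
      * rewrite re_plus, re_RtoC. unfold x. destruct (Rle_dec 0 (Re p)); [left|right]; lra.
    + set (s := ((1 - Cmod p) / Cmod p)%R).
      assert (Ms : Cmod (s * p) = (Cmod p - 1)%R).
      { rewrite Cmod_mult, Cmod_R. unfold s. unfold Rdiv. rewrite Rabs_mult, (Rabs_pos_eq (/ Cmod p)) by (left; apply Rinv_0_lt_compat; lra).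
        rewrite Rabs_left1 by lra. field. lra. }
      assert (Ep : p + s * p = RtoC (/ Cmod p) * p).
      { transitivity (RtoC (1 + s) * p). rewrite RtoC_plus; ring. do 2 f_equal. unfold s. field. lra. }
      apply (touch (s * p)); [lra|lra|]. rewrite Ep. apply re_thR_unit_circle.
      * apply UHP_scale; auto. apply Rinv_0_lt_compat; lra.
      * rewrite Cmod_mult, Cmod_R, Rabs_pos_eq. apply Rinv_l; lra. left; apply Rinv_0_lt_compat; lra.
Qed.

Lemma open_domain_strip tau : open_domain tau -> strip_domain tau.
Proof. intros (H1 & H2 & H3). repeat split; auto; lra. Qed.

(** If R' were 0, the derivative of exp(pi i tau) R would tend to pi i/16; but that function has a
    limit at the cusp, so its derivative tends to 0. *)
Lemma derive_thR_nonzero : exists tau, UHP tau /\ C_derive thR tau <> 0.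
Proof.
  apply NNPP. intros N.
  assert (HD : tends_cusp (C_derive thR_reduced) (PI * Ci * / 16)).
  { apply (tends_cusp_ext (fun t => PI * Ci * thR_reduced t)).
    - intros t Ht. symmetry. apply cder_C_derive. eapply cder_val.
      + apply cder_mult. apply cder_Cexp_linear. apply ex_Cderive_cder, thR_holomorphic; auto.
      + destruct (Ceq_dec (C_derive thR t) 0) as [E|E]. rewrite E. unfold thR_reduced. ring.
        exfalso. apply N. exists t. auto.
    - apply tends_cusp_mult. apply tends_cusp_const. apply thR_reduced_cusp. }
  assert (E : PI * Ci * / 16 = 0).
  { apply (C_filterlim_unique cusp _ _ _ HD).
    apply (tends_cusp_derive thR_reduced (/ 16) thR_reduced_holomorphic thR_reduced_cusp). }
  apply (f_equal Im) in E. replace (/ 16) with (RtoC (/ 16)) in E by (apply RtoC_inv; lra). simpl in E.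
  pose proof PI_RGT_0. lra.
Qed.

(** A zero of Re R in the interior is a minimum, so Re R vanishes on a whole disc by the mean value
    on its circles. Then R' = 0 there, hence everywhere by the identity theorem. *)
Theorem re_thR_pos tau : open_domain tau -> 0 < Re (thR tau).
Proof.
  intros Ht. pose proof (open_domain_strip tau Ht) as Hs. destruct (re_thR_nonneg tau Hs) as [L|E]; auto. exfalso.
  destruct Ht as (Hu & Hr & Hm).
  set (r := Rmin (1 / 2 - Rabs (Re tau)) (Cmod tau - 1)). assert (Hr0 : 0 < r) by (apply Rmin_pos; lra).
  assert (Z : forall z, disc tau r z -> Re (thR z) = 0%R).
  { intros z Hz. cbv beta in Hz. replace z with (tau + (z - tau)) by ring. pose proof (Rmin_l (1 / 2 - Rabs (Re tau)) (Cmod tau - 1)).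
    pose proof (Rmin_r (1 / 2 - Rabs (Re tau)) (Cmod tau - 1)). fold r in H, H0.
    apply mean_value_thR; auto; try lra. intros q Hq. apply re_thR_nonneg; auto. }
  destruct derive_thR_nonzero as (sigma & Hsig & N). apply N.
  apply (identity_segment UHP (C_derive thR) tau sigma UHP_open (holomorphic_derive UHP thR UHP_open thR_holomorphic)).
  - intros s Hs'. apply UHP_segment; auto.
  - intros eps He. set (d := (Rmin eps r / 2)%R).
    assert (Hd : 0 < d /\ d < eps /\ d < r).
    { unfold d. pose proof (Rmin_pos eps r He Hr0). pose proof (Rmin_l eps r). pose proof (Rmin_r eps r). lra. }
    exists (RtoC d). assert (Md : Cmod d = d) by (rewrite Cmod_R, Rabs_pos_eq; lra). rewrite Md. split. lra.
    apply (cder_re_zero thR (tau + d) _ (r - d)). lra.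
    + intros z Hz. cbv beta in Hz. apply Z. cbv beta. replace (z - tau) with (z - (tau + d) + d) by ring.
      eapply Rle_lt_trans; [apply Cmod_triangle|]. lra.
    + apply ex_Cderive_cder, thR_holomorphic. apply UHP_shift; auto.
Qed.

(** Points with Re tau = 1/2 or |tau| = 1 are excluded by a small step to the right or towards 0,
    which leaves the domain. *)
Lemma interior_open_domain tau : Cinterior fundamental_domain tau -> open_domain tau.
Proof.
  intros H. apply C_locally_Cmod in H. destruct H as (e & He & H).
  assert (H0 : fundamental_domain tau). { apply H. replace (tau - tau) with (RtoC 0) by ring. rewrite Cmod_0; auto. }
  assert (Ht : UHP tau) by (destruct H0 as [[? _]|[? _]]; auto).
  assert (Hr : - (1 / 2) < Re tau) by (destruct H0 as [(_ & ? & _)|(_ & _ & ?)]; lra).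
  assert (Hm : 1 <= Cmod tau) by (destruct H0 as [(_ & _ & ?)|(_ & ? & _)]; lra).
  repeat split; auto.
  - apply Rabs_lt_between. split; auto. apply Rnot_le_lt. intros L.
    assert (H1 : fundamental_domain (tau + RtoC (e / 2))).
    { apply H. replace (tau + RtoC (e / 2) - tau) with (RtoC (e / 2)) by ring. rewrite Cmod_R, Rabs_pos_eq; lra. }
    destruct H1 as [(_ & H1 & _)|(_ & _ & H1)]; rewrite re_plus, re_RtoC in H1; lra.
  - destruct Hm as [|E]; auto. exfalso. set (d := Rmin (e / 2) (1 / 2)).
    assert (Hd : 0 < d /\ d < e /\ d < 1).
    { unfold d. pose proof (Rmin_pos (e / 2) (1 / 2) ltac:(lra) ltac:(lra)). pose proof (Rmin_l (e / 2) (1 / 2)). pose proof (Rmin_r (e / 2) (1 / 2)). lra. }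
    assert (H1 : fundamental_domain (RtoC (1 - d) * tau)).
    { apply H. replace (RtoC (1 - d) * tau - tau) with (- (d * tau)) by (rewrite RtoC_minus; ring).
      rewrite Cmod_opp, Cmod_mult, <- E, Cmod_R, Rabs_pos_eq; lra. }
    assert (M : Cmod (RtoC (1 - d) * tau) = (1 - d)%R) by (rewrite Cmod_mult, <- E, Cmod_R, Rabs_pos_eq; lra).
    destruct H1 as [(_ & _ & H1)|(_ & H1 & _)]; rewrite M in H1; lra.
Qed.

(** Supplies interior points near 2 i for the final identity argument. *)
Lemma high_strip_interior tau : Rabs (Re tau) < 1 / 2 -> 1 < Im tau -> Cinterior fundamental_domain tau.
Proof.
  intros Hr Hi. apply C_locally_Cmod. exists (Rmin (1 / 2 - Rabs (Re tau)) (Im tau - 1)).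
  split. apply Rmin_pos; lra. intros w Hw. apply disc_re_im in Hw.
  pose proof (Rmin_l (1 / 2 - Rabs (Re tau)) (Im tau - 1)). pose proof (Rmin_r (1 / 2 - Rabs (Re tau)) (Im tau - 1)).
  pose proof (Rle_abs (Re tau)). pose proof (Rle_abs (- Re tau)). rewrite Rabs_Ropp in H2.
  left. repeat split; unfold upper_half_plane; try lra.
  pose proof (im_le_Cmod w). pose proof (Rle_abs (Im w)). lra.
Qed.

Lemma open_domain_ray tau (s : R) : 0 <= s -> open_domain tau -> open_domain (tau + Ci * s).
Proof.
  intros Hs (Hu & Hr & Hm). unfold upper_half_plane in Hu.
  assert (Er : Re (tau + Ci * s) = Re tau) by (simpl; unfold Re; ring).
  assert (Ei : Im (tau + Ci * s) = (Im tau + s)%R) by (simpl; unfold Im; ring).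
  repeat split.
  - unfold upper_half_plane. rewrite Ei. lra.
  - rewrite Er. auto.
  - apply Rlt_le_trans with (Cmod tau); auto. apply sqrt_le_1_alt.
    change (fst (tau + Ci * s)) with (Re (tau + Ci * s)). change (snd (tau + Ci * s)) with (Im (tau + Ci * s)).
    rewrite Er, Ei. change (fst tau) with (Re tau). change (snd tau) with (Im tau). nra.
Qed.

(** * The differential equation along the half-plane *)

(** Here lambda = C/A, and Jacobi's identity gives 1 - lambda = B/A and lambda^2 - lambda + 1 = (A^2
    + B^2 + C^2)/(2 A^2). *)
Lemma j_invariant_theta tau : UHP tau -> j_invariant tau = 4 / 27 * (thE4 tau ^ 3 / thDelta tau).
Proof.
  intros Ht. pose proof (thABC_nonzero tau Ht) as N. unfold thABC in N.
  assert (NA : thA tau <> 0) by (intros E; apply N; rewrite E; ring).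
  assert (NB : thB tau <> 0) by (intros E; apply N; rewrite E; ring).
  assert (NC : thC tau <> 0) by (intros E; apply N; rewrite E; ring).
  pose proof (Jacobi_identity tau Ht) as J.
  unfold j_invariant, thE4, thDelta, thABC.
  change (lambda tau) with (thC tau / thA tau).
  replace (1 - thC tau / thA tau) with (thB tau / thA tau) by (rewrite J; field; rewrite <- J; auto).
  set (a := thA tau) in *. set (b := thB tau) in *. set (c := thC tau) in *.
  replace ((c / a) ^ 2 - c / a + 1) with ((a ^ 2 + b ^ 2 + c ^ 2) / 2 / a ^ 2).
  - simpl. field. auto.
  - replace b with (a - c) by (rewrite J; ring). simpl. field. auto.
Qed.

Definition inv_j (tau : C) : C := 27 / 4 * thDelta tau / thE4 tau ^ 3.

Lemma discriminant_quotient tau : UHP tau -> thR tau ^ 2 + 27 / 4 = thE4 tau ^ 3 / thDelta tau.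
Proof.
  intros Ht. pose proof (thABC_nonzero tau Ht) as N. pose proof (discriminant_identity tau Ht) as E.
  replace (thE4 tau ^ 3) with (thE6 tau ^ 2 + 27 / 4 * thDelta tau) by (rewrite <- E; ring).
  unfold thR, thDelta. simpl. field. auto.
Qed.

(* A complex number with positive real part has its square off the half line (-oo, 0]. *)
Lemma square_right_half_plane (z : C) (x : R) : 0 < Re z -> z ^ 2 = RtoC x -> 0 < x.
Proof.
  intros Hz E. pose proof (f_equal Re E) as E1. pose proof (f_equal Im E) as E2.
  rewrite re_RtoC in E1. rewrite im_RtoC in E2. destruct z as [a b]. simpl in *. unfold Re, Im in *. simpl in *.
  assert (a * b = 0)%R by lra. assert (b = 0)%R by (apply Rmult_integral in H; lra). subst b. nra.
Qed.

Lemma thE6_nonzero tau : open_domain tau -> thE6 tau <> 0.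
Proof.
  intros Ht E. pose proof (re_thR_pos tau Ht) as P. unfold thR in P. rewrite E in P.
  replace (0 / thABC tau) with (RtoC 0) in P by (unfold Cdiv; ring). simpl in P. lra.
Qed.

(** A zero of E4 would give R^2 = - 27/4. *)
Lemma thE4_nonzero tau : open_domain tau -> thE4 tau <> 0.
Proof.
  intros Ht E. pose proof (re_thR_pos tau Ht) as P. pose proof (discriminant_quotient tau (proj1 Ht)) as D.
  rewrite E in D. assert (Q : thR tau ^ 2 = RtoC (- (27 / 4))).
  { rewrite RtoC_opp, RtoC_div by lra. replace (- (27 / 4)) with (0 - 27 / 4) by ring.
    apply Ceq_minus. replace (thR tau ^ 2 - (0 - 27 / 4)) with (thR tau ^ 2 + 27 / 4) by ring. rewrite D.
    simpl. unfold Cdiv. ring. }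
  apply square_right_half_plane in Q; auto. lra.
Qed.

Lemma inv_j_eq tau : open_domain tau -> 1 / j_invariant tau = inv_j tau.
Proof.
  intros Ht. pose proof (thE4_nonzero tau Ht). pose proof (thDelta_nonzero tau (proj1 Ht)).
  rewrite j_invariant_theta by apply Ht. unfold inv_j. field. auto.
Qed.

Lemma one_minus_inv_j tau : open_domain tau -> 1 - inv_j tau = thE6 tau ^ 2 / thE4 tau ^ 3.
Proof.
  intros Ht. pose proof (thE4_nonzero tau Ht). unfold inv_j.
  rewrite <- (discriminant_identity tau (proj1 Ht)). simpl. field. auto.
Qed.

(** A real value x >= 1 of 1/j would give R^2 = 27/4 (1/x - 1) <= 0. *)
Lemma inv_j_slit tau : open_domain tau -> slit_plane (inv_j tau).
Proof.
  intros Ht [HI HR]. pose proof (thE4_nonzero tau Ht) as N4. pose proof (thDelta_nonzero tau (proj1 Ht)) as ND.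
  assert (E : inv_j tau = RtoC (Re (inv_j tau))) by (rewrite (Cdecomp (inv_j tau)) at 1; rewrite HI; ring).
  set (x := Re (inv_j tau)) in *.
  assert (Nx : RtoC x <> 0) by (intros Z; apply RtoC_inj in Z; lra).
  assert (Q : thR tau ^ 2 = RtoC (27 / 4 * (/ x - 1))).
  { transitivity (thE4 tau ^ 3 / thDelta tau - 27 / 4). rewrite <- discriminant_quotient by apply Ht; ring.
    rewrite RtoC_mult, RtoC_minus, RtoC_inv, RtoC_div by lra. rewrite <- E. unfold inv_j. field. auto. }
  apply square_right_half_plane in Q; [|apply re_thR_pos; auto].
  assert (/ x <= 1). { rewrite <- Rinv_1. apply Rinv_le_contravar; lra. }
  lra.
Qed.

Lemma cder_thDelta tau : UHP tau -> cder thDelta tau (thDelta tau * logderiv_Delta tau).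
Proof.
  intros Ht. eapply cder_val. apply holomorphic_cder; auto. apply thDelta_holomorphic.
  unfold logderiv_Delta. field. apply thDelta_nonzero; auto.
Qed.

Lemma cder_thE4 tau : UHP tau -> cder thE4 tau ((thE4 tau * logderiv_Delta tau - kappa * thE6 tau) / 3).
Proof.
  intros Ht. eapply cder_val. apply holomorphic_cder; auto. apply thE4_holomorphic.
  rewrite <- Ramanujan_E4 by auto. field.
Qed.

Lemma cder_logderiv_Delta tau : UHP tau -> cder logderiv_Delta tau ((logderiv_Delta tau ^ 2 - kappa ^ 2 * thE4 tau) / 12).
Proof.
  intros Ht. eapply cder_val. apply holomorphic_cder; auto. apply logderiv_Delta_holomorphic.
  rewrite <- Ramanujan_E2 by auto. field.
Qed.

Lemma cder_thE6 tau : open_domain tau -> cder thE6 tau ((thE6 tau * logderiv_Delta tau - kappa * thE4 tau ^ 2) / 2).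
Proof.
  intros Ht. pose proof (proj1 Ht) as Hu. pose proof (thE6_nonzero tau Ht) as N6.
  pose proof (holomorphic_cder thE6 tau thE6_holomorphic Hu) as D6.
  eapply cder_val; [exact D6|].
  assert (E : 3 * thE4 tau ^ 2 * ((thE4 tau * logderiv_Delta tau - kappa * thE6 tau) / 3) - 2 * thE6 tau * C_derive thE6 tau
    = 27 / 4 * (thDelta tau * logderiv_Delta tau)).
  { apply (cder_unique_on UHP (fun t => thE4 t ^ 3 - thE6 t ^ 2) (fun t => 27 / 4 * thDelta t) tau _ _ UHP_open Hu discriminant_identity).
    - eapply cder_val. apply cder_minus; apply cder_pow. apply cder_thE4; auto. exact D6. simpl. rewrite !RtoC_plus. ring.
    - apply cder_scal. apply cder_thDelta; auto. }
  rewrite Cmult_assoc, <- (discriminant_identity tau Hu) in E.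
  assert (E2 : 2 * thE6 tau * C_derive thE6 tau = thE6 tau * (thE6 tau * logderiv_Delta tau - kappa * thE4 tau ^ 2)).
  { apply Ceq_minus. apply Ceq_minus in E. rewrite <- (Copp_0), <- E. simpl. field. }
  transitivity (2 * thE6 tau * C_derive thE6 tau / (2 * thE6 tau)). field; auto. rewrite E2. field. auto.
Qed.

(* The derivative of t = 1 / j. *)
Definition flow (tau : C) : C := kappa * inv_j tau * thE6 tau / thE4 tau.

Lemma cder_inv_j tau : open_domain tau -> cder inv_j tau (flow tau).
Proof.
  intros Ht. pose proof (thE4_nonzero tau Ht) as N. eapply cder_val.
  - apply cder_div. apply Cpow_nz; auto. apply cder_scal. apply cder_thDelta; apply Ht. apply cder_pow, cder_thE4; apply Ht.
  - unfold flow, inv_j. simpl. rewrite !RtoC_plus. field. auto.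
Qed.

Definition quarter_logderiv (tau : C) : C := (logderiv_Delta tau - kappa * (thE6 tau / thE4 tau)) / 12.

(* The V of the header; [quarter_logderiv] is E4' / (4 E4) by Ramanujan's equation. *)
Definition defect (tau : C) : C := hyp' (inv_j tau) * flow tau - quarter_logderiv tau * hyp (inv_j tau).

(** In V' - L V the second derivatives enter through t'' - 2 L t' and L' - L^2. This lemma and the
    next one express both by E4 and t, so that the coefficients 1 - 3/2 t and 5/144 of the
    hypergeometric equation appear. *)
Lemma cder_flow tau : open_domain tau ->
  cder flow tau (2 * quarter_logderiv tau * flow tau + kappa ^ 2 * inv_j tau * thE4 tau * (1 - 3 / 2 * inv_j tau)).
Proof.
  intros Ht. pose proof (thE4_nonzero tau Ht) as N. eapply cder_val.
  - apply cder_div. auto. apply cder_mult. apply cder_scal. apply cder_inv_j; auto. apply cder_thE6; auto. apply cder_thE4; apply Ht.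
  - cbv beta. replace (1 - 3 / 2 * inv_j tau) with (3 / 2 * (1 - inv_j tau) - 1 / 2) by field. rewrite one_minus_inv_j by auto.
    unfold flow, quarter_logderiv. simpl. field. auto.
Qed.

Lemma cder_quarter_logderiv tau : open_domain tau ->
  cder quarter_logderiv tau (quarter_logderiv tau ^ 2 + kappa ^ 2 * (5 / 144) * thE4 tau * inv_j tau).
Proof.
  intros Ht. pose proof (thE4_nonzero tau Ht) as N. eapply cder_val.
  - apply cder_div. 2: apply cder_minus. 2: apply cder_logderiv_Delta; apply Ht.
    2: apply cder_scal, cder_div; [auto|apply cder_thE6; auto|apply cder_thE4; apply Ht]. 2: apply cder_const.
    intros E. apply RtoC_inj in E. lra.
  - cbv beta. replace (inv_j tau) with (1 - (1 - inv_j tau)) by ring. rewrite one_minus_inv_j by auto.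
    unfold quarter_logderiv. simpl. field. auto.
Qed.

Lemma cder_hyp_inv_j tau : open_domain tau -> cder (fun t => hyp (inv_j t)) tau (hyp' (inv_j tau) * flow tau).
Proof. intros Ht. apply (cder_comp hyp inv_j). apply cder_inv_j; auto. apply cder_hyp, inv_j_slit; auto. Qed.

Lemma cder_defect tau : open_domain tau -> cder defect tau (quarter_logderiv tau * defect tau).
Proof.
  intros Ht. pose proof (thE4_nonzero tau Ht) as N. pose proof (inv_j_slit tau Ht) as Hs.
  eapply cder_val.
  - apply cder_minus; apply cder_mult. apply (cder_comp hyp' inv_j). apply cder_inv_j; auto. apply cder_hyp'; auto.
    apply cder_flow; auto. apply cder_quarter_logderiv; auto. apply cder_hyp_inv_j; auto.
  - cbv beta. unfold defect. pose proof (hypergeometric_equation (inv_j tau) Hs) as E.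
    (* The square of t' carries the factor t (1 - t), the leading coefficient of the hypergeometric
       equation; V' - L V is that equation times kappa^2 E4 t. *)
    assert (Ef : flow tau ^ 2 = kappa ^ 2 * thE4 tau * inv_j tau * (inv_j tau * (1 - inv_j tau))).
    { rewrite one_minus_inv_j by auto. unfold flow. simpl. field. auto. }
    set (g := hyp (inv_j tau)) in *. set (g1 := hyp' (inv_j tau)) in *. set (g2 := hyp'' (inv_j tau)) in *.
    set (t := inv_j tau) in *. set (u := flow tau) in *. set (L := quarter_logderiv tau) in *.
    apply Ceq_minus. transitivity (g2 * u ^ 2 + kappa ^ 2 * thE4 tau * t * ((1 - 3 / 2 * t) * g1 - 5 / 144 * g)).
    + simpl. field.
    + rewrite Ef, <- E. field.
Qed.

(** As L = E4'/(4 E4), the equation f' = L f gives f^4 the same logarithmic derivative as E4. *)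
Lemma cder_fourth_power_quotient (f : C -> C) tau : open_domain tau -> cder f tau (quarter_logderiv tau * f tau) ->
  cder (fun t => f t ^ 4 / thE4 t) tau 0.
Proof.
  intros Ht Hf. pose proof (thE4_nonzero tau Ht) as N. eapply cder_val.
  - apply cder_div. auto. apply cder_pow. exact Hf. apply cder_thE4; apply Ht.
  - cbv beta. unfold quarter_logderiv. simpl. rewrite !RtoC_plus. field. auto.
Qed.

(** The domain contains the vertical ray above each of its points, and high on the ray f is close to
    l. *)
Lemma ray_constant (f : C -> C) (l : C) : (forall z, open_domain z -> cder f z 0) -> tends_cusp f l ->
  forall tau, open_domain tau -> f tau = l.
Proof.
  intros Hf Hl tau Ht. rewrite tends_cusp_iff in Hl. apply Ceq_minus, Cmod_eq_0.
  apply Rle_antisym; [|apply Cmod_ge_0]. apply le_epsilon. intros eps He. rewrite Rplus_0_l.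
  destruct (Hl eps He) as [Y HY]. set (s := (Rabs Y + 1)%R). pose proof (Rle_abs Y). pose proof (Rabs_pos Y).
  rewrite <- (cder_zero_segment f tau (tau + Ci * s)).
  - left. apply HY. replace (Im (tau + Ci * s)) with (Im tau + s)%R by (simpl; unfold Im; ring).
    destruct Ht as [Hu _]. unfold upper_half_plane in Hu. unfold s. lra.
  - intros x Hx. apply Hf. replace (tau + x * (tau + Ci * s - tau)) with (tau + Ci * RtoC (x * s)) by (rewrite RtoC_mult; ring).
    apply open_domain_ray; auto. apply Rmult_le_pos; unfold s; lra.
Qed.

Lemma tends_cusp_comp (f g : C -> C) (a : C) : tends_cusp g a -> ex_Cderive f a -> tends_cusp (fun t => f (g t)) (f a).
Proof. intros Hg Hf. apply (filterlim_comp _ _ _ g f cusp _ _ Hg). exact (ex_Cderive_continuous f a Hf). Qed.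

Lemma thDelta_cusp : tends_cusp thDelta 0.
Proof.
  eapply tends_cusp_val.
  - apply tends_cusp_pow. apply tends_cusp_mult. apply tends_cusp_mult. apply thA_cusp. apply thB_cusp. apply thC_cusp.
  - simpl. ring.
Qed.

Lemma inv_j_cusp : tends_cusp inv_j 0.
Proof.
  eapply tends_cusp_val.
  - apply (tends_cusp_div (fun t => 27 / 4 * thDelta t) (fun t => thE4 t ^ 3)).
    2: apply tends_cusp_mult; [apply tends_cusp_const|apply thDelta_cusp]. 2: apply tends_cusp_pow, thE4_cusp.
    apply Cpow_nz, C1_nz.
  - simpl. field.
Qed.

Lemma zero_slit : slit_plane 0.
Proof. apply disc_slit_plane. rewrite Cmod_0. lra. Qed.

Lemma hyp_inv_j_cusp : tends_cusp (fun t => hyp (inv_j t)) 1.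
Proof. rewrite <- hyp_0. apply tends_cusp_comp. apply inv_j_cusp. apply hyp_holomorphic, zero_slit. Qed.

Lemma defect_cusp : tends_cusp defect 0.
Proof.
  eapply tends_cusp_val.
  - apply tends_cusp_minus; apply tends_cusp_mult.
    + apply (tends_cusp_comp hyp' inv_j 0). apply inv_j_cusp. eapply cder_ex. apply cder_hyp', zero_slit.
    + apply (tends_cusp_div (fun t => kappa * inv_j t * thE6 t) thE4). apply C1_nz. 2: apply thE4_cusp.
      apply tends_cusp_mult. apply tends_cusp_mult. apply tends_cusp_const. apply inv_j_cusp. apply thE6_cusp.
    + apply (tends_cusp_div (fun t => logderiv_Delta t - kappa * (thE6 t / thE4 t)) (fun _ => 12)). 3: apply tends_cusp_const.
      intros E. apply RtoC_inj in E. lra. apply tends_cusp_minus. apply logderiv_Delta_cusp.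
      apply tends_cusp_mult. apply tends_cusp_const. apply (tends_cusp_div thE6 thE4 1 1 C1_nz thE6_cusp thE4_cusp).
    + apply hyp_inv_j_cusp.
  - field.
Qed.

Lemma defect_zero tau : open_domain tau -> defect tau = 0.
Proof.
  intros Ht. assert (E : defect tau ^ 4 / thE4 tau = 0).
  { apply (ray_constant (fun t => defect t ^ 4 / thE4 t)); auto.
    - intros z Hz. apply cder_fourth_power_quotient; auto. apply cder_defect; auto.
    - eapply tends_cusp_val. apply (tends_cusp_div (fun t => defect t ^ 4) thE4 (0 ^ 4) 1 C1_nz).
      apply tends_cusp_pow, defect_cusp. apply thE4_cusp. simpl. field. }
  pose proof (thE4_nonzero tau Ht) as N. apply NNPP. intros Nd. apply (Cpow_nz _ 4 Nd).
  transitivity (defect tau ^ 4 / thE4 tau * thE4 tau). field; auto. rewrite E. ring.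
Qed.

Theorem thE4_hyp tau : open_domain tau -> thE4 tau = hyp (inv_j tau) ^ 4.
Proof.
  intros Ht. assert (E : hyp (inv_j tau) ^ 4 / thE4 tau = 1).
  { apply (ray_constant (fun t => hyp (inv_j t) ^ 4 / thE4 t)); auto.
    - intros z Hz. apply (cder_fourth_power_quotient (fun t => hyp (inv_j t))); auto.
      (* The vanishing of [defect] is the equation g' = L g. *)
      eapply cder_val. apply cder_hyp_inv_j; auto. apply Ceq_minus. exact (defect_zero z Hz).
    - eapply tends_cusp_val. apply (tends_cusp_div (fun t => hyp (inv_j t) ^ 4) thE4 (1 ^ 4) 1 C1_nz).
      apply tends_cusp_pow, hyp_inv_j_cusp. apply thE4_cusp. simpl. field. }
  pose proof (thE4_nonzero tau Ht) as N.
  transitivity (hyp (inv_j tau) ^ 4 / thE4 tau * thE4 tau). rewrite E; ring. field; auto.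
Qed.

Lemma theta_eighth_powers tau : (theta 0 0 tau ^ 8 + theta 0 1 tau ^ 8 + theta 1 0 tau ^ 8) / 2 = thE4 tau.
Proof. unfold thE4, thA, thB, thC. simpl. field. Qed.

Lemma thE4_hypergeometric tau : Cinterior fundamental_domain tau ->
  thE4 tau = hypergeometric (1 / 12) (5 / 12) 1 (1 / j_invariant tau) ^ 4.
Proof.
  intros Hi. pose proof (interior_open_domain tau Hi) as Ht.
  rewrite inv_j_eq, hypergeometric_hyp by (try apply inv_j_slit; auto). apply thE4_hyp; auto.
Qed.

Theorem theorem6p7 :
  (forall tau : C, Cinterior fundamental_domain tau ->
     E4 tau = (theta 0 0 tau ^ 8 + theta 0 1 tau ^ 8 + theta 1 0 tau ^ 8) / 2
     /\ (theta 0 0 tau ^ 8 + theta 0 1 tau ^ 8 + theta 1 0 tau ^ 8) / 2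
        = hypergeometric (1 / 12) (5 / 12) 1 (1 / j_invariant tau) ^ 4)
  /\
  (let is_rhs := is_continuation (Cinterior fundamental_domain) upper_half_plane
       (fun tau => hypergeometric (1 / 12) (5 / 12) 1 (1 / j_invariant tau) ^ 4)
   in
   (exists G : C -> C, is_rhs G)
   /\ (forall G : C -> C, is_rhs G ->
       forall tau : C, upper_half_plane tau ->
         E4 tau = (theta 0 0 tau ^ 8 + theta 0 1 tau ^ 8 + theta 1 0 tau ^ 8) / 2
         /\ (theta 0 0 tau ^ 8 + theta 0 1 tau ^ 8 + theta 1 0 tau ^ 8) / 2
            = G tau)).
Proof.
  split; [|intros is_rhs; split].
  - intros tau Hi. rewrite theta_eighth_powers. split.
    + apply E4_theta. apply (interior_open_domain tau Hi).
    + apply thE4_hypergeometric; auto.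
  (* The continuation is the theta expression itself, which is holomorphic on the whole
     half-plane. *)
  - exists thE4. split. apply thE4_holomorphic. intros z Hz. apply thE4_hypergeometric; auto.
  - intros G [HG HE] tau Ht. rewrite theta_eighth_powers. split. apply E4_theta; auto.
    (* The identity theorem starts at 2 i, where the interior points 2 i + d of the domain
       accumulate. *)
    apply Ceq_minus. assert (U2 : UHP (2 * Ci)) by (unfold upper_half_plane; simpl; lra).
    apply (identity_segment UHP (fun t => thE4 t - G t) (2 * Ci) tau UHP_open).
    + apply (holomorphic_minus UHP thE4 G); auto. apply thE4_holomorphic.
    + intros s Hs. apply UHP_segment; auto.
    + intros eps He. set (d := Rmin (eps / 2) (1 / 4)). assert (Hd : 0 < d /\ d < eps /\ d < 1 / 2).
      { unfold d. pose proof (Rmin_pos (eps / 2) (1 / 4) ltac:(lra) ltac:(lra)). pose proof (Rmin_l (eps / 2) (1 / 4)). pose proof (Rmin_r (eps / 2) (1 / 4)). lra. }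
      exists (RtoC d). rewrite Cmod_R, Rabs_pos_eq by lra. split. lra.
      assert (Hi : Cinterior fundamental_domain (2 * Ci + d)).
      { apply high_strip_interior.
        - replace (Re (2 * Ci + d)) with d by (simpl; ring). rewrite Rabs_pos_eq; lra.
        - simpl. lra. }
      rewrite HE by auto. rewrite <- thE4_hypergeometric by auto. ring.
Qed.
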